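(* Let $\nu>-1$, $\delta>0$ and $1\le p<\infty$. Then the following are equivalent: (i) for every $f\in L^p((0,1),d\mu_\nu)$ one has $\mathcal{B}_R^\delta(f,x)\to f(x)$ as $R\to\infty$ for almost every $x\in(0,1)$; (ii) $p_0(\delta)\le p$, where $$p_0(\delta)=\begin{cases}1,& \text{if } \delta>\nu+1/2 \text{ or } -1<\nu\le -1/2,\\ \frac{4(\nu+1)}{2\nu+3+2\delta},& \text{if } \delta\le \nu+1/2 \text{ and } \nu>-1/2.\end{cases}$$
   Context: Let $J_\nu$ denote the Bessel function of the first kind of order $\nu>-1$ and let $0<s_1<s_2<\dots$ be the successive positive zeros of $J_\nu$. Let $d\mu_\nu(x)=x^{2\nu+1}\,dx$ on $(0,1)$. Define $\psi_j(x)=\frac{\sqrt2}{|J_{\nu+1}(s_j)|}x^{-\nu}J_\nu(s_jx)$, $j\ge1$; this is a complete orthonormal system in $L^2((0,1),d\mu_\nu)$. For $f$ on $(0,1)$ set $a_j(f)=\int_0^1 f(y)\psi_j(y)\,d\mu_\nu(y)$. For $\delta>0$ and $R>0$ the Bochner–Riesz means are $\mathcal{B}_R^\delta(f,x)=\sum_{j\ge1}\left(1-\frac{s_j^2}{R^2}\right)_+^\delta a_j(f)\psi_j(x)$, where $(1-s^2)_+=\max\{1-s^2,0\}$. *)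

(* Defs.v *)
From HB Require Import structures.
From mathcomp Require Import all_boot all_order all_algebra.
From mathcomp Require Import all_classical all_reals all_analysis.
Set Implicit Arguments. Unset Strict Implicit. Unset Printing Implicit Defensive.
Import Order.TTheory GRing.Theory Num.Theory.
Import numFieldNormedType.Exports.
Local Open Scope classical_set_scope.
Local Open Scope ring_scope.

Section Bessel.
Variable R : realType.
Local Notation mu := (@lebesgue_measure R).

(* Euler's Gamma function, Gamma(s) = int_0^oo t^(s-1) e^(-t) dt (used for s > 0). *)
Definition Gamma (s : R) : R :=
  Rintegral mu `]0, +oo[ (fun t => t `^ (s - 1) * expR (- t)).

(* Bessel function of the first kind of order nu (used for x > 0):
   J_nu(x) = sum_k (-1)^k / (k! Gamma(k+nu+1)) (x/2)^(2k+nu). *)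
Definition besselJ (nu x : R) : R :=
  (x / 2) `^ nu *
  limn (fun n => \sum_(0 <= k < n) ((-1) ^+ k * (x / 2) ^+ (2 * k) / (k`!%:R * Gamma (k%:R + nu + 1)))).

(* s is the increasing enumeration s 0 < s 1 < ... of the positive zeros of J_nu
   (s j corresponds to s_{j+1} in the paper). *)
Definition bessel_zeros (nu : R) (s : nat -> R) : Prop :=
  (forall j, 0 < s j) /\
  (forall i j, (i < j)%N -> s i < s j) /\
  (forall x, 0 < x -> (besselJ nu x = 0 <-> exists j, s j = x)).

Definition psi (nu : R) (s : nat -> R) (j : nat) (x : R) : R :=
  Num.sqrt 2 / `|besselJ (nu + 1) (s j)| * x `^ (- nu) * besselJ nu (s j * x).

Definition weight (nu x : R) : R := x `^ (2 * nu + 1).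

Definition coef (nu : R) (s : nat -> R) (f : R -> R) (j : nat) : R :=
  Rintegral mu `]0, 1[ (fun y => f y * psi nu s j y * weight nu y).

Definition bochner_riesz (nu : R) (s : nat -> R) (delta : R) (f : R -> R) (r x : R) : R :=
  limn (fun n => \sum_(0 <= j < n) ((Num.max (1 - s j ^+ 2 / r ^+ 2) 0) `^ delta
                      * coef nu s f j * psi nu s j x)).

Definition in_Lp_mu (nu p : R) (f : R -> R) : Prop :=
  measurable_fun (`]0, 1[ : set R) f /\
  (\int[mu]_(x in (`]0%R, 1%R[ : set R)) ((`|f x| `^ p * weight nu x)%:E) < +oo)%E.

Definition p0 (nu delta : R) : R :=
  if (nu + 1 / 2 < delta) || (nu <= - (1 / 2)) then 1
  else 4 * (nu + 1) / (2 * nu + 3 + 2 * delta).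

End Bessel.

(* Main.v *)
Require Import Defs.
From HB Require Import structures.
From mathcomp Require Import all_boot all_order all_algebra.
From mathcomp Require Import all_classical all_reals all_analysis.
From mathcomp Require Import measurable_realfun ring lra.
Import Order.TTheory GRing.Theory Num.Theory.
Import numFieldNormedType.Exports.
Local Open Scope classical_set_scope.
Local Open Scope ring_scope.

(** The multiplier (1 - s^2/R^2)_+^delta is split into a local part, the cosine transform of a
    function supported in a small interval ]0, eps[, and an error O(R^(-delta) (1 + |R - s|)^(-q))
    with q arbitrarily large.  Riemann's method for the equation satisfied by y^(nu+1/2) g(sy),
    where g(z) = z^(-nu) J_nu(z), shows that a local multiplier acts near x as an integral operator
    whose kernel is dominated by R (1 + R|y - x|)^(-1-delta).  Completeness of the psi_j identifies
    the series with the integral, so the local part converges at every Lebesgue point.  The error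
    part tends to 0 as soon as a_j(f) = o(s_j^delta); for p >= p_0 this follows from
    |psi_j(y)| <= C (s_j/(1 + s_j y))^(nu+1/2) and Young's inequality near the origin.

    If p < p_0, a lacunary sum f of the functions S_k^gamma 1_(0, tau/S_k), with S_k = s_(j_k), is
    in L^p and a_(j_k)(f) / S_k^delta tends to infinity.  By a theorem of Riesz, convergence of the
    means at x forces a_j(f) psi_j(x) = O(s_j^delta), hence psi_(j_k) -> 0 almost everywhere; by
    dominated convergence this contradicts the normalization of the psi_j in L^2. *)

(** * Calculus and integration *)

Notation leb := (@lebesgue_measure _).
Notation integ D f := (leb.-integrable D (EFin \o f)).

Section calculus.
Context {R : realType}.
Implicit Types (f g F : R -> R) (a b c x y : R).

(** No asymptotic expansion of J_nu is used: every size estimate comes from the near conservation of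
    u^2 + u'^2 for u = sqrt(z) J_nu(z), which separates the zeros and bounds the normalizing
    constants from both sides. Completeness is proved from Jacobi's identity of the calculus of
    variations: a function vanishing at the zeros of g(s_n y) in ]0, 1] has nonnegative energy, and
    interpolation at these zeros by the first n eigenfunctions then bounds the Fourier tail of h by
    ||h'||^2 / s_n^2. The multiplier is localized by averaging a high symmetric difference of its
    profile: the central node returns the multiplier, the other nodes give cosine transforms
    supported in ]0, eps[, and the average itself is the error. For delta < nu + 1/2 the exponent
    p_0 is forced by scaling: with Q conjugate to p_0 one has (nu + 1/2 - delta) Q = 2 nu + 2, so
    that s_j^(-delta) psi_j is bounded in L^Q uniformly in j; delta > 0 makes the scale-free
    integral converge, which is why p = p_0 is included. The counterexample needs an exponent gamma
    with nu + 3/2 + delta < gamma < (2 nu + 2)/p, and such a gamma exists exactly when p < p_0. *)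

Lemma is_derive_continuous f x df : is_derive x 1 f df -> {for x, continuous f}.
Proof. by move=> [fx _]; apply/differentiable_continuous/derivable1_diffP. Qed.

Lemma within_of_derive f (df : R -> R) a b :
  (forall x, a <= x <= b -> is_derive x 1 f (df x)) -> {within `[a, b], continuous f}.
Proof.
move=> H; apply: continuous_in_subspaceT => x; rewrite inE /= in_itv /= => xab.
exact: is_derive_continuous (H _ xab).
Qed.

Lemma derive_ge0_le f (df : R -> R) a b : a <= b ->
  (forall x, a < x < b -> is_derive x 1 f (df x)) ->
  (forall x, a < x < b -> 0 <= df x) ->
  {within `[a, b], continuous f} -> f a <= f b.
Proof.
move=> ab H H0 cf; apply: (@ger0_derive1_ndecr _ f a b) => // x; rewrite in_itv /=.
- by move=> /H [].
- by move=> xab; rewrite derive1E; have [_ ->] := H _ xab; exact: H0.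
Qed.

Lemma norm_le_derive f (df : R -> R) a b M :
  (forall x, Num.min a b <= x <= Num.max a b -> is_derive x 1 f (df x)) ->
  (forall x, Num.min a b <= x <= Num.max a b -> `|df x| <= M) ->
  `|f b - f a| <= M * `|b - a|.
Proof.
move=> H HM; wlog ab : a b H HM / a <= b.
  move=> W; have [ab|/ltW ba] := leP a b; first exact: W.
  rewrite distrC (distrC b a); apply: W => // x.
    by rewrite minC maxC; exact: H.
  by rewrite minC maxC; exact: HM.
rewrite min_l // max_r // in H HM.
have [c cab ->] : exists2 c, c \in `[a, b] & f b - f a = df c * (b - a).
  apply: (MVT_segment ab) => [x|]; last exact: within_of_derive H.
  by rewrite in_itv /= => /andP[xa xb]; apply: H; rewrite !ltW.
by rewrite normrM ler_wpM2r // HM.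
Qed.

End calculus.

(** * Improper integrals by exhaustion with closed intervals *)

Section integration.
Context {R : realType}.
Local Notation mu := (@lebesgue_measure R).
Implicit Types (f g F G : R -> R) (a b c x y : R) (D : set R).

Lemma ae_imp (P Q : R -> Prop) : (forall x, P x -> Q x) ->
  {ae mu, forall x, P x} -> {ae mu, forall x, Q x}.
Proof.
move=> PQ [N [mN N0 sN]]; exists N; split => // x /= nQ; apply: sN => /= Px.
exact: nQ (PQ _ Px).
Qed.

Lemma Rdominated_convergence D (f_ : nat -> R -> R) f g : measurable D ->
  (forall n, measurable_fun D (f_ n)) -> measurable_fun D f ->
  {ae mu, forall x, D x -> f_ n x @[n --> \oo] --> f x} ->
  integ D g -> (forall n x, D x -> `|f_ n x| <= g x) ->
  (\int[mu]_(x in D) f_ n x) @[n --> \oo] --> \int[mu]_(x in D) f x.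
Proof.
move=> mD mf_ mf ff ig fg.
have [fi _ H] : [/\ integ D f,
    [sequence \int[mu]_(x in D) `|(EFin \o f_ n) x - (EFin \o f) x|]_n @ \oo --> 0 &
    [sequence \int[mu]_(x in D) (EFin \o f_ n) x]_n @ \oo --> \int[mu]_(x in D) (EFin \o f) x]%E.
  apply: (@dominated_convergence _ _ _ mu D mD (fun n => EFin \o f_ n) (EFin \o f) (EFin \o g)) => //.
  - by move=> n /=; apply/measurable_EFinP; exact: mf_.
  - exact/measurable_EFinP.
  - by apply: ae_imp ff => x h Dx; apply: cvg_comp; [exact: h|].
  - by apply: aeW => x n Dx; rewrite lee_fin fg.
apply: fine_cvg; rewrite /= fineK; last exact: integrable_fin_num.
exact: H.
Qed.

(** Increasing compact intervals filling D: the form in which the fundamental theorem on closed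
    intervals is carried to integrals with a singular or infinite end. *)
Definition exhausts (D : set R) (al be : nat -> R) :=
  [/\ forall n, al n < be n, nonincreasing_seq al, nondecreasing_seq be &
      D = \bigcup_n `[al n, be n]%classic].

Lemma exhausts_nd D al be : exhausts D al be ->
  nondecreasing_seq (fun n => `[al n, be n]%classic : set R).
Proof.
case=> _ na nb _ m n mn; apply/subsetPset => x /=; rewrite !in_itv /= => /andP[h1 h2].
by rewrite (le_trans (na _ _ mn) h1) (le_trans h2 (nb _ _ mn)).
Qed.

Lemma exhausts_measurable D al be : exhausts D al be -> measurable D.
Proof. by case=> _ _ _ ->; apply: bigcup_measurable. Qed.

Lemma measurable_restrict_sub (D A : set R) f : measurable D -> measurable A ->
  measurable_fun D f -> measurable_fun D (f \_ A).
Proof.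
move=> mD mA mf; rewrite (_ : f \_ A = fun x => f x * \1_A x).
  by apply: measurable_funM => //; apply: measurable_funTS; exact: measurable_indic.
by apply/funext => x; rewrite patchE indicE; case: ifPn => _; rewrite ?mulr1 ?mulr0.
Qed.

Lemma cvg_Rintegral_exhausts D al be f : exhausts D al be -> integ D f ->
  (\int[mu]_(x in `[al n, be n]) f x) @[n --> \oo] --> \int[mu]_(x in D) f x.
Proof.
move=> E fi; have mD := exhausts_measurable _ _ _ E.
have nd := exhausts_nd _ _ _ E.
have sub n : `[al n, be n]%classic `<=` D.
  by case: E => _ _ _ -> x xn; exists n.
have -> : (fun n => \int[mu]_(x in `[al n, be n]) f x) =
   (fun n => \int[mu]_(x in D) (f \_ `[al n, be n]) x).
  by apply/funext => n; rewrite -Rintegral_mkcondr setIidr.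
have mf : measurable_fun D f by apply/measurable_EFinP; exact: measurable_int fi.
apply: (Rdominated_convergence _ _ _ (fun x => `|f x|)) => //.
- by move=> n /=; apply: measurable_restrict_sub.
- apply: aeW => x Dx; have : (\bigcup_n `[al n, be n]%classic) x by case: E => _ _ _ <-.
  move=> [N _ xN]; apply: cvg_near_cst; exists N => // n /= Nn.
  rewrite patchE mem_set //; have /subsetPset := nd _ _ Nn; exact.
- by apply: integrable_norm.
- by move=> n x Dx; rewrite patchE; case: ifPn => // _; rewrite normr0.
Qed.

(** Monotone convergence: for a nonnegative integrand, a bound uniform along the exhaustion is
    enough. *)
Lemma integrable_exhausts D al be g (C : R) : exhausts D al be ->
  measurable_fun D g -> (forall x, D x -> 0 <= g x) ->
  (forall n, (\int[mu]_(x in `[al n, be n]) (g x)%:E <= C%:E)%E) -> integ D g.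
Proof.
move=> E mg g0 HC; have mD := exhausts_measurable _ _ _ E.
have nd := exhausts_nd _ _ _ E.
have sub n : `[al n, be n]%classic `<=` D.
  by case: E => _ _ _ -> x xn; exists n.
apply/integrableP; split; first exact/measurable_EFinP.
have -> : (\int[mu]_(x in D) `|(EFin \o g) x|)%E = (\int[mu]_(x in D) (g x)%:E)%E.
  by apply: eq_integral => x; rewrite inE => Dx /=; rewrite ger0_norm // g0.
apply: (@le_lt_trans _ _ C%:E); last by rewrite ltry.
have DE : D = \bigcup_n `[al n, be n]%classic by case: E.
rewrite {1}DE.
have HH : ((\int[mu]_(x in `[al i, be i]) (g x)%:E) @[i --> \oo] --> (\int[mu]_(x in \bigcup_i `[al i, be i]%classic) (g x)%:E))%E.
  apply: ge0_nondecreasing_set_cvg_integral => //.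
  - by move=> n; apply/measurable_EFinP; apply: measurable_funS mg => //; exact: sub.
  - by move=> n x /sub /g0; rewrite lee_fin.
rewrite -(cvg_lim _ HH) //; apply: lime_le; first by apply/cvg_ex; eexists; exact: HH.
by apply: nearW => n; exact: HC.
Qed.

(** The summand 3 keeps the two ends apart from n = 0 on: each is moved inwards by at most a third
    of the length. *)
Lemma exhausts_oo a b : a < b ->
  exhausts `]a, b[%classic (fun n => a + (b - a) / (n%:R + 3)) (fun n => b - (b - a) / (n%:R + 3)).
Proof.
move=> ab; have p n : 0 < n%:R + 3 :> R by rewrite ltr_wpDl.
have ba : 0 < b - a by rewrite subr_gt0.
have q n : 0 < (b - a) / (n%:R + 3) by rewrite divr_gt0.
have le n m : (n <= m)%N -> (b - a) / (m%:R + 3) <= (b - a) / (n%:R + 3).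
  by move=> nm; rewrite ler_pM2l // lef_pV2 ?posrE // lerD2r ler_nat.
split.
- move=> n; have : 2 * ((b - a) / (n%:R + 3)) < b - a; last by lra.
  rewrite mulrA ltr_pdivrMr // mulrC ltr_pM2l //.
  by have : 0 <= n%:R :> R by []; lra.
- by move=> n m nm; rewrite lerD2l le.
- by move=> n m nm; rewrite lerD2l lerN2 le.
apply/seteqP; split => x /=; rewrite ?in_itv /=.
- move=> /andP[ax xb].
  pose e := Num.min (x - a) (b - x).
  have e0 : 0 < e by rewrite lt_min !subr_gt0 ax.
  have := archi_boundP (ltW (divr_gt0 ba e0)); set N := Num.bound _ => HN.
  exists N => //=; rewrite in_itv /=.
  have : (b - a) / (N%:R + 3) <= e.
    rewrite ler_pdivrMr // mulrC -ler_pdivrMr // (le_trans (ltW HN)) // lerDl //.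
  by rewrite /e le_min => /andP[h1 h2]; apply/andP; split; lra.
- move=> [n _] /=; rewrite in_itv /= => /andP[h1 h2]; have := q n.
  by move=> q0; apply/andP; split; lra.
Qed.

Lemma cvg_natrD_pinfty (c : R) : (n%:R + c) @[n --> \oo] --> +oo.
Proof.
apply/cvgryPge => A; near=> n; rewrite -lerBlDr; near: n; exact: nbhs_infty_ger.
Unshelve. all: by end_near. Qed.

Lemma exhausts_oy a :
  exhausts `]a, +oo[%classic (fun n => a + (n%:R + 1)^-1) (fun n => a + 2 + n%:R).
Proof.
have p n : 0 < n%:R + 1 :> R by rewrite ltr_wpDl.
split.
- move=> n; rewrite -addrA ltrD2l (@le_lt_trans _ _ 1) //.
    by rewrite invf_le1 // lerDr.
  by have : 0 <= n%:R :> R by []; lra.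
- by move=> n m nm; rewrite lerD2l lef_pV2 ?posrE // lerD2r ler_nat.
- by move=> n m nm; rewrite lerD2l ler_nat.
apply/seteqP; split => x /=; rewrite ?in_itv /= ?andbT.
- move=> ax; have xa : 0 < x - a by rewrite subr_gt0.
  have := archi_boundP (ltW xa); set N := Num.bound _ => HN.
  have xa' : 0 < (x - a)^-1 by rewrite invr_gt0.
  have := archi_boundP (ltW xa'); set M := Num.bound _ => HM.
  exists (N + M)%N => //=; rewrite in_itv /= natrD.
  have N0 : 0 <= N%:R :> R by []. have M0 : 0 <= M%:R :> R by [].
  apply/andP; split; last by lra.
  rewrite -lerBrDl -[leRHS]invrK lef_pV2 ?posrE //; last by lra.
- move=> [n _] /=; rewrite in_itv /= => /andP[h1 h2].
  by apply: lt_le_trans h1; rewrite ltrDl invr_gt0.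
Qed.

Lemma integral_FTC f F a b : a < b ->
  (forall x, a <= x <= b -> is_derive x 1 F (f x)) ->
  (forall x, a <= x <= b -> {for x, continuous f}) ->
  (\int[mu]_(x in `[a, b]) (f x)%:E = (F b - F a)%:E)%E.
Proof.
move=> ab dF cf.
have cF x : a <= x <= b -> {for x, continuous F}.
  by move=> xab; exact: is_derive_continuous (dF _ xab).
rewrite EFinB; apply: continuous_FTC2 => //.
- apply: continuous_in_subspaceT => x; rewrite inE /= in_itv /=; exact: cf.
- split.
  + by move=> x; rewrite in_itv /= => /andP[h1 h2]; have [] := dF x; rewrite ?ltW.
  + by apply: cvg_at_right_filter; apply: cF; rewrite lexx ltW.
  + by apply: cvg_at_left_filter; apply: cF; rewrite lexx ltW.
- move=> x; rewrite in_itv /= => /andP[h1 h2].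
  by rewrite derive1E; have [|_ ->] := dF x; rewrite ?ltW.
Qed.

Lemma Rintegral_FTC f F a b : a < b ->
  (forall x, a <= x <= b -> is_derive x 1 F (f x)) ->
  (forall x, a <= x <= b -> {for x, continuous f}) ->
  \int[mu]_(x in `[a, b]) f x = F b - F a.
Proof. by move=> ab dF cf; rewrite /Rintegral (integral_FTC _ _ _ _ ab dF). Qed.

Lemma exhausts_in D al be n x : exhausts D al be -> al n <= x <= be n -> D x.
Proof. by case=> _ _ _ -> xn; exists n => //=; rewrite in_itv. Qed.

Lemma Rintegral_FTC_exhausts D al be f F la lb : exhausts D al be -> integ D f ->
  (forall x, D x -> is_derive x 1 F (f x)) -> (forall x, D x -> {for x, continuous f}) ->
  F (al n) @[n --> \oo] --> la -> F (be n) @[n --> \oo] --> lb ->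
  \int[mu]_(x in D) f x = lb - la.
Proof.
move=> E fi dF cf Fa Fb; have H := cvg_Rintegral_exhausts _ _ _ _ E fi.
have HH : (fun n => \int[mu]_(x in `[al n, be n]) f x) = (fun n => F (be n) - F (al n)).
  apply/funext => n; apply: Rintegral_FTC; first by case: E.
  - by move=> x /(exhausts_in _ _ _ _ _ E)/dF.
  - by move=> x /(exhausts_in _ _ _ _ _ E)/cf.
have H2 : (fun n => F (be n) - F (al n)) @ \oo --> lb - la by apply: cvgB.
by rewrite HH in H; rewrite -(cvg_lim _ H) // (cvg_lim _ H2).
Qed.

Lemma continuous_on_measurable D f : open D -> (forall x, D x -> {for x, continuous f}) ->
  measurable_fun D f.
Proof. by move=> oD cf; apply: open_continuous_measurable_fun => // x /set_mem /cf. Qed.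

(** A bounded antiderivative is the certificate of integrability used below; its limits at the two
    ends need not be known. *)
Lemma integrable_FTC_exhausts D al be g G (C : R) : exhausts D al be -> open D ->
  (forall x, D x -> 0 <= g x) ->
  (forall x, D x -> is_derive x 1 G (g x)) -> (forall x, D x -> {for x, continuous g}) ->
  (forall n, G (be n) - G (al n) <= C) -> integ D g.
Proof.
move=> E oD g0 dG cg HC; apply: (integrable_exhausts _ _ _ _ C E) => //.
  exact: continuous_on_measurable.
move=> n; have -> : (\int[mu]_(x in `[al n, be n]) (g x)%:E = (G (be n) - G (al n))%:E)%E.
  apply: integral_FTC; first by case: E.
  - by move=> x /(exhausts_in _ _ _ _ _ E)/dG.
  - by move=> x /(exhausts_in _ _ _ _ _ E)/cg.
by rewrite lee_fin.
Qed.

Lemma Rintegral_FTC_oo f F a b la lb : a < b -> integ `]a, b[ f ->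
  (forall x, a < x < b -> is_derive x 1 F (f x)) ->
  (forall x, a < x < b -> {for x, continuous f}) ->
  F x @[x --> a^'+] --> la -> F x @[x --> b^'-] --> lb ->
  \int[mu]_(x in `]a, b[) f x = lb - la.
Proof.
move=> ab fi dF cf Fa Fb.
have D0 : ((b - a) / (n%:R + 3)) @[n --> \oo] --> 0.
  rewrite -[X in _ --> X](mulr0 (b - a)); apply: cvgMr.
  apply/gtr0_cvgV0; first by apply: nearW => n; rewrite ltr_wpDl.
  exact: cvg_natrD_pinfty.
have q n : 0 < (b - a) / (n%:R + 3) by rewrite divr_gt0 ?subr_gt0 // ltr_wpDl.
apply: (Rintegral_FTC_exhausts _ _ _ _ F la lb (exhausts_oo a b ab)) => //.
- move/cvg_at_rightP : Fa; apply; split => [n|]; first by rewrite ltrDl.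
  by rewrite -[X in _ --> X]addr0; apply: cvgD D0; exact: cvg_cst.
- move/cvg_at_leftP : Fb; apply; split => [n|]; first by rewrite ltrBlDr ltrDl.
  by rewrite -[X in _ --> X]subr0; apply: cvgB D0; exact: cvg_cst.
Qed.

Lemma Rintegral_FTC_oy f F a la lb : integ `]a, +oo[ f ->
  (forall x, a < x -> is_derive x 1 F (f x)) ->
  (forall x, a < x -> {for x, continuous f}) ->
  F x @[x --> a^'+] --> la -> F x @[x --> +oo] --> lb ->
  \int[mu]_(x in `]a, +oo[) f x = lb - la.
Proof.
move=> fi dF cf Fa Fb.
have D0 : (n%:R + 1)^-1 @[n --> \oo] --> (0 : R).
  apply/gtr0_cvgV0; first by apply: nearW => n; rewrite ltr_wpDl.
  exact: cvg_natrD_pinfty.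
apply: (Rintegral_FTC_exhausts _ _ _ _ F la lb (exhausts_oy a)) => //.
- by move=> x; rewrite /= in_itv /= andbT; exact: dF.
- by move=> x; rewrite /= in_itv /= andbT; exact: cf.
- move/cvg_at_rightP : Fa; apply; split => [n|]; first by rewrite ltrDl invr_gt0 ltr_wpDl.
  by rewrite -[X in _ --> X]addr0; apply: cvgD D0; exact: cvg_cst.
- apply: cvg_comp Fb; under eq_fun do rewrite addrC; exact: cvg_natrD_pinfty.
Qed.

Lemma integrable_FTC_oo g G a b (C : R) : a < b ->
  (forall x, a < x < b -> 0 <= g x) ->
  (forall x, a < x < b -> is_derive x 1 G (g x)) ->
  (forall x, a < x < b -> {for x, continuous g}) ->
  (forall x, a < x < b -> `|G x| <= C) -> integ `]a, b[ g.
Proof.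
move=> ab g0 dG cg HC.
have E := exhausts_oo a b ab.
apply: (integrable_FTC_exhausts _ _ _ _ G (2 * C) E) => //.
move=> n; have lt : a + (b - a) / (n%:R + 3) < b - (b - a) / (n%:R + 3) by case: E.
have q : 0 < (b - a) / (n%:R + 3) by rewrite divr_gt0 ?subr_gt0 // ltr_wpDl.
apply: (le_trans (ler_norm _)); apply: (le_trans (ler_normB _ _)).
have -> : 2 * C = C + C by ring.
by rewrite lerD // HC //; lra.
Qed.

Lemma integrable_FTC_oy g G a (C : R) :
  (forall x, a < x -> 0 <= g x) ->
  (forall x, a < x -> is_derive x 1 G (g x)) ->
  (forall x, a < x -> {for x, continuous g}) ->
  (forall x, a < x -> `|G x| <= C) -> integ `]a, +oo[ g.
Proof.
move=> g0 dG cg HC.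
apply: (integrable_FTC_exhausts _ _ _ _ G (2 * C) (exhausts_oy a)) => //.
- by move=> x; rewrite /= in_itv /= andbT; exact: g0.
- by move=> x; rewrite /= in_itv /= andbT; exact: dG.
- by move=> x; rewrite /= in_itv /= andbT; exact: cg.
move=> n; apply: (le_trans (ler_norm _)); apply: (le_trans (ler_normB _ _)).
have -> : 2 * C = C + C by ring.
rewrite lerD // HC //.
  by rewrite -addrA ltrDl ltr_wpDr.
by rewrite ltrDl invr_gt0 ltr_wpDl.
Qed.

Lemma integ_le D f g : measurable D -> measurable_fun D f ->
  (forall x, D x -> `|f x| <= g x) -> integ D g -> integ D f.
Proof.
move=> mD mf fg gi; apply: (@le_integrable _ _ _ mu D mD (EFin \o f) (EFin \o g)) => //.
  exact/measurable_EFinP.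
by move=> x Dx /=; rewrite lee_fin (le_trans (fg _ Dx)) // ler_norm.
Qed.

End integration.

Section powers.
Context {R : realType}.
Implicit Types (x y a d : R).

Lemma powRN_anti x y d : 0 <= d -> 0 < x -> x <= y -> y `^ (- d) <= x `^ (- d).
Proof.
move=> d0 x0 xy; have y0 := lt_le_trans x0 xy.
by rewrite !powRN lef_pV2 ?posrE ?powR_gt0 // ge0_ler_powR ?nnegrE ?(ltW x0) ?(ltW y0).
Qed.

Lemma powRN_le1 x d : 0 <= d -> 1 <= x -> x `^ (- d) <= 1.
Proof. by move=> d0 x1; apply: le_trans (powRN_anti _ _ _ d0 ltr01 x1) _; rewrite powR1. Qed.

Lemma powR_ge1 (x a : R) : 1 <= x -> 0 <= a -> 1 <= x `^ a.
Proof.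
move=> x1 a0; apply: (@le_trans _ _ (1 `^ a)); first by rewrite powR1.
by rewrite ge0_ler_powR ?nnegrE ?(le_trans ler01 x1).
Qed.

End powers.

(** * Syntax-directed differentiation *)

Section derive_rules.
Context {R : realType}.
Implicit Types (f g : R -> R) (x a b : R).

(** Separates the computation of a derivative from its identification with the wanted expression,
    which is left to [ring] or [field]. *)
Lemma is_derive_val f x a b : is_derive x 1 f a -> a = b -> is_derive x 1 f b.
Proof. by move=> H <-. Qed.
Lemma dD f g x a b : is_derive x 1 f a -> is_derive x 1 g b ->
  is_derive x 1 (fun y => f y + g y) (a + b).
Proof. by move=> ? ?; apply: is_deriveD. Qed.
Lemma dN f x a : is_derive x 1 f a -> is_derive x 1 (fun y => - f y) (- a).
Proof. by move=> ?; apply: is_deriveN. Qed.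
Lemma dM f g x a b : is_derive x 1 f a -> is_derive x 1 g b ->
  is_derive x 1 (fun y => f y * g y) (a * g x + f x * b).
Proof.
move=> ? ?; eapply is_derive_val; first exact: is_deriveM.
by rewrite /GRing.scale /= addrC mulrC (mulrC a).
Qed.
Lemma dX f n x a : is_derive x 1 f a ->
  is_derive x 1 (fun y => f y ^+ n) (n%:R * f x ^+ n.-1 * a).
Proof.
move=> H; elim: n => [|n IH].
  rewrite !mul0r (_ : (fun y => _) = cst 1) //; exact: is_derive_cst.
rewrite (_ : (fun y => _) = (fun y => f y * f y ^+ n)); last by apply/funext => y; rewrite exprS.
eapply is_derive_val; first exact: (dM f (fun y => f y ^+ n) _ _ _ H IH).
case: n {IH} => [|n] /=; first by rewrite !expr0; ring.
by rewrite -(natr1 n.+1) exprS; ring.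
Qed.
Lemma dcst (c : R) x : is_derive x 1 (fun _ : R => c) 0.
Proof. exact: is_derive_cst. Qed.
Lemma did x : is_derive x 1 (fun y : R => y) 1.
Proof. exact: is_derive_id. Qed.
Lemma dcomp f g x a b : is_derive x 1 g b -> is_derive (g x) 1 f a ->
  is_derive x 1 (fun y => f (g y)) (a * b).
Proof. by move=> ? ?; exact: is_derive1_comp. Qed.
Lemma dV f x a : f x != 0 -> is_derive x 1 f a ->
  is_derive x 1 (fun y => (f y)^-1) (- (f x) ^- 2 * a).
Proof. by move=> fx ?; apply: is_deriveV. Qed.
Lemma dpow f x a p : 0 < f x -> is_derive x 1 f a ->
  is_derive x 1 (fun y => f y `^ p) (p * f x `^ (p - 1) * a).
Proof. by move=> fx ?; apply: (dcomp (fun z => z `^ p) f); apply: is_derive1_powR. Qed.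
Lemma dexp f x a : is_derive x 1 f a ->
  is_derive x 1 (fun y => expR (f y)) (expR (f x) * a).
Proof. by move=> ?; apply: dcomp; apply: is_derive_expR. Qed.
Lemma dcos f x a : is_derive x 1 f a ->
  is_derive x 1 (fun y => cos (f y)) (- sin (f x) * a).
Proof. by move=> ?; apply: dcomp; apply: is_derive_cos. Qed.
Lemma dsin f x a : is_derive x 1 f a ->
  is_derive x 1 (fun y => sin (f y)) (cos (f x) * a).
Proof. by move=> ?; apply: dcomp; apply: is_derive_sin. Qed.

End derive_rules.

(* [constr_eq] rules out the eta-expanded functions that the pattern also matches. *)
Ltac is_cst_fun f :=
  lazymatch f with (fun _ : ?T => ?c) => constr_eq f (fun _ : T => c) end.

(** Recursion on the body of the function. The derivative is built as an existential variable; the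
    side conditions of inverses and real powers remain as goals. *)
Ltac der := cbv beta;
  first [ match goal with H : is_derive _ _ ?f _ |- is_derive _ _ ?f _ => exact H end |
  lazymatch goal with |- is_derive _ _ ?f _ => is_cst_fun f; eapply dcst end |
  lazymatch goal with
  | |- is_derive _ _ (fun y => y) _ => eapply did
  | |- is_derive _ _ (fun y => @GRing.add _ (@?f y) (@?g y)) _ => eapply (dD f g); der
  | |- is_derive _ _ (fun y => @GRing.opp _ (@?f y)) _ => eapply (dN f); der
  | |- is_derive _ _ (fun y => @GRing.mul _ (@?f y) (@?g y)) _ => eapply (dM f g); der
  | |- is_derive _ _ (fun y => @GRing.exp _ (@?f y) ?n) _ => eapply (dX f n); der
  | |- is_derive _ _ (fun y => @GRing.inv _ (@?f y)) _ => eapply (dV f); [idtac | der]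
  | |- is_derive _ _ (fun y => powR (@?f y) ?p) _ => eapply (dpow f); [idtac | der]
  | |- is_derive _ _ (fun y => expR (@?f y)) _ => eapply (dexp f); der
  | |- is_derive _ _ (fun y => cos (@?f y)) _ => eapply (dcos f); der
  | |- is_derive _ _ (fun y => sin (@?f y)) _ => eapply (dsin f); der
  | |- _ => first [eassumption | idtac]
  end].
Ltac derval := eapply is_derive_val; [der | ].

Section integration2.
Context {R : realType}.
Local Notation mu := (@lebesgue_measure R).
Implicit Types (f g F G : R -> R) (a b c x y : R) (D : set R).

Lemma Rintegral_subset D D' f : measurable D -> measurable D' -> D' `<=` D ->
  (forall x, D x -> 0 <= f x) -> integ D f ->
  \int[mu]_(x in D') f x <= \int[mu]_(x in D) f x.
Proof.
move=> mD mD' sub f0 fi; have fi' : integ D' f by exact: integrableS fi.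
rewrite /Rintegral fine_le //.
- exact: integrable_fin_num.
- exact: integrable_fin_num.
apply: ge0_subset_integral => //.
- exact: measurable_int fi.
Qed.

Lemma Rintegral_gt0 D f a b c : measurable D -> a < b -> 0 < c -> `]a, b[ `<=` D ->
  (forall x, D x -> 0 <= f x) -> (forall x, a < x < b -> c <= f x) -> integ D f ->
  0 < \int[mu]_(x in D) f x.
Proof.
move=> mD ab c0 sub f0 fc fi; apply: lt_le_trans (Rintegral_subset D `]a, b[ f _ _ _ _ _) => //.
apply: (@lt_le_trans _ _ (c * (b - a))); first by rewrite mulr_gt0 // subr_gt0.
have mab : (mu `]a, b[ = (b - a)%:E)%E by rewrite lebesgue_measure_itv /= lte_fin ab EFinB.
have -> : c * (b - a) = \int[mu]_(x in `]a, b[) c.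
  by rewrite Rintegral_cst //= mab.
apply: le_Rintegral => //.
- apply/integrableP; split; first by apply/measurable_EFinP; exact: measurable_cst.
  by rewrite integral_cst //= mab -EFinM ltry.
- exact: integrableS fi.
Qed.

(** For an integer k > s, e^t = (e^(t/k))^k >= (1 + t/k)^k >= ((1 + t)/k)^k, whence the constant
    k^k. *)
Lemma powR_addDx_le (s : R) : 0 <= s -> exists2 C, 0 < C &
  forall t, 0 <= t -> (1 + t) `^ s * expR (- t) <= C.
Proof.
move=> s0; have := archi_boundP s0; set k := Num.bound _ => sk.
have k0 : 0 < k%:R :> R by exact: le_lt_trans sk.
exists (k%:R ^+ k); first by rewrite exprn_gt0.
move=> t t0; rewrite expRN ler_pdivrMr ?expR_gt0 //.
apply: (@le_trans _ _ ((1 + t) `^ k%:R)); first by rewrite ler_powR // ?lerDl // ltW.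
rewrite powR_mulrn ?addr_ge0 //.
have -> : expR t = expR (t / k%:R) ^+ k by rewrite -expRM_natl mulrCA divff ?mulr1 // gt_eqF.
rewrite -exprMn lerXn2r ?nnegrE ?mulr_ge0 ?addr_ge0 ?expR_ge0 // ?(ltW k0) //.
apply: (@le_trans _ _ (k%:R * (1 + t / k%:R))).
  rewrite mulrDr mulrCA divff ?gt_eqF // !mulr1 lerD2r.
  by move: k0; rewrite ltr0n ler1n.
by rewrite ler_pM2l // expR_ge1Dx.
Qed.

End integration2.

(** * Convergence, positivity and functional equation of Euler's integral *)

Section Gamma.
Context {R : realType}.
Local Notation mu := (@lebesgue_measure R).
Implicit Types (s t : R).

Let g s t := t `^ (s - 1) * expR (- t).

Lemma Gamma_integrand_cont s t : 0 < t -> {for t, continuous (g s)}.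
Proof.
move=> t0; have [d H] : exists d, is_derive t 1 (g s) d by eexists; rewrite /g; der.
exact: is_derive_continuous H.
Qed.

Lemma Gamma_integrable s : 0 < s -> integ `]0, +oo[ (g s).
Proof.
move=> s0; have [C C0 HC] := @powR_addDx_le R (s + 1) (addr_ge0 (ltW s0) ler01).
have D0 (t : R) : 0 < t -> 0 < 1 + t by move=> ?; rewrite ltr_wpDl.
(* The exponential is traded for a power because this majorant has the bounded antiderivative (C/s)
   (t/(1+t))^s, which settles the ends 0 and +oo at once. *)
pose h t := C * (t `^ (s - 1) * (1 + t) `^ (- s - 1)).
have dh (t : R) : 0 < t -> exists d, is_derive t 1 h d.
  by move=> t0; eexists; rewrite /h; der => //; exact: D0.
apply: (integ_le _ _ h) => //.
- apply: continuous_on_measurable; first exact: interval_open.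
  by move=> t /=; rewrite in_itv /= andbT; exact: Gamma_integrand_cont.
- move=> t /=; rewrite in_itv /= andbT => t0.
  rewrite ger0_norm ?mulr_ge0 ?powR_ge0 ?expR_ge0 // /g /h mulrCA ler_wpM2l ?powR_ge0 //.
  have -> : - s - 1 = - (s + 1) by ring.
  rewrite powRN ler_pdivlMr ?powR_gt0 ?D0 // mulrC.
  exact/HC/ltW.
- apply: (@integrable_FTC_oy _ h (fun t => C / s * (t / (1 + t)) `^ s) 0 (C / s)).
  + by move=> t t0; rewrite /h mulr_ge0 ?(ltW C0) // mulr_ge0 ?powR_ge0.
  + move=> t t0; have t1 := D0 _ t0; derval => //.
    * by rewrite divr_gt0.
    * by rewrite gt_eqF.
    have -> : (t / (1 + t)) `^ (s - 1) = t `^ (s - 1) * (1 + t) `^ (- s - 1) * (1 + t) ^+ 2.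
      rewrite powRM ?invr_ge0 ?(ltW t0) ?(ltW t1) // -powR_inv1 ?(ltW t1) // -powRrM.
      rewrite -powR_mulrn ?(ltW t1) // -mulrA -powRD ?(gt_eqF t1) ?implybT //.
      by congr (_ * _ `^ _); ring.
    by rewrite /h; field; rewrite !gt_eqF.
  + by move=> t t0; have [d H] := dh _ t0; exact: is_derive_continuous H.
  + move=> t t0; have t1 := D0 _ t0.
    rewrite ger0_norm ?mulr_ge0 ?powR_ge0 ?invr_ge0 ?(ltW C0) ?(ltW s0) //.
    rewrite ler_piMr ?mulr_ge0 ?invr_ge0 ?(ltW C0) ?(ltW s0) //.
    rewrite -[leRHS](_ : 1 `^ s = 1); last by rewrite powR1.
    rewrite ge0_ler_powR ?nnegrE ?(ltW s0) ?divr_ge0 ?(ltW t0) ?(ltW t1) //.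
    by rewrite ler_pdivrMr // mul1r lerDr.
Qed.

Lemma Gamma_gt0 s : 0 < s -> 0 < Gamma s.
Proof.
move=> s0; apply: (@Rintegral_gt0 _ _ _ 1 2 (expR (- `|s - 1| - 2))) => //.
- by rewrite ltr1n.
- by move=> t /=; rewrite !in_itv /= andbT => /andP[t1 _]; exact: lt_trans t1.
- by move=> t _; rewrite mulr_ge0 ?powR_ge0 ?expR_ge0.
- move=> t /andP[t1 t2]; have t0 : 0 < t by exact: lt_trans t1.
  rewrite /powR gt_eqF // -expRD ler_expR lerD //; last by rewrite lerN2 ltW.
  rewrite -[X in _ <= X]opprK lerN2; apply: (le_trans (ler_norm _)).
  rewrite normrN normrM ler_piMr // ger0_norm; last by rewrite ln_ge0 // ltW.
  by rewrite -[X in _ <= X](expRK 1) ler_ln ?posrE ?expR_gt0 //; apply: le_trans (expR_ge1Dx _); lra.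
- exact: Gamma_integrable.
Qed.

Lemma Gamma_rec s : 0 < s -> Gamma (s + 1) = s * Gamma s.
Proof.
move=> s0; have s1 : 0 < s + 1 by rewrite ltr_wpDl // ltW.
have i1 := Gamma_integrable _ s0; have i2 := Gamma_integrable _ s1.
have [C C0 HC] := @powR_addDx_le R (s + 1) (ltW s1).
apply/eqP; rewrite -subr_eq0; apply/eqP.
have i3 : integ `]0, +oo[ (fun t => s * g s t).
  by apply: (@integrableZl _ _ _ mu _ _ s (EFin \o g s)).
rewrite /Gamma -[X in _ - X]RintegralZl // -RintegralB //.
rewrite -[RHS](subr0 0).
apply: (@Rintegral_FTC_oy _ _ (fun t => - (t `^ s * expR (- t)))).
- exact: (@integrableB _ _ _ mu _ _ (EFin \o g (s + 1)) (EFin \o (fun t => s * g s t))).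
- move=> t t0; derval => //.
  have -> : t `^ s = t `^ (s + 1 - 1) by congr (_ `^ _); ring.
  by ring.
- move=> t t0; have := Gamma_integrand_cont s t t0; have := Gamma_integrand_cont (s+1) t t0.
  rewrite /g => c1 c2; apply: cvgB => //; apply: cvgM => //; exact: cvg_cst.
- rewrite -[X in _ --> X]oppr0; apply: cvgN; rewrite -[X in _ --> X](mul0r (expR (- 0))); apply: cvgM.
    exact: powR_cvg0.
  by apply: cvg_at_right_filter; apply: continuous_comp; [exact: continuousN | exact: continuous_expR].
- rewrite -[X in _ --> X]oppr0; apply: cvgN.
  apply: (@squeeze_cvgr _ _ _ _ (cst 0) (fun t => C * (1 + t)^-1)).
  + near=> t; have t0 : 0 < t by near: t; apply: nbhs_pinfty_gt; exact: num_real.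
    rewrite mulr_ge0 ?powR_ge0 ?expR_ge0 //=.
    rewrite -ler_pdivrMr ?invr_gt0 ?ltr_wpDl // invrK.
    apply: le_trans (HC t (ltW t0)); rewrite mulrAC ler_wpM2r ?expR_ge0 //.
    rewrite -[X in _ * X]powRr1; last by rewrite addr_ge0 // ltW.
    rewrite powRD; last by rewrite gt_eqF ?implybT // ltr_wpDl.
    rewrite ler_wpM2r ?powR_ge0 // ge0_ler_powR ?nnegrE ?(ltW s0) ?(ltW t0) //; last by rewrite lerDr.
    by rewrite addr_ge0 // ltW.
  + exact: cvg_cst.
  + rewrite -[X in _ --> X](mulr0 C); apply: cvgMr; apply/gtr0_cvgV0.
      by near=> t; rewrite ltr_wpDl //; near: t; apply: nbhs_pinfty_gt; exact: num_real.
    by apply/cvgryPge => A; near=> t; rewrite -lerBlDl; near: t; apply: nbhs_pinfty_ge; exact: num_real.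
Unshelve. all: by end_near. Qed.

End Gamma.

(** * Bessel functions and their zeros *)

HB.lock Definition bcoef {R : realType} (nu : R) (k : nat) : R :=
  (-1) ^+ k / (k`!%:R * Gamma (k%:R + nu + 1)).
(** A series in e = (x/2)^2, so that J_nu(x) = (x/2)^nu [bser] nu e ([besselJE]): the real power is
    split off from an entire function. *)
HB.lock Definition bser {R : realType} (nu e : R) : R := limn (pseries (bcoef nu) e).

Section bessel_series.
Context {R : realType}.
Implicit Types (nu e x z : R) (k n : nat).

Lemma Gamma_shift_gt0 nu k : -1 < nu -> 0 < Gamma (k%:R + nu + 1).
Proof. by move=> h; apply: Gamma_gt0; have : 0 <= k%:R :> R by []; lra. Qed.

(** From k = 1 on the functional equation multiplies by a factor larger than 1; only the first
    factor nu + 1 can be smaller, whence the minimum of the first two values. *)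
Lemma Gamma_shift_ge nu : -1 < nu -> exists2 c : R, 0 < c & forall k, c <= Gamma (k%:R + nu + 1).
Proof.
move=> hnu; have G0 k := Gamma_shift_gt0 nu k hnu.
exists (Num.min (Gamma (0%:R + nu + 1)) (Gamma (1%:R + nu + 1))); first by rewrite lt_min !G0.
elim=> [|k IH]; first by rewrite ge_min lexx.
case: k IH => [|k] IH; first by rewrite ge_min lexx orbT.
apply: (le_trans IH); rewrite -(natr1 k.+1).
have -> : k.+1%:R + 1 + nu + 1 = (k.+1%:R + nu + 1) + 1 :> R by ring.
have : 0 <= k%:R :> R by [].
move=> k0; rewrite -(natr1 k).
have s0 : 0 < k%:R + 1 + nu + 1 by lra.
rewrite (Gamma_rec _ s0); have := Gamma_gt0 _ s0; move: (Gamma _) => G G1.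
by rewrite ler_peMl ?ltW //; lra.
Qed.

Lemma bser_cvg nu e : -1 < nu -> cvgn (pseries (bcoef nu) e).
Proof.
move=> hnu; have [c c0 Hc] := Gamma_shift_ge nu hnu.
apply: normed_cvg.
apply: (@series_le_cvg _ _ (fun k => c^-1 * exp_coeff `|e| k)).
- by move=> k /=.
- by move=> k; rewrite mulr_ge0 ?invr_ge0 ?(ltW c0) // exp_coeff_ge0.
- move=> k; rewrite bcoef.unlock /exp_coeff /= normrM normrX normrM normfV normrX normrN1 expr1n mul1r.
  rewrite [c^-1 * _]mulrCA mulrC ler_wpM2l ?exprn_ge0 // -?invfM normrM normr_nat.
  have := Hc k; have G0 := Gamma_shift_gt0 nu k hnu => Hk.
  rewrite (gtr0_norm G0) lef_pV2 ?posrE ?mulr_gt0 ?ltr0n ?fact_gt0 //.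
  by rewrite [c * _]mulrC ler_pM2l // ltr0n fact_gt0.
- by apply: is_cvg_seriesZ; exact: is_cvg_series_exp_coeff.
Qed.

Lemma bcoef_diffs nu : -1 < nu -> pseries_diffs (bcoef nu) = (fun k => - bcoef (nu + 1) k).
Proof.
move=> hnu; apply/funext => k; rewrite /pseries_diffs bcoef.unlock factS natrM exprS -(natr1 k).
have -> : k%:R + 1 + nu + 1 = k%:R + (nu + 1) + 1 :> R by ring.
have h1 : -1 < nu + 1 by lra.
have := Gamma_shift_gt0 (nu + 1) k h1; move: (Gamma _) => G G0.
have F0 : 0 < k`!%:R :> R by rewrite ltr0n fact_gt0.
have k1 : 0 < k%:R + 1 :> R by rewrite ltr_wpDl.
by field; rewrite !gt_eqF.
Qed.

Lemma pseriesN (f : nat -> R) e : pseries (fun k => - f k) e = - pseries f e.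
Proof.
apply/funext => n; rewrite /pseries /series !fctE /= -sumrN.
by apply: eq_bigr => i _; rewrite mulNr.
Qed.

Lemma bser_derive nu e : -1 < nu -> is_derive e 1 (bser nu) (- bser (nu + 1) e).
Proof.
move=> hnu; have h1 : -1 < nu + 1 by lra. have h2 : -1 < nu + 1 + 1 by lra.
pose K := `|e| + 1.
have NN : - - bcoef (nu + 1 + 1) = bcoef (nu + 1 + 1) by apply/funext => k; rewrite !fctE opprK.
have D2 : pseries_diffs (pseries_diffs (bcoef nu)) = bcoef (nu + 1 + 1).
  by rewrite bcoef_diffs // (pseries_diffsN (bcoef (nu + 1))) bcoef_diffs.
have -> : - bser (nu + 1) e = limn (pseries (pseries_diffs (bcoef nu)) e).
  by rewrite bcoef_diffs // pseriesN limN ?bser.unlock //; exact: bser_cvg.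
rewrite bser.unlock; apply: (@pseries_snd_diffs _ _ K); rewrite ?D2.
- exact: bser_cvg.
- by rewrite bcoef_diffs // pseriesN; apply: is_cvgN; exact: bser_cvg.
- exact: bser_cvg.
- by rewrite [`|K|]ger0_norm ?addr_ge0 // ltrDl.
Qed.

(** The three-term recurrence of Bessel functions. By the functional equation of Gamma, the k-th
    coefficient of order nu is k + nu + 1 times that of order nu + 1, and the factor k is produced
    by e d/de. *)
Lemma bser_rec nu e : -1 < nu -> bser nu e = (nu + 1) * bser (nu + 1) e - e * bser (nu + 1 + 1) e.
Proof.
move=> hnu; have h1 : -1 < nu + 1 by lra. have h2 : -1 < nu + 1 + 1 by lra.
have c1 := bser_cvg _ e h1; have c2 := bser_cvg _ e h2.
have D1 : pseries_diffs (bcoef (nu + 1)) = (fun k => - bcoef (nu + 1 + 1) k) by exact: (bcoef_diffs _ h1).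
have := @pseries_diffs_equiv _ (bcoef (nu + 1)) e; rewrite D1 pseriesN => /(_ (is_cvgN c2)).
rewrite limN // => H.
rewrite bser.unlock; apply: cvg_lim => //.
have -> : pseries (bcoef nu) e = (fun n => (nu + 1) * pseries (bcoef (nu + 1)) e n + e * series (fun i => i%:R * bcoef (nu + 1) i * e ^+ i.-1) n).
  apply/funext => n; rewrite /pseries /series /= !mulr_sumr -big_split /=.
  apply: eq_bigr => k _.
  have -> : e * (k%:R * bcoef (nu + 1) k * e ^+ k.-1) = k%:R * bcoef (nu + 1) k * e ^+ k.
    by move: (bcoef _ _) => b; case: k => [|k]; rewrite ?mulr0 ?mul0r //= ?mulr0 // exprS; ring.
  rewrite mulrA -mulrDl -mulrDl bcoef.unlock; congr (_ * _).
  have -> : k%:R + (nu + 1) + 1 = (k%:R + nu + 1) + 1 :> R by ring.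
  have p : 0 < k%:R + nu + 1 :> R by have : 0 <= k%:R :> R by []; lra.
  rewrite (Gamma_rec _ p); have := Gamma_gt0 _ p; move: (Gamma _) => G G0.
  have F0 : 0 < k`!%:R :> R by rewrite ltr0n fact_gt0.
  by field; rewrite !gt_eqF.
by rewrite -mulrN; apply: cvgD; apply: cvgMr.
Qed.

Lemma bser0 nu : bser nu 0 = (Gamma (nu + 1))^-1.
Proof.
rewrite bser.unlock; apply: cvg_lim => //; rewrite -(cvg_shiftS (pseries _ _)) /=.
apply: cvg_near_cst; apply: nearW => n; rewrite /pseries /series /= big_nat_recl // big1 ?addr0.
  by rewrite expr0 mulr1 bcoef.unlock expr0 fact0 mul1r mul1r add0r.
by move=> i _; rewrite exprS mul0r mulr0.
Qed.

Lemma besselJE nu x : besselJ nu x = (x / 2) `^ nu * bser nu ((x / 2) ^+ 2).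
Proof.
rewrite /besselJ bser.unlock; apply: congr2 => //.
apply: (congr1 (fun s : nat -> R => limn s)); apply/funext => n; apply: eq_bigr => k _.
by rewrite /= bcoef.unlock -exprM mulrAC.
Qed.

(* [gbes nu z = (z / 2) ^ (- nu) J_nu(z)], an entire even function of [z]. *)
Definition gbes nu z : R := bser nu ((z / 2) ^+ 2).

Lemma gbes_derive nu z : -1 < nu -> is_derive z 1 (gbes nu) (- (z / 2) * gbes (nu + 1) z).
Proof.
move=> hnu; rewrite /gbes.
eapply is_derive_val.
  eapply (dcomp (bser nu) (fun z => (z / 2) ^+ 2)); [der | exact: bser_derive].
by rewrite /=; field.
Qed.

Lemma gbes_rec nu z : -1 < nu ->
  (z / 2) ^+ 2 * gbes (nu + 1 + 1) z = (nu + 1) * gbes (nu + 1) z - gbes nu z.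
Proof. by move=> hnu; rewrite /gbes (bser_rec nu) //; ring. Qed.

(** Eliminating order nu + 2 by the recurrence makes [gbes nu] and [gbes (nu + 1)] a closed first
    order system; the price is the division by z. *)
Lemma gbes1_derive nu z : -1 < nu -> z != 0 ->
  is_derive z 1 (gbes (nu + 1)) ((2 * gbes nu z - (2 * nu + 2) * gbes (nu + 1) z) / z).
Proof.
move=> hnu z0; have h1 : -1 < nu + 1 by lra.
apply: is_derive_val; first exact: gbes_derive.
apply: (@mulfI _ (z / 2)); first by rewrite mulf_neq0.
transitivity (- ((z / 2) ^+ 2 * gbes (nu + 1 + 1) z)); first by ring.
by rewrite gbes_rec //; field.
Qed.

Lemma gbes_continuous nu z : -1 < nu -> {for z, continuous (gbes nu)}.
Proof. by move=> hnu; exact: is_derive_continuous (gbes_derive _ _ hnu). Qed.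

Lemma gbes0_gt0 nu : -1 < nu -> 0 < gbes nu 0.
Proof.
move=> hnu; rewrite /gbes mul0r expr0n /= bser0 invr_gt0 Gamma_gt0 //; lra.
Qed.

Lemma dpow_id (a z : R) : 0 < z -> is_derive z 1 (fun z => z `^ a) (a * z `^ a / z).
Proof.
move=> z0; derval => //.
rewrite powRB ?powRr1 ?(ltW z0) ?(gt_eqF z0) ?implybT //; ring.
Qed.

End bessel_series.

(** The sign sg = 1 or -1 selects one of two monotonicity statements: E e^(c/x) decreases, E
    e^(-c/x) increases. As c/x stays bounded at infinity, E then varies by a bounded factor only. *)
Lemma gronwall_inv_sq {R : realType} (sg : R) (E D : R -> R) (c a b : R) : 0 < a -> a <= b ->
  sg * sg = 1 -> (forall x, a <= x <= b -> is_derive x 1 E (D x)) ->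
  (forall x, a <= x <= b -> `|D x| <= c / x ^+ 2 * E x) ->
  sg * (E b * expR (sg * (c / b))) <= sg * (E a * expR (sg * (c / a))).
Proof.
move=> a0 ab sg1 dE lE.
have dh (x : R) : a <= x <= b -> is_derive x 1 (fun z => - (sg * (E z * expR (sg * (c / z)))))
    (- (sg * D x - (sg * sg) * (c / x ^+ 2 * E x)) * expR (sg * (c / x))).
  move=> xab; have xn : x != 0 by case/andP : xab => h _; rewrite gt_eqF // (lt_le_trans a0).
  have H := dE _ xab.
  eapply is_derive_val; first by der.
  by move: (expR _) => e; field.
rewrite -lerN2; apply: (derive_ge0_le (fun z => - (sg * (E z * expR (sg * (c / z))))) (fun x => - (sg * D x - (sg * sg) * (c / x ^+ 2 * E x)) * expR (sg * (c / x))) a b ab) => [x|x|].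
- by move=> /andP[/ltW h /ltW h2]; apply: dh; rewrite h h2.
- move=> /andP[/ltW h /ltW h2]; rewrite mulr_ge0 ?expR_ge0 // sg1 mul1r oppr_ge0 subr_le0.
  apply: le_trans (ler_norm _) _; rewrite normrM.
  have -> : `|sg| = 1 by apply/eqP; rewrite -(eqrXn2 (n := 2)) // expr1n -normrX expr2 sg1 normr1.
  by rewrite mul1r; apply: lE; rewrite h h2.
- exact: within_of_derive dh.
Qed.

(** * Energy estimates for the normal form of Bessel's equation *)

Section energy.
Context {R : realType}.
Variables (nu : R) (hnu : -1 < nu).
Implicit Types (z s y c : R).
Let g0 := gbes nu.
Let g1 := gbes (nu + 1).

(** 2^nu sqrt(z) J_nu(z), and [vbes] its derivative. In this normalization u'' = - (1 - (nu^2 -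
    1/4)/z^2) u, a perturbation of u'' = - u that is integrable at infinity. *)
Definition ubes z := z `^ (nu + 1 / 2) * g0 z.
Definition vbes z := (nu + 1 / 2) * (z `^ (nu + 1 / 2) / z) * g0 z - z `^ (nu + 1 / 2) * (z / 2) * g1 z.

Lemma ubes_derive z : 0 < z -> is_derive z 1 ubes (vbes z).
Proof.
move=> z0; have H := dpow_id (nu + 1 / 2) z z0; have H2 := gbes_derive nu z hnu.
rewrite /ubes; eapply is_derive_val; first exact: (dM (fun z => z `^ (nu + 1/2)) g0 _ _ _ H H2).
by rewrite /vbes /g0 /g1; ring.
Qed.

Lemma vbes_derive z : 0 < z -> is_derive z 1 vbes (- (1 - (nu ^+ 2 - 1 / 4) / z ^+ 2) * ubes z).
Proof.
move=> z0; have zn : z != 0 by rewrite gt_eqF.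
have H := dpow_id (nu + 1 / 2) z z0; have H2 := gbes_derive nu z hnu.
have H3 := gbes1_derive nu z hnu zn.
rewrite /vbes; eapply is_derive_val.
  eapply (dD (fun z => (nu + 1 / 2) * (z `^ (nu + 1 / 2) / z) * g0 z) (fun z => - (z `^ (nu + 1 / 2) * (z / 2) * g1 z))).
    der => //.
  der.
by rewrite /ubes /g0 /g1; field.
Qed.

Let c0 : R := `|nu ^+ 2 - 1 / 4|.
Let E z : R := ubes z ^+ 2 + vbes z ^+ 2.

Lemma energy_derive z : 0 < z ->
  is_derive z 1 E (2 * (nu ^+ 2 - 1 / 4) * ubes z * vbes z / z ^+ 2).
Proof.
move=> z0; have H1 := ubes_derive z z0; have H2 := vbes_derive z z0.
rewrite /E; derval; rewrite /= ?expr1; field; exact: lt0r_neq0.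
Qed.

Lemma energy_derive_le z : 0 < z ->
  `|2 * (nu ^+ 2 - 1 / 4) * ubes z * vbes z / z ^+ 2| <= c0 / z ^+ 2 * E z.
Proof.
move=> z0; have -> : 2 * (nu ^+ 2 - 1 / 4) * ubes z * vbes z / z ^+ 2 =
  (nu ^+ 2 - 1 / 4) * (z ^+ 2)^-1 * (2 * ubes z * vbes z) by ring.
rewrite [leLHS]normrM normrM [X in _ * X * _]ger0_norm ?invr_ge0 ?sqr_ge0 // ler_wpM2l ?mulr_ge0 ?invr_ge0 ?sqr_ge0 //.
rewrite ler_norml; have := sqr_ge0 (ubes z + vbes z); have := sqr_ge0 (ubes z - vbes z).
by rewrite /E => h1 h2; apply/andP; split; nra.
Qed.

Lemma energy_mono a b : 0 < a -> a <= b ->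
  E b * expR (c0 / b) <= E a * expR (c0 / a) /\ E a * expR (- (c0 / a)) <= E b * expR (- (c0 / b)).
Proof.
move=> a0 ab; have pos x : a <= x <= b -> 0 < x by move=> /andP[+ _]; exact: lt_le_trans.
have dE x (xab : a <= x <= b) := energy_derive x (pos x xab).
have lE x (xab : a <= x <= b) := energy_derive_le x (pos x xab).
split.
  by have := gronwall_inv_sq 1 _ _ c0 a b a0 ab (mul1r 1) dE lE; rewrite !mul1r.
by have := gronwall_inv_sq (-1) _ _ c0 a b a0 ab _ dE lE; rewrite mulrNN mulr1 !mulN1r lerN2; apply.
Qed.

(** If the energy vanished at z, monotonicity of E e^(-c0/x) would make it vanish on all of ]0, z],
    hence [g0] there; but [g0] is continuous with a positive value at 0. *)
Lemma energy_gt0 z : 0 < z -> 0 < E z.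
Proof.
move=> z0; rewrite lt_neqAle addr_ge0 ?sqr_ge0 // andbT eq_sym; apply/eqP => Ez.
have g00 x : 0 < x -> x <= z -> g0 x = 0.
  move=> x0 xz; have [_] := energy_mono x z x0 xz; rewrite Ez mul0r pmulr_lle0 ?expR_gt0 // => h.
  have : ubes x ^+ 2 = 0.
    by apply/eqP; rewrite eq_le sqr_ge0 andbT (le_trans _ h) // lerDl sqr_ge0.
  by move=> /eqP; rewrite sqrf_eq0 mulf_eq0 (gt_eqF (powR_gt0 _ _)) //= => /eqP.
have c := gbes_continuous nu 0 hnu.
have c' : gbes nu x @[x --> 0^'+] --> gbes nu 0 by exact: cvg_at_right_filter.
have : gbes nu x @[x --> 0^'+] --> 0.
  apply: cvg_near_cst; near=> x; apply: g00.
    by near: x; exact: nbhs_right_gt.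
  by near: x; exact: nbhs_right_le.
move=> c2; have := gbes0_gt0 nu hnu; rewrite -(cvg_lim _ c') // (cvg_lim _ c2) //.
by rewrite ltxx.
Unshelve. all: by end_near. Qed.

(** The upper bound will give the decay of J_nu; the lower one keeps u' away from 0 at the zeros of
    u, hence simple zeros and control of the normalizing constants. *)
Lemma energy_bounds z0 : 0 < z0 -> exists a : R, exists A : R, [/\ 0 < a, 0 < A &
  forall z, z0 <= z -> a <= ubes z ^+ 2 + vbes z ^+ 2 <= A].
Proof.
move=> h; have e0 := energy_gt0 _ h.
exists (E z0 * expR (- (c0 / z0))), (E z0 * expR (c0 / z0)); split; rewrite ?mulr_gt0 ?expR_gt0 //.
move=> z hz; have zp := lt_le_trans h hz; have [h1 h2] := energy_mono _ _ h hz.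
have ez := ltW (energy_gt0 _ zp).
have q : 0 <= c0 / z by rewrite divr_ge0 ?normr_ge0 // ltW.
apply/andP; split.
  by apply: (le_trans h2); rewrite ler_piMr // -expR0 ler_expR oppr_le0.
by apply: le_trans h1; rewrite ler_peMr // -expR0 ler_expR.
Qed.

End energy.

(** * Separation of the zeros, normalizing constants and size of the psi_j *)

Section zeros.
Context {R : realType}.
Variables (nu : R) (s : nat -> R).
Hypotheses (hnu : -1 < nu) (hs : bessel_zeros nu s).
Implicit Types (x y z : R) (i j n : nat).
Local Notation g0 := (gbes nu).
Local Notation g1 := (gbes (nu + 1)).
Local Notation ka := (nu + 1 / 2).

Lemma s_gt0 j : 0 < s j. Proof. by case: hs => + _; exact. Qed.
Lemma s_neq0 j : s j != 0. Proof. by rewrite gt_eqF // s_gt0. Qed.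
Lemma s_lt i j : (i < j)%N -> s i < s j. Proof. by case: hs => _ [+ _]; exact. Qed.
Lemma s_le i j : (i <= j)%N -> s i <= s j.
Proof. by rewrite leq_eqVlt => /orP[/eqP -> //|/s_lt/ltW]. Qed.
Lemma s_ge0th j : s 0%N <= s j. Proof. exact: s_le. Qed.

Lemma besselJ_eq0 x : 0 < x -> (besselJ nu x == 0) = (g0 x == 0).
Proof. by move=> x0; rewrite besselJE mulf_eq0 gt_eqF // powR_gt0 // divr_gt0. Qed.

Lemma gbes_s j : g0 (s j) = 0.
Proof.
apply/eqP; rewrite -besselJ_eq0 ?s_gt0 //; apply/eqP.
by case: hs => _ [_ h]; apply/h; [exact: s_gt0 | exists j].
Qed.

Lemma gbes_eq0_s x : 0 < x -> g0 x = 0 -> exists j, s j = x.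
Proof.
move=> x0 gx; case: hs => _ [_ h]; apply/h => //; apply/eqP.
by rewrite besselJ_eq0 // gx.
Qed.

Lemma ubes_s j : ubes nu (s j) = 0. Proof. by rewrite /ubes gbes_s mulr0. Qed.
Lemma vbes_s j : vbes nu (s j) = - (s j `^ ka * (s j / 2) * g1 (s j)).
Proof. by rewrite /vbes gbes_s mulr0 sub0r. Qed.

Lemma vbes_s_bounds : exists a : R, exists A : R, [/\ 0 < a, 0 < A & forall j, a <= `|vbes nu (s j)| <= A].
Proof.
have [a [A [a0 A0 H]]] := energy_bounds nu hnu _ (s_gt0 0).
exists (Num.sqrt a), (Num.sqrt A); split; rewrite ?sqrtr_gt0 // => j.
have := H _ (s_ge0th j); rewrite ubes_s expr0n /= add0r => /andP[h1 h2].
by rewrite -sqrtr_sqr !ler_wsqrtr.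
Qed.

(** By Rolle, u' vanishes at some xi between two consecutive zeros of u. As |u'| is at least b at
    the left zero and |u''| is at most M beyond the first zero, xi is at distance at least b/M from
    it. *)
Lemma s_gap : exists2 c : R, 0 < c & forall j, s j + c <= s j.+1.
Proof.
have [b [B [b0 B0 Hb]]] := vbes_s_bounds.
have [a [A [a0 A0 H]]] := energy_bounds nu hnu _ (s_gt0 0).
pose M := (1 + `|nu ^+ 2 - 1 / 4| / s 0%N ^+ 2) * Num.sqrt A.
have M0 : 0 < M.
  rewrite mulr_gt0 ?sqrtr_gt0 // ltr_pwDl // divr_ge0 ?normr_ge0 ?sqr_ge0 //.
exists (b / M); first by rewrite divr_gt0.
move=> j; have lt := s_lt _ _ (ltnSn j); have sj := s_gt0 j.
have pos x : s j <= x -> 0 < x by exact: lt_le_trans.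
have [xi xij] : exists2 c, c \in `]s j, s j.+1[ & ubes nu (s j.+1) - ubes nu (s j) = vbes nu c * (s j.+1 - s j).
  apply: MVT => //.
    by move=> x; rewrite in_itv /= => /andP[/ltW/pos h _]; exact: ubes_derive.
  by apply: (@within_of_derive _ _ (vbes nu)) => x /andP[/pos h _]; exact: ubes_derive.
rewrite !ubes_s subrr => /esym/eqP; rewrite mulf_eq0 [X in _ || X]subr_eq0 (gt_eqF lt) orbF => /eqP vx.
move: xij; rewrite in_itv /= => /andP[x1 x2].
have [c [+ cc]] : exists c, c \in `[s j, xi] /\ vbes nu xi - vbes nu (s j) = (- (1 - (nu ^+ 2 - 1 / 4) / c ^+ 2) * ubes nu c) * (xi - s j).
  have [||c h1 h2] := @MVT_segment R (vbes nu) (fun c => - (1 - (nu ^+ 2 - 1 / 4) / c ^+ 2) * ubes nu c) _ _ (ltW x1).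
  - by move=> x; rewrite in_itv /= => /andP[/ltW/pos h _]; exact: vbes_derive.
  - apply: (@within_of_derive _ _ (fun c => - (1 - (nu ^+ 2 - 1 / 4) / c ^+ 2) * ubes nu c)).
    by move=> x /andP[/pos h _]; exact: vbes_derive.
  - by exists c.
rewrite in_itv /= => /andP[c1 c2].
have cs : s 0%N <= c by exact: le_trans (s_ge0th j) c1.
have c0 := pos _ c1.
have uc : `|ubes nu c| <= Num.sqrt A.
  rewrite -sqrtr_sqr ler_wsqrtr //; have /andP[_] := H _ cs; apply: le_trans.
  by rewrite lerDl sqr_ge0.
have /andP[bj _] := Hb j.
rewrite -lerBrDl ler_pdivrMr //; apply: (@le_trans _ _ (`|vbes nu (s j)|)) => //.
have -> : `|vbes nu (s j)| = `|vbes nu xi - vbes nu (s j)| by rewrite vx sub0r normrN.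
rewrite cc normrM mulrC ler_pM ?normr_ge0 //.
  by rewrite ger0_norm ?subr_ge0 ?(ltW x1) // lerD2r ltW.
rewrite normrM /M ler_pM ?normr_ge0 // normrN (le_trans (ler_normB _ _)) // normr1 lerD2l.
rewrite normrM ler_wpM2l ?normr_ge0 // normfV ger0_norm ?sqr_ge0 //.
by rewrite lef_pV2 ?posrE ?exprn_gt0 ?s_gt0 // lerXn2r ?nnegrE ?(ltW (s_gt0 _)) // ltW.
Qed.

Lemma s_linear : exists2 c : R, 0 < c & forall i j, (i <= j)%N -> s i + c * (j - i)%:R <= s j.
Proof.
have [c c0 H] := s_gap; exists c => // i j ij; rewrite -{2}(subnK ij).
elim: (j - i)%N => [|n IH]; first by rewrite mulr0 addr0 add0n.
rewrite addSn; apply: le_trans (H _).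
by rewrite -natr1 mulrDr mulr1 addrA lerD2r.
Qed.

Lemma s_cvg : s n @[n --> \oo] --> +oo.
Proof.
have [c c0 H] := s_linear; apply/cvgryPge => A.
near=> n; apply: (@le_trans _ _ (s 0%N + c * (n - 0)%:R)); last exact: H.
rewrite subn0 -lerBlDl mulrC -ler_pdivrMr //; near: n; exact: nbhs_infty_ger.
Unshelve. all: by end_near. Qed.

Lemma powRV (a c : R) : 0 < a -> a^-1 `^ c = a `^ (- c).
Proof. by move=> a0; rewrite -powR_inv1 ?ltW // -powRrM mulN1r. Qed.

(** The exponent nu + 1/2 may be negative, so bounds on powers of s/(1 + s y) also need a positive
    lower bound of the base, uniform in j and y. *)
Lemma s_ratio_le j y : 0 <= y <= 1 -> s 0%N / (1 + s 0%N) <= s j / (1 + s j * y).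
Proof.
move=> /andP[y0 y1]; have := s_gt0 0; have := s_ge0th j.
move: (s j) (s 0%N) => S S0 SS S00; have S1 : 0 < S by exact: lt_le_trans SS.
have p : 0 < 1 + S * y by rewrite ltr_pwDl // mulr_ge0 // ltW.
rewrite ler_pdivrMr ?addr_gt0 // mulrAC ler_pdivlMr //.
have : 0 <= S0 * S * (1 - y) by rewrite mulr_ge0 ?subr_ge0 // mulr_ge0 // ltW.
by move: SS; clear; lra.
Qed.

(** The sum of both end values covers either sign of c without a case distinction for the user. *)
Lemma powR_ratio_le (a b c t : R) : 0 < a -> a <= t <= b -> t `^ c <= a `^ c + b `^ c.
Proof.
move=> a0 /andP[at_ tb]; have t0 := lt_le_trans a0 at_.
have [c0|c0] := leP 0 c.
  apply: (@le_trans _ _ (b `^ c)); last by rewrite lerDr powR_ge0.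
  by rewrite ge0_ler_powR ?nnegrE // ltW // (lt_le_trans t0).
apply: (@le_trans _ _ (a `^ c)); last by rewrite lerDl powR_ge0.
have -> : c = - (- c) by rewrite opprK.
rewrite !(powRN _ (- c)) lef_pV2 ?posrE ?powR_gt0 //.
by rewrite ge0_ler_powR ?nnegrE ?(ltW a0) ?(ltW t0) // oppr_ge0 ltW.
Qed.

(** Compactness on [0, 1], the energy bound on |u| = z^(nu+1/2) |g0(z)| beyond. *)
Lemma gbes_bound : exists2 C : R, 0 < C & forall z, 0 <= z -> `|g0 z| <= C * (1 + z) `^ (- ka).
Proof.
have [a [A [a0 A0 H]]] := energy_bounds nu hnu 1 ltr01.
have [M HM] : exists M : R, forall z, 0 <= z <= 1 -> `|g0 z| <= M.
  have [|M1 _ H1] := @EVT_max R (fun z => `|g0 z|) 0 1 ler01.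
    by apply: continuous_in_subspaceT => z _; apply: continuous_comp; [exact: gbes_continuous | exact: norm_continuous].
  by exists `|g0 M1| => z zz; apply: H1; rewrite in_itv.
pose K : R := 2^-1 `^ (- ka) + 1 `^ (- ka).
pose K2 : R := 1 `^ ka + 2 `^ ka.
have K0 : 0 < K by rewrite addr_gt0 ?powR_gt0 // invr_gt0.
have K20 : 0 < K2 by rewrite addr_gt0 ?powR_gt0.
have M0 : 0 <= M by apply: le_trans (HM 0 _); rewrite ?lexx ?ler01.
have sA : 0 < Num.sqrt A by rewrite sqrtr_gt0.
exists (M * K2 + Num.sqrt A * K2); first by rewrite ltr_wpDl ?mulr_ge0 ?mulr_gt0 ?(ltW K20).
move=> z z0; have z1 : 0 < 1 + z by rewrite ltr_pwDl.
rewrite powRN ler_pdivlMr ?powR_gt0 //.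
have [zle|zgt] := leP z 1.
  apply: (@le_trans _ _ (M * K2)); last by rewrite lerDl mulr_ge0 ?(ltW sA) ?(ltW K20).
  rewrite ler_pM ?normr_ge0 ?powR_ge0 ?HM ?z0 //.
  by apply: powR_ratio_le => //; apply/andP; split; lra.
apply: (@le_trans _ _ (Num.sqrt A * K2)); last by rewrite lerDr mulr_ge0 ?(ltW K20).
have zp : 0 < z by exact: lt_trans zgt.
have -> : 1 + z = z * ((1 + z) / z) by field; rewrite gt_eqF.
rewrite powRM ?divr_ge0 ?(ltW z1) // mulrA ler_pM ?mulr_ge0 ?normr_ge0 ?powR_ge0 //.
  have -> : `|g0 z| * z `^ ka = `|ubes nu z| by rewrite /ubes normrM [`|_ `^ _|]ger0_norm ?powR_ge0 // mulrC.
  rewrite -sqrtr_sqr ler_wsqrtr //; have /andP[_] := H _ (ltW zgt); apply: le_trans.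
  by rewrite lerDl sqr_ge0.
apply: powR_ratio_le => //; rewrite ler_pdivlMr // ler_pdivrMr //; apply/andP; split; lra.
Qed.

(** The constant with psi_j(x) = [psiN] j * g0 (s_j x) for x > 0: of the powers of s_j/2 in J_nu and
    J_(nu+1) a single factor survives. *)
Definition psiN j : R := 2 * Num.sqrt 2 / (s j * `|g1 (s j)|).

Lemma g1_s_neq0 j : g1 (s j) != 0.
Proof.
have [a [A [a0 _ H]]] := vbes_s_bounds; have /andP[h _] := H j.
by apply/eqP => g; move: h; rewrite vbes_s g mulr0 oppr0 normr0 leNgt a0.
Qed.

Lemma psiE j x : 0 < x -> psi nu s j x = psiN j * g0 (s j * x).
Proof.
move=> x0; have s0 := s_gt0 j; rewrite /psi !besselJE /psiN.
have xs : 0 < x * s j / 2 by rewrite divr_gt0 // mulr_gt0.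
rewrite -/(gbes (nu + 1) (s j)) -/(gbes nu (s j * x)).
rewrite normrM [`|_ `^ _|]ger0_norm ?powR_ge0 //.
have -> : (s j * x / 2) `^ nu = x `^ nu * (s j / 2) `^ nu.
  by rewrite -powRM ?divr_ge0 ?(ltW x0) ?(ltW s0) //; congr (_ `^ _); ring.
have s2 : s j / 2 != 0 by rewrite gt_eqF // divr_gt0.
have -> : (s j / 2) `^ (nu + 1) = (s j / 2) `^ nu * (s j / 2).
  by rewrite powRD ?s2 ?implybT // powRr1 ?divr_ge0 ?(ltW s0).
rewrite powRN.
have := g1_s_neq0 j; have := powR_gt0 nu x0; have := powR_gt0 nu (divr_gt0 s0 (ltr0Sn R 1)).
move: (_ `^ _) (_ `^ _) (gbes nu _) (gbes _ _) => P Q G G1 P0 Q0 G10.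
by field; rewrite normr_eq0 G10 !gt_eqF.
Qed.

Lemma psiN_gt0 j : 0 < psiN j.
Proof. by rewrite divr_gt0 ?mulr_gt0 ?sqrtr_gt0 ?s_gt0 ?normr_gt0 ?g1_s_neq0. Qed.

(** At a zero of u, [vbes] reduces to its g1 term; so the energy bounds translate into [psiN] j
    comparable to s_j^(nu + 1/2). *)
Lemma psiN_vbes j : psiN j * `|vbes nu (s j)| = Num.sqrt 2 * s j `^ ka.
Proof.
rewrite vbes_s normrN !normrM [`|_ `^ _|]ger0_norm ?powR_ge0 //.
rewrite [`|s j|]gtr0_norm ?s_gt0 // normfV [`|2|]ger0_norm // /psiN.
have := g1_s_neq0 j; rewrite -normr_eq0; have := s_neq0 j.
by move: (s j) (Num.sqrt 2) (_ `^ _) => S r P S0; move: (`|_|) => g h; field; rewrite S0 h.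
Qed.

Lemma psiN_bounds : exists a : R, exists A : R, [/\ 0 < a, 0 < A & forall j,
  a * s j `^ ka <= psiN j <= A * s j `^ ka].
Proof.
have [a [A [a0 A0 H]]] := vbes_s_bounds; have r2 : 0 < Num.sqrt 2 :> R by rewrite sqrtr_gt0.
exists (Num.sqrt 2 / A), (Num.sqrt 2 / a); split; rewrite ?divr_gt0 // => j.
have /andP[h1 h2] := H j; have N0 := psiN_gt0 j.
rewrite ![_ / _ * _]mulrAC -psiN_vbes ler_pdivrMr // ler_pdivlMr //.
by rewrite !ler_wpM2l // ltW.
Qed.

Lemma psi_bound : exists2 C : R, 0 < C & forall j y, 0 <= y ->
  `|psiN j * g0 (s j * y)| <= C * (s j / (1 + s j * y)) `^ ka.
Proof.
have [a [A [a0 A0 HA]]] := psiN_bounds; have [C C0 HC] := gbes_bound.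
exists (A * C); first by rewrite mulr_gt0.
move=> j y y0; have s0 := s_gt0 j; have p : 0 < 1 + s j * y.
  by rewrite ltr_pwDl // mulr_ge0 // ltW.
rewrite normrM (gtr0_norm (psiN_gt0 j)) powRM ?invr_ge0 ?(ltW s0) ?(ltW p) //.
rewrite powRV // mulrACA ler_pM ?normr_ge0 ?(ltW (psiN_gt0 j)) //.
  by have /andP[] := HA j.
by apply: HC; rewrite mulr_ge0 // ltW.
Qed.

Lemma psi_bound_unif : exists2 C : R, 0 < C & forall j y, 0 <= y <= 1 ->
  `|psiN j * g0 (s j * y)| <= C * (s j `^ ka + 1).
Proof.
have [C C0 HC] := psi_bound; have s00 := s_gt0 0.
pose m : R := s 0%N / (1 + s 0%N).
have m0 : 0 < m by rewrite divr_gt0 // addr_gt0.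
exists (C * (m `^ ka + 1)); first by rewrite mulr_gt0 // ltr_pwDr // powR_ge0.
move=> j y /andP[y0 y1]; apply: (le_trans (HC j y y0)).
rewrite -mulrA ler_pM2l //; have s0 := s_gt0 j.
have p : 0 < 1 + s j * y by rewrite ltr_pwDl // mulr_ge0 // ltW.
apply: (@le_trans _ _ (m `^ ka + s j `^ ka)).
  apply: powR_ratio_le => //; rewrite s_ratio_le ?y0 //= ler_pdivrMr //.
  by rewrite ler_peMr ?(ltW s0) // lerDl mulr_ge0 // ltW.
have := powR_ge0 m ka; have := powR_ge0 (s j) ka.
by move: (m `^ _) (s j `^ _) => P Q Q0 P0; nra.
Qed.

Lemma psi_bound_away (eta : R) : 0 < eta -> exists2 C : R, 0 < C & forall j y, eta <= y <= 1 ->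
  `|psiN j * g0 (s j * y)| <= C.
Proof.
move=> e0; have [C C0 HC] := psi_bound; have s00 := s_gt0 0.
pose m : R := s 0%N / (1 + s 0%N).
have m0 : 0 < m by rewrite divr_gt0 // addr_gt0.
exists (C * (m `^ ka + eta^-1 `^ ka)); first by rewrite mulr_gt0 // addr_gt0 ?powR_gt0 ?invr_gt0.
move=> j y /andP[ye y1]; have y0 := lt_le_trans e0 ye; apply: (le_trans (HC j y (ltW y0))).
rewrite ler_pM2l //; have s0 := s_gt0 j.
have p : 0 < 1 + s j * y by rewrite ltr_pwDl // mulr_ge0 // ltW.
apply: powR_ratio_le => //; rewrite s_ratio_le ?(ltW y0) //= ler_pdivrMr //.
rewrite ler_pdivlMl //; have : s j * eta <= s j * y by rewrite ler_pM2l.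
by clear; lra.
Qed.

End zeros.

(** * Orthogonality and completeness *)

Section continuity_rules.
Context {R : realType}.
Implicit Types (f g : R -> R) (x : R).
Lemma cD f g x : {for x, continuous f} -> {for x, continuous g} -> {for x, continuous (fun y => f y + g y)}.
Proof. exact: cvgD. Qed.
Lemma cN f x : {for x, continuous f} -> {for x, continuous (fun y => - f y)}.
Proof. exact: cvgN. Qed.
Lemma cM f g x : {for x, continuous f} -> {for x, continuous g} -> {for x, continuous (fun y => f y * g y)}.
Proof. exact: cvgM. Qed.
Lemma cX f n x : {for x, continuous f} -> {for x, continuous (fun y => f y ^+ n)}.
Proof.
move=> cf; elim: n => [|n IH]; first exact: cvg_cst.
rewrite (_ : (fun y => _) = (fun y => f y * f y ^+ n)); last by apply/funext => y; rewrite exprS.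
exact: cM.
Qed.
Lemma cV f x : f x != 0 -> {for x, continuous f} -> {for x, continuous (fun y => (f y)^-1)}.
Proof. by move=> ? ?; apply: cvgV. Qed.
Lemma cC (c : R) x : {for x, continuous (fun _ : R => c)}. Proof. exact: cvg_cst. Qed.
Lemma cI x : {for x, continuous (fun y : R => y)}. Proof. exact: cvg_id. Qed.
Lemma cabs f x : {for x, continuous f} -> {for x, continuous (fun y => `|f y|)}.
Proof. by move=> cf; apply: cvg_norm. Qed.
Lemma ccomp f g x : {for x, continuous g} -> {for g x, continuous f} -> {for x, continuous (fun y => f (g y))}.
Proof. by move=> ? ?; apply: continuous_comp. Qed.
Lemma cpow f (p : R) x : 0 < f x -> {for x, continuous f} -> {for x, continuous (fun y => f y `^ p)}.
Proof.
move=> fx cf; apply: (ccomp (fun z => z `^ p) f) => //.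
exact: is_derive_continuous (is_derive1_powR p fx).
Qed.
Lemma ccos f x : {for x, continuous f} -> {for x, continuous (fun y => cos (f y))}.
Proof. by move=> cf; apply: (ccomp cos f) => //; exact: continuous_cos. Qed.
Lemma csin f x : {for x, continuous f} -> {for x, continuous (fun y => sin (f y))}.
Proof. by move=> cf; apply: (ccomp sin f) => //; exact: continuous_sin. Qed.
Lemma csum n (F : nat -> R -> R) x : (forall i, {for x, continuous (F i)}) ->
  {for x, continuous (fun y => \sum_(i < n) F i y)}.
Proof.
move=> cF; elim: n => [|n IH].
  by rewrite (_ : (fun y => _) = fun=> 0); [exact: cC | apply/funext => y; rewrite big_ord0].
rewrite (_ : (fun y => _) = fun y => \sum_(i < n) F i y + F n y); first exact: cD.
by apply/funext => y; rewrite big_ord_recr.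
Qed.
Lemma dsum n (F dF : nat -> R -> R) x : (forall i, is_derive x 1 (F i) (dF i x)) ->
  is_derive x 1 (fun y => \sum_(i < n) F i y) (\sum_(i < n) dF i x).
Proof.
move=> hF; elim: n => [|n IH].
  rewrite big_ord0 (_ : (fun y => _) = fun=> 0); first exact: dcst.
  by apply/funext => y; rewrite big_ord0.
rewrite big_ord_recr /= (_ : (fun y => _) = fun y => \sum_(i < n) F i y + F n y); first exact: dD.
by apply/funext => y; rewrite big_ord_recr.
Qed.
End continuity_rules.

Ltac cont := cbv beta;
  first [ match goal with H : ?P |- ?P => exact H end |
  lazymatch goal with |- {for _, continuous ?f} => is_cst_fun f; eapply cC end |
  lazymatch goal with
  | |- {for _, continuous (fun y => y)} => eapply cI
  | |- {for _, continuous (fun y => @GRing.add _ (@?f y) (@?g y))} => eapply (cD f g); cont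
  | |- {for _, continuous (fun y => @GRing.opp _ (@?f y))} => eapply (cN f); cont
  | |- {for _, continuous (fun y => @GRing.mul _ (@?f y) (@?g y))} => eapply (cM f g); cont
  | |- {for _, continuous (fun y => @GRing.exp _ (@?f y) ?n)} => eapply (cX f n); cont
  | |- {for _, continuous (fun y => @GRing.inv _ (@?f y))} => eapply (cV f); [idtac | cont]
  | |- {for _, continuous (fun y => powR (@?f y) ?p)} => eapply (cpow f); [idtac | cont]
  | |- {for _, continuous (fun y => cos (@?f y))} => eapply (ccos f); cont
  | |- {for _, continuous (fun y => sin (@?f y))} => eapply (csin f); cont
  | |- {for _, continuous (fun y => `|@?f y|)} => eapply (cabs f); cont
  | |- {for _, continuous (fun y => ?f y)} => match goal with H : {for _, continuous f} |- _ => exact H end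
  | |- _ => idtac
  end].

(** * Sturm-Liouville form, Green's formula and norms *)

Section orthonormal.
Context {R : realType}.
Variables (nu : R).
Hypotheses (hnu : -1 < nu).
Local Notation mu := (@lebesgue_measure R).
Implicit Types (x y z t : R) (i j n : nat) (f h v dv : R -> R).
Local Notation g0 := (gbes nu).
Local Notation g1 := (gbes (nu + 1)).
Local Notation w := (weight nu).
Local Notation I01 := (`]0%R, 1%R[%classic : set R).

Lemma weight_ge0 y : 0 <= w y. Proof. exact: powR_ge0. Qed.
Lemma weight_gt0 y : 0 < y -> 0 < w y. Proof. by move=> y0; exact: powR_gt0. Qed.

Lemma weight_derive y : 0 < y -> is_derive y 1 w ((2 * nu + 1) * w y / y).
Proof. exact: dpow_id. Qed.

Lemma weight_continuous y : 0 < y -> {for y, continuous w}.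
Proof. by move=> y0; exact: is_derive_continuous (weight_derive _ y0). Qed.

Lemma weight_mulr y : 0 < y -> w y * y = y `^ (2 * nu + 2).
Proof.
move=> y0; rewrite /weight -[X in _ * X]powRr1 ?ltW // -powRD ?(gt_eqF y0) ?implybT //.
by congr (_ `^ _); ring.
Qed.

Lemma in01 x : I01 x -> 0 < x < 1. Proof. by rewrite /= in_itv. Qed.

Lemma weight_integrable : integ I01 w.
Proof.
have p : 0 < 2 * nu + 2 by move: hnu; lra.
apply: (@integrable_FTC_oo _ w (fun y => y `^ (2 * nu + 2) / (2 * nu + 2)) 0 1 (2 * nu + 2)^-1) => //.
- by move=> x _; exact: weight_ge0.
- move=> x /andP[x0 _]; have H := dpow_id (2 * nu + 2) x x0; derval.
  by rewrite -weight_mulr //; field; rewrite !gt_eqF.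
- by move=> x /andP[x0 _]; exact: weight_continuous.
- move=> x /andP[x0 x1]; rewrite ger0_norm ?divr_ge0 ?powR_ge0 ?(ltW p) //.
  rewrite ler_pdivrMr // mulVf ?gt_eqF // -[leRHS](_ : 1 `^ (2 * nu + 2) = 1); last by rewrite powR1.
  by rewrite ge0_ler_powR ?nnegrE ?(ltW p) ?(ltW x0) ?(ltW x1).
Qed.

Lemma weight_measurable : measurable_fun I01 w.
Proof. by have /measurable_int/measurable_EFinP := weight_integrable. Qed.

Lemma integ_weight_bounded f (C : R) : measurable_fun I01 f ->
  (forall y, 0 < y < 1 -> `|f y| <= C) -> integ I01 (fun y => f y * w y).
Proof.
move=> mf fC; apply: (integ_le _ _ (fun y => C * w y)) => //.
- by apply: measurable_funM => //; exact: weight_measurable.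
- move=> y /in01 y01; rewrite normrM [X in _ * X]ger0_norm ?weight_ge0 //.
  by rewrite ler_wpM2r ?weight_ge0 ?fC.
- by apply: (@integrableZl _ _ _ mu _ _ C (EFin \o w)) => //; exact: weight_integrable.
Qed.

Lemma integ_weight_continuous f : (forall y, {for y, continuous f}) -> integ I01 (fun y => f y * w y).
Proof.
move=> cf; have [|M _ HM] := @EVT_max R (fun z => `|f z|) 0 1 ler01.
  by apply: continuous_in_subspaceT => z _; exact: cabs.
apply: (integ_weight_bounded _ `|f M|).
- by apply: continuous_on_measurable; first exact: interval_open.
- by move=> y /andP[y0 y1]; apply: HM; rewrite in_itv /= !ltW.
Qed.

(** Disposes of the boundary terms at the singular end: w itself blows up when nu < -1/2, but y w(y)
    = y^(2 nu + 2) always tends to 0. *)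
Lemma weight_lim0 h : {for 0, continuous h} -> (w y * y * h y) @[y --> 0^'+] --> (0 : R).
Proof.
move=> ch; rewrite -[X in _ --> X](mul0r (h 0)); apply: cvgM; last exact: cvg_at_right_filter.
have : (y `^ (2 * nu + 2)) @[y --> 0^'+] --> (0 : R) by apply: powR_cvg0; move: hnu; lra.
apply: cvg_trans; apply: near_eq_cvg; near=> y; rewrite weight_mulr //.
Unshelve. all: by end_near. Qed.

Definition gd (S y : R) : R := - (S ^+ 2 / 2) * y * g1 (S * y).

Lemma g_derive S y : is_derive y 1 (fun y => g0 (S * y)) (gd S y).
Proof.
eapply is_derive_val; first by eapply (dcomp g0 (fun y => S * y)); [der | exact: gbes_derive].
by rewrite /gd; field.
Qed.

Lemma g_cont S y : {for y, continuous (fun y => g0 (S * y))}.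
Proof. exact: is_derive_continuous (g_derive S y). Qed.

Lemma gd_cont S y : {for y, continuous (gd S)}.
Proof.
have h1 : -1 < nu + 1 by move: hnu; lra.
have c : {for y, continuous (fun y => g1 (S * y))}.
  by apply: (ccomp g1 (fun y => S * y)); [cont | exact: gbes_continuous].
by rewrite /gd; cont.
Qed.

(** Bessel's equation in Sturm-Liouville form, (w Y')' = - S^2 w Y for Y(y) = g0 (S y). *)
Lemma wgd_derive S y : S != 0 -> 0 < y ->
  is_derive y 1 (fun y => w y * gd S y) (- S ^+ 2 * (w y * g0 (S * y))).
Proof.
move=> S0 y0; have H := weight_derive y y0; have yn : y != 0 by rewrite gt_eqF.
have Sy : S * y != 0 by rewrite mulf_neq0.
have H2 : is_derive y 1 (fun y => g1 (S * y)) ((2 * g0 (S * y) - (2 * nu + 2) * g1 (S * y)) / y).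
  eapply is_derive_val; first by eapply (dcomp g1 (fun y => S * y)); [der | exact: gbes1_derive].
  by field; apply/andP.
rewrite /gd; derval; field.
by [].
Qed.

Lemma wgd_lim0 S h : {for 0, continuous h} -> (h y * (w y * gd S y)) @[y --> 0^'+] --> (0 : R).
Proof.
move=> ch; have h1 : -1 < nu + 1 by move: hnu; lra.
rewrite (_ : (fun y => _) = (fun y => w y * y * (h y * (- (S ^+ 2 / 2) * g1 (S * y))))).
  apply: weight_lim0; have c : {for 0, continuous (fun y => g1 (S * y))}.
    by apply: (ccomp g1 (fun y => S * y)); [cont | exact: gbes_continuous].
  by cont.
by apply/funext => y; rewrite /gd; ring.
Qed.

Lemma cvg_left1 f : {for 1, continuous f} -> f y @[y --> (1 : R)^'-] --> f 1.
Proof. by move=> cf; exact: cvg_at_left_filter. Qed.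

(** Integration by parts without boundary terms: v vanishes at 1 and w Y' tends to 0 at 0. *)
Lemma weight_green S v dv : S != 0 -> (forall y, is_derive y 1 v (dv y)) ->
  (forall y, {for y, continuous dv}) -> v 1 = 0 ->
  \int[mu]_(y in I01) (dv y * gd S y * w y) = S ^+ 2 * \int[mu]_(y in I01) (v y * g0 (S * y) * w y).
Proof.
move=> S0 hv cdv v1.
have cv y : {for y, continuous v} by exact: is_derive_continuous (hv y).
have cg := gd_cont S; have cg0 := g_cont S.
have i1 : integ I01 (fun y => dv y * gd S y * w y).
  by apply: integ_weight_continuous => y; have := cg y; have := cdv y => ? ?; cont.
have i2 : integ I01 (fun y => v y * g0 (S * y) * w y).
  by apply: integ_weight_continuous => y; have := cg0 y; have := cv y => ? ?; cont.
have i3 : integ I01 (fun y => S ^+ 2 * (v y * g0 (S * y) * w y)).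
  exact: (@integrableZl _ _ _ mu _ _ (S ^+ 2) (EFin \o (fun y => v y * g0 (S * y) * w y))).
apply/eqP; rewrite -subr_eq0 -RintegralZl // -RintegralB //; apply/eqP.
rewrite -[RHS](subr0 0).
apply: (@Rintegral_FTC_oo _ _ (fun y => v y * (w y * gd S y))); first exact: ltr01.
- exact: (@integrableB _ _ _ mu _ _ (EFin \o (fun y => dv y * gd S y * w y)) (EFin \o (fun y => S ^+ 2 * (v y * g0 (S * y) * w y)))).
- move=> y /andP[y0 _]; have H := wgd_derive S y S0 y0; have H2 := hv y.
  eapply is_derive_val; first exact: (dM v (fun y => w y * gd S y)).
  by rewrite /=; ring.
- move=> y /andP[y0 _]; have := cg y; have := cg0 y; have := cdv y; have := cv y; have := weight_continuous y y0.
  by move=> ? ? ? ? ?; cont.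
- exact: wgd_lim0.
- have c : {for 1, continuous (fun y => v y * (w y * gd S y))}.
    have := cg 1; have := cv 1; have := weight_continuous 1 ltr01 => ? ? ?; cont.
  by have := cvg_left1 _ c; rewrite v1 mul0r.
Qed.

(** Green's formula applied in both directions evaluates the same derivative pairing as T^2 and as
    S^2 times the integral. *)
Lemma weight_orth S T : S != 0 -> T != 0 -> S ^+ 2 != T ^+ 2 -> g0 S = 0 -> g0 T = 0 ->
  \int[mu]_(y in I01) (g0 (S * y) * g0 (T * y) * w y) = 0.
Proof.
move=> S0 T0 ST gS gT.
have e1 := weight_green T (fun y => g0 (S * y)) (gd S) T0 (g_derive S) (gd_cont S).
have e2 := weight_green S (fun y => g0 (T * y)) (gd T) S0 (g_derive T) (gd_cont T).
rewrite mulr1 in e1; rewrite mulr1 in e2; have {}e1 := e1 gS; have {}e2 := e2 gT.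
have : T ^+ 2 * \int[mu]_(y in I01) (g0 (S * y) * g0 (T * y) * w y) =
       S ^+ 2 * \int[mu]_(y in I01) (g0 (S * y) * g0 (T * y) * w y).
  rewrite -e1; under [X in _ = _ * X]eq_Rintegral do rewrite [_ * g0 (T * _)]mulrC.
  by rewrite -e2; apply: eq_Rintegral => y _; rewrite [gd S y * _]mulrC.
move/eqP; rewrite -subr_eq0 -mulrBl mulf_eq0 subr_eq0 eq_sym (negbTE ST) /=.
by move/eqP.
Qed.

Lemma weight_norm S : S != 0 -> g0 S = 0 ->
  \int[mu]_(y in I01) (g0 (S * y) * g0 (S * y) * w y) = S ^+ 2 / 8 * g1 S ^+ 2.
Proof.
move=> S0 gS; have h1 : -1 < nu + 1 by move: hnu; lra.
have cg := gd_cont S; have cg0 := g_cont S.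
have c1 y : {for y, continuous (fun y => g1 (S * y))}.
  by apply: (ccomp g1 (fun y => S * y)); [cont | exact: gbes_continuous].
(* A Pohozaev-type antiderivative: for Y = g0 (S .), the function y w Y'^2 + S^2 y w Y^2 + 2 nu w Y
   Y' has derivative 2 S^2 w Y^2. At y = 1 only the first term is left, since Y(1) = 0. *)
pose F y := (2 * S ^+ 2)^-1 * (y * (w y * gd S y * gd S y) + S ^+ 2 * (y * (w y * g0 (S * y) ^+ 2)) + 2 * nu * (w y * gd S y * g0 (S * y))).
have -> : S ^+ 2 / 8 * g1 S ^+ 2 = F 1 - 0.
  rewrite /F /gd !mulr1 gS /weight powR1; field.
  by [].
apply: (Rintegral_FTC_oo _ F 0 1 0 (F 1) ltr01).
- by apply: integ_weight_continuous => y; have := cg0 y => ?; cont.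
- move=> y y01; case/andP: (y01) => y0 _; have H := wgd_derive S y S0 y0; have H2 := g_derive S y.
  have H3 := weight_derive y y0.
  have yn : y != 0 by rewrite gt_eqF.
  have H4 : is_derive y 1 (gd S) (- (S ^+ 2 / 2) * (2 * g0 (S * y) - (2 * nu + 1) * g1 (S * y))).
    have H2' : is_derive y 1 (fun y => g1 (S * y)) ((2 * g0 (S * y) - (2 * nu + 2) * g1 (S * y)) / y).
      eapply is_derive_val; first by eapply (dcomp g1 (fun y => S * y)); [der | apply: gbes1_derive => //; rewrite mulf_neq0].
      by field; apply/andP.
    by rewrite /gd; derval; field.
  rewrite /F; derval; rewrite /gd /=; field; apply/andP; split => //.
- by move=> y /andP[y0 _]; have := cg0 y; have := weight_continuous y y0 => ? ?; cont.
- rewrite (_ : F = fun y => w y * y * ((2 * S ^+ 2)^-1 * (gd S y * gd S y + S ^+ 2 * g0 (S * y) ^+ 2 - nu * (S ^+ 2) * g1 (S * y) * g0 (S * y)))).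
    by apply: weight_lim0; have := cg 0; have := cg0 0; have := c1 0 => ? ? ?; cont.
  by apply/funext => y; rewrite /F /gd; field.
- apply: cvg_left1; have := cg 1; have := cg0 1; have := weight_continuous 1 ltr01 => ? ? ?.
  by rewrite /F; cont.
Qed.

End orthonormal.

Section bounded_measurable.
Context {R : realType}.
Variables (nu : R).
Hypotheses (hnu : -1 < nu).
Local Notation mu := (@lebesgue_measure R).
Local Notation w := (weight nu).
Local Notation I01 := (`]0%R, 1%R[%classic : set R).
Implicit Types (f g h : R -> R).

(* A boolean, so that membership side conditions can be discharged by rewriting. *)
Definition bm f : bool :=
  `[< measurable_fun I01 f /\ exists C : R, forall y, 0 < y < 1 -> `|f y| <= C >].

Lemma bmP f : reflect (measurable_fun I01 f /\ exists C : R, forall y, 0 < y < 1 -> `|f y| <= C) (bm f).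
Proof. exact: asboolP. Qed.

Lemma bmC (c : R) : bm (fun=> c).
Proof. by apply/bmP; split; [exact: measurable_cst | exists `|c|]. Qed.
Lemma bmD f g : bm f -> bm g -> bm (fun y => f y + g y).
Proof.
move=> /bmP[mf [C HC]] /bmP[mg [D HD]]; apply/bmP; split; first exact: measurable_funD.
by exists (C + D) => y y01; apply: (le_trans (ler_normD _ _)); rewrite lerD ?HC ?HD.
Qed.
Lemma bmM f g : bm f -> bm g -> bm (fun y => f y * g y).
Proof.
move=> /bmP[mf [C HC]] /bmP[mg [D HD]]; apply/bmP; split; first exact: measurable_funM.
by exists (C * D) => y y01; rewrite normrM ler_pM ?HC ?HD.
Qed.
Lemma bmZ (c : R) f : bm f -> bm (fun y => c * f y).
Proof. by move=> bf; apply: bmM => //; exact: bmC. Qed.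
Lemma bmN f : bm f -> bm (fun y => - f y).
Proof.
move=> /bmP[mf [C HC]]; apply/bmP; split; first exact: measurable_funN.
by exists C => y y01; rewrite normrN HC.
Qed.
Lemma bmB f g : bm f -> bm g -> bm (fun y => f y - g y).
Proof. by move=> bf bg; apply: (bmD f (fun y => - g y)) => //; exact: bmN. Qed.
Lemma bm_sum n (F : nat -> R -> R) : (forall i, bm (F i)) -> bm (fun y => \sum_(i < n) F i y).
Proof.
move=> bF; elim: n => [|n IH].
  by under eq_fun do rewrite big_ord0; exact: bmC.
by under eq_fun do rewrite big_ord_recr /=; exact: bmD.
Qed.
Lemma bm_continuous f : (forall y, {for y, continuous f}) -> bm f.
Proof.
move=> cf; apply/bmP; split; first by apply: continuous_on_measurable; first exact: interval_open.
have [|M _ HM] := @EVT_max R (fun z => `|f z|) 0 1 ler01.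
  by apply: continuous_in_subspaceT => z _; exact: cabs.
by exists `|f M| => y /andP[y0 y1]; apply: HM; rewrite in_itv /= !ltW.
Qed.
Lemma bm_integrable f : bm f -> integ I01 (fun y => f y * w y).
Proof. by move=> /bmP[mf [C HC]]; exact: (integ_weight_bounded nu hnu f C). Qed.

Definition ip f g : R := \int[mu]_(y in I01) (f y * g y * w y).

Lemma ipC f g : ip f g = ip g f.
Proof. by apply: eq_Rintegral => y _; rewrite [f y * _]mulrC. Qed.

Lemma eq_ip f f' g g' : (forall y, 0 < y < 1 -> f y * g y = f' y * g' y) -> ip f g = ip f' g'.
Proof. by move=> e; apply: eq_Rintegral => y /set_mem/in01 y01; rewrite e. Qed.

Lemma ipDl f g h : bm f -> bm g -> bm h -> ip (fun y => f y + g y) h = ip f h + ip g h.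
Proof.
move=> bf bg bh; rewrite /ip -RintegralD //; last 2 first.
- by apply: bm_integrable; exact: bmM.
- by apply: bm_integrable; exact: bmM.
by apply: eq_Rintegral => y _; rewrite mulrDl mulrDl.
Qed.
Lemma ipZl (c : R) f g : bm f -> bm g -> ip (fun y => c * f y) g = c * ip f g.
Proof.
move=> bf bg; rewrite /ip -RintegralZl //; last by apply: bm_integrable; exact: bmM.
by apply: eq_Rintegral => y _; rewrite !mulrA.
Qed.
Lemma ipBl f g h : bm f -> bm g -> bm h -> ip (fun y => f y - g y) h = ip f h - ip g h.
Proof.
move=> bf bg bh; rewrite -[X in _ - X]mul1r -mulNr -ipZl // -ipDl //; last exact: bmZ.
by apply: eq_ip => y _; rewrite mulN1r.
Qed.
Lemma ip_suml n (F : nat -> R -> R) g : (forall i, bm (F i)) -> bm g ->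
  ip (fun y => \sum_(i < n) F i y) g = \sum_(i < n) ip (F i) g.
Proof.
move=> bF bg; elim: n => [|n IH].
  rewrite big_ord0 -[RHS](mul0r (ip (fun=> 0) g)) -ipZl ?bmC //.
  by apply: eq_ip => y _; rewrite big_ord0 mul0r.
rewrite big_ord_recr /= -IH -ipDl //; last exact: bm_sum.
by apply: eq_ip => y _; rewrite big_ord_recr.
Qed.
Lemma ip_ge0 f : 0 <= ip f f.
Proof. by apply: Rintegral_ge0 => y _; rewrite mulr_ge0 ?weight_ge0 // -expr2 sqr_ge0. Qed.

(** Cauchy-Schwarz with a free parameter, from the positivity of the norms of c f + g and c f - g;
    the parameter will be taken to be s_n. *)
Lemma ip_young (c : R) f g : 0 < c -> bm f -> bm g -> `|ip f g| <= c / 2 * ip f f + (2 * c)^-1 * ip g g.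
Proof.
move=> c0 bf bg; have cn : c != 0 by rewrite gt_eqF.
have key (e : R) : e ^+ 2 = 1 -> - e * ip f g <= c / 2 * ip f f + (2 * c)^-1 * ip g g.
  move=> e1; have b : bm (fun y => c * f y + e * g y) by apply: (bmD (fun y => c * f y) (fun y => e * g y)); exact: bmZ.
  have Z h : bm h -> ip (fun y => c * f y + e * g y) h = c * ip f h + e * ip g h.
    by move=> bh; rewrite (ipDl (fun y => c * f y) (fun y => e * g y)) ?ipZl //; exact: bmZ.
  have := ip_ge0 (fun y => c * f y + e * g y).
  rewrite (Z _ b) (ipC f) (ipC g) !Z // (ipC g f).
  move: (ip f f) (ip f g) (ip g g) => ff fg gg H.
  have : 0 <= (2 * c)^-1 * (c * (c * ff + e * fg) + e * (c * fg + e * gg)).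
    by rewrite mulr_ge0 // invr_ge0 mulr_ge0 // ltW.
  have -> : (2 * c)^-1 * (c * (c * ff + e * fg) + e * (c * fg + e * gg)) =
    c / 2 * ff + e * fg + e ^+ 2 * ((2 * c)^-1 * gg) by field.
  by rewrite e1; lra.
rewrite ler_norml; apply/andP; split.
  by have := key 1 (expr1n _ _); lra.
have e : (- 1 : R) ^+ 2 = 1 by rewrite sqrrN expr1n.
by have := key (-1) e; lra.
Qed.

End bounded_measurable.

(** * Jacobi's inequality for functions vanishing at the zeros of an eigenfunction *)

Section jacobi.
Context {R : realType}.
Variables (nu : R) (s : nat -> R).
Hypotheses (hnu : -1 < nu) (hs : bessel_zeros nu s).
Local Notation mu := (@lebesgue_measure R).
Local Notation w := (weight nu).
Local Notation I01 := (`]0%R, 1%R[%classic : set R).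
Local Notation g0 := (gbes nu).
Local Notation g1 := (gbes (nu + 1)).
Implicit Types (f g h v dv : R -> R) (y : R).

Lemma gbes1_neq0 z : 0 < z -> g0 z = 0 -> g1 z != 0.
Proof.
move=> z0 gz; have [a [A [a0 _ H]]] := energy_bounds nu hnu z z0.
apply/eqP => g1z; have /andP[+ _] := H z (lexx _).
by rewrite /ubes /vbes gz g1z !mulr0 subr0 expr0n /= addr0 leNgt a0.
Qed.

(** The boundary term w (Y'/Y) v^2 of Jacobi's identity, for Y = g0 (S .). *)
Let B (S : R) v y := w y * gd nu S y * v y ^+ 2 / g0 (S * y).

(** At a common zero, v^2 vanishes to second order while the zero of Y is simple, so the quotient
    tends to 0. Caratheodory's form of the derivative factors y - c out of both functions. *)
Lemma jacobi_boundary S v (d c : R) : S != 0 -> 0 < S * c -> 0 < c -> g0 (S * c) = 0 -> v c = 0 ->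
  is_derive c 1 v d -> B S v y @[y --> c^'] --> (0 : R).
Proof.
move=> S0 Sc c0 gc vc dv.
have [gv [Hv cgv gvc]] := (is_derive1_caratheodory v c d).1 dv.
have [gY [HY cgY gYc]] := (is_derive1_caratheodory (fun y => g0 (S * y)) c (gd nu S c)).1 (g_derive nu hnu S c).
have gdc : gd nu S c != 0.
  apply: mulf_neq0; last exact: gbes1_neq0.
  apply: mulf_neq0; last by rewrite gt_eqF.
  by rewrite oppr_eq0 mulf_neq0 ?expf_neq0 ?invr_eq0 ?pnatr_eq0.
have cF : {for c, continuous (fun y => w y * gd nu S y * (gv y ^+ 2 * (y - c)) / gY y)}.
  have := weight_continuous nu c c0; have := gd_cont nu hnu S c => ? ?.
  by cont; rewrite gYc.
have F0 : w c * gd nu S c * (gv c ^+ 2 * (c - c)) / gY c = 0 by rewrite subrr !mulr0 mul0r.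
have : (fun y => w y * gd nu S y * (gv y ^+ 2 * (y - c)) / gY y) y @[y --> c^'] --> (0 : R).
  by rewrite -F0; apply: cvg_within_filter; exact: cF.
apply: cvg_trans; apply: near_eq_cvg; near=> y.
have yc : y - c != 0 by rewrite subr_eq0; near: y; exact: nbhs_dnbhs_neq.
rewrite /B; have -> : v y = gv y * (y - c) by have := Hv y; rewrite vc subr0.
have -> : g0 (S * y) = gY y * (y - c) by have := HY y; rewrite gc subr0.
have [gy0|gy] := eqVneq (gY y) 0; first by rewrite gy0 mul0r invr0 !mulr0.
by field; rewrite yc gy.
Unshelve. all: by end_near. Qed.

Lemma jacobi_boundary0 S v : {for 0, continuous v} -> B S v y @[y --> 0^'+] --> (0 : R).
Proof.
move=> cv; have g00 := gbes0_gt0 nu hnu.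
have c1 : {for 0, continuous (fun y => v y ^+ 2 / g0 (S * y))}.
  by have := g_cont nu hnu S 0 => ?; cont; rewrite mulr0 gt_eqF.
rewrite (_ : B S v = fun y => v y ^+ 2 / g0 (S * y) * (w y * gd nu S y)); first exact: wgd_lim0.
by apply/funext => y; rewrite /B; ring.
Qed.

Let J (S : R) v dv y := (dv y ^+ 2 - S ^+ 2 * v y ^+ 2) * w y.

(* Jacobi's identity: J - B' = w (v' - (Y'/Y) v)^2 for Y = g0 (S .). *)
Lemma jacobi_itv S v dv a b : 0 < S -> 0 <= a -> a < b ->
  (forall y, is_derive y 1 v (dv y)) -> (forall y, {for y, continuous dv}) ->
  (forall y, a < y < b -> g0 (S * y) != 0) -> integ `]a, b[ (J S v dv) ->
  B S v y @[y --> a^'+] --> (0 : R) -> B S v y @[y --> b^'-] --> (0 : R) ->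
  0 <= \int[mu]_(y in `]a, b[) J S v dv y.
Proof.
move=> S0 a0 ab hv cdv gn0 iJ Ba Bb.
have cv y : {for y, continuous v} by exact: is_derive_continuous (hv y).
have Sn : S != 0 by rewrite gt_eqF.
pose T y := gd nu S y / g0 (S * y).
pose dB y := J S v dv y - w y * (dv y - T y * v y) ^+ 2.
have hB y : a < y < b -> is_derive y 1 (B S v) (dB y).
  move=> yab; have y0 : 0 < y by case/andP: yab => h _; exact: le_lt_trans h.
  have H := wgd_derive nu hnu S y Sn y0; have H2 := g_derive nu hnu S y; have H3 := hv y.
  have gy := gn0 _ yab.
  rewrite /B; derval => //; rewrite /dB /J /T /= expr1.
  by field.
have cdB y : a < y < b -> {for y, continuous dB}.
  move=> yab; have y0 : 0 < y by case/andP: yab => h _; exact: le_lt_trans h.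
  have := weight_continuous nu y y0; have := gd_cont nu hnu S y; have := g_cont nu hnu S y.
  have := cv y; have := cdv y => c1 c2 c3 c4 c5.
  by rewrite /dB /J /T; cont; exact: gn0.
have cJ y : a < y < b -> {for y, continuous (J S v dv)}.
  move=> yab; have y0 : 0 < y by case/andP: yab => h _; exact: le_lt_trans h.
  have := weight_continuous nu y y0; have := cv y; have := cdv y => c1 c2 c3.
  by rewrite /J; cont.
have E := exhausts_oo a b ab.
have sub n y : a + (b - a) / (n%:R + 3) <= y <= b - (b - a) / (n%:R + 3) -> a < y < b.
  by move=> h; have := exhausts_in _ _ _ n y E h; rewrite /= in_itv.
have lim1 := cvg_Rintegral_exhausts _ _ _ _ E iJ.
have D0 : ((b - a) / (n%:R + 3)) @[n --> \oo] --> (0 : R).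
  rewrite -[X in _ --> X](mulr0 (b - a)); apply: cvgMr.
  apply/gtr0_cvgV0; first by apply: nearW => n; rewrite ltr_wpDl.
  exact: cvg_natrD_pinfty.
have q n : 0 < (b - a) / (n%:R + 3) by rewrite divr_gt0 ?subr_gt0 // ltr_wpDl.
have lim2 : (B S v (b - (b - a) / (n%:R + 3)) - B S v (a + (b - a) / (n%:R + 3))) @[n --> \oo] --> (0 : R).
  rewrite -[X in _ --> X]subr0; apply: cvgB.
  - move/cvg_at_leftP : Bb; apply; split => [n|]; first by rewrite ltrBlDr ltrDl.
    by rewrite -[X in _ --> X]subr0; apply: cvgB D0; exact: cvg_cst.
  - move/cvg_at_rightP : Ba; apply; split => [n|]; first by rewrite ltrDl.
    by rewrite -[X in _ --> X]addr0; apply: cvgD D0; exact: cvg_cst.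
apply: (ler_cvg_to lim2 lim1); apply: nearW => n.
have lt : a + (b - a) / (n%:R + 3) < b - (b - a) / (n%:R + 3) by case: E.
have <- : \int[mu]_(y in `[a + (b - a) / (n%:R + 3), b - (b - a) / (n%:R + 3)]) dB y =
   B S v (b - (b - a) / (n%:R + 3)) - B S v (a + (b - a) / (n%:R + 3)).
  by apply: Rintegral_FTC => // y /sub; [exact: hB | exact: cdB].
apply: le_Rintegral => //.
- apply: continuous_compact_integrable; first exact: segment_compact.
  by apply: continuous_in_subspaceT => y; rewrite inE /= in_itv /= => /sub; exact: cdB.
- apply: continuous_compact_integrable; first exact: segment_compact.
  by apply: continuous_in_subspaceT => y; rewrite inE /= in_itv /= => /sub; exact: cJ.
- by move=> y _; rewrite /dB gerBl mulr_ge0 ?weight_ge0 ?sqr_ge0.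
Qed.

(** Because [s] enumerates all positive zeros, g0 (s_n y) vanishes in ]0, 1] only at the nodes
    s_k/s_n with k <= n. Between consecutive nodes Jacobi's identity applies, and at the nodes its
    boundary terms vanish with v. *)
Lemma jacobi_ge0 n v dv :
  (forall y, is_derive y 1 v (dv y)) -> (forall y, {for y, continuous dv}) ->
  (forall k, (k <= n)%N -> v (s k / s n) = 0) ->
  0 <= \int[mu]_(y in I01) J (s n) v dv y.
Proof.
move=> hv cdv v0; have sn := s_gt0 _ _ hs n; have snn : s n != 0 by rewrite gt_eqF.
have cv y : {for y, continuous v} by exact: is_derive_continuous (hv y).
have iJ : integ I01 (J (s n) v dv).
  by apply: (integ_weight_continuous nu hnu) => y; have := cv y; have := cdv y => c1 c2; cont.
have sub k : (k <= n)%N -> `]0, (s k / s n)[ `<=` I01.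
  move=> kn y /=; rewrite !in_itv /= => /andP[-> h]; apply: (lt_le_trans h).
  by rewrite ler_pdivrMr // mul1r (s_le _ _ hs).
have iJ' (A : set R) : measurable A -> A `<=` I01 -> integ A (J (s n) v dv).
  by move=> mA sA; exact: integrableS iJ.
have gk k : g0 (s n * (s k / s n)) = 0 by rewrite mulrCA divff // mulr1; exact: gbes_s.
have yk k : 0 < s k / s n by rewrite divr_gt0 // (s_gt0 _ _ hs).
have Bk k : (k <= n)%N -> B (s n) v y @[y --> (s k / s n)^'] --> (0 : R).
  move=> kn; apply: (jacobi_boundary _ _ _ _ snn _ _ _ _ (hv _)); rewrite ?v0 //.
  by rewrite mulr_gt0.
(* Induction on the number of nodes passed: the last one is s_n/s_n = 1. *)
suff : forall k, (k <= n)%N -> 0 <= \int[mu]_(y in `]0, (s k / s n)[) J (s n) v dv y.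
  by move=> /(_ n (leqnn _)); rewrite divff.
elim=> [_|k IH kn].
- apply: jacobi_itv => //.
  + move=> y /andP[y0 y1]; apply/eqP => gy.
    have [j sj] := gbes_eq0_s _ _ hs _ (mulr_gt0 sn y0) gy.
    have := s_ge0th _ _ hs j; rewrite sj; apply/negP; rewrite -ltNge mulrC -ltr_pdivlMr //.
  + by apply: iJ' => //; exact: sub.
  + exact: jacobi_boundary0.
  + by apply: cvg_dnbhs_at_left; exact: Bk.
- have {}IH := IH (ltnW kn).
  have lt : s k / s n < s k.+1 / s n by rewrite ltr_pM2r ?invr_gt0 // (s_lt _ _ hs).
  have := @Rintegral_itvB R (J (s n) v dv) (BRight 0) (BLeft (s k.+1 / s n)) (s k / s n).
  rewrite !bnd_simp => /(_ (iJ' _ (measurable_itv _) (sub _ kn)) (ltW (yk k)) lt).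
  rewrite -Rintegral_itv_bndo_bndc; last by apply: iJ' => //; apply: sub; exact: ltnW.
  move/eqP; rewrite subr_eq => /eqP ->; rewrite addr_ge0 //.
  apply: jacobi_itv => //.
  + exact: ltW.
  + move=> y /andP[y0 y1]; apply/eqP => gy; have yp := lt_trans (yk k) y0.
    have [j sj] := gbes_eq0_s _ _ hs _ (mulr_gt0 sn yp) gy.
    have h1 : s k < s j by rewrite sj mulrC -ltr_pdivrMr.
    have h2 : s j < s k.+1 by rewrite sj mulrC -ltr_pdivlMr.
    have [jk|kj] := leqP j k; first by have := s_le _ _ hs _ _ jk; rewrite leNgt h1.
    by have := s_le _ _ hs _ _ kj; rewrite leNgt h2.
  + apply: iJ' => // y /=; rewrite !in_itv /= => /andP[h1 h2].
    by have := sub _ kn y; rewrite /= !in_itv /= h2 (lt_trans (yk k) h1); apply.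
  + by apply: cvg_dnbhs_at_right; apply: Bk; exact: ltnW.
  + by apply: cvg_dnbhs_at_left; exact: Bk.
Qed.

End jacobi.

(** * Completeness with a rate, by interpolation at the zeros *)

Section completeness.
Context {R : realType}.
Variables (nu : R) (s : nat -> R).
Hypotheses (hnu : -1 < nu) (hs : bessel_zeros nu s).
Local Notation mu := (@lebesgue_measure R).
Local Notation w := (weight nu).
Local Notation I01 := (`]0%R, 1%R[%classic : set R).
Local Notation g0 := (gbes nu).
Local Notation g1 := (gbes (nu + 1)).
Implicit Types (f g h v dv : R -> R) (y : R).
Local Notation ip := (ip nu).

(* [psi nu s j] on ]0, 1[, extended to a smooth function on the whole line. *)
Definition pj j y := psiN nu s j * g0 (s j * y).
Definition dpj j y := psiN nu s j * gd nu (s j) y.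

Lemma pj_derive j y : is_derive y 1 (pj j) (dpj j y).
Proof.
have H := g_derive nu hnu (s j) y; rewrite /pj /dpj; eapply is_derive_val.
  by eapply (dM (fun=> psiN nu s j)); [exact: dcst | exact: H].
by rewrite mul0r add0r.
Qed.
Lemma pj_cont j y : {for y, continuous (pj j)}.
Proof. exact: is_derive_continuous (pj_derive j y). Qed.
Lemma dpj_cont j y : {for y, continuous (dpj j)}.
Proof. by have := gd_cont nu hnu (s j) y => c; rewrite /dpj; cont. Qed.
Lemma pj1 j : pj j 1 = 0.
Proof. by rewrite /pj mulr1 gbes_s // mulr0. Qed.
Lemma pj_bm j : bm (pj j). Proof. by apply: bm_continuous => y; exact: pj_cont. Qed.
Lemma dpj_bm j : bm (dpj j). Proof. by apply: bm_continuous => y; exact: dpj_cont. Qed.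

Lemma g_bm S : bm (fun y => g0 (S * y)).
Proof. by apply: bm_continuous => y; exact: g_cont. Qed.

Lemma pj_orth i j : ip (pj i) (pj j) = (i == j)%:R.
Proof.
rewrite /pj ipZl ?bmZ ?g_bm // [X in _ * X]ipC ipZl ?g_bm // [X in _ * (_ * X)]ipC.
have [<-|ij] := eqVneq i j.
  have -> : ip (fun y => g0 (s i * y)) (fun y => g0 (s i * y)) = s i ^+ 2 / 8 * g1 (s i) ^+ 2.
    exact: (weight_norm nu hnu (s i) (s_neq0 _ _ hs i) (gbes_s _ _ hs i)).
  rewrite /psiN.
  have := g1_s_neq0 _ _ hnu hs i; have := s_neq0 _ _ hs i.
  move: (s i) (g1 _) => S G S0 G0.
  have -> : S ^+ 2 / 8 * G ^+ 2 = (S * `|G|) ^+ 2 / 8 by rewrite exprMn real_normK ?num_real //; ring.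
  have e2 : Num.sqrt 2 ^+ 2 = 2 :> R by rewrite sqr_sqrtr.
  have -> : 2 * Num.sqrt 2 / (S * `|G|) * (2 * Num.sqrt 2 / (S * `|G|) * ((S * `|G|) ^+ 2 / 8)) = Num.sqrt 2 ^+ 2 / 2.
    by field; rewrite S0 normr_eq0 G0.
  by rewrite e2 divff.
suff -> : ip (fun y => g0 (s i * y)) (fun y => g0 (s j * y)) = 0 by rewrite !mulr0.
apply: (weight_orth nu hnu (s i) (s j) (s_neq0 _ _ hs i) (s_neq0 _ _ hs j) _ (gbes_s _ _ hs i) (gbes_s _ _ hs j)).
rewrite eqrXn2 ?(ltW (s_gt0 _ _ hs _)) //; apply/eqP => e.
by case: (ltngtP i j) ij => // l _; have := s_lt _ _ hs _ _ l; rewrite e ltxx.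
Qed.

Lemma pj_green j v dv : (forall y, is_derive y 1 v (dv y)) ->
  (forall y, {for y, continuous dv}) -> v 1 = 0 -> ip dv (dpj j) = s j ^+ 2 * ip v (pj j).
Proof.
move=> hv cdv v1.
have bv : bm v by apply: bm_continuous => y; exact: is_derive_continuous (hv y).
have bdv : bm dv by exact: bm_continuous.
have bgd : bm (gd nu (s j)) by apply: bm_continuous => y; exact: gd_cont.
have G := weight_green nu hnu (s j) v dv (s_neq0 _ _ hs j) hv cdv v1.
rewrite ipC [ip v _]ipC /dpj /pj !ipZl ?g_bm //.
rewrite mulrCA; congr (_ * _); rewrite ipC [X in _ = _ * X]ipC; exact: G.
Qed.

Section expansion.
Variables (d : nat -> R) (n : nat).

Definition comb y := \sum_(i < n) d i * pj i y.
Definition dcomb y := \sum_(i < n) d i * dpj i y.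

Lemma comb_derive y : is_derive y 1 comb (dcomb y).
Proof.
rewrite /dcomb; apply: (dsum n (fun i y => d i * pj i y) (fun i y => d i * dpj i y)) => i.
eapply is_derive_val; first by eapply (dM (fun=> d i)); [exact: dcst | exact: pj_derive].
by rewrite mul0r add0r.
Qed.

Lemma dcomb_cont y : {for y, continuous dcomb}.
Proof.
apply: (csum n (fun i y => d i * dpj i y)) => i; apply: cM; first exact: cC.
exact: dpj_cont.
Qed.

Lemma comb1 : comb 1 = 0.
Proof. by rewrite /comb big1 // => i _; rewrite pj1 mulr0. Qed.

Lemma comb_bm : bm comb.
Proof. by apply: bm_continuous => y; exact: is_derive_continuous (comb_derive y). Qed.
Lemma dcomb_bm : bm dcomb.
Proof. by apply: bm_continuous => y; exact: dcomb_cont. Qed.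

Lemma ip_comb f : bm f -> ip f comb = \sum_(i < n) d i * ip f (pj i).
Proof.
move=> bf; rewrite ipC (ip_suml nu hnu n (fun i y => d i * pj i y)) //; last by move=> i; rewrite bmZ ?pj_bm.
by apply: eq_bigr => i _; rewrite ipZl ?pj_bm // ipC.
Qed.

Lemma ip_dcomb f df : (forall y, is_derive y 1 f (df y)) -> (forall y, {for y, continuous df}) -> f 1 = 0 ->
  ip df dcomb = \sum_(i < n) d i * (s i ^+ 2 * ip f (pj i)).
Proof.
move=> hf cdf f1; have bdf : bm df by exact: bm_continuous.
rewrite ipC (ip_suml nu hnu n (fun i y => d i * dpj i y)) //; last by move=> i; rewrite bmZ ?dpj_bm.
by apply: eq_bigr => i _; rewrite ipZl ?dpj_bm // ipC (pj_green _ _ _ hf cdf f1).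
Qed.

Variables (h dh : R -> R).
Hypotheses (hh : forall y, is_derive y 1 h (dh y)) (cdh : forall y, {for y, continuous dh}).
Hypothesis (h1 : h 1 = 0).
Let v y := h y - comb y.
Let dv y := dh y - dcomb y.
Let a i := ip h (pj i).

Let bh : bm h. Proof. by apply: bm_continuous => y; exact: is_derive_continuous (hh y). Qed.
Let bdh : bm dh. Proof. exact: bm_continuous. Qed.

Lemma residual_derive y : is_derive y 1 v (dv y).
Proof using hnu hh. by have := hh y; have := comb_derive y => ? ?; apply: dD => //; exact: dN. Qed.
Lemma residual_derive_cont y : {for y, continuous dv}.
Proof using hnu cdh. by have := cdh y; have := dcomb_cont y => ? ?; apply: cD => //; exact: cN. Qed.

Lemma ip_residual_pj i : (i < n)%N -> ip v (pj i) = a i - d i.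
Proof using hnu hs hh.
move=> ilt; rewrite /v ipBl ?pj_bm ?comb_bm // -/(a i); congr (_ - _).
rewrite ipC ip_comb ?pj_bm // (bigD1 (Ordinal ilt)) //= pj_orth eqxx mulr1 big1 ?addr0 //.
by move=> j ji; rewrite pj_orth; case: eqP => [e|]; rewrite ?mulr0 //; case/eqP: ji; apply/val_inj.
Qed.

(** Stated for arbitrary coefficients d, since those of an interpolant are not the Fourier
    coefficients a. Green's formula turns the derivative pairings with psi_i into s_i^2 times the
    plain ones, so only diagonal terms appear. *)
Lemma residual_energy S : ip dv dv - S ^+ 2 * ip v v =
  ip dh dh - S ^+ 2 * ip h h - \sum_(i < n) (s i ^+ 2 - S ^+ 2) * (2 * a i * d i - d i ^+ 2).
Proof.
have v1 : v 1 = 0 by rewrite /v comb1 h1 subrr.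
have bv : bm v by rewrite bmB ?comb_bm.
have E f g : bm f -> bm g ->
    ip (fun y => f y - g y) (fun y => f y - g y) = ip f f - ip f g - ip (fun y => f y - g y) g.
  move=> bf bg; have bfg : bm (fun y => f y - g y) by rewrite bmB.
  rewrite {1}ipBl // [ip f (fun y => f y - g y)]ipC [ip g (fun y => f y - g y)]ipC.
  by congr (_ - _); rewrite ipBl // [ip g f]ipC.
rewrite /v /dv (E dh dcomb) ?dcomb_bm // (E h comb) ?comb_bm //.
rewrite -/dv -/v (ip_dcomb _ _ hh cdh h1) (ip_dcomb _ _ residual_derive residual_derive_cont v1) !ip_comb //.
have -> : \sum_(i < n) (s i ^+ 2 - S ^+ 2) * (2 * a i * d i - d i ^+ 2) =
  \sum_(i < n) d i * (s i ^+ 2 * ip h (pj i)) + \sum_(i < n) d i * (s i ^+ 2 * ip v (pj i))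
  - S ^+ 2 * (\sum_(i < n) d i * ip h (pj i) + \sum_(i < n) d i * ip v (pj i)).
  rewrite -!big_split /= mulr_sumr -sumrB; apply: eq_bigr => i _.
  by rewrite ip_residual_pj // -/(a i); ring.
ring.
Qed.

End expansion.

Lemma jacobi_J n v dv : bm v -> bm dv -> ip dv dv - s n ^+ 2 * ip v v =
  \int[mu]_(y in I01) ((dv y ^+ 2 - s n ^+ 2 * v y ^+ 2) * w y).
Proof.
move=> bv bdv; rewrite /ip -RintegralZl //; last by apply: bm_integrable => //; exact: bmM.
rewrite -RintegralB //.
- by apply: eq_Rintegral => y _; ring.
- by apply: bm_integrable => //; exact: bmM.
- apply: (@integrableZl _ _ _ mu _ _ (s n ^+ 2) (EFin \o (fun y => v y * v y * w y))) => //.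
  by apply: bm_integrable => //; exact: bmM.
Qed.

(* The Sturm-type matrix (psi_i (s_k / s_n))_{i, k < n} is invertible: a combination of psi_0, ..,
   psi_(n-1) vanishing at all zeros of psi_n has nonnegative Jacobi energy. *)
Lemma interpolation n (c : nat -> R) : exists d : nat -> R,
  forall k, (k < n)%N -> \sum_(i < n) d i * pj i (s k / s n) = c k.
Proof.
pose A := \matrix_(i < n, k < n) pj i (s k / s n).
have rf : row_free A.
  apply: inj_row_free => u uA.
  (* The row vector is extended by 0 to all indices; only the values below n enter the sums. *)
  pose d i : R := if insub i is Some o then u ord0 o else 0.
  have dE (i : 'I_n) : d i = u ord0 i by rewrite /d valK.
  have z0 y : is_derive y 1 (fun=> 0 : R) ((fun=> 0 : R) y) by exact: dcst.
  have cz y : {for y, continuous (fun=> 0 : R)} by exact: cC.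
  have HD := residual_derive d n (fun=> 0) (fun=> 0) z0.
  have HC := residual_derive_cont d n (fun=> 0) cz.
  (* For h = 0 and S = s_n the energy is the sum of (s_i^2 - s_n^2) d_i^2. Its factors are negative
     for i < n, so Jacobi's inequality forces d = 0. *)
  have := residual_energy d n (fun=> 0) (fun=> 0) z0 cz erefl (s n).
  have ip0 f : bm f -> ip (fun=> 0) f = 0.
    move=> bf; rewrite -[RHS](mul0r (ip (fun=> 0) f)) -ipZl ?bmC //.
    by apply: eq_ip => y _; rewrite mulr0.
  rewrite jacobi_J; last 2 first.
  - by apply: bm_continuous => y; exact: is_derive_continuous (HD y).
  - exact: bm_continuous.
  have := jacobi_ge0 nu s hnu hs n _ _ HD HC.
  have V k : (k <= n)%N -> 0 - \sum_(i < n) d i * pj i (s k / s n) = 0.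
    rewrite leq_eqVlt => /orP[/eqP ->|kn].
      by rewrite big1 ?subrr // => i _; rewrite divff ?(s_neq0 _ _ hs) // pj1 mulr0.
    have := congr1 (fun M : 'rV_n => M ord0 (Ordinal kn)) uA; rewrite !mxE => e.
    suff -> : \sum_(i < n) d i * pj i (s k / s n) = 0 by rewrite subrr.
    by rewrite -[RHS]e; apply: eq_bigr => i _; rewrite dE mxE.
  move=> /(_ V) Jge E; rewrite E in Jge; move: Jge.
  rewrite !ip0 ?bmC ?mulr0 ?subrr ?sub0r //.
  rewrite -sumrN => Hge.
  have Hle (i : 'I_n) : true -> - ((s i ^+ 2 - s n ^+ 2) * (2 * ip (fun=> 0) (pj i) * d i - d i ^+ 2)) <= 0.
    move=> _; rewrite ip0 ?pj_bm // mulr0 mul0r sub0r mulrN opprK mulr_le0_ge0 ?sqr_ge0 //.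
    by rewrite subr_le0 lerXn2r ?nnegrE ?(ltW (s_gt0 _ _ hs _)) // (s_le _ _ hs) // ltnW.
  have S0 : \sum_(i < n) - ((s i ^+ 2 - s n ^+ 2) * (2 * ip (fun=> 0) (pj i) * d i - d i ^+ 2)) = 0.
    by apply/eqP; rewrite eq_le Hge andbT; apply: sumr_le0 => i _; exact: Hle.
  have := S0; move/eqP; rewrite -oppr_eq0 -sumrN psumr_eq0; last by move=> i _; rewrite oppr_ge0 Hle.
  move/allP => H; apply/rowP => i; rewrite mxE -dE; have := H i (mem_index_enum _).
  rewrite ip0 ?pj_bm // mulr0 mul0r sub0r opprK mulf_eq0 oppr_eq0 sqrf_eq0 => /orP[|/eqP //].
  rewrite subr_eq0 eqrXn2 ?(ltW (s_gt0 _ _ hs _)) // => /eqP e.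
  by have := s_lt _ _ hs _ _ (ltn_ord i); rewrite e ltxx.
have uA : A \in unitmx by rewrite -row_free_unit.
pose b := \row_(k < n) c k; pose u := b *m invmx A.
exists (fun i => if insub i is Some o then u ord0 o else 0) => k kn.
have : (u *m A) ord0 (Ordinal kn) = c k by rewrite mulmxKV // mxE.
by rewrite mxE => <-; apply: eq_bigr => i _; rewrite valK [A _ _]mxE.
Qed.

(** Jacobi's inequality for h minus its interpolant at the nodes s_k/s_n. The unknown interpolation
    coefficients disappear through 2 a d - d^2 <= a^2, where s_n^2 - s_i^2 >= 0 is used. *)
Lemma deficit n h dh : (forall y, is_derive y 1 h (dh y)) -> (forall y, {for y, continuous dh}) ->
  h 1 = 0 -> s n ^+ 2 * (ip h h - \sum_(i < n) ip h (pj i) ^+ 2) <= ip dh dh.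
Proof.
move=> hh cdh h1; have [d Hd] := interpolation n (fun k => h (s k / s n)).
have HD := residual_derive d n h dh hh; have HC := residual_derive_cont d n dh cdh.
have E := residual_energy d n h dh hh cdh h1 (s n).
rewrite jacobi_J in E; last 2 first.
- by apply: bm_continuous => y; exact: is_derive_continuous (HD y).
- exact: bm_continuous.
have V k : (k <= n)%N -> h (s k / s n) - \sum_(i < n) d i * pj i (s k / s n) = 0.
  rewrite leq_eqVlt => /orP[/eqP ->|kn]; last by rewrite Hd // subrr.
  rewrite divff ?(s_neq0 _ _ hs) // h1 big1 ?subrr // => i _.
  by rewrite pj1 mulr0.
have := jacobi_ge0 nu s hnu hs n _ _ HD HC V; rewrite E.
have : - \sum_(i < n) (s i ^+ 2 - s n ^+ 2) * (2 * ip h (pj i) * d i - d i ^+ 2) <= s n ^+ 2 * \sum_(i < n) ip h (pj i) ^+ 2.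
  rewrite mulr_sumr -sumrN; apply: ler_sum => i _.
  have l : s i ^+ 2 <= s n ^+ 2 by rewrite lerXn2r ?nnegrE ?(ltW (s_gt0 _ _ hs _)) // (s_le _ _ hs) // ltnW.
  have : 0 <= (s n ^+ 2 - s i ^+ 2) * (ip h (pj i) - d i) ^+ 2 by rewrite mulr_ge0 ?subr_ge0 ?sqr_ge0.
  have : 0 <= s i ^+ 2 * ip h (pj i) ^+ 2 by rewrite mulr_ge0 ?sqr_ge0.
  by clear; nra.
by rewrite mulrBr; clear; lra.
Qed.

(** The function e pairs only with the Fourier remainder r of h, and s_n^2 ||r||^2 <= ||h'||^2.
    Young's inequality with parameter s_n makes the pairing O(1/s_n). *)
Lemma complete_pairing e h dh : bm e -> (forall i, ip e (pj i) = 0) ->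
  (forall y, is_derive y 1 h (dh y)) -> (forall y, {for y, continuous dh}) -> h 1 = 0 -> ip h e = 0.
Proof.
move=> be e0 hh cdh h1.
have bh : bm h by apply: bm_continuous => y; exact: is_derive_continuous (hh y).
pose C := 2^-1 * ip e e + 2^-1 * ip dh dh.
have C0 : 0 <= C by rewrite addr_ge0 // mulr_ge0 ?ip_ge0 ?invr_ge0.
have key n : `|ip h e| <= C / s n.
  have sn := s_gt0 _ _ hs n.
  pose a i := ip h (pj i).
  pose r y := h y - \sum_(i < n) a i * pj i y.
  have bG : bm (fun y => \sum_(i < n) a i * pj i y) by exact: comb_bm.
  have br : bm r by exact: bmB.
  have re : ip h e = ip r e.
    rewrite /r ipBl // [X in _ - X]ipC (ip_comb a n) // [X in _ - X]big1 ?subr0 // => i _.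
    by rewrite e0 mulr0.
  have rr : ip r r = ip h h - \sum_(i < n) a i ^+ 2.
    rewrite {1}/r ipBl // [X in _ - X]ipC (ip_comb a n) // [X in _ - X]big1 ?subr0; last first.
      by move=> i _; rewrite (ip_residual_pj a n h dh hh) // subrr mulr0.
    rewrite [ip h r]ipC {1}/r ipBl // [X in _ - X]ipC (ip_comb a n) //; congr (_ - _).
  have D := deficit n h dh hh cdh h1; rewrite -rr in D.
  rewrite re; apply: (le_trans (ip_young nu hnu (s n) r e sn br be)).
  rewrite ler_pdivlMr // /C; have sn0 : s n != 0 by rewrite gt_eqF.
  have -> : (s n / 2 * ip r r + (2 * s n)^-1 * ip e e) * s n = (s n ^+ 2 * ip r r + ip e e) / 2 by field.
  by move: D; clear; lra.
apply/eqP; rewrite -normr_le0; apply/ler_addgt0Pl => eps e1; rewrite addr0.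
have ns := s_cvg _ _ hnu hs.
have [n Hn] : exists n, C / eps <= s n.
  have /cvgryPge/(_ (C / eps)) [N _ HN] := ns.
  by exists N; apply: HN => /=.
by apply: (le_trans (key n)); rewrite ler_pdivrMr ?(s_gt0 _ _ hs) // mulrC -ler_pdivrMr.
Qed.

End completeness.

Section smooth_cutoff.
Context {R : realType}.
Implicit Types (t x y : R).
Definition pos2 t : R := Num.max t 0 ^+ 2.

Lemma max0_cont x : {for x, continuous (fun t : R => Num.max t 0)}.
Proof.
rewrite (_ : (fun t => _) = (fun t => (t + `|t|) / 2)); first by cont; exact: cabs.
by apply/funext => t; have [t0|t0] := leP t 0; [rewrite ler0_norm // subrr mul0r | rewrite gtr0_norm //; field].
Qed.

Lemma pos2_derive x : is_derive x 1 pos2 (2 * Num.max x 0).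
Proof.
have [x0|x0|->] := ltrgtP x 0.
- rewrite mulr0.
  apply: (@near_eq_is_derive _ _ _ (fun _ : R => 0 : R)).
  near=> t; rewrite /pos2 max_r ?expr0n //.
  by apply: ltW; near: t; exact: lt_nbhsl.
- apply: (@near_eq_is_derive _ _ _ (fun t => t ^+ 2)).
    by near=> t; rewrite /pos2 max_l //; apply: ltW; near: t; exact: lt_nbhsr.
  by derval; rewrite /= expr1 mulr1.
- rewrite mulr0; apply/is_derive1_caratheodory; exists (fun t => Num.max t 0); split.
  + move=> z; rewrite /pos2 maxxx expr0n /= !subr0.
    by have [z0|z0] := leP z 0; rewrite ?expr0n ?mul0r // expr2.
  + exact: max0_cont.
  + by rewrite maxxx.
Unshelve. all: by end_near. Qed.

Lemma pos2_ge0 t : 0 <= pos2 t. Proof. exact: sqr_ge0. Qed.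

(** An explicit C^1 step: zero on the left half line, and [cutoff] (n t) tends to 1 for every t >
    0. *)
Definition cutoff t : R := pos2 t / (1 + pos2 t).
Definition dcutoff t : R := 2 * Num.max t 0 / (1 + pos2 t) ^+ 2.

Lemma pos2_1 t : 1 + pos2 t != 0.
Proof. by rewrite gt_eqF // ltr_pwDl // pos2_ge0. Qed.

Lemma cutoff_derive x : is_derive x 1 cutoff (dcutoff x).
Proof.
have H := pos2_derive x; have := pos2_1 x => n0; rewrite /cutoff; derval => //.
by rewrite /dcutoff; field.
Qed.

Lemma dcutoff_cont x : {for x, continuous dcutoff}.
Proof.
have H : {for x, continuous pos2} by exact: is_derive_continuous (pos2_derive x).
have c1 : {for x, continuous (fun t : R => Num.max t 0)} by exact: max0_cont.
rewrite /dcutoff.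
apply: (cM (fun t => 2 * Num.max t 0) (fun t => ((1 + pos2 t) ^+ 2)^-1)).
  by apply: (cM (fun=> 2) (fun t => Num.max t 0)) => //; exact: cC.
apply: cV; first by rewrite expf_neq0 // pos2_1.
by apply: (cX (fun t => 1 + pos2 t)); apply: (cD (fun=> 1) pos2) => //; exact: cC.
Qed.

Lemma cutoff_bounds t : 0 <= cutoff t <= 1.
Proof.
have p := pos2_ge0 t; rewrite /cutoff divr_ge0 ?addr_ge0 //=.
by rewrite ler_pdivrMr ?ltr_pwDl // mul1r lerDr.
Qed.

Lemma cutoff_le0 t : t <= 0 -> cutoff t = 0.
Proof. by move=> t0; rewrite /cutoff /pos2 max_r // expr0n mul0r. Qed.

Lemma cutoff_lim t : 0 < t -> cutoff (n%:R * t) @[n --> \oo] --> (1 : R).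
Proof.
move=> t0.
have E n : cutoff (n%:R * t) = 1 - (1 + pos2 (n%:R * t))^-1.
  by have := pos2_1 (n%:R * t) => h; rewrite /cutoff; field.
rewrite (_ : (fun n => _) = (fun n => 1 - (1 + pos2 (n%:R * t))^-1)); last by apply/funext.
rewrite -[X in _ --> X]subr0; apply: cvgB; first exact: cvg_cst.
apply/gtr0_cvgV0; first by apply: nearW => n; rewrite ltr_pwDl // pos2_ge0.
apply/cvgryPge => A; near=> n.
have h1 : A <= n%:R * t ^+ 2.
  by rewrite -ler_pdivrMr ?exprn_gt0 //; near: n; exact: nbhs_infty_ger.
apply: (le_trans h1); rewrite /pos2 max_l ?mulr_ge0 ?(ltW t0) // exprMn.
apply: (@le_trans _ _ (n%:R ^+ 2 * t ^+ 2)); last by rewrite lerDr.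
rewrite ler_wpM2r ?sqr_ge0 // -natrX ler_nat; case: (n) => // k.
by rewrite expnS leq_pmulr // expn_gt0.
Unshelve. all: by end_near. Qed.

End smooth_cutoff.

Section completeness_ae.
Context {R : realType}.
Variables (nu : R) (s : nat -> R).
Hypotheses (hnu : -1 < nu) (hs : bessel_zeros nu s).
Local Notation mu := (@lebesgue_measure R).
Local Notation w := (weight nu).
Local Notation I01 := (`]0%R, 1%R[%classic : set R).
Local Notation ip := (ip nu).

(** The indicator of ]0, b[ is the bounded limit of [cutoff] (n y (b - y)); b < 1 makes these test
    functions vanish at 1, as completeness requires. *)
Lemma complete_interval (e : R -> R) b : bm e -> (forall i, ip e (pj nu s i) = 0) -> 0 < b -> b < 1 ->
  \int[mu]_(y in `]0, b[) (e y * w y) = 0.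
Proof.
move=> be e0 b0 b1.
pose p y := y * (b - y).
pose h n y := cutoff (n%:R * p y).
have hE n : ip (h n) e = 0.
  apply: (complete_pairing nu s hnu hs e (h n) (fun y => dcutoff (n%:R * p y) * (n%:R * (b - 2 * y))) be e0).
  - move=> y; rewrite /h /p; eapply is_derive_val.
      by eapply (dcomp cutoff (fun y => n%:R * (y * (b - y)))); [der | exact: cutoff_derive].
    by congr (_ * _); ring.
  - move=> y; have c1 : {for y, continuous (fun y => dcutoff (n%:R * p y))}.
      by apply: (ccomp dcutoff (fun y => n%:R * p y)); [rewrite /p; cont | exact: dcutoff_cont].
    by cont.
  - rewrite /h cutoff_le0 // mulr_ge0_le0 // /p mul1r subr_le0 ltW //.
have /bmP[me [M HM]] := be.
have M0 : 0 <= M.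
  by have := HM 2^-1; rewrite invr_gt0 ltr0n invf_lt1 ?ltr1n //= => /(_ isT); apply: le_trans; exact: normr_ge0.
have hc n y : {for y, continuous (h n)}.
  apply: (ccomp cutoff (fun y => n%:R * p y)); first by rewrite /p; cont.
  exact: is_derive_continuous (cutoff_derive _).
have bh n : bm (h n) by exact: bm_continuous.
have mI : measurable_fun I01 ((\1_(`]0, b[%classic : set R) : R -> R)).
  by apply: measurable_funTS; exact: measurable_indic.
have D : (\int[mu]_(y in I01) (h n y * e y * w y)) @[n --> \oo] --> \int[mu]_(y in I01) (\1_(`]0, b[%classic : set R) y * e y * w y).
  apply: (Rdominated_convergence _ (fun n y => h n y * e y * w y) (fun y => \1_(`]0, b[%classic : set R) y * e y * w y) (fun y => M * w y)) => //.
  - move=> n; have /bmP[mh _] := bh n.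
    by apply: measurable_funM; [exact: measurable_funM | exact: weight_measurable].
  - by apply: measurable_funM; [exact: measurable_funM | exact: weight_measurable].
  - apply: aeW => y /in01/andP[y0 y1]; apply: cvgM; last exact: cvg_cst.
    apply: cvgM; last exact: cvg_cst; rewrite indicE.
    have [yb|yb] := ltP y b.
      rewrite mem_set /=; last by rewrite in_itv /= y0.
      by apply: cutoff_lim; rewrite mulr_gt0 // subr_gt0.
    rewrite memNset /=; last by rewrite in_itv /= y0 ltNge yb.
    apply: cvg_near_cst; apply: nearW => n; rewrite /h cutoff_le0 //.
    by rewrite mulr_ge0_le0 // mulr_ge0_le0 ?(ltW y0) // subr_le0.
  - apply: (@integrableZl _ _ _ mu _ _ M (EFin \o w)) => //; exact: weight_integrable.
  - move=> n y /in01 y01; rewrite normrM [`|w y|]ger0_norm ?weight_ge0 // ler_wpM2r ?weight_ge0 //.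
    have /andP[h0 h1] := cutoff_bounds (n%:R * p y).
    rewrite normrM (le_trans _ (HM y y01)) // ler_piMl ?normr_ge0 //.
    by rewrite /h ger0_norm.
have z : (fun n => \int[mu]_(y in I01) (h n y * e y * w y)) = fun=> 0 by apply/funext => n; exact: hE.
rewrite z in D; have H : \int[mu]_(y in I01) (\1_(`]0, b[%classic : set R) y * e y * w y) = 0.
  by apply: cvg_unique D (cvg_cst 0).
rewrite -[RHS]H (_ : (fun y => \1_(`]0, b[%classic : set R) y * e y * w y) = (fun y => e y * w y) \_ (`]0, b[%classic : set R)); last first.
  by apply/funext => y; rewrite patchE indicE; case: ifPn => _; rewrite ?mul1r ?mul0r.
rewrite -Rintegral_mkcondr; congr (Rintegral _ _ _).
apply/seteqP; split => y /=; rewrite !in_itv /=; last by case.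
by move=> /andP[-> yb]; rewrite yb (lt_trans yb).
Qed.

(** Almost everywhere e w is the derivative of its own primitive, and that primitive vanishes on ]0,
    1[. *)
Lemma complete_ae (e : R -> R) : bm e -> (forall i, ip e (pj nu s i) = 0) ->
  {ae mu, forall y, 0 < y < 1 -> e y = 0}.
Proof.
move=> be e0.
pose f := (fun y => e y * w y) \_ I01.
have fi : integ setT f.
  rewrite /f -restrict_EFin; have [+ _] := @integrable_mkcond _ _ _ mu _ (EFin \o (fun y => e y * w y)) (measurable_itv `]0%R, 1%R[).
  apply.
  exact: (bm_integrable nu hnu e be).
have lf : locally_integrable setT f by exact: open_integrable_locally openT fi.
have fi' y : integ `]-oo, y] f by exact: integrableS fi.
have H := FTC1Ny fi' lf; apply: ae_imp H => y [_ dF] y01.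
case/andP: (y01) => y0 y1.
have F0 b : 0 < b -> b < 1 -> \int[mu]_(t in `]-oo, b]) f t = 0.
  move=> b0 b1; rewrite /f -Rintegral_mkcondr.
  rewrite (_ : `]-oo, b] `&` I01 = `]0, b]%classic); last first.
    apply/seteqP; split => z /=; rewrite !in_itv /=; first by move=> [-> /andP[-> _]].
    by move=> /andP[-> zb]; rewrite zb (le_lt_trans zb).
  rewrite -Rintegral_itv_bndo_bndc; first exact: complete_interval.
  apply: (integrableS _ _ _ (bm_integrable nu hnu e be)) => // z /=.
  by rewrite !in_itv /= => /andP[-> zb]; exact: lt_trans zb b1.
have : f y = 0.
  rewrite -dF derive1E (@near_eq_derive _ _ _ _ (fun=> 0)) ?derive_cst ?oner_eq0 //.
  by near=> z; apply: F0; near: z; [exact: lt_nbhsr | exact: lt_nbhsl].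
rewrite /f patchE mem_set /=; last by rewrite in_itv.
by move/eqP; rewrite mulf_eq0 (gt_eqF (weight_gt0 _ _ y0)) orbF => /eqP.
Unshelve. all: by end_near. Qed.

(** The passage through almost everywhere vanishing frees f from any square integrability, which
    matters for L^p with p < 2. *)
Lemma complete_integral (e f : R -> R) : bm e -> (forall i, ip e (pj nu s i) = 0) ->
  measurable_fun I01 f -> \int[mu]_(y in I01) (f y * e y * w y) = 0.
Proof.
move=> be e0 mf; have H := complete_ae e be e0.
have /bmP[me _] := be.
transitivity (\int[mu]_(y in I01) (0 : R)); last by rewrite Rintegral_cst // mul0r.
rewrite /Rintegral; congr fine; apply: ae_eq_integral => //.
- by apply/measurable_EFinP; apply: measurable_funM; [exact: measurable_funM | exact: weight_measurable].
- apply: ae_imp H => y Hy /in01 y01; by rewrite Hy // mulr0 mul0r.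
Qed.

End completeness_ae.

(** * Local multipliers *)

Section integral_tools.
Context {R : realType}.
Local Notation mu := (@lebesgue_measure R).
Implicit Types (f : R -> R) (a b c d u v : R).

Lemma continuous_integ f u v : (forall x, {for x, continuous f}) -> integ `[u, v] f.
Proof.
move=> cf; apply: continuous_compact_integrable; first exact: segment_compact.
by apply: continuous_subspaceT => x; exact: cf.
Qed.

Lemma integ_oo f u v : integ `[u, v] f -> integ `]u, v[ f.
Proof.
apply: integrableS => // x /=; rewrite !in_itv /= => /andP[ux xv].
by rewrite (ltW ux) (ltW xv).
Qed.

Lemma continuous_integ_oo f u v : (forall x, {for x, continuous f}) -> integ `]u, v[ f.
Proof. by move=> cf; apply: integ_oo; exact: continuous_integ. Qed.

Lemma Rintegral_oo_cc f u v : integ `[u, v] f ->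
  \int[mu]_(x in `]u, v[) f x = \int[mu]_(x in `[u, v]) f x.
Proof.
move=> fi; rewrite -Rintegral_itv_obnd_cbnd; last first.
  by apply: integrableS fi => // x /=; rewrite !in_itv /= => /andP[/ltW -> ->].
by rewrite Rintegral_itv_bndo_bndc //; exact: integ_oo.
Qed.

Lemma Rintegral_cst_itv a b c : a <= b -> \int[mu]_(x in `]a, b[) c = c * (b - a).
Proof.
move=> ab; rewrite Rintegral_cst //=; congr (_ * _).
have -> : mu `]a, b[%classic = (b - a)%:E; last by [].
rewrite lebesgue_measure_itv /= lte_fin; have [//|ba] := ltP a b.
by rewrite (_ : a = b) ?subrr //; apply/eqP; rewrite eq_le ab.
Qed.

Lemma primitive f c d : (forall x, {for x, continuous f}) ->
  exists F : R -> R, forall x : R, c < x < d -> is_derive x 1 F (f x).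
Proof.
move=> cf; exists (fun x => \int[mu]_(t in `[c, x]) f t) => x /andP[cx xd].
have [h1 h2] := @continuous_FTC1_closed R f c x d xd (continuous_integ f c d cf) cx (cf x).
by split; [exact: h1 | rewrite -h2 derive1E].
Qed.

Lemma Rintegral_continuous f u v F : u < v -> (forall x, {for x, continuous f}) ->
  (forall x, u <= x <= v -> is_derive x 1 F (f x)) ->
  \int[mu]_(x in `]u, v[) f x = F v - F u.
Proof.
move=> uv cf dF; rewrite Rintegral_oo_cc; last exact: continuous_integ.
by apply: Rintegral_FTC.
Qed.

Lemma Rintegral_affine f a b u v : 0 < a -> u < v -> (forall x, {for x, continuous f}) ->
  \int[mu]_(x in `]a * u + b, a * v + b[) f x = a * \int[mu]_(x in `]u, v[) f (a * x + b).
Proof.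
move=> a0 uv cf.
(* The margin 1 on both sides is there because [primitive] differentiates only inside an open
   interval, while the closed end points are needed. *)
have [F dF] := primitive f (a * u + b - 1) (a * v + b + 1) cf.
have dF' x : a * u + b <= x <= a * v + b -> is_derive x 1 F (f x).
  by move=> /andP[h1 h2]; apply: dF; lra.
have le x : u <= x <= v -> a * u + b <= a * x + b <= a * v + b.
  by rewrite !lerD2r !ler_pM2l.
transitivity (F (a * v + b) - F (a * u + b)).
  by apply: Rintegral_continuous => //; rewrite ltrD2r ltr_pM2l.
have -> : a * \int[mu]_(x in `]u, v[) f (a * x + b) = \int[mu]_(x in `]u, v[) (a * f (a * x + b)).
  rewrite RintegralZl //; apply: continuous_integ_oo => x.
  by apply: (ccomp f (fun x => a * x + b)) => //; cont.
symmetry; apply: (Rintegral_continuous (fun x => a * f (a * x + b)) u v (fun x => F (a * x + b))) => //.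
  move=> x; apply: (cM (fun=> a) (fun x => f (a * x + b))); first exact: cC.
  by apply: (ccomp f (fun x => a * x + b)) => //; cont.
move=> x /le/dF' H; eapply is_derive_val; first by eapply (dcomp F (fun x => a * x + b)); [der | exact: H].
by ring.
Qed.

Lemma Rintegral_opp f u v : u < v -> (forall x, {for x, continuous f}) ->
  \int[mu]_(x in `]- v, - u[) f x = \int[mu]_(x in `]u, v[) f (- x).
Proof.
move=> uv cf.
have [F dF] := primitive f (- v - 1) (- u + 1) cf.
have dF' x : - v <= x <= - u -> is_derive x 1 F (f x).
  by move=> /andP[h1 h2]; apply: dF; lra.
transitivity (F (- u) - F (- v)); first by apply: Rintegral_continuous => //; rewrite ltrN2.
transitivity (- F (- v) - - F (- u)); first by ring.
symmetry; apply: (Rintegral_continuous (fun x => f (- x)) u v (fun x => - F (- x))) => //.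
  by move=> x; apply: (ccomp f (fun x => - x)) => //; cont.
move=> x xuv; eapply is_derive_val.
  eapply (dN (fun x => F (- x))); eapply (dcomp F (fun x => - x)); [der | apply: dF'; lra].
by ring.
Qed.

Lemma Rintegral_split f a c b : a < c -> c < b -> (forall x, {for x, continuous f}) ->
  \int[mu]_(x in `]a, b[) f x = \int[mu]_(x in `]a, c[) f x + \int[mu]_(x in `]c, b[) f x.
Proof.
move=> ac cb cf; have [F dF] := primitive f (a - 1) (b + 1) cf.
have E u v : a <= u -> u < v -> v <= b -> \int[mu]_(x in `]u, v[) f x = F v - F u.
  move=> au uv vb; apply: Rintegral_continuous => // x /andP[ux xv]; apply: dF; lra.
by rewrite !E ?lexx ?(ltW ac) ?(ltW cb) // ?(lt_trans ac) //; ring.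
Qed.

(** A majorant of product form reduces joint integrability to two integrals in one variable.
    Everything is extended by zero to the plane; measurability of the inner integral is returned as
    well, for later estimates of kernels. *)
Lemma Rfubini_both (D1 D2 : set R) (f : R -> R -> R) (al be : R -> R) :
  measurable D1 -> measurable D2 ->
  measurable_fun (D1 `*` D2) (fun z : R * R => f z.1 z.2) ->
  integ D1 al -> integ D2 be -> (forall x y, D1 x -> D2 y -> `|f x y| <= al x * be y) ->
  \int[mu]_(x in D1) \int[mu]_(y in D2) f x y = \int[mu]_(y in D2) \int[mu]_(x in D1) f x y /\
  measurable_fun D2 (fun y => \int[mu]_(x in D1) f x y).
Proof.
move=> m1 m2 mf ia ib H.
have m12 : measurable (D1 `*` D2) by exact: measurableX.
pose g : R * R -> R := (fun z => f z.1 z.2) \_ (D1 `*` D2).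
have mg : measurable_fun setT (EFin \o g).
  by apply/measurable_EFinP; apply/(measurable_restrictT _ m12).
pose al' := al \_ D1. pose be' := be \_ D2.
have ial : integ setT al'.
  rewrite -restrict_EFin; have [+ _] := @integrable_mkcond _ _ _ mu _ (EFin \o al) m1.
  exact.
have ibe : integ setT be'.
  rewrite -restrict_EFin; have [+ _] := @integrable_mkcond _ _ _ mu _ (EFin \o be) m2.
  exact.
have gH x y : `|g (x, y)| <= `|al' x| * `|be' y|.
  rewrite /g /al' /be' !patchE; case: ifPn => [/set_mem[/= x1 x2]|_].
    by rewrite !mem_set // -normrM (le_trans (H _ _ x1 x2)) // ler_norm.
  by rewrite normr0 mulr_ge0.
have gE x : D1 x -> (\int[mu]_y (g (x, y))%:E = \int[mu]_(y in D2) (f x y)%:E)%E.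
  move=> D1x; rewrite [RHS]integral_mkcond; apply: eq_integral => y _.
  rewrite /g !patchE; case: (asboolP (D2 y)) => D2y; first by rewrite !mem_set.
  by rewrite !memNset // => -[].
have gN x : ~ D1 x -> (\int[mu]_y (g (x, y))%:E = 0)%E.
  by move=> D1x; apply: integral0_eq => y _; rewrite /g patchE memNset // => -[].
have gE2 y : D2 y -> (\int[mu]_x (g (x, y))%:E = \int[mu]_(x in D1) (f x y)%:E)%E.
  move=> D2y; rewrite [RHS]integral_mkcond; apply: eq_integral => x _.
  rewrite /g !patchE; case: (asboolP (D1 x)) => D1x; first by rewrite !mem_set.
  by rewrite !memNset // => -[].
have gN2 y : ~ D2 y -> (\int[mu]_x (g (x, y))%:E = 0)%E.
  by move=> D2y; apply: integral0_eq => x _; rewrite /g patchE memNset // => -[].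
have inorm (h : R -> R) : integ setT h -> (\int[mu]_y `|(h y)%:E| < +oo)%E.
  by move=> /integrableP[].
have mabs (h : R -> R) : integ setT h -> measurable_fun setT (fun y => `|(h y)%:E|%E).
  by move=> ih; apply: measurableT_comp => //; apply: measurable_int ih.
have ig : (mu \x mu)%E.-integrable setT (EFin \o g).
  apply/integrable12ltyP => //.
  have [B BE] : exists B : R, (\int[mu]_y `|(be' y)%:E| = B%:E)%E.
    exists (fine (\int[mu]_y `|(be' y)%:E|)%E); rewrite fineK // ge0_fin_numE ?inorm //.
    by apply: integral_ge0.
  have bnd x : (\int[mu]_y `|(g (x, y))%:E| <= `|(al' x)%:E| * B%:E)%E.
    rewrite -BE -ge0_integralZl //; last exact: mabs.
    apply: ge0_le_integral => //.
    - by apply: measurableT_comp => //; apply: (measurableT_comp mg); exact: pair1_measurable.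
    - by apply: measurable_funeM; exact: mabs.
    - by move=> y _; rewrite -EFinM lee_fin; exact: gH.
  apply: (@le_lt_trans _ _ (\int[mu]_x (`|(al' x)%:E| * B%:E))%E).
    apply: ge0_le_integral => //.
    - by move=> x _; apply: integral_ge0.
    - apply: (@measurable_fun_fubini_tonelli_F _ _ _ _ R mu (abse \o (EFin \o g))); last by move=> z; exact: abse_ge0.
      by apply: measurableT_comp.
    - by apply: emeasurable_funM => //; exact: mabs.
    - by move=> x _; exact: bnd.
  rewrite ge0_integralZr //; [|exact: mabs|by rewrite -BE integral_ge0].
  by rewrite muleC lte_mul_pinfty ?inorm // -BE integral_ge0.
have F := Fubini ig.
have iy x : integ setT (fun y => g (x, y)).
  apply: (integ_le _ _ (fun y => `|al' x| * `|be' y|)) => //.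
    by apply/measurable_EFinP; apply: (measurableT_comp mg); exact: pair1_measurable.
  apply: (@integrableZl _ _ _ mu _ _ `|al' x| (EFin \o (fun y => `|be' y|))) => //.
  exact: (integrable_norm ibe).
have ix y : integ setT (fun x => g (x, y)).
  apply: (integ_le _ _ (fun x => `|be' y| * `|al' x|)) => //.
  - by apply/measurable_EFinP; apply: (measurableT_comp mg); exact: pair2_measurable.
  - by move=> x _; rewrite mulrC; exact: gH.
  - apply: (@integrableZl _ _ _ mu _ _ `|be' y| (EFin \o (fun x => `|al' x|))) => //.
    exact: (integrable_norm ial).
have L1 : (\int[mu]_x \int[mu]_y (EFin \o g) (x, y) = \int[mu]_(x in D1) (\int[mu]_(y in D2) f x y)%:E)%E.
  rewrite [RHS]integral_mkcond; apply: eq_integral => x _; rewrite patchE.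
  case: (asboolP (D1 x)) => D1x; last by rewrite memNset // gN.
  rewrite mem_set // /Rintegral fineK; first by rewrite gE.
  by rewrite -gE //; have := @integrable_fin_num _ _ _ mu setT measurableT _ (iy x).
have L2 : (\int[mu]_y \int[mu]_x (EFin \o g) (x, y) = \int[mu]_(y in D2) (\int[mu]_(x in D1) f x y)%:E)%E.
  rewrite [RHS]integral_mkcond; apply: eq_integral => y _; rewrite patchE.
  case: (asboolP (D2 y)) => D2y; last by rewrite memNset // gN2.
  rewrite mem_set // /Rintegral fineK; first by rewrite gE2.
  by rewrite -gE2 //; have := @integrable_fin_num _ _ _ mu setT measurableT _ (ix y).
split; first by congr fine; rewrite -L1 -L2; exact: F.
apply/measurable_EFinP; apply: (eq_measurable_fun (fun y => (\int[mu]_x (EFin \o g) (x, y))%E)).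
  move=> y /set_mem D2y; rewrite /= /Rintegral -gE2 // fineK //.
  exact: (@integrable_fin_num _ _ _ mu setT measurableT _ (ix y)).
apply: measurable_funTS.
exact: (measurable_fubini_G ig).
Qed.

Lemma Rfubini (D1 D2 : set R) (f : R -> R -> R) (al be : R -> R) :
  measurable D1 -> measurable D2 ->
  measurable_fun (D1 `*` D2) (fun z : R * R => f z.1 z.2) ->
  integ D1 al -> integ D2 be -> (forall x y, D1 x -> D2 y -> `|f x y| <= al x * be y) ->
  \int[mu]_(x in D1) \int[mu]_(y in D2) f x y = \int[mu]_(y in D2) \int[mu]_(x in D1) f x y.
Proof. by move=> m1 m2 mf ia ib H; have [] := Rfubini_both D1 D2 f al be m1 m2 mf ia ib H. Qed.
End integral_tools.

(** * Poisson's integral for the cosine transform of the Bochner-Riesz profile *)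

Section bump.
Context {R : realType}.
Local Notation mu := (@lebesgue_measure R).
Implicit Types (a t x : R).

Lemma maxpow_cont a x : 0 < a -> {for x, continuous (fun t : R => Num.max t 0 `^ a)}.
Proof.
move=> a0; have [x0|x0] := leP x 0; last first.
  apply: (cpow (fun t => Num.max t 0)); [by rewrite lt_max x0 | exact: max0_cont].
have E0 : Num.max x 0 `^ a = 0 by rewrite max_r // powR0 // gt_eqF.
rewrite /prop_for /continuous_at E0.
apply/cvgrPdist_lt => e e0; have p0 : 0 < e `^ a^-1 by exact: powR_gt0.
near=> t.
rewrite sub0r normrN ger0_norm ?powR_ge0 //.
have h : Num.max t 0 < e `^ a^-1.
  rewrite gt_max p0 andbT; near: t; apply: lt_nbhsl; exact: le_lt_trans p0.
rewrite (lt_le_trans (gt0_ltr_powR a0 _ _ h)) ?nnegrE ?le_max ?lexx ?orbT ?(ltW p0) //.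
by rewrite -powRrM mulVf ?gt_eqF // powRr1 // ltW.
Unshelve. all: by end_near. Qed.

(* The profile of the Bochner-Riesz multiplier and its cosine transform [Hf], a multiple of
   [gbes (a + 1 / 2)]. *)
Definition Mf a x : R := Num.max (1 - x ^+ 2) 0 `^ a.

Lemma Mf_cont a x : 0 < a -> {for x, continuous (Mf a)}.
Proof.
move=> a0; apply: (ccomp (fun t => Num.max t 0 `^ a) (fun x => 1 - x ^+ 2)); first by cont.
exact: maxpow_cont.
Qed.

Lemma MfN a x : Mf a (- x) = Mf a x. Proof. by rewrite /Mf sqrrN. Qed.

Lemma Mf_ge0 a x : 0 <= Mf a x. Proof. exact: powR_ge0. Qed.

Lemma Mf_le1 a x : 0 < a -> Mf a x <= 1.
Proof.
move=> a0; apply: (@le_trans _ _ (1 `^ a)); last by rewrite powR1.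
rewrite ge0_ler_powR ?nnegrE ?le_max ?lexx ?orbT //; first exact: ltW.
by rewrite ge_max ler01 andbT gerBl sqr_ge0.
Qed.

Lemma Mf_out a x : 0 < a -> 1 <= `|x| -> Mf a x = 0.
Proof.
move=> a0 x1; rewrite /Mf max_r ?powR0 ?gt_eqF //.
by rewrite subr_le0 -real_normK ?num_real // exprn_ege1.
Qed.

Lemma Mf_in a x : `|x| < 1 -> Mf a x = (1 - x ^+ 2) `^ a.
Proof.
move=> x1; rewrite /Mf max_l // subr_ge0 -real_normK ?num_real // exprn_ile1 //; exact: ltW.
Qed.

Local Notation J := (`]-1, 1[%classic : set R).

Definition mom a k := \int[mu]_(x in J) (Mf a x * x ^+ k.*2).

Let mM n a x : 0 < a -> {for x, continuous (fun x : R => Mf a x * x ^+ n)}.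
Proof. by move=> a0; have := Mf_cont a x a0 => ?; cont. Qed.

Let iM n a : 0 < a -> integ J (fun x : R => Mf a x * x ^+ n).
Proof. by move=> a0; apply: continuous_integ_oo => x; exact: mM. Qed.

(** Integrates the derivative of (1 - x^2)^(a+1) x^(2k+1), a function that vanishes at both ends. *)
Lemma mom_rec a k : 0 < a -> mom a k.+1 = mom a k * ((k.*2.+1)%:R / (k.*2%:R + 2 * a + 3)).
Proof.
move=> a0; pose A : R := (k.*2.+1)%:R. pose B : R := A + 2 * a + 2.
have A0 : 0 <= A by [].
have H : \int[mu]_(x in J) (A * (Mf a x * x ^+ k.*2) - B * (Mf a x * x ^+ k.+1.*2)) = 0 - 0.
  have c x : {for x, continuous (fun x => A * (Mf a x * x ^+ k.*2) - B * (Mf a x * x ^+ k.+1.*2))}.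
    by have := Mf_cont a x a0 => ?; cont.
  apply: (Rintegral_FTC_oo _ (fun x => Mf (a + 1) x * x ^+ k.*2.+1)) => //.
  - exact: continuous_integ_oo.
  - move=> x /andP[x0 x1]; have xn : `|x| < 1 by rewrite ltr_norml x0.
    have p : 0 < 1 - x ^+ 2 by rewrite subr_gt0 -real_normK ?num_real // exprn_ilt1.
    apply: (@near_eq_is_derive _ _ _ (fun x => (1 - x ^+ 2) `^ (a + 1) * x ^+ k.*2.+1)).
      near=> y; rewrite Mf_in // ltr_norml; apply/andP; split; near: y.
        exact: lt_nbhsr.
      exact: lt_nbhsl.
    derval => //.
    have -> : a + 1 - 1 = a by ring.
    rewrite Mf_in // powRD ?powRr1 ?(ltW p) //; last by apply/implyP => _; rewrite gt_eqF.
    rewrite /B -/A doubleS [x ^+ k.*2.+2]exprS [x ^+ k.*2.+1]exprS /=.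
    by generalize A ((1 - x ^+ 2) `^ a) (x ^+ k.*2) => A' P T; ring.
  - rewrite (_ : 0 = Mf (a + 1) (-1) * (-1) ^+ k.*2.+1); last by rewrite Mf_out ?mul0r ?normrN1 // addr_gt0.
    by apply: cvg_at_right_filter; apply: mM; rewrite addr_gt0.
  - rewrite (_ : 0 = Mf (a + 1) 1 * 1 ^+ k.*2.+1); last by rewrite Mf_out ?mul0r ?normr1 // addr_gt0.
    by apply: cvg_at_left_filter; apply: mM; rewrite addr_gt0.
have {}H : A * mom a k - B * mom a k.+1 = 0.
  rewrite -[RHS]subr0 -H RintegralB //; last 2 first.
  - exact: (@integrableZl _ _ _ mu _ _ A (EFin \o (fun x => Mf a x * x ^+ k.*2)) (iM _ _ a0)).
  - exact: (@integrableZl _ _ _ mu _ _ B (EFin \o (fun x => Mf a x * x ^+ k.+1.*2)) (iM _ _ a0)).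
  by rewrite !RintegralZl //; exact: iM.
have B0 : B != 0 by rewrite /B gt_eqF //; lra.
have -> : k.*2%:R + 2 * a + 3 = B by rewrite /B /A -natr1; ring.
apply: (mulfI B0); rewrite -(subr0_eq H); field.
Unshelve. all: by end_near. Qed.

Definition Hf a t := \int[mu]_(x in J) (Mf a x * cos (t * x)).

(** Both sides have the same ratio of consecutive terms: the moment recursion against the functional
    equation of Gamma at order a + 1/2. *)
Lemma mom_coef a t k : 0 < a -> (-1) ^+ k * t ^+ k.*2 / k.*2`!%:R * mom a k =
  mom a 0 * Gamma (a + 1 / 2 + 1) * (bcoef (a + 1 / 2) k * ((t / 2) ^+ 2) ^+ k).
Proof.
move=> a0; elim: k => [|k IH].
  rewrite bcoef.unlock !expr0 !fact0 add0r; have : 0 < a + 1 / 2 + 1 by lra.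
  by move=> /Gamma_gt0; move: (Gamma _) => G G0; field; rewrite gt_eqF.
rewrite mom_rec // bcoef.unlock.
have p : 0 < k%:R + (a + 1 / 2) + 1 :> R by have : 0 <= k%:R :> R by []; lra.
have -> : (k.+1)%:R + (a + 1 / 2) + 1 = (k%:R + (a + 1 / 2) + 1) + 1 :> R by rewrite -natr1; ring.
rewrite (Gamma_rec _ p) doubleS !factS !natrM exprS 2![t ^+ _]exprS [(_ ^+ 2) ^+ k.+1]exprS.
move: IH; rewrite bcoef.unlock; have := Gamma_gt0 _ p; move: (Gamma (k%:R + _ + _)) => G G0.
move: (Gamma _) (mom a 0) (mom a k) => G1 m0 mk.
have f0 : k`!%:R != 0 :> R by rewrite pnatr_eq0 -lt0n fact_gt0.
have f1 : k.*2`!%:R != 0 :> R by rewrite pnatr_eq0 -lt0n fact_gt0.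
move: (k`!%:R) f0 (k.*2`!%:R) f1 => F0 f0 F1 f1.
rewrite -[(k.*2.+2)%:R]natr1 -[(k.*2.+1)%:R]natr1 -[(k.+1)%:R]natr1.
rewrite (_ : k.*2%:R = k%:R * 2 :> R); last by rewrite -muln2 natrM.
move: ((-1) ^+ k) (t ^+ k.*2) (((t / 2) ^+ 2) ^+ k) => e T S.
move: (p) => /gt_eqF p0 IH.
have k0 : 0 <= k%:R :> R by [].
transitivity ((e * T / F1 * mk) * (- t * t / ((k%:R * 2 + 2) * (k%:R * 2 + 2 * a + 3)))).
  by field; rewrite ?f1 ?gt_eqF //; lra.
by rewrite IH; field; rewrite ?f0 ?gt_eqF //; lra.
Qed.

Lemma expcosh_bound t n : \sum_(k < n) `|t| ^+ k.*2 / k.*2`!%:R <= expR `|t|.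
Proof.
have H : \sum_(k < n) `|t| ^+ k.*2 / k.*2`!%:R <= series (exp_coeff `|t|) n.*2.
  rewrite /series /= big_mkord; elim: n => [|n IH]; first by rewrite !big_ord0.
  rewrite doubleS !big_ord_recr /= -addrA lerD // lerDl.
  by rewrite /exp_coeff divr_ge0 ?exprn_ge0.
apply: (le_trans H); apply: nondecreasing_cvgn_le; last exact: is_cvg_series_exp_coeff.
by apply: nondecreasing_series => k _ _; rewrite /exp_coeff divr_ge0 ?exprn_ge0.
Qed.

(** Poisson's integral: the cosine series is integrated term by term, with e^|t| as majorant on |x|
    < 1. *)
Lemma Hf_gbes a t : 0 < a -> Hf a t = mom a 0 * Gamma (a + 1 / 2 + 1) * gbes (a + 1 / 2) t.
Proof.
move=> a0; have h : -1 < a + 1 / 2 by lra.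
have D : (\int[mu]_(x in J) (Mf a x * \sum_(k < n) cos_coeff' (t * x) k)) @[n --> \oo] --> Hf a t.
  apply: (Rdominated_convergence _ (fun n x => Mf a x * \sum_(k < n) cos_coeff' (t * x) k) _ (fun=> expR `|t|)) => //.
  - move=> n; apply: continuous_on_measurable; first exact: interval_open.
    move=> x _; have := Mf_cont a x a0 => ?; apply: cM => //; apply: (csum _ (fun k x => cos_coeff' (t * x) k)) => k.
    by rewrite /cos_coeff'; cont.
  - apply: continuous_on_measurable; first exact: interval_open.
    by move=> x _; have := Mf_cont a x a0 => ?; cont.
  - apply: aeW => x _; apply: cvgM; first exact: cvg_cst.
    by have := @cvg_cos_coeff' R (t * x); rewrite /series /=; under eq_fun do rewrite big_mkord.
  - by apply: continuous_integ_oo => x; exact: cC.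
  - move=> n x; rewrite /= in_itv /= => /andP[x0 x1]; rewrite normrM ger0_norm ?Mf_ge0 //.
    rewrite (le_trans (ler_piMl _ (Mf_le1 _ _ a0))) //.
    rewrite (le_trans (ler_norm_sum _ _ _)) // (le_trans _ (expcosh_bound t n)) //.
    apply: ler_sum => k _; rewrite /cos_coeff' !normrM normrV ?unitfE // normr_nat.
    rewrite -exprnP normrX normrN1 expr1n mul1r ler_wpM2r ?invr_ge0 // normrX lerXn2r ?nnegrE //.
    by rewrite normrM ler_piMr // ler_norml (ltW x0) (ltW x1).
have E n : \int[mu]_(x in J) (Mf a x * \sum_(k < n) cos_coeff' (t * x) k) =
    mom a 0 * Gamma (a + 1 / 2 + 1) * pseries (bcoef (a + 1 / 2)) ((t / 2) ^+ 2) n.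
  rewrite /pseries /series /= big_mkord mulr_sumr.
  transitivity (\sum_(k < n) \int[mu]_(x in J) ((-1) ^+ k * t ^+ k.*2 / k.*2`!%:R * (Mf a x * x ^+ k.*2))).
    elim: n => [|n IH].
      by rewrite big_ord0 -[RHS](mul0r (fine (mu J))) -Rintegral_cst //; apply: eq_Rintegral => x _; rewrite big_ord0 mulr0.
    rewrite big_ord_recr /= -IH -RintegralD //.
    - apply: eq_Rintegral => x _; rewrite big_ord_recr /= mulrDr; congr (_ + _).
      by rewrite /cos_coeff' exprMn -exprnP; ring.
    - apply: continuous_integ_oo => x.
      have := Mf_cont a x a0 => ?; apply: cM => //; apply: (csum _ (fun k x => cos_coeff' (t * x) k)) => k.
      by rewrite /cos_coeff'; cont.
    - by apply: (@integrableZl _ _ _ mu _ _ _ (EFin \o (fun x => Mf a x * x ^+ n.*2))) => //; exact: iM.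
  apply: eq_bigr => k _; rewrite RintegralZl //; last exact: iM.
  by rewrite -/(mom a k) mom_coef.
have D2 : (mom a 0 * Gamma (a + 1 / 2 + 1) * pseries (bcoef (a + 1 / 2)) ((t / 2) ^+ 2) n) @[n --> \oo] --> mom a 0 * Gamma (a + 1 / 2 + 1) * gbes (a + 1 / 2) t.
  by apply: cvgM; [exact: cvg_cst | rewrite /gbes bser.unlock; exact: bser_cvg].
have {}D : (mom a 0 * Gamma (a + 1 / 2 + 1) * pseries (bcoef (a + 1 / 2)) ((t / 2) ^+ 2) n) @[n --> \oo] --> Hf a t.
  by rewrite (_ : (fun n => _) = (fun n => \int[mu]_(x in J) (Mf a x * \sum_(k < n) cos_coeff' (t * x) k))) //; apply/funext => n; rewrite E.
by apply: cvg_unique D D2.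
Qed.

Lemma Hf_cont a t : 0 < a -> {for t, continuous (Hf a)}.
Proof.
move=> a0; rewrite (_ : Hf a = fun t => mom a 0 * Gamma (a + 1 / 2 + 1) * gbes (a + 1 / 2) t); last first.
  by apply/funext => u; exact: Hf_gbes.
by have : {for t, continuous (gbes (a + 1 / 2))} by [apply: gbes_continuous; lra]; move=> ?; cont.
Qed.

Lemma HfN a t : Hf a (- t) = Hf a t.
Proof. by apply: eq_Rintegral => x _; rewrite mulNr cosN. Qed.

Lemma Hf_bound a : 0 < a -> exists2 C, 0 < C & forall t, `|Hf a t| <= C * (1 + `|t|) `^ (- (a + 1)).
Proof.
move=> a0; have h : -1 < a + 1 / 2 by lra.
have [C C0 HC] := gbes_bound (a + 1 / 2) h.
exists (`|mom a 0 * Gamma (a + 1 / 2 + 1)| * C + 1); first by rewrite ltr_wpDl // mulr_ge0 // ltW.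
move=> t; have -> : Hf a t = Hf a `|t| by have [//|_] := ger0P t; rewrite HfN.
rewrite (Hf_gbes _ _ a0) mulrDl.
have -> : a + 1 = a + 1 / 2 + 1 / 2 by field.
move: (a + 1 / 2) HC => b HC; have := HC `|t| (normr_ge0 t) => Hg.
rewrite [X in X <= _]normrM (le_trans (ler_wpM2l (normr_ge0 _) Hg)) //.
by rewrite mulrA lerDl mulr_ge0 ?powR_ge0.
Qed.

End bump.

(** * Abel summation: positivity of the total integral of the cosine transform *)

Section abel.
Context {R : realType}.
Local Notation mu := (@lebesgue_measure R).
Implicit Types (a t x : R).

Lemma integ_decay q : 1 < q -> integ `]0, +oo[ (fun x : R => (1 + x) `^ (- q)).
Proof.
move=> q1; apply: (integrable_FTC_oy _ (fun x => - ((1 + x) `^ (1 - q)) / (q - 1)) _ (q - 1)^-1).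
- by move=> x _; exact: powR_ge0.
- move=> x x0; have p : 0 < 1 + x by rewrite addr_gt0.
  derval => //; rewrite (_ : 1 - q - 1 = - q); last by ring.
  by field; rewrite subr_eq0 gt_eqF.
- by move=> x x0; have p : 0 < 1 + x by [rewrite addr_gt0]; cont.
- move=> x x0; rewrite mulNr normrN ger0_norm ?divr_ge0 ?powR_ge0 ?subr_ge0 ?(ltW q1) //.
  rewrite ler_piMl ?invr_ge0 ?subr_ge0 ?(ltW q1) //.
  rewrite (_ : 1 - q = - (q - 1)); last by ring.
  rewrite powRN invf_le1 ?powR_gt0 ?addr_gt0 //; apply: (@le_trans _ _ (1 `^ (q - 1))); first by rewrite powR1.
  by rewrite ge0_ler_powR ?nnegrE ?lerDl ?subr_ge0 ?(ltW q1) ?(ltW x0) // addr_ge0 // ltW.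
Qed.

Let E e t x : R := expR (- (e * x)) * cos (t * x).
Let EP e t x : R := expR (- (e * x)) * (- e * cos (t * x) + t * sin (t * x)) / (e ^+ 2 + t ^+ 2).

Lemma integ_exp e : 0 < e -> integ `]0, +oo[ (fun x : R => expR (- (e * x))).
Proof.
move=> e0; apply: (integrable_FTC_oy _ (fun x => - expR (- (e * x)) / e) _ e^-1).
- by move=> x _; exact: expR_ge0.
- by move=> x _; derval; field; rewrite gt_eqF.
- move=> x _; apply: (ccomp expR (fun x => - (e * x))); [by cont | exact: continuous_expR].
- move=> x x0; rewrite mulNr normrN ger0_norm ?divr_ge0 ?expR_ge0 ?(ltW e0) //.
  by rewrite ler_piMl ?invr_ge0 ?(ltW e0) // -expR0 ler_expR oppr_le0 mulr_ge0 ?ltW.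
Qed.

Lemma laplace_cos e t : 0 < e -> \int[mu]_(x in `]0, +oo[) (expR (- (e * x)) * cos (t * x)) = e / (e ^+ 2 + t ^+ 2).
Proof.
move=> e0; have d0 : 0 < e ^+ 2 + t ^+ 2 by rewrite ltr_pwDl ?exprn_gt0 ?sqr_ge0.
have cE x : {for x, continuous (fun x => expR (- (e * x)) * cos (t * x))}.
  apply: (cM (fun x => expR (- (e * x)))); last by cont.
  by apply: (ccomp expR (fun x => - (e * x))); [cont | exact: continuous_expR].
have dEP x : is_derive x 1 (EP e t) (expR (- (e * x)) * cos (t * x)).
  by rewrite /EP; derval; move: (expR _) (cos _) (sin _) => X c s; field; rewrite gt_eqF.
transitivity (0 - EP e t 0); last first.
  by rewrite /EP !mulr0 oppr0 expR0 cos0 sin0 mulr0; field; rewrite gt_eqF.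
apply: (Rintegral_FTC_oy _ (EP e t)).
- apply: (integ_le _ _ (fun x => expR (- (e * x)))) => //.
  + by apply: continuous_on_measurable; [exact: interval_open | move=> x _; exact: cE].
  + by move=> x _; rewrite normrM ger0_norm ?expR_ge0 // ler_piMr ?expR_ge0 // ler_norml cos_geN1 cos_le1.
  + exact: integ_exp.
- by move=> x _; exact: cE.
- by apply: cvg_at_right_filter; exact: is_derive_continuous (dEP 0).
- pose K := (e + `|t|) / (e ^+ 2 + t ^+ 2).
  have D : (fun x : R => expR (- (e * x)) * K) x @[x --> +oo] --> 0.
    rewrite -[X in _ --> X](mul0r K); apply: cvgM; last exact: cvg_cst.
    have h : (fun x : R => e * x) x @[x --> +oo] --> +oo.
      apply/cvgryPge => A; near=> x; rewrite mulrC -ler_pdivrMr //; near: x.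
    exact: (cvg_comp (fun x => e * x) (fun x => expR (- x)) h (@cvgr_expR R)).
  have H x : `|EP e t x| <= expR (- (e * x)) * K.
    rewrite /EP /K -mulrA normrM ger0_norm ?expR_ge0 // ler_wpM2l ?expR_ge0 //.
    rewrite normrM [`|_^-1|]ger0_norm ?invr_ge0 ?(ltW d0) // ler_wpM2r ?invr_ge0 ?(ltW d0) //.
    rewrite (le_trans (ler_normD _ _)) // !normrM normrN (gtr0_norm e0).
    by rewrite lerD // ler_piMr ?(ltW e0) // ler_norml ?cos_geN1 ?cos_le1 ?sin_geN1 ?sin_le1.
  apply/cvgr0Pnorm_lt => d d0'; have /cvgr0Pnorm_lt/(_ d d0') := D; apply: filterS => x.
  by apply: le_lt_trans; rewrite (le_trans (H x)) // ler_norm.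
Unshelve. all: by end_near. Qed.

Lemma meas_fst (f : R -> R) : (forall x, {for x, continuous f}) -> measurable_fun setT (fun z : R * R => f z.1).
Proof.
by move=> cf; apply: (measurableT_comp _ measurable_fst); apply: continuous_measurable_fun => x; exact: cf.
Qed.

Lemma meas_snd (f : R -> R) : (forall x, {for x, continuous f}) -> measurable_fun setT (fun z : R * R => f z.2).
Proof.
by move=> cf; apply: (measurableT_comp _ measurable_snd); apply: continuous_measurable_fun => x; exact: cf.
Qed.

Local Notation J := (`]-1, 1[%classic : set R).

(** Damping by e^(-e x) makes Fubini applicable and pairs the profile with the Poisson kernel. *)
Lemma laplace_Hf a e : 0 < a -> 0 < e ->
  \int[mu]_(x in `]0, +oo[) (expR (- (e * x)) * Hf a x) = \int[mu]_(y in J) (Mf a y * (e / (e ^+ 2 + y ^+ 2))).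
Proof.
move=> a0 e0; have cM := Mf_cont a ^~ a0.
have cE x : {for x, continuous (fun x => expR (- (e * x)))}.
  by apply: (ccomp expR (fun x => - (e * x))); [cont | exact: continuous_expR].
transitivity (\int[mu]_(x in `]0, +oo[) \int[mu]_(y in J) (expR (- (e * x)) * (Mf a y * cos (x * y)))).
  apply: eq_Rintegral => x _; rewrite RintegralZl //.
  by apply: continuous_integ_oo => y; have := cM y => ?; cont.
rewrite (Rfubini _ _ (fun x y => expR (- (e * x)) * (Mf a y * cos (x * y))) (fun x => expR (- (e * x))) (fun=> 1)) //.
- apply: eq_Rintegral => y _; rewrite -laplace_cos // -RintegralZl //.
    by apply: eq_Rintegral => x _; rewrite mulrCA [y * x]mulrC.
  apply: (integ_le _ _ (fun x => expR (- (e * x)))) => //.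
  + by apply: continuous_on_measurable; [exact: interval_open | move=> x _; have := cE x => ?; cont].
  + by move=> x _; rewrite normrM ger0_norm ?expR_ge0 // ler_piMr ?expR_ge0 // ler_norml cos_geN1 cos_le1.
  + exact: integ_exp.
- apply: measurable_funTS; apply: measurable_funM.
    exact: (meas_fst (fun x => expR (- (e * x)))).
  apply: measurable_funM; first exact: (meas_snd (Mf a)).
  apply: (measurableT_comp (f := cos)); first by apply: continuous_measurable_fun; exact: continuous_cos.
  by apply: (measurable_funM (f := fst) (g := snd)).
- exact: integ_exp.
- by apply: continuous_integ_oo => x; exact: cC.
- move=> x y _ _; rewrite mulr1 normrM ger0_norm ?expR_ge0 // ler_piMr ?expR_ge0 //.
  rewrite normrM mulr_ile1 //; first by rewrite ger0_norm ?Mf_ge0 // Mf_le1.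
  by rewrite ler_norml cos_geN1 cos_le1.
Qed.

(** Uniform in e: on ]0, e[ the Poisson kernel is at least 1/(2e), and the profile is at least
    (3/4)^a because y < 1/2. *)
Lemma laplace_Hf_ge a e : 0 < a -> 0 < e <= 1 / 2 ->
  (3 / 4) `^ a / 2 <= \int[mu]_(y in J) (Mf a y * (e / (e ^+ 2 + y ^+ 2))).
Proof.
move=> a0 /andP[e0 e2].
have d0 y : 0 < e ^+ 2 + y ^+ 2 by rewrite ltr_pwDl ?exprn_gt0 ?sqr_ge0.
have c y : {for y, continuous (fun y => Mf a y * (e / (e ^+ 2 + y ^+ 2)))}.
  by have := Mf_cont a y a0 => ?; cont; rewrite gt_eqF.
have sub : `]0, e[%classic `<=` J.
  by move=> y /=; rewrite !in_itv /= => /andP[y0 ye]; apply/andP; split; lra.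
apply: le_trans (Rintegral_subset J `]0, e[ (fun y => Mf a y * (e / (e ^+ 2 + y ^+ 2))) _ _ sub _ _) => //; last 2 first.
- by move=> y _; rewrite mulr_ge0 ?Mf_ge0 // divr_ge0 // ltW.
- exact: continuous_integ_oo.
have -> : (3 / 4) `^ a / 2 = \int[mu]_(y in `]0, e[) ((3 / 4) `^ a * (2 * e)^-1).
  rewrite Rintegral_cst_itv ?ltW // subr0.
  by field; rewrite gt_eqF.
apply: le_Rintegral => //; [by apply: continuous_integ_oo => y; exact: cC|exact: continuous_integ_oo|].
move=> y; rewrite /= in_itv /= => /andP[y0 ye].
have y2 : y ^+ 2 <= e ^+ 2 by rewrite lerXn2r ?nnegrE ?ltW.
apply: ler_pM; rewrite ?powR_ge0 ?invr_ge0 ?mulr_ge0 ?(ltW e0) //.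
  rewrite Mf_in; last by rewrite gtr0_norm //; lra.
  have : e ^+ 2 <= (1 / 2) ^+ 2 by rewrite lerXn2r ?nnegrE ?(ltW e0).
  by move=> h; rewrite ge0_ler_powR ?nnegrE ?(ltW a0) //; lra.
rewrite -[X in _ <= X]invrK lef_pV2 ?posrE ?invr_gt0 ?divr_gt0 ?mulr_gt0 //.
by rewrite invfM invrK mulrC ler_pdivrMr // ; nra.
Qed.

Lemma Hf_integ a : 0 < a -> integ `]0, +oo[ (Hf a).
Proof.
move=> a0; have [C C0 HC] := Hf_bound a a0.
apply: (integ_le _ _ (fun x => C * (1 + x) `^ (- (a + 1)))) => //.
- by apply: continuous_on_measurable; [exact: interval_open | move=> x _; exact: Hf_cont].
- by move=> x; rewrite /= in_itv /= andbT => x0; have := HC x; rewrite (gtr0_norm x0).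
- apply: (@integrableZl _ _ _ mu _ _ C (EFin \o (fun x => (1 + x) `^ (- (a + 1))))) => //.
  by apply: integ_decay; rewrite ltrDr.
Qed.

(** Fourier inversion at 0 would give the value pi; positivity is enough to divide by the integral,
    and it follows from the undamped limit. *)
Lemma Hf_int_gt0 a : 0 < a -> 0 < \int[mu]_(x in `]0, +oo[) Hf a x.
Proof.
move=> a0; apply: (@lt_le_trans _ _ ((3 / 4) `^ a / 2)); first by rewrite divr_gt0 ?powR_gt0.
pose e n : R := n.+2%:R^-1.
have D : (\int[mu]_(x in `]0, +oo[) (expR (- (e n * x)) * Hf a x)) @[n --> \oo] --> \int[mu]_(x in `]0, +oo[) Hf a x.
  apply: (Rdominated_convergence _ (fun n x => expR (- (e n * x)) * Hf a x) (Hf a) (fun x => `|Hf a x|)) => //.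
  - move=> n; apply: continuous_on_measurable; first exact: interval_open.
    move=> x _; apply: cM; last exact: Hf_cont.
    by apply: (ccomp expR (fun x => - (e n * x))); [cont | exact: continuous_expR].
  - by apply: continuous_on_measurable; [exact: interval_open | move=> x _; exact: Hf_cont].
  - apply: aeW => x _; rewrite -[X in _ --> X]mul1r; apply: cvgM; last exact: cvg_cst.
    rewrite -expR0; apply: (cvg_comp (fun n => - (e n * x)) expR); last exact: continuous_expR.
    rewrite -oppr0 -(mul0r x); apply: cvgN; apply: cvgM; last exact: cvg_cst.
    have := @cvg_harmonic R; rewrite -(cvg_shiftS (@harmonic R)); exact.
  - exact: (integrable_norm (Hf_integ a a0)).
  - move=> n x; rewrite /= in_itv /= andbT => x0; rewrite normrM ler_piMl //.
    by rewrite gtr0_norm ?expR_gt0 // -expR0 ler_expR oppr_le0 mulr_ge0 ?(ltW x0) // /e invr_ge0.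
rewrite -(cvg_lim (@Rhausdorff R) D); apply: limr_ge; first by apply/cvg_ex; eexists; exact: D.
near=> n; rewrite laplace_Hf //; last by rewrite /e invr_gt0.
apply: laplace_Hf_ge => //; rewrite /e invr_gt0 ltr0n /= div1r lef_pV2 ?posrE //.
by rewrite ler_nat.
Unshelve. all: by end_near. Qed.
End abel.

(** * Symmetric finite differences *)

Section finite_difference.
Context {R : realType}.
Implicit Types (f g : R -> R) (a b x y h : R).

(** Symmetric n-th difference with spacing 2h: the nodes are x + (n - 2i) h, so for even n the
    middle node is x itself. *)
Fixpoint fd n h f : R -> R :=
  if n is m.+1 then fd m h (fun y => f (y + h) - f (y - h)) else f.

Lemma fdE n h f x : fd n h f x = \sum_(i < n.+1) (-1) ^+ i * 'C(n, i)%:R * f (x + (n%:R - 2 * i%:R) * h).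
Proof.
elim: n f => [|n IH] f.
  by rewrite big_ord_recl big_ord0 /= bin0 expr0 !mul1r mulr0 subr0 mul0r !addr0.
rewrite /= IH.
pose g i := f (x + (n.+1%:R - 2 * i%:R) * h).
have e1 i : f (x + (n%:R - 2 * i%:R) * h + h) = g i.
  by rewrite /g -natr1; congr f; ring.
have e2 i : f (x + (n%:R - 2 * i%:R) * h - h) = g i.+1.
  by rewrite /g -!natr1; congr f; ring.
transitivity (\sum_(i < n.+1) (-1) ^+ i * 'C(n, i)%:R * g i - \sum_(i < n.+1) (-1) ^+ i * 'C(n, i)%:R * g i.+1).
  by rewrite -sumrB; apply: eq_bigr => i _; rewrite e1 e2 mulrBr.
transitivity (\sum_(i < n.+2) (-1) ^+ i * 'C(n, i)%:R * g i - \sum_(i < n.+1) (-1) ^+ i * 'C(n, i)%:R * g i.+1).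
  by rewrite [in RHS]big_ord_recr /= bin_small // mulr0 mul0r addr0.
rewrite [X in X - _]big_ord_recl [RHS]big_ord_recl /= !bin0 -addrA -sumrB; congr (_ + _).
by apply: eq_bigr => i _; rewrite /bump /= add1n binS natrD exprS -/(g i.+1); ring.
Qed.

Lemma fd_ext n h f g x : 0 <= h -> (forall y, x - n%:R * h <= y <= x + n%:R * h -> f y = g y) ->
  fd n h f x = fd n h g x.
Proof.
move=> h0 H; rewrite !fdE; apply: eq_bigr => i _; congr (_ * _); apply: H.
have i0 : 0 <= i%:R * h by rewrite mulr_ge0.
have in_ : i%:R * h <= n%:R * h by rewrite ler_wpM2r // ler_nat -ltnS.
by rewrite mulrBl -mulrA; lra.
Qed.

Lemma fd_parity n h f s x : (forall y, f (- y) = s * f y) -> fd n h f (- x) = (-1) ^+ n * s * fd n h f x.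
Proof.
elim: n f s => [|n IH] f s H; first by rewrite expr0 mul1r /= H.
rewrite /= (IH _ (- s)); first by rewrite exprS; ring.
by move=> y; rewrite (_ : - y + h = - (y - h)) 1?(_ : - y - h = - (y + h)) ?H; ring.
Qed.

Lemma fd_trivial n h f x M : 0 <= h -> (forall y, x - n%:R * h <= y <= x + n%:R * h -> `|f y| <= M) ->
  `|fd n h f x| <= 2 ^+ n * M.
Proof.
move=> h0; elim: n f x M => [|n IH] f x M H.
  by rewrite expr0 mul1r; apply: H; rewrite mul0r subr0 addr0 lexx.
rewrite exprS (_ : 2 * 2 ^+ n * M = 2 ^+ n * (2 * M)); last by ring.
apply: IH => y yx; rewrite (le_trans (ler_normB _ _)) // (_ : 2 * M = M + M); last by ring.
by rewrite lerD // H // -natr1; lra.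
Qed.

(** [F] k stands for the k-th derivative of [F] 0; each difference costs one mean value theorem and
    a factor 2h. *)
Lemma fd_bound n h (F : nat -> R -> R) x M : 0 <= h ->
  (forall k y, (k < n)%N -> x - n%:R * h <= y <= x + n%:R * h -> is_derive y 1 (F k) (F k.+1 y)) ->
  (forall y, x - n%:R * h <= y <= x + n%:R * h -> `|F n y| <= M) ->
  `|fd n h (F 0) x| <= (2 * h) ^+ n * M.
Proof.
move=> h0; elim: n F x M => [|n IH] F x M dF HM.
  by rewrite expr0 mul1r; apply: HM; rewrite mul0r subr0 addr0 lexx.
rewrite exprS (_ : 2 * h * (2 * h) ^+ n * M = (2 * h) ^+ n * (2 * h * M)); last by ring.
apply: (IH (fun k y => F k (y + h) - F k (y - h))) => [k y kn yx|y yx].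
  have hn : n.+1%:R * h = n%:R * h + h by rewrite -natr1; ring.
  have d1 : is_derive (y + h) 1 (F k) (F k.+1 (y + h)) by apply: dF; [exact: ltnW | rewrite hn; lra].
  have d2 : is_derive (y - h) 1 (F k) (F k.+1 (y - h)) by apply: dF; [exact: ltnW | rewrite hn; lra].
  eapply is_derive_val.
    eapply (dD (fun y => F k (y + h)) (fun y => - F k (y - h))).
      by eapply (dcomp (F k) (fun y => y + h)); [der | exact: d1].
    eapply (dN (fun y => F k (y - h))).
    by eapply (dcomp (F k) (fun y => y - h)); [der | exact: d2].
  by ring.
have hn : n.+1%:R * h = n%:R * h + h by rewrite -natr1; ring.
have -> : 2 * h * M = M * `|(y + h) - (y - h)|.
  by rewrite (_ : (y + h) - (y - h) = 2 * h) ?ger0_norm ?mulr_ge0 //; ring.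
have le1 : y - h <= y + h by lra.
by apply: (norm_le_derive (F n) (F n.+1)) => z; rewrite min_l // max_r // => zy;
  [apply: dF => //| apply: HM]; rewrite hn; lra.
Qed.

(** The k-th derivative of (1 - y)^a (1 + y)^b, by recursion on the exponents instead of Leibniz'
    formula. *)
Fixpoint dF k a b y : R :=
  if k is m.+1 then - a * dF m (a - 1) b y + b * dF m a (b - 1) y else (1 - y) `^ a * (1 + y) `^ b.

Lemma dF_derive k a b y : -1 < y < 1 -> is_derive y 1 (dF k a b) (dF k.+1 a b y).
Proof.
move=> y1; have [p q] : 0 < 1 - y /\ 0 < 1 + y by lra.
elim: k a b => [|k IH] a b; first by rewrite /=; derval => //; ring.
have H1 := IH (a - 1) b; have H2 := IH a (b - 1).
eapply is_derive_val.
  by eapply (dD (fun y => - a * dF k (a - 1) b y) (fun y => b * dF k a (b - 1) y)); der.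
by rewrite [dF k.+2 a b y]/=; rewrite /=; ring.
Qed.

Lemma powR_bound2 b y : 1 / 2 <= y <= 2 -> y `^ b <= 2 `^ `|b|.
Proof.
move=> /andP[y1 y2]; have y0 : 0 < y by lra.
have [b0|b0] := leP 0 b; first by rewrite ger0_norm // ge0_ler_powR ?nnegrE ?(ltW y0).
rewrite ltr0_norm // -[X in X <= _]powRr1 ?powR_ge0 // -powRrM mulr1.
have -> : y `^ b = y^-1 `^ (- b) by rewrite powRV ?opprK.
rewrite ge0_ler_powR ?nnegrE ?invr_ge0 ?(ltW y0) ?oppr_ge0 ?(ltW b0) //.
by rewrite -[leRHS]invrK lef_pV2 ?posrE ?invr_gt0 //; lra.
Qed.

Lemma dF_bound k a b : exists2 C, 0 < C & forall y, - (1 / 2) <= y < 1 -> `|dF k a b y| <= C * (1 - y) `^ (a - k%:R).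
Proof.
elim: k a b => [|k IH] a b.
  exists (2 `^ `|b|); first exact: powR_gt0.
  move=> y y1; rewrite /= subr0 ger0_norm ?mulr_ge0 ?powR_ge0 // mulrC ler_wpM2r ?powR_ge0 //.
  by apply: powR_bound2; lra.
have [C1 C10 H1] := IH (a - 1) b; have [C2 C20 H2] := IH a (b - 1).
exists (`|a| * C1 + `|b| * C2 * 2 + 1).
  by rewrite ltr_wpDl // addr_ge0 // !mulr_ge0 // ltW.
move=> y y1; have p : 0 < 1 - y by lra.
have e1 : a - 1 - k%:R = a - k.+1%:R by rewrite -natr1; ring.
have e2 : (1 - y) `^ (a - k%:R) = (1 - y) `^ (a - k.+1%:R) * (1 - y).
  by rewrite -[X in _ * X]powRr1 ?(ltW p) // -powRD ?(gt_eqF p) ?implybT // -natr1; congr powR; ring.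
rewrite /= (le_trans (ler_normD _ _)) // !normrM normrN.
have := H1 y y1; have := H2 y y1; rewrite e1 e2.
have := powR_ge0 (1 - y) (a - k.+1%:R); move: (powR _ _) => P P0 h2 h1.
have := ler_wpM2l (normr_ge0 a) h1; have := ler_wpM2l (normr_ge0 b) h2.
have := normr_ge0 b; have := normr_ge0 a; move: `|a| `|b| => A B A0 B0 g2 g1.
have : B * (C2 * (P * (1 - y))) <= B * C2 * 2 * P.
  rewrite (_ : B * _ = B * C2 * P * (1 - y)); last by ring.
  rewrite (_ : _ * 2 * P = B * C2 * P * 2); last by ring.
  by rewrite ler_wpM2l ?mulr_ge0 ?(ltW C20) //; lra.
by move: g1 g2; rewrite !mulrDl mulrA mul1r; lra.
Qed.

End finite_difference.

Section bump_difference.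
Context {R : realType}.
Implicit Types (a b x y h : R).

Lemma fd_opp n h (f : R -> R) x : fd n (- h) f x = (-1) ^+ n * fd n h f x.
Proof.
rewrite !fdE.
have rev (G : nat -> R) : \sum_(i < n.+1) G i = \sum_(i < n.+1) G (n - i)%N.
  by rewrite (reindex_inj rev_ord_inj) /=; apply: eq_bigr => i _; rewrite subSS.
rewrite (rev (fun i => (-1) ^+ i * 'C(n, i)%:R * f (x + (n%:R - 2 * i%:R) * - h))) mulr_sumr.
apply: eq_bigr => i _; have le_in : (i <= n)%N by rewrite -ltnS.
rewrite bin_sub // natrB // !mulrA; congr (_ * _ * f _); last by ring.
by rewrite -signr_odd -[in RHS]signr_odd -[X in _ = _ * X]signr_odd oddB // -signr_addb.
Qed.

Lemma Mf_le a x : 0 <= a -> Mf a x <= (2 * `|1 - `|x| |) `^ a.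
Proof.
move=> a0; have : Num.max (1 - x ^+ 2) 0 <= 2 * `|1 - `|x| |.
  rewrite ge_max mulr_ge0 // andbT -real_normK ?num_real //.
  have := normr_ge0 x; move: `|x| => y y0.
  have [y1|y1] := leP y 1; first by rewrite ger0_norm ?subr_ge0 //; nra.
  by rewrite (@le_trans _ _ 0) ?mulr_ge0 // subr_le0 exprn_ege1 // ltW.
move=> h; rewrite /Mf ge0_ler_powR ?nnegrE ?mulr_ge0 //.
by rewrite le_max lexx orbT.
Qed.

(** Within distance 2nh of the singular point 1 the profile itself is O(h^a). Farther away all nodes
    lie on one side of 1, where the profile is zero or has n-th derivative O(d^(a-n)). *)
Lemma Mf_fd a k : 0 < a -> a <= k.*2%:R -> exists2 C, 0 < C & forall x h, 0 < h ->
  `|fd k.*2 h (Mf a) x| <= C * (h `^ a * (1 + `|1 - `|x| | / h) `^ (a - k.*2%:R)).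
Proof.
move=> a0 ak; set n := k.*2 in ak *.
have n0 : 0 < n%:R :> R by exact: lt_le_trans ak.
have n1 : 1 <= n%:R :> R by move: n0; rewrite ltr0n -(ler_nat R).
have [C1 C10 H1] := @dF_bound R n a a.
pose Ca := 2 ^+ n * (6 * n%:R) `^ a / (1 + 2 * n%:R) `^ (a - n%:R).
pose Cb := 2 ^+ n * (C1 * ((1 / 2) `^ (a - n%:R) * (1 / 2) `^ (a - n%:R))).
have Ca0 : 0 < Ca by rewrite divr_gt0 ?mulr_gt0 ?exprn_gt0 ?powR_gt0 // ?addr_gt0 ?mulr_gt0.
have Cb0 : 0 < Cb by rewrite !mulr_gt0 ?exprn_gt0 ?powR_gt0.
exists (Ca + Cb) => [|x h h0]; first exact: addr_gt0.
(* The order n is even, so the difference of the even profile is even in x. *)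
wlog x0 : x / 0 <= x.
  move=> W; have [//|xl] := leP 0 x; first exact: W.
  have := W (- x); rewrite (@fd_parity _ n h (Mf a) 1); last by move=> y; rewrite MfN mul1r.
  rewrite normrN mulr1 -signr_odd /n odd_double expr0 mul1r; apply; lra.
rewrite (ger0_norm x0); set d := `|1 - x|.
have d0 : 0 <= d by exact: normr_ge0.
set V := h `^ a * _; have V0 : 0 < V.
  by rewrite mulr_gt0 ?powR_gt0 // ltr_pwDl // divr_ge0 // ltW.
have [near_|far] := leP d (2 * n%:R * h).
  suff : `|fd n h (Mf a) x| <= Ca * V by move=> /le_trans; apply; rewrite ler_pM2r // lerDl ltW.
  apply: (@le_trans _ _ (2 ^+ n * (6 * n%:R * h) `^ a)).
    apply: fd_trivial; first exact: ltW.
    move=> y yx; rewrite ger0_norm ?Mf_ge0 // (le_trans (Mf_le _ _ (ltW a0))) //.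
    rewrite ge0_ler_powR ?nnegrE ?mulr_ge0 ?(ltW a0) ?(ltW h0) //.
    have : `|1 - `|y| | <= d + n%:R * h.
      rewrite /d; have t : `| `|y| - `|x| | <= `|y - x| by exact: ler_dist_dist.
      have t2 : `|y - x| <= n%:R * h by rewrite ler_norml; lra.
      rewrite (_ : 1 - `|y| = (1 - x) - (`|y| - `|x|)); last by rewrite (ger0_norm x0); ring.
      by rewrite (le_trans (ler_normB _ _)) // lerD2l (le_trans t).
    by move: near_; lra.
  have -> : (6 * n%:R * h) `^ a = (6 * n%:R) `^ a * h `^ a by rewrite powRM ?mulr_ge0 // ltW.
  rewrite /Ca /V [X in _ <= X](_ : _ = 2 ^+ n * (6 * n%:R) `^ a * h `^ a * ((1 + d / h) `^ (a - n%:R) / (1 + 2 * n%:R) `^ (a - n%:R))); last by ring.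
  rewrite [X in X <= _]mulrA ler_peMr ?mulr_ge0 ?powR_ge0 ?exprn_ge0 //.
  have p1 : 0 < 1 + 2 * n%:R :> R by rewrite addr_gt0 ?mulr_gt0.
  have p2 : 0 < 1 + d / h by rewrite ltr_pwDl // divr_ge0 // ltW.
  rewrite ler_pdivlMr ?powR_gt0 // mul1r (_ : a - n%:R = - (n%:R - a)); last by ring.
  rewrite !powRN lef_pV2 ?posrE ?powR_gt0 // ge0_ler_powR ?nnegrE ?subr_ge0 ?(ltW p1) ?(ltW p2) //.
  by rewrite lerD2l ler_pdivrMr.
suff : `|fd n h (Mf a) x| <= Cb * V by move=> /le_trans; apply; rewrite ler_pM2r // lerDr ltW.
have nh : 0 < n%:R * h by rewrite mulr_gt0.
have [x1|x1] := leP 1 x.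
  have dE : d = x - 1 by rewrite /d distrC ger0_norm // subr_ge0.
  rewrite (@fd_ext _ n h (Mf a) (fun=> 0)) ?(ltW h0) //; last first.
    by move=> y yx; rewrite Mf_out // ger0_norm; move: far yx; rewrite dE; lra.
  have -> : fd n h (fun=> 0) x = 0 by rewrite fdE big1 // => i _; rewrite mulr0.
  by rewrite normr0 mulr_ge0 // ltW.
have dE : d = 1 - x by rewrite /d gtr0_norm // subr_gt0.
have yin y : x - n%:R * h <= y <= x + n%:R * h -> - (1 / 2) <= y < 1 /\ d / 2 <= 1 - y.
  by move=> yx; move: far; rewrite dE; lra.
have dp : 0 < d by rewrite (lt_trans _ far) // -mulrA mulr_gt0.
rewrite (@fd_ext _ n h (Mf a) (dF 0 a a)) ?(ltW h0) //; last first.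
  move=> y /yin[y1 _]; have yn : `|y| < 1 by rewrite ltr_norml; lra.
  rewrite Mf_in // /= -powRM; try lra; by congr powR; ring.
apply: (@le_trans _ _ ((2 * h) ^+ n * (C1 * (d / 2) `^ (a - n%:R)))).
  apply: (fd_bound n h (fun k => dF k a a)) => [|j y _ /yin[y1 _]|y /yin[y1 y2]]; first exact: ltW.
    by apply: dF_derive; lra.
  rewrite (le_trans (H1 _ y1)) // ler_pM2l // (_ : a - n%:R = - (n%:R - a)); last by ring.
  rewrite !powRN lef_pV2 ?posrE ?powR_gt0 ?divr_gt0 //; last lra.
  by rewrite ge0_ler_powR ?nnegrE ?subr_ge0 //; lra.
have hn : h ^+ n = h `^ a * h `^ (n%:R - a).
  by rewrite -powRD ?(gt_eqF h0) ?implybT // -powR_mulrn ?ltW //; congr powR; ring.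
rewrite exprMn hn /Cb /V.
have -> : (d / 2) `^ (a - n%:R) = d `^ (a - n%:R) * (1 / 2) `^ (a - n%:R).
  by rewrite -powRM ?divr_ge0 //; congr powR; ring.
rewrite [X in X <= _](_ : _ = 2 ^+ n * (C1 * (1 / 2) `^ (a - n%:R)) * h `^ a * (h `^ (n%:R - a) * d `^ (a - n%:R))); last by ring.
rewrite [X in _ <= X](_ : _ = 2 ^+ n * (C1 * (1 / 2) `^ (a - n%:R)) * h `^ a * ((1 / 2) `^ (a - n%:R) * (1 + d / h) `^ (a - n%:R))); last by ring.
rewrite ler_wpM2l ?mulr_ge0 ?powR_ge0 ?exprn_ge0 ?(ltW C10) //.
have -> : h `^ (n%:R - a) * d `^ (a - n%:R) = (d / h) `^ (a - n%:R).
  by rewrite powRM ?invr_ge0 ?(ltW h0) ?(ltW dp) // powRV // mulrC; congr (_ * _ `^ _); ring.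
have p3 : 1 <= d / h by rewrite ler_pdivlMr // mul1r (le_trans _ (ltW far)) // ler_peMl ?(ltW h0) //; lra.
rewrite -powRM ?addr_ge0 ?divr_ge0 ?(ltW h0) //.
rewrite (_ : a - n%:R = - (n%:R - a)); last by ring.
by apply: powRN_anti; [rewrite subr_ge0 | lra | lra].
Qed.

Lemma pow_fd b n : b <= n%:R -> exists2 C, 0 < C & forall u h, 0 < h -> 0 < u -> 2 * n%:R * h <= u ->
  `|fd n h (fun y => y `^ b) u| <= C * (h ^+ n * u `^ (b - n%:R)).
Proof.
move=> bn; pose ff k := \prod_(i < k) (b - i%:R).
exists (2 ^+ n * (`|ff n| + 1) * (1 / 2) `^ (b - n%:R)).
  by rewrite !mulr_gt0 ?exprn_gt0 ?powR_gt0 // ltr_wpDl.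
move=> u h h0 u0 hu; have yin y : u - n%:R * h <= y <= u + n%:R * h -> u / 2 <= y by lra.
have -> : fd n h (fun y => y `^ b) u = fd n h (fun y => ff 0%N * y `^ (b - 0%:R)) u.
  by congr (fd _ _ _ _); apply/funext => y; rewrite /ff big_ord0 mul1r subr0.
apply: (le_trans (fd_bound n h (fun k y => ff k * y `^ (b - k%:R)) u (`|ff n| * (u / 2) `^ (b - n%:R)) (ltW h0) _ _)).
- move=> k y kn /yin uy; have y0 : 0 < y by lra.
  derval => //; rewrite /ff big_ord_recr /= -natr1 (_ : b - (k%:R + 1) = b - k%:R - 1); ring.
- move=> y /yin uy; have y0 : 0 < y by lra.
  rewrite normrM [`|_ `^ _|]ger0_norm ?powR_ge0 // ler_wpM2l // (_ : b - n%:R = - (n%:R - b)); last by ring.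
  rewrite !powRN lef_pV2 ?posrE ?powR_gt0 ?divr_gt0 // ge0_ler_powR ?nnegrE ?subr_ge0 //; lra.
have -> : (u / 2) `^ (b - n%:R) = u `^ (b - n%:R) * (1 / 2) `^ (b - n%:R).
  by rewrite -powRM ?(ltW u0) //; congr powR; ring.
rewrite exprMn [X in X <= _](_ : _ = 2 ^+ n * `|ff n| * (1 / 2) `^ (b - n%:R) * (h ^+ n * u `^ (b - n%:R))); last by ring.
rewrite ler_wpM2r ?mulr_ge0 ?powR_ge0 ?exprn_ge0 ?(ltW h0) // ler_wpM2r ?powR_ge0 // ler_wpM2l ?exprn_ge0 //.
by rewrite lerDl.
Qed.

End bump_difference.

(** * Convolution identities that produce multipliers of small support *)

Section local_multiplier.
Context {R : realType}.
Local Notation mu := (@lebesgue_measure R).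
Local Notation J := (`]-1, 1[%classic : set R).
Implicit Types (a b x y t l : R).

Lemma Rintegral_supp (D D' : set R) (f : R -> R) : measurable D -> measurable D' -> D' `<=` D ->
  (forall x, D x -> ~ D' x -> f x = 0) -> \int[mu]_(x in D) f x = \int[mu]_(x in D') f x.
Proof.
move=> mD mD' sub H; rewrite /Rintegral [in LHS]integral_mkcond [in RHS]integral_mkcond; congr fine.
apply: eq_integral => x _; rewrite !patchE; case: ifPn => [/set_mem xD|/negP xD].
  by case: ifPn => // /negP xD'; rewrite H // => ?; apply: xD'; rewrite inE.
by rewrite memNset // => /sub ?; apply: xD; rewrite inE.
Qed.

Lemma Hf_conv a A B : 0 < a -> \int[mu]_(y in J) (Mf a y * cos (A * y - B)) = cos B * Hf a A.
Proof.
move=> a0; have cMa y := Mf_cont a y a0.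
have cs y : {for y, continuous (fun y => Mf a y * sin (A * y))} by have := cMa y => ?; cont.
have cc y : {for y, continuous (fun y => Mf a y * cos (A * y))} by have := cMa y => ?; cont.
have lt11 : -1 < 1 :> R by rewrite ltrN10 || lra.
have odd0 : \int[mu]_(y in J) (Mf a y * sin (A * y)) = 0.
  have := Rintegral_opp (fun y => Mf a y * sin (A * y)) (-1) 1 lt11 cs; rewrite opprK.
  rewrite (_ : (fun x => Mf a (- x) * _) = (fun x => -1 * (Mf a x * sin (A * x)))); last first.
    by apply/funext => x; rewrite MfN mulrN sinN; ring.
  rewrite RintegralZl //; last exact: continuous_integ_oo.
  by move=> h; lra.
transitivity (cos B * \int[mu]_(y in J) (Mf a y * cos (A * y)) + sin B * \int[mu]_(y in J) (Mf a y * sin (A * y))).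
  rewrite -!RintegralZl //; [|exact: continuous_integ_oo|exact: continuous_integ_oo].
  rewrite -RintegralD //; last 2 first.
  - by apply: continuous_integ_oo => y; have := cc y => ?; cont.
  - by apply: continuous_integ_oo => y; have := cs y => ?; cont.
  apply: eq_Rintegral => y _; rewrite cosB; ring.
by rewrite odd0 mulr0 addr0.
Qed.

(** Fubini on the two cosine integrals. The factor [Mf] a (b t) vanishes for |t| >= 1/b: a dilate of
    [Hf] a is band limited. *)
Lemma Hf_conv2 a d A b l : 0 < a -> 0 < d -> 0 < b ->
  \int[mu]_(y in J) (Hf a ((A * y - l) / b) * Mf d y) =
  b * \int[mu]_(t in `]- b^-1, b^-1[) (Mf a (b * t) * Hf d (A * t) * cos (t * l)).
Proof.
move=> a0 d0 b0; have cMa y := Mf_cont a y a0; have cM2 y := Mf_cont d y d0.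
pose f x := Mf a x * (cos (x * l / b) * Hf d (A * x / b)).
have cf x : {for x, continuous f}.
  have := cMa x => ?; rewrite /f; apply: cM => //; apply: cM; first by cont.
  by apply: (ccomp (Hf d) (fun x => A * x / b)); [cont | exact: Hf_cont].
have -> : b * \int[mu]_(t in `]- b^-1, b^-1[) (Mf a (b * t) * Hf d (A * t) * cos (t * l)) = \int[mu]_(x in J) f x.
  have bb : - b^-1 < b^-1 by have : 0 < b^-1; [rewrite invr_gt0 | lra].
  have := Rintegral_affine f b 0 (- b^-1) b^-1 b0 bb cf.
  rewrite mulrN divff ?gt_eqF // !addr0 => ->; congr (_ * _); apply: eq_Rintegral => t _.
  rewrite addr0 /f -mulrA; congr (_ * _); rewrite mulrC; congr (cos _ * Hf d _); field; rewrite gt_eqF //.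
transitivity (\int[mu]_(y in J) \int[mu]_(x in J) (Mf d y * (Mf a x * cos (x * A / b * y - x * l / b)))).
  apply: eq_Rintegral => y _; rewrite RintegralZl; [|by []|].
    rewrite mulrC /Hf; congr (_ * _); apply: eq_Rintegral => x _; congr (_ * cos _); field.
    by rewrite gt_eqF.
  by apply: continuous_integ_oo => x; have := cMa x => ?; cont.
rewrite (Rfubini _ _ (fun y x => Mf d y * (Mf a x * cos (x * A / b * y - x * l / b))) (fun=> 1) (fun=> 1)) //.
- apply: eq_Rintegral => x _; rewrite /f.
  have -> : A * x / b = x * A / b by rewrite [A * x]mulrC.
  rewrite -(Hf_conv d (x * A / b) (x * l / b) d0).
  transitivity (\int[mu]_(y in J) (Mf a x * (Mf d y * cos (x * A / b * y - x * l / b)))).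
    by apply: eq_Rintegral => y _; rewrite mulrCA.
  rewrite RintegralZl //; by apply: continuous_integ_oo => y; have := cM2 y => ?; cont.
- apply: measurable_funTS; apply: measurable_funM; first exact: (meas_fst (Mf d)).
  apply: measurable_funM; first exact: (meas_snd (Mf a)).
  apply: (measurableT_comp (f := cos)); first by apply: continuous_measurable_fun; exact: continuous_cos.
  apply: measurable_funB.
    apply: measurable_funM; last exact: measurable_fst.
    by apply: (meas_snd (fun x => x * A / b)) => x; cont.
  by apply: (meas_snd (fun x => x * l / b)) => x; cont.
- by apply: continuous_integ_oo => x; exact: cC.
- by apply: continuous_integ_oo => x; exact: cC.
- move=> y x _ _; rewrite !mulr1 normrM mulr_ile1 //; first by rewrite ger0_norm ?Mf_ge0 // Mf_le1.
  rewrite normrM mulr_ile1 //; first by rewrite ger0_norm ?Mf_ge0 // Mf_le1.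
  by rewrite ler_norml cos_geN1 cos_le1.
Qed.

(** The two half-line integrals are the two halves of one convolution over the line, as [Hf] a is
    even; band limitation puts its cosine transform in ]0, 1/b[, inside ]0, e[. *)
Lemma Hf_pair a d r b e l : 0 < a -> 0 < d -> 0 < r -> 0 < b -> b^-1 <= e ->
  \int[mu]_(x in `]0, +oo[) (Hf a x * Mf d ((l + b * x) / r)) +
  \int[mu]_(x in `]0, +oo[) (Hf a x * Mf d ((l - b * x) / r)) =
  2 * \int[mu]_(t in `]0, e[) (r * Mf a (b * t) * Hf d (r * t) * cos (t * l)).
Proof.
move=> a0 d0 r0 b0 be.
pose G x := Hf a x * Mf d ((l + b * x) / r).
have cG x : {for x, continuous G}.
  apply: cM; first exact: Hf_cont.
  by apply: (ccomp (Mf d) (fun x => (l + b * x) / r)); [cont | exact: Mf_cont].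
(* Beyond L the argument of [Mf] d is outside ]-1, 1[, which reduces both integrals to bounded
   intervals. *)
pose L := (r + `|l|) / b.
have L0 : 0 < L by rewrite divr_gt0 // ltr_pwDl.
have out x : L <= `|x| -> G x = 0.
  rewrite /L ler_pdivrMr // => h; rewrite /G Mf_out ?mulr0 // normrM (gtr0_norm (_ : 0 < r^-1)) ?invr_gt0 //.
  rewrite ler_pdivlMr // mul1r; have := lerB_normD (b * x) l; rewrite normrM (gtr0_norm b0) [b * x + l]addrC => h2.
  by move: h; rewrite mulrC; lra.
have -> : \int[mu]_(x in `]0, +oo[) (Hf a x * Mf d ((l + b * x) / r)) = \int[mu]_(x in `]0, L[) G x.
  apply: Rintegral_supp => //; first by move=> x /=; rewrite !in_itv /= => /andP[->].
  move=> x /=; rewrite !in_itv /= andbT => x0 /negP; rewrite x0 /= -leNgt => xL.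
  by apply: out; rewrite (le_trans xL) // ler_norm.
have -> : \int[mu]_(x in `]0, +oo[) (Hf a x * Mf d ((l - b * x) / r)) = \int[mu]_(x in `]0, L[) G (- x).
  have E x : Hf a x * Mf d ((l - b * x) / r) = G (- x) by rewrite /G HfN mulrN.
  rewrite (_ : (fun x => Hf a x * Mf d ((l - b * x) / r)) = fun x => G (- x)); last by apply/funext.
  apply: Rintegral_supp => //; first by move=> x /=; rewrite !in_itv /= => /andP[->].
  move=> x /=; rewrite !in_itv /= andbT => x0 /negP; rewrite x0 /= -leNgt => xL.
  by apply: out; rewrite normrN (le_trans xL) // ler_norm.
rewrite -Rintegral_opp // oppr0.
have -> : \int[mu]_(x in `]0, L[) G x + \int[mu]_(x in `]- L, 0[) G x = \int[mu]_(x in `]- L, L[) G x.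
  by rewrite (Rintegral_split _ (- L) 0 L) ?oppr_lt0 // addrC.
pose f y := Hf a ((r * y - l) / b) * Mf d y.
have cf y : {for y, continuous f}.
  apply: cM; last exact: Mf_cont.
  by apply: (ccomp (Hf a) (fun y => (r * y - l) / b)); [cont | exact: Hf_cont].
have LL : - L < L by lra.
have br : 0 < b / r by rewrite divr_gt0.
have := Rintegral_affine f (b / r) (l / r) (- L) L br LL cf.
have -> : \int[mu]_(x in `]- L, L[) f (b / r * x + l / r) = \int[mu]_(x in `]- L, L[) G x.
  apply: eq_Rintegral => x _; rewrite /f /G; congr (Hf a _ * Mf d _); field; rewrite ?gt_eqF //.
have e1 : b / r * L = 1 + `|l| / r by rewrite /L; field; rewrite !gt_eqF.
have lr : `|l / r| = `|l| / r by rewrite normrM (gtr0_norm (_ : 0 < r^-1)) ?invr_gt0.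
have := ler_norm (l / r); have := ler_norm (- (l / r)); rewrite normrN lr => h1 h2.
have -> : \int[mu]_(x in `]b / r * - L + l / r, b / r * L + l / r[) f x = \int[mu]_(x in J) f x.
  apply: Rintegral_supp => //.
    by move=> x /=; rewrite !in_itv /= mulrN e1 => /andP[x1 x2]; apply/andP; split; lra.
  move=> x _ /= h; rewrite /f Mf_out ?mulr0 //; rewrite leNgt; apply/negP => xn.
  by apply: h; rewrite in_itv /= -ltr_norml.
rewrite Hf_conv2 // => H.
have b0' : b != 0 by rewrite gt_eqF.
have r0' : r != 0 by rewrite gt_eqF.
pose g t := Mf a (b * t) * Hf d (r * t) * cos (t * l).
have cg t : {for t, continuous g}.
  apply: cM; last by cont.
  apply: cM; first by apply: (ccomp (Mf a) (fun t => b * t)); [cont | exact: Mf_cont].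
  by apply: (ccomp (Hf d) (fun t => r * t)); [cont | exact: Hf_cont].
have -> : \int[mu]_(x in `]- L, L[) G x = r * \int[mu]_(t in `]- b^-1, b^-1[) g t.
  have {}H : b * (\int[mu]_(t in `]- b^-1, b^-1[) g t * r) = b * \int[mu]_(x in `]- L, L[) G x.
    by rewrite mulrA -/(g _) H; field.
  by rewrite -(mulfI b0' H) mulrC.
have bi0 : 0 < b^-1 by rewrite invr_gt0.
have -> : \int[mu]_(t in `]- b^-1, b^-1[) g t = 2 * \int[mu]_(t in `]0, b^-1[) g t.
  have o := Rintegral_opp g 0 b^-1 bi0 cg; rewrite oppr0 in o.
  have gN : \int[mu]_(t in `]0, b^-1[) g (- t) = \int[mu]_(t in `]0, b^-1[) g t.
    by apply: eq_Rintegral => t _; rewrite /g !mulrN MfN HfN mulNr cosN.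
  rewrite gN in o.
  by rewrite (Rintegral_split _ (- b^-1) 0 b^-1) ?oppr_lt0 // o; ring.
rewrite mulrCA; congr (_ * _).
have -> : \int[mu]_(t in `]0, b^-1[) g t = \int[mu]_(t in `]0, e[) g t.
  symmetry; apply: Rintegral_supp => //.
    by move=> x /=; rewrite !in_itv /= => /andP[-> h]; exact: lt_le_trans be.
  move=> x /=; rewrite !in_itv /= => /andP[x0 xe] /negP; rewrite x0 /= -leNgt => bx.
  rewrite /g Mf_out ?mul0r // ger0_norm ?mulr_ge0 ?(ltW b0) ?(ltW x0) //.
  by rewrite mulrC -ler_pdivrMr // div1r.
rewrite -RintegralZl //; last exact: continuous_integ_oo.
by apply: eq_Rintegral => t _; rewrite /g !mulrA.
Qed.

End local_multiplier.

Section local_multiplier2.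
Context {R : realType}.
Local Notation mu := (@lebesgue_measure R).
Implicit Types (a b x y t l : R).

Lemma norm_Rintegral_le (D : set R) (f g : R -> R) : measurable D -> measurable_fun D f ->
  (forall x, D x -> `|f x| <= g x) -> integ D g ->
  `|\int[mu]_(x in D) f x| <= \int[mu]_(x in D) g x.
Proof.
move=> mD mf fg ig; have fi : integ D f := integ_le D f g mD mf fg ig.
rewrite (le_trans (@le_normr_Rintegral _ _ _ mu D f mD fi)) // le_Rintegral //.
exact: integrable_norm fi.
Qed.

Lemma Rintegral_sum (D : set R) n (c : nat -> R) (f : nat -> R -> R) : measurable D ->
  (forall i, integ D (f i)) ->
  \int[mu]_(x in D) (\sum_(i < n) c i * f i x) = \sum_(i < n) c i * \int[mu]_(x in D) f i x.
Proof.
move=> mD fi.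
have ici i : integ D (fun x => c i * f i x).
  exact: (@integrableZl _ _ _ mu _ mD (c i) (EFin \o f i) (fi i)).
have isum m : integ D (fun x => \sum_(i < m) c i * f i x).
  elim: m => [|m IH].
    rewrite (_ : (fun x => _) = fun=> 0); last by apply/funext => x; rewrite big_ord0.
    exact: integrable0.
  rewrite (_ : (fun x => _) = fun x => (\sum_(i < m) c i * f i x) + c m * f m x); last first.
    by apply/funext => x; rewrite big_ord_recr.
  exact: (@integrableD _ _ _ mu _ mD (EFin \o (fun x => \sum_(i < m) c i * f i x)) (EFin \o (fun x => c m * f m x))).
elim: n => [|n IH].
  by rewrite big_ord0 -[RHS](mul0r (fine (mu D))) -Rintegral_cst //; apply: eq_Rintegral => x _; rewrite big_ord0.
rewrite big_ord_recr /= -IH -RintegralZl // -RintegralD //.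
by apply: eq_Rintegral => x _; rewrite big_ord_recr.
Qed.

(** The 2k-th difference of the profile at l/r, with step x/(eps r), is averaged in x against [Hf]
    N. Its central term is a nonzero multiple of the profile; every other node is displaced by at
    least x/(eps r), hence local by [Hf_pair]; the whole average is small by [Mf_fd]. *)
Lemma local_multiplier d eps k : 0 < d -> 0 < eps -> d <= k.*2%:R ->
  exists C : R, exists th : R -> R, [/\ 0 < C, forall t, {for t, continuous th}, forall t, `|th t| <= C &
  forall r l, 0 < r -> 0 <= l ->
    `|Mf d (l / r) - \int[mu]_(t in `]0, eps[) (r * th t * Hf d (r * t) * cos (t * l))| <=
    C * (r `^ (- d) * (1 + `|r - l|) `^ (d - k.*2%:R))].
Proof.
move=> d0 e0 dk; set n := k.*2 in dk *.
(* The decay (1 + x)^(-(n+2)) of [Hf] N absorbs a factor (1 + x)^n and still leaves the integrable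
   (1 + x)^(-2). *)
pose N : R := n%:R + 1. pose s := eps^-1.
have N0 : 0 < N by rewrite ltr_wpDl.
have s0 : 0 < s by rewrite invr_gt0.
pose b i := (n%:R - 2 * i%:R) * s.
pose c0 := \int[mu]_(x in `]0, +oo[) Hf N x.
have c00 : 0 < c0 := Hf_int_gt0 N N0.
pose cf i : R := (-1) ^+ i * 'C(n, i)%:R.
pose D := cf k * c0.
have D0 : D != 0.
  rewrite mulf_neq0 ?(gt_eqF c00) // mulf_neq0 ?signr_eq0 // pnatr_eq0 -lt0n bin_gt0.
  by rewrite /n -addnn leq_addr.
(* The central coefficient is dropped: it produces the multiplier itself, and [th] collects the rest
   divided by [D]. *)
pose cc i := if i == k then 0 else cf i.
pose th t := - D^-1 * \sum_(i < n.+1) cc i * Mf N (b i * t).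
have bk : b k = 0 by rewrite /b /n -addnn natrD; ring.
have bi i : i != k -> eps^-1 <= `|b i|.
  move=> ik; rewrite /b normrM (gtr0_norm s0) ler_peMl ?(ltW s0) //.
  have -> : n%:R - 2 * i%:R = 2 * (k%:Z - i%:Z)%:~R :> R by rewrite /n -addnn natrD intrD rmorphN /=; ring.
  rewrite normrM -intr_norm normr_nat; have : (1 <= `|k%:Z - i%:Z|)%R.
    by rewrite -gtz0_ge1 normr_gt0 subr_eq0 eq_sym.
  by rewrite -(ler_int R) => h; rewrite (le_trans h) // ler_peMl ?ler0z // ler1n.
have bE i : b i = (n%:R - 2 * i%:R) * s by [].
clearbody b.
have [Cf Cf0 HCf] := Mf_fd d k d0 dk.
have [Ch Ch0 HCh] := Hf_bound N N0.
pose I2 := \int[mu]_(x in `]0, +oo[) (1 + x) `^ (- 2).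
have iI2 : integ `]0, +oo[ (fun x : R => (1 + x) `^ (- 2)) by apply: integ_decay; rewrite ltr1n.
pose Cg := Ch * Cf * (1 + s) `^ n%:R.
have Cg0 : 0 < Cg by rewrite !mulr_gt0 ?powR_gt0 // addr_gt0.
have thc t : {for t, continuous th}.
  rewrite /th; apply: cM; first exact: cC.
  apply: (csum _ (fun i t => cc i * Mf N (b i * t))) => i; apply: cM; first exact: cC.
  by apply: (ccomp (Mf N) (fun t => b i * t)); [cont | exact: Mf_cont].
pose Ct := `|D^-1| * \sum_(i < n.+1) `|cc i|.
have Ct0 : 0 <= Ct by rewrite mulr_ge0 // sumr_ge0.
have thb t : `|th t| <= Ct.
  rewrite normrM normrN ler_wpM2l // (le_trans (ler_norm_sum _ _ _)) // ler_sum // => i _.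
  by rewrite normrM ler_piMr // ger0_norm ?Mf_ge0 // Mf_le1.
have I20 : 0 <= I2 by apply: Rintegral_ge0 => x _; exact: powR_ge0.
have K0 : 0 <= `|D^-1| * (Cg * I2) by apply: mulr_ge0 => //; apply: mulr_ge0 => //; exact: ltW.
exists (Ct + `|D^-1| * (Cg * I2) + 1), th; split => //.
- by rewrite ltr_wpDl // addr_ge0.
- move=> t; by rewrite (le_trans (thb t)) // -addrA lerDl; apply: addr_ge0.
move=> r l r0 l0.
pose P b0 x := Hf N x * Mf d ((l + b0 * x) / r).
have cP b0 x : {for x, continuous (P b0)}.
  apply: cM; first exact: Hf_cont.
  by apply: (ccomp (Mf d) (fun x => (l + b0 * x) / r)); [cont | exact: Mf_cont].
have iP b0 : integ `]0, +oo[ (P b0).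
  apply: (integ_le _ _ (fun x => `|Hf N x|)) => //.
  - by apply: continuous_on_measurable; [exact: interval_open | move=> x _; exact: cP].
  - by move=> x _; rewrite normrM ler_piMr // ger0_norm ?Mf_ge0 // Mf_le1.
  - exact: (integrable_norm (Hf_integ N N0)).
pose Q x := Hf N x * fd n (s * x / r) (Mf d) (l / r).
have QE x : Q x = \sum_(i < n.+1) (cf i / 2) * (P (b i) x + P (- b i) x).
  (* The order is even, so the steps h and -h give the same difference; averaging them creates the
     pairs of opposite shifts that [Hf_pair] expects. *)
  rewrite /Q; have -> : fd n (s * x / r) (Mf d) (l / r) = (fd n (s * x / r) (Mf d) (l / r) + fd n (- (s * x / r)) (Mf d) (l / r)) / 2.
    by rewrite fd_opp -signr_odd /n odd_double expr0 mul1r; field.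
  rewrite !fdE -big_split /= mulr_suml mulr_sumr; apply: eq_bigr => i _.
  rewrite /P /cf.
  have -> : l / r + (n%:R - 2 * i%:R) * (s * x / r) = (l + b i * x) / r by rewrite bE; ring.
  have -> : l / r + (n%:R - 2 * i%:R) * - (s * x / r) = (l + - b i * x) / r by rewrite bE; ring.
  by field.
have mQ : measurable_fun (`]0, +oo[%classic : set R) Q.
  rewrite (_ : Q = fun x => \sum_(i < n.+1) (cf i / 2) * (P (b i) x + P (- b i) x)); last exact/funext.
  apply: continuous_on_measurable; first exact: interval_open.
  move=> x _; apply: (csum _ (fun i x => (cf i / 2) * (P (b i) x + P (- b i) x))) => i.
  by apply: cM; [exact: cC | apply: cD; exact: cP].
pose T i := \int[mu]_(t in `]0, eps[) (r * Mf N (b i * t) * Hf d (r * t) * cos (t * l)).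
have PEB B : 0 < B -> B^-1 <= eps -> \int[mu]_(x in `]0, +oo[) P B x + \int[mu]_(x in `]0, +oo[) P (- B) x =
    2 * \int[mu]_(t in `]0, eps[) (r * Mf N (B * t) * Hf d (r * t) * cos (t * l)).
  move=> B0 Be; have EN : P (- B) = fun x => Hf N x * Mf d ((l - B * x) / r).
    by apply/funext => x; rewrite /P mulNr.
  by rewrite EN; exact: (Hf_pair N d r B eps l N0 d0 r0 B0 Be).
have PE i : i != k -> \int[mu]_(x in `]0, +oo[) (P (b i) x + P (- b i) x) = 2 * T i.
  move=> ik; rewrite (@RintegralD _ _ _ mu _ _ _ (measurable_itv _) (iP _) (iP _)); have := bi i ik.
  have [b0|b0] := ltP 0 (b i).
    rewrite (gtr0_norm b0) => h; apply: PEB => //.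
    by rewrite -[leRHS]invrK lef_pV2 ?posrE ?invr_gt0.
  rewrite (ler0_norm b0) => h; have b0' : 0 < - b i by apply: lt_le_trans h; rewrite invr_gt0.
  have h' : (- b i)^-1 <= eps by rewrite -[leRHS]invrK lef_pV2 ?posrE ?invr_gt0.
  have -> : T i = \int[mu]_(t in `]0, eps[) (r * Mf N (- b i * t) * Hf d (r * t) * cos (t * l)).
    by apply: eq_Rintegral => t _; rewrite mulNr MfN.
  by have E := PEB _ b0' h'; rewrite opprK in E; rewrite addrC; exact: E.
have GE : \int[mu]_(x in `]0, +oo[) Q x = D * Mf d (l / r) + \sum_(i < n.+1) cc i * T i.
  rewrite (_ : Q = fun x => \sum_(i < n.+1) (cf i / 2) * (P (b i) x + P (- b i) x)); last exact/funext.
  rewrite (Rintegral_sum _ _ (fun i => cf i / 2) (fun i x => P (b i) x + P (- b i) x)) //; last first.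
    move=> i; exact: (@integrableD _ _ _ mu _ _ (EFin \o P (b i)) (EFin \o P (- b i))).
  have kn : (k < n.+1)%N by rewrite ltnS /n -addnn leq_addr.
  rewrite (bigD1 (Ordinal kn)) //= [in RHS](bigD1 (Ordinal kn)) //= /cc eqxx mul0r add0r; congr (_ + _).
    rewrite bk oppr0 /D.
    have -> : \int[mu]_(x in `]0, +oo[) (P 0 x + P 0 x) = 2 * Mf d (l / r) * c0.
      rewrite /c0 -RintegralZl //; last exact: Hf_integ.
      by apply: eq_Rintegral => x _; rewrite /P mul0r addr0; ring.
    by field.
  apply: eq_bigr => i ik; have {}ik : i != k :> nat by [].
  by rewrite (negPf ik) PE //; field.
have E1 : Mf d (l / r) - \int[mu]_(t in `]0, eps[) (r * th t * Hf d (r * t) * cos (t * l)) =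
    D^-1 * \int[mu]_(x in `]0, +oo[) Q x.
  rewrite GE mulrDr mulKf //; congr (_ + _).
  have ct i t : {for t, continuous (fun t => r * Mf N (b i * t) * Hf d (r * t) * cos (t * l))}.
    apply: cM; last by cont.
    apply: cM; last by apply: (ccomp (Hf d) (fun t => r * t)); [cont | exact: Hf_cont].
    apply: cM; first exact: cC.
    by apply: (ccomp (Mf N) (fun t => b i * t)); [cont | exact: Mf_cont].
  rewrite mulr_sumr -mulN1r.
  have -> : \sum_(i < n.+1) D^-1 * (cc i * T i) = \sum_(i < n.+1) (D^-1 * cc i) * T i.
    by apply: eq_bigr => i _; rewrite mulrA.
  rewrite -(Rintegral_sum _ n.+1 (fun i => D^-1 * cc i) (fun i t => r * Mf N (b i * t) * Hf d (r * t) * cos (t * l))) //; last first.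
    by move=> i; apply: continuous_integ_oo => t; exact: ct.
  rewrite -RintegralZl //.
    apply: eq_Rintegral => t _; rewrite /th.
    rewrite [X in _ = X](_ : _ = D^-1 * (\sum_(i < n.+1) cc i * Mf N (b i * t)) * (r * Hf d (r * t) * cos (t * l))); last first.
      by rewrite mulr_sumr mulr_suml; apply: eq_bigr => i _; ring.
    by ring.
  apply: continuous_integ_oo => t; apply: cM; last by cont.
  apply: cM; last by apply: (ccomp (Hf d) (fun t => r * t)); [cont | exact: Hf_cont].
  by have := thc t => ?; cont.
rewrite E1 normrM.
set V := r `^ (- d) * _; have V0 : 0 <= V by rewrite mulr_ge0 ?powR_ge0.
suff H : `|\int[mu]_(x in `]0, +oo[) Q x| <= Cg * I2 * V.
  rewrite (le_trans (ler_wpM2l (normr_ge0 _) H)) // mulrA ler_wpM2r //.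
  by rewrite addrAC lerDr addr_ge0.
have -> : Cg * I2 * V = \int[mu]_(x in `]0, +oo[) (Cg * V * (1 + x) `^ (- 2)).
  by rewrite RintegralZl // /I2; ring.
apply: norm_Rintegral_le => //; last first.
  exact: (@integrableZl _ _ _ mu _ _ (Cg * V) (EFin \o (fun x => (1 + x) `^ (- 2)))).
move=> x; rewrite /= in_itv /= andbT => x0.
have h0 : 0 < s * x / r by rewrite divr_gt0 ?mulr_gt0.
have sx0 : 0 < 1 + s * x by rewrite addr_gt0 ?mulr_gt0.
have x10 : 0 < 1 + x by rewrite addr_gt0.
have := HCf (l / r) _ h0; have := HCh x; rewrite (gtr0_norm x0) => g1.
rewrite [`|l / r|]ger0_norm ?divr_ge0 ?(ltW r0) //.
set dd := `|r - l|; have dd0 : 0 <= dd by exact: normr_ge0.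
have -> : `|1 - l / r| / (s * x / r) = dd / (s * x).
  have -> : 1 - l / r = (r - l) / r by field; rewrite gt_eqF.
  by rewrite normrM (gtr0_norm (_ : 0 < r^-1)) ?invr_gt0 // -/dd; field; rewrite !gt_eqF.
have e1 : (s * x / r) `^ d = r `^ (- d) * (s * x) `^ d.
  have q1 : 0 <= s * x by rewrite mulr_ge0 ?(ltW s0) ?(ltW x0).
  have q2 : 0 <= r^-1 by rewrite invr_ge0 ltW.
  by rewrite (powRM _ q1 q2) (powRV r d r0) mulrC.
rewrite e1 => g2.
(* Comes from 1 + dd <= (1 + s x)(1 + dd/(s x)): the step is unscaled at the price of powers of 1 +
   s x. *)
have g3 : (1 + dd / (s * x)) `^ (d - n%:R) <= (1 + s * x) `^ (n%:R - d) * (1 + dd) `^ (d - n%:R).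
  rewrite (_ : d - n%:R = - (n%:R - d)); last by ring.
  have p1 : 0 < 1 + dd / (s * x) by rewrite ltr_pwDl // divr_ge0 // mulr_ge0 // ltW.
  have p2 : 0 < 1 + dd by rewrite ltr_pwDl.
  rewrite !powRN ler_pdivlMr ?powR_gt0 // mulrC ler_pdivrMr ?powR_gt0 // -powRM ?(ltW sx0) ?(ltW p1) //.
  rewrite ge0_ler_powR ?nnegrE ?subr_ge0 ?mulr_ge0 ?(ltW sx0) ?(ltW p1) ?(ltW p2) //.
  rewrite (_ : (1 + s * x) * (1 + dd / (s * x)) = 1 + dd + s * x + dd / (s * x)); last by field; rewrite !gt_eqF.
  by rewrite -addrA lerDl addr_ge0 ?divr_ge0 ?mulr_ge0 ?(ltW s0) ?(ltW x0).
have g4 : (s * x) `^ d * (1 + s * x) `^ (n%:R - d) <= (1 + s) `^ n%:R * (1 + x) `^ n%:R.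
  apply: (@le_trans _ _ ((1 + s * x) `^ d * (1 + s * x) `^ (n%:R - d))).
    by rewrite ler_wpM2r ?powR_ge0 // ge0_ler_powR ?nnegrE ?mulr_ge0 ?(ltW s0) ?(ltW x0) ?(ltW sx0) ?(ltW d0) // lerDr.
  rewrite -powRD ?(gt_eqF sx0) ?implybT // (_ : d + (n%:R - d) = n%:R); last by ring.
  rewrite -powRM ?addr_ge0 ?(ltW s0) ?(ltW x0) // ge0_ler_powR ?nnegrE ?mulr_ge0 ?(ltW sx0) ?addr_ge0 ?(ltW s0) ?(ltW x0) //.
  by have : 0 < s * x by [rewrite mulr_gt0]; move: s0 x0 => s0 x0 sx; rewrite mulrDl !mulrDr; lra.
have e2 : (1 + x) `^ (- (N + 1)) * (1 + x) `^ n%:R = (1 + x) `^ (- 2).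
  by rewrite -powRD ?(gt_eqF x10) ?implybT //; congr powR; rewrite /N; ring.
rewrite /Q normrM.
apply: (@le_trans _ _ (Ch * (1 + x) `^ (- (N + 1)) * (Cf * (r `^ (- d) * (s * x) `^ d * ((1 + s * x) `^ (n%:R - d) * (1 + dd) `^ (d - n%:R)))))).
  rewrite ler_pM // (le_trans g2) // ler_pM2l // ler_wpM2l // mulr_ge0 ?powR_ge0 //.
rewrite -e2 /Cg /V.
rewrite [X in X <= _](_ : _ = Ch * Cf * (1 + x) `^ (- (N + 1)) * r `^ (- d) * (1 + dd) `^ (d - n%:R) * ((s * x) `^ d * (1 + s * x) `^ (n%:R - d))); last by ring.
rewrite [X in _ <= X](_ : _ = Ch * Cf * (1 + x) `^ (- (N + 1)) * r `^ (- d) * (1 + dd) `^ (d - n%:R) * ((1 + s) `^ n%:R * (1 + x) `^ n%:R)); last by ring.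
by rewrite ler_wpM2l // !mulr_ge0 ?powR_ge0 // ltW.
Qed.

End local_multiplier2.

(** * Riemann's method *)

Section geometric_series.
Context {R : realType}.
Implicit Types (c : nat -> R) (A B e K : R).

Definition geo A B c := 0 <= A /\ 0 < B /\ forall n, `|c n| <= A * B ^+ n.

Lemma geo_cvg A B c e : geo A B c -> `|e| * B < 1 -> cvgn (pseries c e).
Proof.
move=> [A0 [B0 H]] eB; apply: normed_cvg.
apply: (@series_le_cvg _ _ (geometric A (`|e| * B))).
- by move=> n; exact: normr_ge0.
- by move=> n; rewrite mulr_ge0 // exprn_ge0 // mulr_ge0 // ltW.
- move=> n; rewrite /= normrM normrX /geometric /= exprMn [`|e| ^+ n * _]mulrC mulrA.
  by rewrite ler_wpM2r ?exprn_ge0.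
- by apply: is_cvg_geometric_series; rewrite ger0_norm // mulr_ge0 // ltW.
Qed.

(** The crude bound n + 1 <= 2^n lets a formal derivative halve the guaranteed radius. *)
Lemma geo_diffs A B c : geo A B c -> geo (A * B) (2 * B) (pseries_diffs c).
Proof.
move=> [A0 [B0 H]]; split; first by rewrite mulr_ge0 // ltW.
split => [|n]; first by rewrite mulr_gt0.
rewrite /pseries_diffs normrM normr_nat.
have n2 : n.+1%:R <= 2 ^+ n :> R by rewrite -natrX ler_nat ltn_expl.
apply: (@le_trans _ _ (2 ^+ n * (A * B ^+ n.+1))); first by apply: ler_pM.
rewrite (_ : 2 ^+ n * (A * B ^+ n.+1) = A * B * (2 * B) ^+ n) //.
by rewrite exprS exprMn; ring.
Qed.

Lemma geo_derive A B c K e : geo A B c -> 0 < K -> 4 * B * K < 1 -> `|e| < K ->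
  is_derive e 1 (fun x => limn (pseries c x)) (limn (pseries (pseries_diffs c) e)).
Proof.
move=> g K0 BK eK; have g1 := geo_diffs _ _ _ g; have g2 := geo_diffs _ _ _ g1.
have [_ [B0 _]] := g; have BK0 : 0 < B * K by rewrite mulr_gt0.
by apply: (@pseries_snd_diffs _ _ K); [apply: (geo_cvg _ _ _ _ g) | apply: (geo_cvg _ _ _ _ g1) | apply: (geo_cvg _ _ _ _ g2) | rewrite (gtr0_norm K0)];
  rewrite ?(gtr0_norm K0) //; lra.
Qed.

End geometric_series.

(** Coefficients of the Gauss series F(1/2 + nu, 1/2 - nu; 1; e), which is the Legendre function
    P_(nu-1/2)(1 - 2e). At e = (t^2 - (x-y)^2)/(4xy) it is the Riemann function of u_tt = u_yy -
    ((nu^2 - 1/4)/y^2) u. *)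
Fixpoint pcoef {R : realType} (nu : R) n : R :=
  if n is m.+1 then pcoef nu m * (((m%:R + 1 / 2) ^+ 2 - nu ^+ 2) / (m%:R + 1) ^+ 2) else 1.
(** The index j counts formal derivatives; inside the radius [prad] they are the actual ones
    ([pser_derive]). *)
HB.lock Definition pser {R : realType} (nu : R) (j : nat) (e : R) : R :=
  limn (pseries (iter j (@pseries_diffs R) (pcoef nu)) e).

(** Small enough for the crude geometric bounds to survive up to j = 3 in [pser_derive], where 4 *
    2^3 / 65 < 1 is needed, and smaller than 1/2. *)
HB.lock Definition prad {R : realType} (nu : R) : R := (65 * (1 + nu ^+ 2))^-1.

Section riemann_series.
Context {R : realType}.
Variable nu : R.
Implicit Types (e x t : R).

Lemma pcoef_geo : geo 1 (1 + nu ^+ 2) (pcoef nu).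
Proof.
have B0 : 0 < 1 + nu ^+ 2 by rewrite ltr_pwDl ?sqr_ge0.
split => //; split => // n; rewrite mul1r; elim: n => [|n IH]; first by rewrite expr0 normr1.
rewrite /= normrM [(1 + nu ^+ 2) ^+ n.+1]exprSr ler_pM //.
have p : 0 < (n%:R + 1) ^+ 2 :> R by rewrite exprn_gt0 // ltr_wpDl.
rewrite normrM (gtr0_norm (_ : 0 < ((n%:R + 1) ^+ 2)^-1)) ?invr_gt0 // ler_pdivrMr //.
have n0 : 0 <= n%:R :> R by [].
have := sqr_ge0 nu; move: (nu ^+ 2) => q q0; move: (n%:R : R) n0 => N n0.
have h1 : 0 <= N * q by rewrite mulr_ge0.
have h2 : 0 <= N * (N * q) by rewrite mulr_ge0.
have h3 : 0 <= N * N by rewrite mulr_ge0.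
by rewrite ler_norml; apply/andP; split; rewrite -subr_ge0 !expr2; lra.
Qed.


Lemma prad_gt0 : 0 < prad nu. Proof. by rewrite prad.unlock invr_gt0 mulr_gt0 // ltr_pwDl ?sqr_ge0. Qed.
Lemma prad_lt1 : prad nu < 1 / 2.
Proof.
rewrite prad.unlock invf_plt ?posrE ?mulr_gt0 ?ltr_pwDl ?sqr_ge0 //.
by rewrite div1r invrK; have := sqr_ge0 nu; lra.
Qed.

Lemma pser_derive j e : (j <= 3)%N -> `|e| < prad nu -> is_derive e 1 (pser nu j) (pser nu j.+1 e).
Proof.
move=> j3 eK; have K0 := prad_gt0.
have [A g] : exists A, geo A (2 ^+ j * (1 + nu ^+ 2)) (iter j (@pseries_diffs R) (pcoef nu)).
  elim: j {j3} => [|j [A g]]; first by exists 1; rewrite mul1r; exact: pcoef_geo.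
  by exists (A * (2 ^+ j * (1 + nu ^+ 2))); rewrite [2 ^+ j.+1]exprS -[2 * 2 ^+ j * _]mulrA; exact: geo_diffs g.
rewrite pser.unlock; apply: (geo_derive _ _ _ (prad nu) _ g) => //.
have : 2 ^+ j <= 8 :> R by case: j j3 {g} => [|[|[|[|]]]] // _; rewrite ?expr0 ?expr1 ?exprS; lra.
have B0 : 0 < 1 + nu ^+ 2 by rewrite ltr_pwDl ?sqr_ge0.
have e1 : (1 + nu ^+ 2) * prad nu = 65^-1 by rewrite prad.unlock; field; rewrite gt_eqF.
move: (2 ^+ j) => J h; have -> : 4 * (J * (1 + nu ^+ 2)) * prad nu = 4 * J * ((1 + nu ^+ 2) * prad nu) by ring.
by rewrite e1; lra.
Qed.

Lemma pser_cont j e : (j <= 3)%N -> `|e| < prad nu -> {for e, continuous (pser nu j)}.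
Proof. by move=> j3 eK; exact: is_derive_continuous (pser_derive _ _ j3 eK). Qed.

Lemma pser00 : pser nu 0 0 = 1.
Proof.
rewrite pser.unlock; apply: cvg_lim => //; apply: cvg_near_cst; exists 1%N => // n /= n1.
rewrite /pseries /series /= big_mkord -(prednK n1) big_ord_recl /= expr0 mulr1 big1 ?addr0 //.
by move=> i _; rewrite expr0n mulr0.
Qed.

(** Gauss' hypergeometric equation, checked on partial sums whose defect consists of end terms
    tending to 0. *)
Lemma pser_ode e : `|e| < prad nu ->
  e * (1 - e) * pser nu 2 e + (1 - 2 * e) * pser nu 1 e - (1 / 4 - nu ^+ 2) * pser nu 0 e = 0.
Proof.
move=> eK; pose c := pcoef nu; pose c1 := pseries_diffs c; pose c2 := pseries_diffs c1.
have g := pcoef_geo; have g1 := geo_diffs _ _ _ g; have g2 := geo_diffs _ _ _ g1.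
have B0 : 0 < 1 + nu ^+ 2 by rewrite ltr_pwDl ?sqr_ge0.
have K1 : `|e| * (1 + nu ^+ 2) < 65^-1.
  by move: eK; rewrite prad.unlock invfM -ltr_pdivlMr // ltr_pdivrMr.
have K0 : 0 <= `|e| * (1 + nu ^+ 2) by rewrite mulr_ge0 // ltW.
have v0 : cvgn (pseries c e) by apply: (geo_cvg _ _ _ _ g); lra.
have v1 : cvgn (pseries c1 e) by apply: (geo_cvg _ _ _ _ g1); lra.
have v2 : cvgn (pseries c2 e) by apply: (geo_cvg _ _ _ _ g2); lra.
(* The staggered lengths n, n+1, n+2 make all coefficients cancel except the two at the top. *)
pose T n := e * (1 - e) * pseries c2 e n + (1 - 2 * e) * pseries c1 e n.+1 - (1 / 4 - nu ^+ 2) * pseries c e n.+2.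
have TE n : T n = - (e * (c2 n * e ^+ n) + c1 n.+1 * e ^+ n.+1).
  rewrite /T; elim: n => [|n IH].
    rewrite /pseries /series /= !big_nat1 big_nil big_nat_recr //= big_nat1 /c2 /c1 /pseries_diffs /c /= !expr0 !expr1.
    by field.
  rewrite /pseries /series /= in IH *.
  rewrite big_nat_recr //= [X in (1 - 2 * e) * X]big_nat_recr //= [X in (1 / 4 - nu ^+ 2) * X]big_nat_recr //=.
  move: (\sum_(_ <= _ < n) _) (\sum_(_ <= _ < n.+1) _) (\sum_(_ <= _ < n.+2) _) IH => a b d IH.
  rewrite (_ : _ - _ = (e * (1 - e) * a + (1 - 2 * e) * b - (1 / 4 - nu ^+ 2) * d) + (e * (1 - e) * (c2 n * e ^+ n) + (1 - 2 * e) * (c1 n.+1 * e ^+ n.+1) - (1 / 4 - nu ^+ 2) * (c n.+2 * e ^+ n.+2))); last by ring.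
  rewrite IH /c2 /c1 /pseries_diffs /c /= !exprS -!natr1; move: (e ^+ n) (pcoef nu n) => E P.
  have n0 : 0 <= n%:R :> R by []; move: (n%:R : R) n0 => N n0.
  by field; rewrite ?gt_eqF //; lra.
have L1 : T n @[n --> \oo] --> e * (1 - e) * pser nu 2 e + (1 - 2 * e) * pser nu 1 e - (1 / 4 - nu ^+ 2) * pser nu 0 e.
  rewrite pser.unlock /=; apply: cvgB.
    apply: cvgD; first by apply: cvgM; [exact: cvg_cst | exact: v2].
    by apply: cvgM; [exact: cvg_cst | rewrite (cvg_shiftS (pseries c1 e))].
  apply: cvgM; first exact: cvg_cst.
  by rewrite (cvg_shiftS (fun n => pseries c e n.+1)) (cvg_shiftS (pseries c e)).
have L2 : T n @[n --> \oo] --> - (e * 0 + 0).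
  rewrite (_ : T = fun n => - (e * (c2 n * e ^+ n) + c1 n.+1 * e ^+ n.+1)); last exact/funext.
  apply: cvgN; apply: cvgD.
    by apply: cvgM; [exact: cvg_cst | exact: (cvg_series_cvg_0 v2)].
  by rewrite (cvg_shiftS (fun n => c1 n * e ^+ n)); exact: (cvg_series_cvg_0 v1).
have H : e * (1 - e) * pser nu 2 e + (1 - 2 * e) * pser nu 1 e - (1 / 4 - nu ^+ 2) * pser nu 0 e = - (e * 0 + 0).
  by apply: cvg_unique L1 L2.
by rewrite H mulr0 addr0 oppr0.
Qed.

End riemann_series.

Section bessel_wave.
Context {R : realType}.
Variables (nu s : R).
Hypothesis hnu : -1 < nu.
Implicit Types (x y t : R).
Local Notation ka := (nu + 1 / 2).

(** Proportional to sqrt(y) J_nu(s y) for s > 0; cos(t s) [wv] s y solves the wave equation with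
    potential (nu^2 - 1/4)/y^2. The value s = 0 is allowed and gives a multiple of y^(nu+1/2). *)
Definition wv y := y `^ ka * gbes nu (s * y).
Definition dwv y := ka * y `^ (ka - 1) * gbes nu (s * y) - y `^ ka * (s ^+ 2 * y / 2) * gbes (nu + 1) (s * y).

Lemma wv_derive y : 0 < y -> is_derive y 1 wv (dwv y).
Proof.
move=> y0; have H := gbes_derive nu (s * y) hnu.
eapply is_derive_val.
  eapply (dM (fun y => y `^ ka) (fun y => gbes nu (s * y))); first by der.
  by eapply (dcomp (gbes nu) (fun y => s * y)); [der | exact: H].
by rewrite /dwv; ring.
Qed.

Lemma dwv_derive y : 0 < y -> is_derive y 1 dwv (((nu ^+ 2 - 1 / 4) / y ^+ 2 - s ^+ 2) * wv y).
Proof.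
move=> y0; have h1 : -1 < nu + 1 by move: hnu; lra.
have H := gbes_derive nu (s * y) hnu; have H1 := gbes_derive (nu + 1) (s * y) h1.
have D0 : is_derive y 1 (fun y => gbes nu (s * y)) (- (s * y / 2) * gbes (nu + 1) (s * y) * s).
  by eapply is_derive_val; [by eapply (dcomp (gbes nu) (fun y => s * y)); [der | exact: H] | ring].
have D1 : is_derive y 1 (fun y => gbes (nu + 1) (s * y)) (- (s * y / 2) * gbes (nu + 1 + 1) (s * y) * s).
  by eapply is_derive_val; [by eapply (dcomp (gbes (nu + 1)) (fun y => s * y)); [der | exact: H1] | ring].
rewrite /dwv; derval => //.
have e1 : y `^ (ka - 1) = y `^ ka / y by rewrite -[y^-1]powR_inv1 ?(ltW y0) // -powRD ?(gt_eqF y0) ?implybT.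
have e2 : y `^ (ka - 1 - 1) = y `^ ka / y / y by rewrite -e1 -[y^-1]powR_inv1 ?(ltW y0) // -powRD ?(gt_eqF y0) ?implybT.
have R0 := gbes_rec nu (s * y) hnu.
rewrite /wv e1 e2; move: (y `^ ka) (gbes nu _) (gbes (nu + 1) _) (gbes (nu + 1 + 1) _) R0 => P G0 G1 G2 R0.
have e3 : (s * y / 2) ^+ 2 * G2 = (nu + 1) * G1 - G0 by [].
transitivity (P * s ^+ 2 * ((s * y / 2) ^+ 2 * G2) + ((nu ^+ 2 - 1 / 4) / y ^+ 2) * P * G0 - P * s ^+ 2 * (nu + 1) * G1).
  by field; rewrite gt_eqF.
by rewrite e3; ring.
Qed.

End bessel_wave.

Section measurable_bounded.
Context {R : realType}.
Variables (D : set (R * R)).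
Implicit Types (f g : R * R -> R).

Definition mb f := measurable_fun D f /\ exists C : R, forall z, D z -> `|f z| <= C.

Lemma mbC (c : R) : mb (fun=> c).
Proof. by split; [exact: measurable_cst | exists `|c|]. Qed.
Lemma mbD f g : mb f -> mb g -> mb (fun z => f z + g z).
Proof.
move=> [mf [A HA]] [mg [B HB]]; split; first exact: measurable_funD.
by exists (A + B) => z Dz; rewrite (le_trans (ler_normD _ _)) // lerD ?HA ?HB.
Qed.
Lemma mbN f : mb f -> mb (fun z => - f z).
Proof.
move=> [mf [A HA]]; split; first exact: measurableT_comp.
by exists A => z Dz; rewrite normrN HA.
Qed.
Lemma mbM f g : mb f -> mb g -> mb (fun z => f z * g z).
Proof.
move=> [mf [A HA]] [mg [B HB]]; split; first exact: measurable_funM.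
by exists (A * B) => z Dz; rewrite normrM ler_pM ?HA ?HB.
Qed.
Lemma mbX f n : mb f -> mb (fun z => f z ^+ n).
Proof.
move=> mf; elim: n => [|n IH]; first exact: mbC.
rewrite (_ : (fun z => _) = (fun z => f z * f z ^+ n)); last by apply/funext => z; rewrite exprS.
exact: mbM.
Qed.
Lemma mb_comp (h : R -> R) a b f : (forall y, a <= y <= b -> {for y, continuous h}) ->
  (forall z, D z -> a <= f z <= b) -> mb f -> mb (fun z => h (f z)).
Proof.
move=> ch fab [mf _].
have wh : {within `[a, b], continuous h}.
  by apply: continuous_in_subspaceT => y; rewrite inE /= in_itv /=; exact: ch.
split.
  apply: (@measurable_comp _ _ _ _ _ _ `[a, b]%classic h D f) => //.
    by move=> _ [z Dz <-] /=; rewrite in_itv /= fab.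
  exact: subspace_continuous_measurable_fun.
have [ab|ba] := leP a b; last first.
  by exists 0 => z /fab /andP[h1 h2]; have := le_trans h1 h2; rewrite leNgt ba.
have [|c _ Hc] := @EVT_max R (fun y => `|h y|) a b ab.
  by apply: continuous_in_subspaceT => y; rewrite inE /= in_itv /= => /ch; exact: cabs.
by exists `|h c| => z /fab fz; apply: Hc; rewrite in_itv.
Qed.
End measurable_bounded.

Ltac mbt := cbv beta;
  first [ match goal with H : ?P |- ?P => exact H end |
  lazymatch goal with |- mb _ (fun _ => ?c) => eapply mbC end |
  lazymatch goal with
  | |- mb _ (fun z => @GRing.add _ (@?f z) (@?g z)) => eapply (mbD _ f g); mbt
  | |- mb _ (fun z => @GRing.opp _ (@?f z)) => eapply (mbN _ f); mbt
  | |- mb _ (fun z => @GRing.mul _ (@?f z) (@?g z)) => eapply (mbM _ f g); mbt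
  | |- mb _ (fun z => @GRing.exp _ (@?f z) ?n) => eapply (mbX _ f n); mbt
  | |- _ => idtac
  end].

Ltac contq := cbv beta;
  first [ match goal with H : {for _, continuous ?f} |- {for _, continuous ?g} => constr_eq f g; exact H end |
  lazymatch goal with |- {for _, continuous ?f} => is_cst_fun f; eapply cC end |
  lazymatch goal with
  | |- {for _, continuous (fun y => y)} => eapply cI
  | |- {for _, continuous (fun y => @GRing.add _ (@?f y) (@?g y))} => eapply (cD f g); contq
  | |- {for _, continuous (fun y => @GRing.opp _ (@?f y))} => eapply (cN f); contq
  | |- {for _, continuous (fun y => @GRing.mul _ (@?f y) (@?g y))} => eapply (cM f g); contq
  | |- {for _, continuous (fun y => @GRing.exp _ (@?f y) ?n)} => eapply (cX f n); contq
  | |- {for _, continuous (fun y => @GRing.inv _ (@?f y))} => eapply (cV f); [assumption | contq]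
  | |- {for _, continuous (fun y => cos (@?f y))} => eapply (ccos f); contq
  | |- {for _, continuous (fun y => sin (@?f y))} => eapply (csin f); contq
  end].

(** * Stokes' theorem on the characteristic triangle *)

Section riemann_form.
Context {R : realType}.
Variables (nu s x t0 : R).
Hypotheses (hnu : -1 < nu) (x0 : 0 < x) (t00 : 0 < t0) (t0x : t0 <= x * prad nu).
Local Notation mu := (@lebesgue_measure R).
Local Notation U := (wv nu s).
Local Notation dU := (dwv nu s).
Local Notation p j := (pser nu j).
Implicit Types (T r y t : R).

(** The argument of the Riemann function; [zet] is the same quantity along y = x + T r. *)
Definition zeta T y := (T ^+ 2 - (x - y) ^+ 2) / (4 * x * y).
Definition zet T r := T ^+ 2 * (1 - r ^+ 2) / (4 * x * (x + T * r)).

(** With [kform], the components of Riemann's closed form [hform] dr - [kform] dT for the solution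
    cos((t0 - T) s) U(y). Here T is the depth below the vertex (t0, x) and y = x + T r, so that the
    characteristic triangle becomes the rectangle [0, t0] x [-1, 1]. *)
Definition hform T r := T * (p 0 (zet T r) * (- s * sin ((t0 - T) * s) * U (x + T * r))
  + p 1 (zet T r) * (T / (2 * x * (x + T * r))) * (cos ((t0 - T) * s) * U (x + T * r))).
Definition kform T r := - r * p 0 (zet T r) * (- s * sin ((t0 - T) * s) * U (x + T * r))
  + p 0 (zet T r) * (cos ((t0 - T) * s) * dU (x + T * r))
  + p 1 (zet T r) * (zet T r / (x + T * r)) * (cos ((t0 - T) * s) * U (x + T * r)).

Let K0 := prad_gt0 nu.
Let K1 := prad_lt1 nu.

Lemma y_bounds T r : 0 <= T <= t0 -> -1 <= r <= 1 -> x / 2 <= x + T * r <= 2 * x.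
Proof.
move=> /andP[T0 Tt] /andP[r1 r2].
have h1 : T <= x / 2.
  rewrite (le_trans Tt) // (le_trans t0x) // ler_wpM2l ?(ltW x0) //; move: K1; lra.
have h2 : T * r <= T by rewrite ler_piMr.
have h3 : - T <= T * r by rewrite -subr_ge0 opprK -{2}[T]mulr1 -mulrDr mulr_ge0 //; lra.
move: x0; lra.
Qed.

Lemma zet_bounds T r : 0 <= T <= t0 -> -1 <= r <= 1 -> 0 <= zet T r <= prad nu / 2.
Proof.
move=> hT hr; have := y_bounds T r hT hr; case/andP: hT => T0 Tt; case/andP: hr => r1 r2.
move=> /andP[y1 y2]; have y0 : 0 < x + T * r by move: x0; lra.
have r20 : 0 <= 1 - r ^+ 2 by rewrite subr_ge0 -real_normK ?num_real // exprn_ile1 // ler_norml r1.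
have d0 : 0 < 4 * x * (x + T * r) by rewrite !mulr_gt0.
apply/andP; split; first by apply: divr_ge0; [exact: mulr_ge0 (sqr_ge0 _) r20 | exact: ltW].
rewrite /zet ler_pdivrMr //.
have T2 : T ^+ 2 <= (x * prad nu) ^+ 2 by rewrite lerXn2r ?nnegrE ?mulr_ge0 ?(ltW x0) ?(ltW K0) // (le_trans Tt).
have : T ^+ 2 * (1 - r ^+ 2) <= T ^+ 2 by rewrite ler_piMr ?sqr_ge0 // gerBl sqr_ge0.
have : prad nu / 2 * (4 * x * (x / 2)) <= prad nu / 2 * (4 * x * (x + T * r)).
  by rewrite !ler_pM2l ?divr_gt0 ?mulr_gt0.
have : (x * prad nu) ^+ 2 <= prad nu / 2 * (4 * x * (x / 2)).
  rewrite (_ : (x * prad nu) ^+ 2 = (x ^+ 2 * prad nu) * prad nu); last by ring.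
  rewrite (_ : prad nu / 2 * _ = (x ^+ 2 * prad nu) * 1); last by field.
  by rewrite ler_wpM2l ?mulr_ge0 ?sqr_ge0 ?(ltW K0) //; move: K1; lra.
lra.
Qed.

Lemma zet_lt T r : 0 <= T <= t0 -> -1 <= r <= 1 -> `|zet T r| < prad nu.
Proof.
by move=> hT hr; have /andP[h1 h2] := zet_bounds T r hT hr; rewrite ger0_norm //; move: K0; lra.
Qed.

(** The common value of the T-derivative of [hform] and of minus the r-derivative of [kform],
    written out so that its continuity and measurability follow from its syntax. *)
Definition gform T r := let y := x + T * r in let z := zet T r in
  let S := sin ((t0 - T) * s) in let C := cos ((t0 - T) * s) in
  let zT := (2 * T * (1 - r ^+ 2) * (4 * x * y) - T ^+ 2 * (1 - r ^+ 2) * (4 * x * r)) / (4 * x * y) ^+ 2 in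
  (p 0 z * (- s * S * U y) + p 1 z * (T / (2 * x * y)) * (C * U y))
  + T * (p 1 z * zT * (- s * S * U y) + p 0 z * (s * s * C * U y - s * S * dU y * r)
    + p 2 z * zT * (T / (2 * x * y)) * (C * U y)
    + p 1 z * ((2 * x * y - T * (2 * x * r)) / (2 * x * y) ^+ 2) * (C * U y)
    + p 1 z * (T / (2 * x * y)) * (s * S * U y + C * dU y * r)).

Section at_point.
Variables (T r : R).
Hypotheses (hT : 0 <= T <= t0) (hr : -1 <= r <= 1).
Let y0 : 0 < x + T * r.
Proof. by have /andP[h _] := y_bounds T r hT hr; move: x0; lra. Qed.

Let DU (f : R -> R) z df : f z = x + T * r -> is_derive z 1 f df ->
  is_derive z 1 (fun z => U (f z)) (dU (x + T * r) * df).
Proof.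
by move=> fz Hf; eapply (dcomp U f); [exact: Hf | rewrite fz; exact: wv_derive].
Qed.
Let DdU (f : R -> R) z df : f z = x + T * r -> is_derive z 1 f df ->
  is_derive z 1 (fun z => dU (f z)) (((nu ^+ 2 - 1 / 4) / (x + T * r) ^+ 2 - s ^+ 2) * U (x + T * r) * df).
Proof.
by move=> fz Hf; eapply (dcomp dU f); [exact: Hf | rewrite fz; exact: dwv_derive].
Qed.
Let Dp j (f : R -> R) z df : (j <= 3)%N -> f z = zet T r -> is_derive z 1 f df ->
  is_derive z 1 (fun z => p j (f z)) (p j.+1 (zet T r) * df).
Proof.
by move=> j3 fz Hf; eapply (dcomp (p j) f); [exact: Hf | rewrite fz; apply: pser_derive => //; exact: zet_lt].
Qed.

Lemma hform_derive : is_derive T 1 (hform ^~ r) (gform T r).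
Proof.
have nz : x + T * r != 0 by rewrite gt_eqF.
have xn : x != 0 by rewrite gt_eqF.
have n4 : 4 * x * (x + T * r) != 0 by rewrite !mulf_neq0.
have n2 : 2 * x * (x + T * r) != 0 by rewrite !mulf_neq0.
have Dy : is_derive T 1 (fun T => x + T * r) r by derval; ring.
have Dz : is_derive T 1 (zet ^~ r) ((2 * T * (1 - r ^+ 2) * (4 * x * (x + T * r)) - T ^+ 2 * (1 - r ^+ 2) * (4 * x * r)) / (4 * x * (x + T * r)) ^+ 2).
  by rewrite /zet; derval => //; rewrite /= ?expr1; field; rewrite nz xn.
have D0 := Dp 0 (zet ^~ r) T _ isT erefl Dz; have D1 := Dp 1 (zet ^~ r) T _ isT erefl Dz.
have Du := DU (fun T => x + T * r) T r erefl Dy.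
rewrite /hform; derval => //; rewrite /gform /=.
move: (p 0 _) (p 1 _) (p 2 _) (U _) (dU _) (sin _) (cos _) => P0 P1 P2 u du S C.
by field; rewrite nz xn.
Qed.

Lemma kform_derive : is_derive r 1 (kform T) (- gform T r).
Proof.
have nz : x + T * r != 0 by rewrite gt_eqF.
have xn : x != 0 by rewrite gt_eqF.
have n4 : 4 * x * (x + T * r) != 0 by rewrite !mulf_neq0.
have Dy : is_derive r 1 (fun r => x + T * r) T by derval; ring.
pose zr := (- 2 * T ^+ 2 * r * (4 * x * (x + T * r)) - T ^+ 2 * (1 - r ^+ 2) * (4 * x * T)) / (4 * x * (x + T * r)) ^+ 2.
have Dz : is_derive r 1 (zet T) zr.
  by rewrite /zet /zr; derval => //; rewrite /= ?expr1; field; rewrite nz xn.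
have D0 := Dp 0 (zet T) r _ isT erefl Dz; have D1 := Dp 1 (zet T) r _ isT erefl Dz.
have Du := DU (fun r => x + T * r) r T erefl Dy; have Ddu := DdU (fun r => x + T * r) r T erefl Dy.
rewrite /kform; derval => //; rewrite /gform /=.
have ode := pser_ode nu (zet T r) (zet_lt T r hT hr).
move: ode; move: (p 0 _) (p 1 _) (p 2 _) (U _) (dU _) (sin _) (cos _) => P0 P1 P2 u du S C ode.
pose z := zet T r; rewrite -/z in ode.
have zE : z = T ^+ 2 * (1 - r ^+ 2) / (4 * x * (x + T * r)) by [].
apply/eqP; rewrite -subr_eq0; apply/eqP.
(* The defect of closedness is a multiple of the hypergeometric equation: this is where the Riemann
   function enters. *)
transitivity ((z * (1 - z) * P2 + (1 - 2 * z) * P1 - (1 / 4 - nu ^+ 2) * P0) * (T / (x + T * r) ^+ 2 * C * u)).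
  by rewrite -/z zE /zr; field; rewrite nz xn.
by rewrite ode mul0r.
Qed.

End at_point.

Let gc j z : (j <= 3)%N -> 0 <= z <= prad nu / 2 -> {for z, continuous (p j)}.
Proof. by move=> j3 z0; apply: pser_cont => //; rewrite ger0_norm; move: K0; lra. Qed.
Let Uc y : x / 2 <= y <= 2 * x -> {for y, continuous U}.
Proof. by move=> hy; apply: (is_derive_continuous U y _ (wv_derive nu s hnu y _)); move: x0; lra. Qed.
Let dUc y : x / 2 <= y <= 2 * x -> {for y, continuous dU}.
Proof. by move=> hy; apply: (is_derive_continuous dU y _ (dwv_derive nu s hnu y _)); move: x0; lra. Qed.

Lemma gform_cont1 T r : 0 <= T <= t0 -> -1 <= r <= 1 -> {for T, continuous (gform ^~ r)}.
Proof.
move=> hT hr; have yb := y_bounds T r hT hr; have zb := zet_bounds T r hT hr.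
have y0 : x + T * r != 0 by rewrite gt_eqF //; move: x0; lra.
have xn : x != 0 by rewrite gt_eqF.
have n4 : 4 * x * (x + T * r) != 0 by rewrite !mulf_neq0.
have n2 : 2 * x * (x + T * r) != 0 by rewrite !mulf_neq0.
have n42 : (4 * x * (x + T * r)) ^+ 2 != 0 by rewrite expf_neq0.
have n22 : (2 * x * (x + T * r)) ^+ 2 != 0 by rewrite expf_neq0.
have cz : {for T, continuous (zet ^~ r)} by rewrite /zet; cont.
have cp j : (j <= 3)%N -> {for T, continuous (fun T => p j (zet T r))}.
  by move=> j3; apply: (ccomp (p j) (zet ^~ r)) => //; exact: gc.
have c0 := cp 0%N isT; have c1 := cp 1%N isT; have c2 := cp 2%N isT.
have cU : {for T, continuous (fun T => U (x + T * r))}.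
  by apply: (ccomp U (fun T => x + T * r)); [cont | exact: Uc].
have cdU : {for T, continuous (fun T => dU (x + T * r))}.
  by apply: (ccomp dU (fun T => x + T * r)); [cont | exact: dUc].
by rewrite /gform /=; contq.
Qed.

Lemma gform_cont2 T r : 0 <= T <= t0 -> -1 <= r <= 1 -> {for r, continuous (gform T)}.
Proof.
move=> hT hr; have yb := y_bounds T r hT hr; have zb := zet_bounds T r hT hr.
have y0 : x + T * r != 0 by rewrite gt_eqF //; move: x0; lra.
have xn : x != 0 by rewrite gt_eqF.
have n4 : 4 * x * (x + T * r) != 0 by rewrite !mulf_neq0.
have n2 : 2 * x * (x + T * r) != 0 by rewrite !mulf_neq0.
have n42 : (4 * x * (x + T * r)) ^+ 2 != 0 by rewrite expf_neq0.
have n22 : (2 * x * (x + T * r)) ^+ 2 != 0 by rewrite expf_neq0.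
have cz : {for r, continuous (zet T)} by rewrite /zet; cont.
have cp j : (j <= 3)%N -> {for r, continuous (fun r => p j (zet T r))}.
  by move=> j3; apply: (ccomp (p j) (zet T)) => //; exact: gc.
have c0 := cp 0%N isT; have c1 := cp 1%N isT; have c2 := cp 2%N isT.
have cU : {for r, continuous (fun r => U (x + T * r))}.
  by apply: (ccomp U (fun r => x + T * r)); [cont | exact: Uc].
have cdU : {for r, continuous (fun r => dU (x + T * r))}.
  by apply: (ccomp dU (fun r => x + T * r)); [cont | exact: dUc].
by rewrite /gform /=; contq.
Qed.

Local Notation I1 := (`[0, t0]%classic : set R).
Local Notation I2 := (`[-1, 1]%classic : set R).

Lemma gform_mb : mb (I1 `*` I2) (fun z => gform z.1 z.2).
Proof.
have hD z : (I1 `*` I2) z -> (0 <= z.1 <= t0) /\ (-1 <= z.2 <= 1) by case=> /=; rewrite !in_itv.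
have m1 : mb (I1 `*` I2) (fun z : R * R => z.1).
  split; first exact: measurable_funTS measurable_fst.
  by exists t0 => z /hD[/andP[h1 h2] _]; rewrite ger0_norm.
have m2 : mb (I1 `*` I2) (fun z : R * R => z.2).
  split; first exact: measurable_funTS measurable_snd.
  by exists 1 => z /hD[_ h]; rewrite ler_norml.
have my : mb (I1 `*` I2) (fun z : R * R => x + z.1 * z.2) by mbt.
have hy z : (I1 `*` I2) z -> x / 2 <= x + z.1 * z.2 <= 2 * x by move=> /hD[h1 h2]; exact: y_bounds.
have hz z : (I1 `*` I2) z -> 0 <= zet z.1 z.2 <= prad nu / 2 by move=> /hD[h1 h2]; exact: zet_bounds.
have mi (c : R) (n : nat) : 0 < c -> mb (I1 `*` I2) (fun z : R * R => ((c * x * (x + z.1 * z.2)) ^+ n)^-1).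
  move=> c0; eapply (mb_comp _ (fun y => ((c * x * y) ^+ n)^-1) (x / 2) (2 * x) (fun z => x + z.1 * z.2)); [|exact: hy|exact: my].
  move=> y hy'; have yn : c * x * y != 0 by rewrite !mulf_neq0 ?gt_eqF //; move: x0; lra.
  by apply: (cV (fun y => (c * x * y) ^+ n)); [rewrite expf_neq0 | cont].
have i4 := mi 4 1%N (ltr0Sn R _); have i2 := mi 2 1%N (ltr0Sn R _); have i42 := mi 4 2%N (ltr0Sn R _); have i22 := mi 2 2%N (ltr0Sn R _).
have mz : mb (I1 `*` I2) (fun z => zet z.1 z.2) by rewrite /zet; mbt.
have mp j : (j <= 3)%N -> mb (I1 `*` I2) (fun z => p j (zet z.1 z.2)).
  by move=> j3; eapply (mb_comp _ (p j) 0 (prad nu / 2) (fun z => zet z.1 z.2)); [|exact: hz|exact: mz] => y hy'; exact: gc.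
have c0 := mp 0%N isT; have c1 := mp 1%N isT; have c2 := mp 2%N isT.
have cU : mb (I1 `*` I2) (fun z => U (x + z.1 * z.2)).
  eapply (mb_comp _ U (x / 2) (2 * x) (fun z => x + z.1 * z.2)); [exact: Uc|exact: hy|exact: my].
have cdU : mb (I1 `*` I2) (fun z => dU (x + z.1 * z.2)).
  eapply (mb_comp _ dU (x / 2) (2 * x) (fun z => x + z.1 * z.2)); [exact: dUc|exact: hy|exact: my].
have cS : mb (I1 `*` I2) (fun z => sin ((t0 - z.1) * s)).
  eapply (mb_comp _ (fun y => sin ((t0 - y) * s)) 0 t0 (fun z => z.1)); [|by move=> z /hD[]|exact: m1].
  by move=> y _; cont.
have cC : mb (I1 `*` I2) (fun z => cos ((t0 - z.1) * s)).
  eapply (mb_comp _ (fun y => cos ((t0 - y) * s)) 0 t0 (fun z => z.1)); [|by move=> z /hD[]|exact: m1].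
  by move=> y _; cont.
by rewrite /gform /=; mbt.
Qed.

(** The t-derivative of the Riemann function at [zeta] t y: the smooth kernel by which the potential
    perturbs d'Alembert's formula. *)
Definition Vt t y := p 1 (zeta t y) * (t / (2 * x * y)).

(** The double integral of [gform] in both orders: integrating in T first leaves the base of the
    triangle, where sin((t0 - T) s) = 0; integrating in r first leaves the two characteristic
    sides. *)
Lemma riemann_identity_r : \int[mu]_(r in I2) (t0 * (Vt t0 (x + t0 * r) * U (x + t0 * r))) =
  2 * cos (t0 * s) * U x - U (x + t0) - U (x - t0).
Proof.
have [mg [M HM]] := gform_mb.
have F := Rfubini I1 I2 gform (fun=> M) (fun=> 1).
have {F} : \int[mu]_(T in I1) \int[mu]_(r in I2) gform T r = \int[mu]_(r in I2) \int[mu]_(T in I1) gform T r.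
  apply: F => //.
  - by apply: continuous_integ => y; exact: cC.
  - by apply: continuous_integ => y; exact: cC.
  - by move=> T r T1 r1; rewrite mulr1; exact: (HM (T, r)).
have hin1 T : I1 T -> 0 <= T <= t0 by rewrite /= in_itv.
have hin2 r : I2 r -> -1 <= r <= 1 by rewrite /= in_itv.
have -> : \int[mu]_(r in I2) \int[mu]_(T in I1) gform T r = \int[mu]_(r in I2) (t0 * (Vt t0 (x + t0 * r) * U (x + t0 * r))).
  apply: eq_Rintegral => r /set_mem/hin2 hr.
  transitivity (hform t0 r - hform 0 r).
    apply: (Rintegral_FTC (gform ^~ r) (hform ^~ r) 0 t0 t00) => T hT.
      exact: hform_derive.
    exact: gform_cont1.
  rewrite /hform subrr !mul0r sin0 cos0 mulr0 mul0r mulr0 add0r subr0 mul1r /Vt.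
  have y0 : x + t0 * r != 0.
    have tt : 0 <= t0 <= t0 by rewrite lexx (ltW t00).
    by rewrite gt_eqF //; have := y_bounds t0 r tt hr; move: x0; lra.
  suff -> : zeta t0 (x + t0 * r) = zet t0 r by [].
  by rewrite /zeta /zet; field; rewrite y0 gt_eqF.
move=> <-.
(* On the characteristics r = 1 and r = -1 the argument [zet] is 0 and the Riemann function equals
   1. *)
have z0 T c : c ^+ 2 = 1 -> zet T c = 0 by move=> c1; rewrite /zet c1 subrr mulr0 mul0r.
transitivity (\int[mu]_(T in I1) (- (kform T 1 - kform T (-1)))).
  apply: eq_Rintegral => T /set_mem/hin1 hT.
  have lt11 : -1 < (1 : R) by lra.
  transitivity (- kform T 1 - - kform T (-1)); last by ring.
  apply: (Rintegral_FTC (gform T) (fun r => - kform T r) (-1) 1 lt11).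
  - by move=> r hr; rewrite -[gform T r]opprK; apply: dN; exact: kform_derive.
  - by move=> r hr; exact: gform_cont2.
(* Along both characteristic sides the integrand is a total derivative; its end values are
   d'Alembert's terms. *)
pose W T := - (cos ((t0 - T) * s) * U (x + T)) - cos ((t0 - T) * s) * U (x - T).
have hp T : 0 <= T <= t0 -> 0 < x + T /\ 0 < x - T.
  move=> hT; have h1 : -1 <= (-1 : R) <= 1 by rewrite lexx; lra.
  by have := y_bounds T (-1) hT h1; move: x0; lra.
have E T : - (kform T 1 - kform T (-1)) = - (s * sin ((t0 - T) * s) * U (x + T) + cos ((t0 - T) * s) * dU (x + T)) + (- (s * sin ((t0 - T) * s) * U (x - T)) + cos ((t0 - T) * s) * dU (x - T)).
  rewrite /kform !z0 ?expr1n ?sqrrN ?expr1n // pser00 mulr1 mulrN1; ring.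
rewrite (_ : (fun T => - (kform T 1 - kform T (-1))) = fun T => - (s * sin ((t0 - T) * s) * U (x + T) + cos ((t0 - T) * s) * dU (x + T)) + (- (s * sin ((t0 - T) * s) * U (x - T)) + cos ((t0 - T) * s) * dU (x - T))); last exact/funext.
transitivity (W t0 - W 0); last first.
  by rewrite /W subrr subr0 mul0r cos0 addr0 subr0; ring.
apply: (Rintegral_FTC (fun T => - (s * sin ((t0 - T) * s) * U (x + T) + cos ((t0 - T) * s) * dU (x + T)) + (- (s * sin ((t0 - T) * s) * U (x - T)) + cos ((t0 - T) * s) * dU (x - T))) W 0 t0 t00).
- move=> T /hp[p1 p2]; have D1 := wv_derive nu s hnu _ p1; have D2 := wv_derive nu s hnu _ p2.
  have D1' : is_derive T 1 (fun T => U (x + T)) (dU (x + T)).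
    by eapply is_derive_val; [eapply (dcomp U (fun T => x + T)); [der | exact: D1] | ring].
  have D2' : is_derive T 1 (fun T => U (x - T)) (- dU (x - T)).
    by eapply is_derive_val; [eapply (dcomp U (fun T => x - T)); [der | exact: D2] | ring].
  by rewrite /W; derval; ring.
- move=> T /hp[p1 p2]; have D1 := wv_derive nu s hnu _ p1; have D2 := wv_derive nu s hnu _ p2.
  have D3 := dwv_derive nu s hnu _ p1; have D4 := dwv_derive nu s hnu _ p2.
  have k1 : {for T, continuous (fun T => U (x + T))} by apply: (ccomp U (fun T => x + T)); [cont | exact: is_derive_continuous D1].
  have k2 : {for T, continuous (fun T => U (x - T))} by apply: (ccomp U (fun T => x - T)); [cont | exact: is_derive_continuous D2].
  have k3 : {for T, continuous (fun T => dU (x + T))} by apply: (ccomp dU (fun T => x + T)); [cont | exact: is_derive_continuous D3].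
  have k4 : {for T, continuous (fun T => dU (x - T))} by apply: (ccomp dU (fun T => x - T)); [cont | exact: is_derive_continuous D4].
  by contq.
Qed.

End riemann_form.

Section clipping.
Context {R : realType}.
Local Notation mu := (@lebesgue_measure R).
Implicit Types (f : R -> R) (a b u v x y : R).

(** Projection to [a, b]. Composition with it makes a function continuous on the whole line without
    changing it on [a, b], so that substitution rules stated for globally continuous functions
    apply. *)
Definition clip a b y : R := a + Num.max ((b - Num.max (b - y) 0) - a) 0.

Lemma clip_cont a b y : {for y, continuous (clip a b)}.
Proof.
rewrite /clip; apply: cD; first exact: cC.
apply: (ccomp (fun t => Num.max t 0) (fun y => b - Num.max (b - y) 0 - a)); last exact: max0_cont.
apply: cD; last exact: cC; apply: cD; first exact: cC; apply: cN.
by apply: (ccomp (fun t => Num.max t 0) (fun y => b - y)); [cont | exact: max0_cont].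
Qed.

Lemma clip_in a b y : a <= b -> a <= clip a b y <= b.
Proof.
move=> ab; rewrite /clip; have [h1|h1] := leP (b - y) 0.
  by rewrite subr0 max_l ?subr_ge0 // [a + _]addrC subrK ab lexx.
by have [h2|h2] := leP (b - (b - y) - a) 0; lra.
Qed.

Lemma clip_id a b y : a <= y <= b -> clip a b y = y.
Proof.
move=> /andP[ay yb]; rewrite /clip.
have -> : Num.max (b - y) 0 = b - y by rewrite max_l // subr_ge0.
rewrite (_ : b - (b - y) - a = y - a); last by ring.
by rewrite max_l ?subr_ge0 //; ring.
Qed.

Lemma clip_comp_cont f a b y : a <= b -> (forall x, a <= x <= b -> {for x, continuous f}) ->
  {for y, continuous (fun y => f (clip a b y))}.
Proof.
move=> ab cf; apply: (ccomp f (clip a b)); first exact: clip_cont.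
by apply: cf; exact: clip_in.
Qed.

Lemma Rintegral_affine_in f a b u v : 0 < a -> u < v ->
  (forall x, a * u + b <= x <= a * v + b -> {for x, continuous f}) ->
  \int[mu]_(x in `]a * u + b, a * v + b[) f x = a * \int[mu]_(x in `]u, v[) f (a * x + b).
Proof.
move=> a0 uv cf; have uv' : a * u + b <= a * v + b by rewrite lerD2r ler_pM2l // ltW.
pose g x := f (clip (a * u + b) (a * v + b) x).
have := Rintegral_affine g a b u v a0 uv (fun x => clip_comp_cont f _ _ x uv' cf).
have -> : \int[mu]_(x in `]a * u + b, a * v + b[) g x = \int[mu]_(x in `]a * u + b, a * v + b[) f x.
  apply: eq_Rintegral => x /set_mem; rewrite /= in_itv /= => /andP[h1 h2].
  by rewrite /g clip_id // !ltW.
move=> ->; congr (_ * _); apply: eq_Rintegral => x /set_mem; rewrite /= in_itv /= => /andP[h1 h2].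
by rewrite /g clip_id // !lerD2r !ler_pM2l // !ltW.
Qed.

Lemma continuous_in_integ f u v : u <= v -> (forall x, u <= x <= v -> {for x, continuous f}) -> integ `[u, v] f.
Proof.
move=> uv cf; apply: continuous_compact_integrable; first exact: segment_compact.
by apply: continuous_in_subspaceT => y; rewrite inE /= in_itv /=; exact: cf.
Qed.

End clipping.

Lemma itv_ball {R : realType} (x t y : R) : (y \in `]x - t, x + t[) = (`|y - x| < t).
Proof. by rewrite in_itv /= ltr_norml; congr andb; apply/idP/idP => ?; lra. Qed.

Lemma half_in {R : realType} (e : R) : 0 < e -> 0 < e / 2 < e.
Proof. by move=> e0; rewrite divr_gt0 //= ltr_pdivrMr // ltr_pMr // ltr1n. Qed.

Lemma clip_ball {R : realType} (x e t : R) : 0 < t < e ->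
  clip (x - e) (x + e) (x + t) = x + t /\ clip (x - e) (x + e) (x - t) = x - t.
Proof. by move=> te; split; apply: clip_id; lra. Qed.

(** * Local multipliers as integral operators with a kernel independent of the frequency *)

Section riemann_kernel.
Context {R : realType}.
Variables (nu x eps : R).
Hypotheses (hnu : -1 < nu) (x0 : 0 < x) (e0 : 0 < eps) (epx : eps <= x * prad nu).
Local Notation mu := (@lebesgue_measure R).
Local Notation U := (wv nu).
Local Notation Vt := (Vt nu x).
Implicit Types (t y s : R).

Let K0 := prad_gt0 nu.
Let K1 := prad_lt1 nu.
Let e2 : eps <= x / 2.
Proof. by rewrite (le_trans epx) // ler_wpM2l ?(ltW x0) //; move: K1; lra. Qed.

Let yin t y : 0 <= t <= eps -> x - t <= y <= x + t -> x / 2 <= y <= 2 * x.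
Proof. by move: e2 x0; lra. Qed.

Lemma zeta_bounds t y : 0 <= t <= eps -> x - t <= y <= x + t -> 0 <= zeta x t y <= prad nu / 2.
Proof.
move=> ht hy; have [t1|t1] := leP t 0.
  have tE : t = 0 by lra.
  have yE : y = x by lra.
  by rewrite tE yE /zeta subrr !expr0n /= subr0 mul0r lexx divr_ge0 // ltW.
have tx : t <= x * prad nu by rewrite (le_trans _ epx) //; case/andP: ht.
have hT : 0 <= t <= t by rewrite lexx ltW.
have hr : -1 <= (y - x) / t <= 1 by rewrite ler_pdivlMr // ler_pdivrMr //; lra.
have := zet_bounds nu x t x0 tx t ((y - x) / t) hT hr.
have y0 : y != 0 by rewrite gt_eqF //; have := yin t y ht hy; move: x0; lra.
suff -> : zet x t ((y - x) / t) = zeta x t y by [].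
rewrite /zet /zeta (_ : x + t * ((y - x) / t) = y); last by field; rewrite gt_eqF.
by field; rewrite ?y0 ?(gt_eqF x0) ?(gt_eqF t1).
Qed.

Lemma VtU_cont s t y : 0 <= t <= eps -> x - t <= y <= x + t -> {for y, continuous (fun y => Vt t y * U s y)}.
Proof.
move=> ht hy'.
have yb := yin t y ht hy'; have zb := zeta_bounds t y ht hy'.
have yp : 0 < y by move: x0; lra.
have xn : x != 0 by rewrite gt_eqF.
have yn : y != 0 by rewrite gt_eqF.
have n4 : 4 * x * y != 0 by rewrite !mulf_neq0.
have n2 : 2 * x * y != 0 by rewrite !mulf_neq0.
have cz : {for y, continuous (zeta x t)} by rewrite /zeta; contq.
have cp : {for y, continuous (fun y => pser nu 1 (zeta x t y))}.
  by apply: (ccomp (pser nu 1) (zeta x t)) => //; apply: pser_cont => //; rewrite ger0_norm; move: K0; lra.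
have cU : {for y, continuous (U s)} by exact: is_derive_continuous (wv_derive nu s hnu y yp).
apply: (cM (fun y => pser nu 1 (zeta x t y) * (t / (2 * x * y))) (U s)) => //.
by contq.
Qed.

Lemma riemann_identity s t : 0 < t <= eps ->
  2 * cos (t * s) * U s x = U s (x + t) + U s (x - t) + \int[mu]_(y in `]x - t, x + t[) (Vt t y * U s y).
Proof.
move=> /andP[t0 te]; have tx : t <= x * prad nu by exact: le_trans epx.
have := riemann_identity_r nu s x t hnu x0 t0 tx.
have cV y : t * -1 + x <= y <= t * 1 + x -> {for y, continuous (fun y => Vt t y * U s y)}.
  by move=> hy; apply: VtU_cont; [rewrite ltW | lra].
have lt11 : -1 < (1 : R) by lra.
have := Rintegral_affine_in (fun y => Vt t y * U s y) t x (-1) 1 t0 lt11 cV.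
rewrite mulrN1 mulr1 (addrC (- t)) (addrC t) => -> H.
have -> : t * \int[mu]_(r in `]-1, 1[) (Vt t (t * r + x) * U s (t * r + x)) =
   \int[mu]_(r in `[-1, 1]) (t * (Vt t (x + t * r) * U s (x + t * r))).
  have ci : integ (`[-1, 1]%classic : set R) (fun r => Vt t (x + t * r) * U s (x + t * r)).
    apply: continuous_in_integ; first lra.
    move=> r hr; apply: (ccomp (fun y => Vt t y * U s y) (fun r => x + t * r)); first by cont.
    have h1 : t * -1 <= t * r by rewrite ler_pM2l //; lra.
    have h2 : t * r <= t * 1 by rewrite ler_pM2l //; lra.
    by apply: cV; lra.
  rewrite RintegralZl // -Rintegral_oo_cc //; congr (_ * _); apply: eq_Rintegral => r _.
  by rewrite ![_ + x]addrC.
by rewrite H; ring.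
Qed.


Variable kap : R -> R.
Hypothesis ckap : forall t, {for t, continuous kap}.

(** [Vt] is controlled only inside the cone |y - x| <= t, where [zeta] stays within the radius of
    the series; clipping extends it to a bounded function on the rectangle and changes nothing in
    the cone ([Vc_eq]). *)
Definition Vc t y := pser nu 1 (clip 0 (prad nu / 2) (zeta x t y)) * (t / (2 * x * y)).
(** Indicator of |y - x| < t ([coneE]), written as a composition so that joint measurability is
    immediate. *)
Definition cone t y : R := \1_(`]0%R, +oo[%classic : set R) (t - `|y - x|).
(** The two boundary terms of [riemann_identity] contribute kap(|y - x|), its cone integral the
    perturbation; the division by 2 undoes the factor of 2 cos(t s). *)
Definition kern y := (kap `|y - x| + \int[mu]_(t in `]0, eps[) (cone t y * kap t * Vc t y)) / 2.

Local Notation E1 := (`]0, eps[%classic : set R).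
Local Notation E2 := (`]x - eps, x + eps[%classic : set R).

Lemma coneE t y : cone t y = (`|y - x| < t)%R%:R.
Proof.
rewrite /cone indicE; congr (nat_of_bool _)%:R.
apply/idP/idP; first by move=> /set_mem; rewrite /= in_itv /= andbT subr_gt0.
by move=> h; rewrite mem_set //= in_itv /= andbT subr_gt0.
Qed.

Let hD z : (E1 `*` E2) z -> (0 <= z.1 <= eps) /\ (x / 2 <= z.2 <= 2 * x).
Proof. by case=> /=; rewrite !in_itv /=; move: e2 x0; lra. Qed.
Let pD2 c y : 0 < c -> x / 2 <= y <= 2 * x -> c * x * y != 0.
Proof. by move=> c0 hy; rewrite !mulf_neq0 ?gt_eqF //; move: x0; lra. Qed.

Let m1 : mb (E1 `*` E2) (fun z : R * R => z.1).
Proof.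
split; first exact: measurable_funTS measurable_fst.
by exists eps => z /hD[/andP[h1 h2] _]; rewrite ger0_norm.
Qed.
Let m2 : mb (E1 `*` E2) (fun z : R * R => z.2).
Proof.
split; first exact: measurable_funTS measurable_snd.
by exists (2 * x) => z /hD[_ /andP[h1 h2]]; rewrite ger0_norm //; move: x0; lra.
Qed.

Lemma Vc_mb : mb (E1 `*` E2) (fun z => Vc z.1 z.2).
Proof.
have mi (c : R) : 0 < c -> mb (E1 `*` E2) (fun z : R * R => (c * x * z.2)^-1).
  move=> c0; eapply (mb_comp _ (fun y => (c * x * y)^-1) (x / 2) (2 * x) (fun z => z.2)); [|by move=> z /hD[]|exact: m2].
  by move=> y hy'; have yn := pD2 c y c0 hy'; contq.
have i4 := mi 4 (ltr0Sn R _); have i2 := mi 2 (ltr0Sn R _).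
have mz : mb (E1 `*` E2) (fun z => zeta x z.1 z.2) by rewrite /zeta; mbt.
have mp : mb (E1 `*` E2) (fun z => pser nu 1 (clip 0 (prad nu / 2) (zeta x z.1 z.2))).
  have [mzz [M HM]] := mz.
  eapply (mb_comp _ (fun y => pser nu 1 (clip 0 (prad nu / 2) y)) (- M) M (fun z => zeta x z.1 z.2)); last exact: mz.
    move=> y _; apply: (clip_comp_cont (pser nu 1)); first by rewrite divr_ge0 // ltW.
    by move=> z hz; apply: pser_cont => //; rewrite ger0_norm; move: K0; lra.
  by move=> z /HM; rewrite ler_norml.
by rewrite /Vc; mbt.
Qed.

Lemma cone_mb : mb (E1 `*` E2) (fun z => cone z.1 z.2).
Proof.
split; last by exists 1 => z _; rewrite coneE; case: (_ < _); rewrite ?normr1 ?normr0.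
apply: measurable_funTS; apply: (@measurableT_comp _ _ _ _ _ _ (\1_(`]0%R, +oo[%classic : set R) : R -> R) _ (fun z : R * R => z.1 - `|z.2 - x|)).
  exact: measurable_indic.
apply: measurable_funB; first exact: measurable_fst.
by apply: (meas_snd (fun y => `|y - x|)) => y; cont.
Qed.

Let kap_mb : mb (E1 `*` E2) (fun z => kap z.1).
Proof. by eapply (mb_comp _ kap 0 eps (fun z => z.1)); [move=> y _; exact: ckap | by move=> z /hD[] | exact: m1]. Qed.

Lemma Vc_eq t y : 0 <= t <= eps -> `|y - x| <= t -> Vc t y = Vt t y.
Proof.
by move=> ht; rewrite ler_norml => hy; rewrite /Vc clip_id //; apply: zeta_bounds => //; lra.
Qed.

Let integc u v (c : R) : integ `]u, v[ (fun _ : R => c).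
Proof. by apply: continuous_integ_oo => y; exact: cC. Qed.

Lemma kern_measurable : measurable_fun E2 kern.
Proof.
have H : mb (E1 `*` E2) (fun z => cone z.1 z.2 * kap z.1 * Vc z.1 z.2).
  by have h1 := cone_mb; have h2 := Vc_mb; have h3 := kap_mb; mbt.
have [mf [M HM]] := H.
have [_ mI] := Rfubini_both E1 E2 (fun t y => cone t y * kap t * Vc t y) (fun=> M) (fun=> 1) (measurable_itv _) (measurable_itv _) mf (integc _ _ _) (integc _ _ _) (fun t y h1 h2 => eq_ind_r (fun c => _ <= c) (HM (t, y) (conj h1 h2)) (mulr1 M)).
rewrite /kern; apply: measurable_funM; last exact: measurable_cst.
apply: measurable_funD => //; apply: measurable_funTS; apply: continuous_measurable_fun => y.
by apply: (ccomp kap (fun y => `|y - x|)); [cont | exact: ckap].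
Qed.

Let Ipart y := \int[mu]_(t in E1) (cone t y * kap t * Vc t y).

Let cVc y t : x / 2 <= y <= 2 * x -> {for t, continuous (Vc ^~ y)}.
Proof.
move=> hy; have n4 := pD2 4 y (ltr0Sn R _) hy; have n2 := pD2 2 y (ltr0Sn R _) hy.
have cz : {for t, continuous (zeta x ^~ y)} by rewrite /zeta; contq.
have cp : {for t, continuous (fun t => pser nu 1 (clip 0 (prad nu / 2) (zeta x t y)))}.
  apply: (ccomp (fun z => pser nu 1 (clip 0 (prad nu / 2) z)) (zeta x ^~ y)) => //.
  apply: (clip_comp_cont (pser nu 1)); first by rewrite divr_ge0 // ltW.
  by move=> z hz; apply: pser_cont => //; rewrite ger0_norm; move: K0; lra.
by apply: (cM (fun t => pser nu 1 (clip 0 (prad nu / 2) (zeta x t y))) (fun t => t / (2 * x * y))) => //; contq.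
Qed.

Let m_int y : x / 2 <= y <= 2 * x -> measurable_fun E1 (fun t => cone t y * kap t * Vc t y).
Proof.
move=> hy; apply: measurable_funM; last first.
  by apply: continuous_on_measurable; [exact: interval_open | move=> t _; exact: cVc].
apply: measurable_funM; last first.
  by apply: continuous_on_measurable; [exact: interval_open | move=> t _; exact: ckap].
apply: measurable_funTS; apply: (@measurableT_comp _ _ _ _ _ _ (\1_(`]0%R, +oo[%classic : set R) : R -> R) _ (fun t : R => t - `|y - x|)).
  exact: measurable_indic.
by apply: (measurable_funD (f := fun t : R => t) (g := fun=> - `|y - x|)).
Qed.

(** Only t > |y - x| contributes, so the decay of kap survives as a tail integral. *)
Lemma kern_bound CV (b : R -> R) y : 0 <= CV -> (forall t y, E1 t -> E2 y -> `|Vc t y| <= CV) -> (forall t, E1 t -> `|kap t| <= b t) -> integ E1 b ->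
  E2 y -> integ E1 (fun t => cone t y * kap t * Vc t y) /\
  `|Ipart y| <= CV * \int[mu]_(t in `] `|y - x|, eps[) b t.
Proof.
move=> CV0 HV Hb ib Ey.
have hy : x / 2 <= y <= 2 * x by move: Ey; rewrite /= in_itv /=; move: e2 x0; lra.
pose g t := CV * (cone t y * b t).
have sub : `] `|y - x|, eps[%classic `<=` E1.
  by move=> t /=; rewrite !in_itv /= => /andP[h ->]; rewrite (le_lt_trans _ h).
have gb t : E1 t -> `|cone t y * kap t * Vc t y| <= g t.
  move=> Et; rewrite /g [CV * _]mulrC [X in X <= _]normrM.
  apply: ler_pM; [exact: normr_ge0 | exact: normr_ge0 | | exact: (HV t y Et Ey)].
  by rewrite normrM coneE normr_nat ler_wpM2l // Hb.
have mb_ : measurable_fun E1 b by have /integrableP[/measurable_EFinP] := ib.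
have icb : integ E1 (fun t => cone t y * b t).
  apply: (integ_le _ _ b) => //.
    apply: measurable_funM => //; apply: measurable_funTS.
    apply: (@measurableT_comp _ _ _ _ _ _ (\1_(`]0%R, +oo[%classic : set R) : R -> R) _ (fun t : R => t - `|y - x|)).
      exact: measurable_indic.
    by apply: (measurable_funD (f := fun t : R => t) (g := fun=> - `|y - x|)).
  move=> t Et; have b0 : 0 <= b t by exact: le_trans (normr_ge0 _) (Hb t Et).
  by rewrite coneE; case: (_ < _); rewrite ?mul1r ?mul0r ?normr0 // ger0_norm.
have ig : integ E1 g by exact: (@integrableZl _ _ _ mu _ _ CV (EFin \o (fun t => cone t y * b t))).
split; first by apply: (integ_le _ _ g) => //; exact: m_int.
apply: (le_trans (norm_Rintegral_le E1 _ g (measurable_itv _) (m_int y hy) gb ig)).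
rewrite /g RintegralZl // ler_wpM2l // (Rintegral_supp E1 `] `|y - x|, eps[ _ (measurable_itv _) (measurable_itv _) sub).
  rewrite le_eqVlt; apply/orP; left; apply/eqP; apply: eq_Rintegral => t /set_mem; rewrite /= in_itv /= => /andP[h _].
  by rewrite coneE h mul1r.
move=> t; rewrite /= !in_itv /= => /andP[t0 te] /negP; rewrite te andbT -leNgt => h.
by rewrite coneE ltNge h mul0r.
Qed.

Lemma Vc_bound : exists2 CV : R, 0 <= CV & forall t y, E1 t -> E2 y -> `|Vc t y| <= CV.
Proof.
have [_ [M HM]] := Vc_mb; exists `|M| => // t y h1 h2.
by rewrite (le_trans (HM (t, y) (conj h1 h2))) // ler_norm.
Qed.

(** [riemann_identity] is multiplied by kap(t) and integrated over ]0, eps[. Since [kern] does not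
    involve s, one kernel serves all frequencies, including those that are not zeros of J_nu. *)
Lemma kernel_identity s : \int[mu]_(t in E1) (kap t * cos (t * s)) * U s x = \int[mu]_(y in E2) (kern y * U s y).
Proof.
have U_c y : x / 2 <= y <= 2 * x -> {for y, continuous (U s)}.
  by move=> hy; apply: (is_derive_continuous (U s) y _ (wv_derive nu s hnu y _)); move: x0; lra.
have xe : x - eps <= x + eps by move: e0; lra.
have U_in y : x - eps <= y <= x + eps -> {for y, continuous (U s)}.
  by move=> hy; apply: U_c; move: e2 x0; lra.
have E2in y : E2 y -> x / 2 <= y <= 2 * x by rewrite /= in_itv /=; move: e2 x0; lra.
pose G r := kap `|r| * U s (clip (x - eps) (x + eps) (x + r)).
have cG r : {for r, continuous G}.
  apply: cM; first by apply: (ccomp kap (fun r => `|r|)); [cont | exact: ckap].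
  apply: (ccomp (fun y => U s (clip (x - eps) (x + eps) y)) (fun r => x + r)); first by cont.
  exact: clip_comp_cont.
have U_mb : mb (E1 `*` E2) (fun z => U s z.2).
  by eapply (mb_comp _ (U s) (x / 2) (2 * x) (fun z => z.2)); [exact: U_c | by move=> z /hD[] | exact: m2].
have H : mb (E1 `*` E2) (fun z => cone z.1 z.2 * kap z.1 * Vc z.1 z.2 * U s z.2).
  by have h1 := cone_mb; have h2 := Vc_mb; have h3 := kap_mb; mbt.
have [mf [M HM]] := H.
have [FE _] := Rfubini_both E1 E2 (fun t y => cone t y * kap t * Vc t y * U s y) (fun=> M) (fun=> 1) (measurable_itv _) (measurable_itv _) mf (integc _ _ _) (integc _ _ _) (fun t y h1 h2 => eq_ind_r (fun c => _ <= c) (HM (t, y) (conj h1 h2)) (mulr1 M)).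
pose A t := \int[mu]_(y in E2) (cone t y * kap t * Vc t y * U s y).
have AE t : E1 t -> A t = kap t * \int[mu]_(y in `]x - t, x + t[) (Vt t y * U s y).
  rewrite /= in_itv /= => /andP[t0 te]; have sub : `]x - t, x + t[%classic `<=` E2.
    by move=> y /=; rewrite !itv_ball => h; exact: lt_trans te.
  have ht : 0 <= t <= eps by rewrite !ltW.
  rewrite /A (Rintegral_supp E2 `]x - t, x + t[ _ (measurable_itv _) (measurable_itv _) sub); last first.
    move=> y _ /= /negP hy; move: hy; rewrite itv_ball => /negbTE hy.
    by rewrite coneE hy !mul0r.
  transitivity (\int[mu]_(y in `]x - t, x + t[) (kap t * (Vt t y * U s y))).
    apply: eq_Rintegral => y /set_mem; rewrite /= itv_ball => yt.
    by rewrite coneE yt mul1r (Vc_eq t y ht (ltW yt)) mulrA.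
  rewrite RintegralZl //; apply: integ_oo; apply: continuous_in_integ; first by rewrite lerBlDr -addrA lerDl addr_ge0 ?(ltW t0).
  by move=> y hy; exact: VtU_cont.
have GE t : E1 t -> G t = kap t * U s (x + t) /\ G (- t) = kap t * U s (x - t).
  rewrite /= in_itv /= => te; have [c1 c2] := clip_ball x eps t te; have /andP[t0 _] := te.
  by rewrite /G normrN (gtr0_norm t0) c1 c2.
have ckc (c : R) t : {for t, continuous (fun t => c * (kap t * cos (t * s)))} by have := ckap t => ?; cont.
have ick : integ E1 (fun t => kap t * cos (t * s)).
  by apply: continuous_integ_oo => t; have := ckap t => ?; cont.
have iA : \int[mu]_(t in E1) A t = 2 * (\int[mu]_(t in E1) (kap t * cos (t * s)) * U s x) - \int[mu]_(t in E1) G t - \int[mu]_(t in E1) G (- t).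
  have cGN t : {for t, continuous (fun t => G (- t))} by apply: (ccomp G (fun t => - t)); [cont | exact: cG].
  transitivity (\int[mu]_(t in E1) ((2 * U s x) * (kap t * cos (t * s)) - G t - G (- t))).
    apply: eq_Rintegral => t /set_mem Et; rewrite (AE t Et); have [-> ->] := GE t Et.
    move: Et; rewrite /= in_itv /= => /andP[t0 te]; have ht : 0 < t <= eps by rewrite t0 ltW.
    have I := riemann_identity s t ht; rewrite -[X in kap t * X](addrK (U s (x + t) + U s (x - t))) [X in X - _]addrC -I; ring.
  have i1 : integ E1 (fun t => 2 * U s x * (kap t * cos (t * s))) by apply: continuous_integ_oo => t; exact: ckc.
  have i2 : integ E1 G by exact: continuous_integ_oo.
  have i3 : integ E1 (fun t => G (- t)) by exact: continuous_integ_oo.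
  have i12 : integ E1 (fun t => 2 * U s x * (kap t * cos (t * s)) - G t).
    exact: (@integrableB _ _ _ mu E1 (measurable_itv _) (EFin \o (fun t => 2 * U s x * (kap t * cos (t * s)))) (EFin \o G)).
  rewrite (@RintegralB _ _ _ mu E1 _ _ (measurable_itv _) i12 i3) (@RintegralB _ _ _ mu E1 _ _ (measurable_itv _) i1 i2).
  by rewrite (@RintegralZl _ _ _ mu E1 _ _ (measurable_itv _) ick); ring.
have [M1 HM1] : exists M1 : R, forall t, E1 t -> `|kap t| <= M1.
  have [_ [M1 HM1]] := kap_mb; exists M1 => t Et; apply: (HM1 (t, x)); split; first exact: Et.
  by rewrite /= itv_ball subrr normr0.
have iB : \int[mu]_(y in E2) (Ipart y * U s y) = \int[mu]_(t in E1) A t.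
  rewrite FE; apply: eq_Rintegral => y /set_mem Ey; rewrite /Ipart.
  have [CV CV0 HCV] := Vc_bound.
  have [ii _] := kern_bound CV (fun=> M1) y CV0 HCV HM1 (integc _ _ _) Ey.
  by rewrite (@RintegralZr _ _ _ mu E1 _ _ (measurable_itv _) ii).
have iU : integ E2 (fun y => kap `|y - x| * U s y).
  apply: integ_oo; apply: (continuous_in_integ _ _ _ xe) => y hy.
  apply: (cM (fun y => kap `|y - x|) (U s)); last exact: U_in.
  by apply: (ccomp kap (fun y => `|y - x|)); [cont | exact: ckap].
have [CU HCU] : exists C : R, forall y, E2 y -> `|U s y| <= C.
  have [_ [C HC]] := U_mb; exists C => y Ey; apply: (HC (eps / 2, y)); split; last exact: Ey.
  by rewrite /= in_itv /= half_in.
have mI : measurable_fun E2 Ipart.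
  have H' : mb (E1 `*` E2) (fun z => cone z.1 z.2 * kap z.1 * Vc z.1 z.2).
    by have h1 := cone_mb; have h2 := Vc_mb; have h3 := kap_mb; mbt.
  have [mf' [M' HM']] := H'.
  by have [_ mI] := Rfubini_both E1 E2 (fun t y => cone t y * kap t * Vc t y) (fun=> M') (fun=> 1) (measurable_itv _) (measurable_itv _) mf' (integc _ _ _) (integc _ _ _) (fun t y h1 h2 => eq_ind_r (fun c => _ <= c) (HM' (t, y) (conj h1 h2)) (mulr1 M')).
have iI : integ E2 (fun y => Ipart y * U s y).
  have [CV CV0 HCV] := Vc_bound.
  apply: (integ_le _ _ (fun=> CV * (M1 * eps) * CU)); [exact: measurable_itv | | | exact: integc].
    apply: (measurable_funM mI); apply: open_continuous_measurable_fun; first exact: interval_open.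
    by move=> y /set_mem/E2in/U_c.
  move=> y Ey; rewrite normrM; apply: ler_pM; [exact: normr_ge0|exact: normr_ge0| |exact: HCU].
  have [_ h] := kern_bound CV (fun=> M1) y CV0 HCV HM1 (integc _ _ _) Ey.
  apply: (le_trans h); apply: (ler_wpM2l CV0).
  have ye : `|y - x| < eps by rewrite -itv_ball; exact: Ey.
  have M10 : 0 <= M1.
    have e3 : E1 (eps / 2) by rewrite /= in_itv /= half_in.
    exact: le_trans (normr_ge0 _) (HM1 _ e3).
  by rewrite (Rintegral_cst_itv _ _ _ (ltW ye)); apply: (ler_wpM2l M10); rewrite gerBl.
have GG : \int[mu]_(t in E1) G t + \int[mu]_(t in E1) G (- t) = \int[mu]_(y in E2) (kap `|y - x| * U s y).
  have o := Rintegral_opp G 0 eps e0 cG; rewrite oppr0 in o; rewrite -o addrC.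
  have ne : - eps < 0 by rewrite oppr_lt0.
  rewrite -(Rintegral_split G (- eps) 0 eps ne e0 cG).
  have ca y : 1 * - eps + x <= y <= 1 * eps + x -> {for y, continuous (fun y => kap `|y - x| * U s y)}.
    rewrite !mul1r ![_ + x]addrC => hy.
    apply: (cM (fun y => kap `|y - x|) (U s)); last exact: U_in.
    by apply: (ccomp kap (fun y => `|y - x|)); [cont | exact: ckap].
  have := Rintegral_affine_in (fun y => kap `|y - x| * U s y) 1 x (- eps) eps ltr01 (lt_trans ne e0) ca.
  rewrite !mul1r ![_ + x]addrC => ->; apply: eq_Rintegral => r /set_mem; rewrite /= in_itv /= => /andP[r1 r2].
  have hr : x - eps <= x + r <= x + eps by rewrite !lerD2l (ltW r1) (ltW r2).
  by rewrite mul1r addrK [r + x]addrC /G (clip_id _ _ _ hr).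
have -> : \int[mu]_(y in E2) (kern y * U s y) = \int[mu]_(y in E2) (2^-1 * (kap `|y - x| * U s y + Ipart y * U s y)).
  by apply: eq_Rintegral => y _; rewrite /kern /Ipart; ring.
have iS : integ E2 (fun y => kap `|y - x| * U s y + Ipart y * U s y).
  exact: (@integrableD _ _ _ mu E2 (measurable_itv _) (EFin \o (fun y => kap `|y - x| * U s y)) (EFin \o (fun y => Ipart y * U s y))).
rewrite (@RintegralZl _ _ _ mu E2 _ _ (measurable_itv _) iS) (@RintegralD _ _ _ mu E2 _ _ (measurable_itv _) iU iI) iB iA -GG.
by field.
Qed.

End riemann_kernel.

(** * Convergence at Lebesgue points *)

Section separated_sums.
Context {R : realType}.
Implicit Types (c r t u v : R).

Definition squash t : R := t / (1 + `|t|).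

Lemma squash_bound t : `|squash t| <= 1.
Proof.
have h := normr_ge0 t.
by rewrite /squash normrM normfV (ger0_norm (addr_ge0 ler01 h)) ler_pdivrMr; lra.
Qed.

(** The function t/(1 + |t|) is bounded and increasing with derivative (1 + |t|)^(-2): its
    increments over c-separated points dominate the terms to be summed, and telescope. *)
Lemma squash_gap c u v : 0 < c <= 1 -> u + c <= v ->
  c / 4 * ((1 + `|u|) ^+ 2)^-1 <= squash v - squash u.
Proof.
move=> /andP[c0 c1] uv; rewrite /squash.
have [u0|u0] := leP 0 u.
  have v0 : 0 <= v by lra.
  rewrite (ger0_norm u0) (ger0_norm v0).
  have -> : v / (1 + v) - u / (1 + u) = (v - u) / ((1 + v) * (1 + u)) by field; apply/andP; split; lra.
  have p1 : 0 < 1 + u by lra.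
  have p2 : 0 < 1 + v by lra.
  rewrite ler_pdivrMr ?exprn_gt0 // mulrAC ler_pdivlMr ?mulr_gt0 //.
  have h : c * (1 + v) <= 2 * ((v - u) * (1 + u)) by nra.
  have h2 : c * (1 + v) * (1 + u) <= 2 * ((v - u) * (1 + u)) * (1 + u) by rewrite ler_wpM2r // ltW.
  have : 0 <= (v - u) * (1 + u) * (1 + u) by rewrite !mulr_ge0 ?(ltW p1) //; lra.
  by rewrite expr2; nra.
have au : `|u| = - u by rewrite ltr0_norm.
rewrite au.
have p1 : 0 < 1 - u by lra.
have [v0|v0] := leP v 0.
  rewrite (ler0_norm v0).
  have p2 : 0 < 1 - v by lra.
  have -> : v / (1 - v) - u / (1 - u) = (v - u) / ((1 - v) * (1 - u)) by field; apply/andP; split; lra.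
  rewrite ler_pdivrMr ?exprn_gt0 // mulrAC ler_pdivlMr ?mulr_gt0 //.
  have h : c / 4 * (1 - v) <= (v - u) * (1 - u) by nra.
  have : c / 4 * (1 - v) * (1 - u) <= (v - u) * (1 - u) * (1 - u) by rewrite ler_wpM2r // ltW.
  by rewrite expr2; nra.
rewrite (gtr0_norm v0).
have p2 : 0 < 1 + v by lra.
have k1 : ((1 - u) ^+ 2)^-1 <= 1 by rewrite invf_le1 ?exprn_gt0 // expr_ge1 //; lra.
apply: (@le_trans _ _ (c / 4)); first by rewrite ler_piMr //; lra.
have -> : v / (1 + v) - u / (1 - u) = v / (1 + v) + (- u) / (1 - u) by field; apply/andP; split; lra.
have [cv|cv] := leP (c / 2) v.
  have : c / 4 <= v / (1 + v) by rewrite ler_pdivlMr //; nra.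
  have : 0 <= (- u) / (1 - u) by rewrite divr_ge0 // ltW // oppr_gt0.
  lra.
have : c / 4 <= (- u) / (1 - u) by rewrite ler_pdivlMr //; nra.
have : 0 <= v / (1 + v) by rewrite divr_ge0 // ltW.
lra.
Qed.

(** The constant is 2, the total variation of [squash], divided by c/4. *)
Lemma separated_sum (s : nat -> R) c r n : 0 < c <= 1 -> (forall j, s j + c <= s j.+1) ->
  \sum_(0 <= j < n) ((1 + `|r - s j|) ^+ 2)^-1 <= 8 / c.
Proof.
move=> c01 gap; have /andP[c0 _] := c01.
have : c / 4 * \sum_(0 <= j < n) ((1 + `|r - s j|) ^+ 2)^-1 <= squash (s n - r) - squash (s 0%N - r).
  rewrite -(telescope_sumr (fun j => squash (s j - r)) (leq0n n)) mulr_sumr; apply: ler_sum => j _.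
  rewrite distrC; apply: squash_gap => //; have := gap j; lra.
have := squash_bound (s n - r); have := squash_bound (s 0%N - r); rewrite !ler_norml.
move=> /andP[h1 h2] /andP[h3 h4] h5.
rewrite ler_pdivlMr // mulrC; move: h5; rewrite -ler_pdivlMl ?divr_gt0 // invf_div => h5.
rewrite -ler_pdivlMl //; apply: (le_trans h5); rewrite mulrAC [c^-1 * _]mulrC ler_pM2r ?invr_gt0 //; lra.
Qed.

End separated_sums.

Section zero_sums.
Context {R : realType}.
Variables (nu : R) (s : nat -> R).
Hypotheses (hnu : -1 < nu) (hs : bessel_zeros nu s).
Implicit Types (a q r : R).

Lemma zeros_sum : exists2 C : R, 0 < C & forall q r n, 2 <= q ->
  \sum_(0 <= j < n) (1 + `|r - s j|) `^ (- q) <= C.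
Proof.
have [c c0 H] := s_gap nu s hnu hs.
have c01 : 0 < Num.min c 1 <= 1 by rewrite lt_min c0 ltr01 /= ge_min lexx orbT.
have /andP[m0 _] := c01.
exists (8 / Num.min c 1); first by rewrite divr_gt0.
move=> q r n q2; apply: le_trans (separated_sum s _ r n c01 _); last first.
  by move=> j; apply: le_trans (H j); rewrite lerD2l ge_min lexx.
apply: ler_sum => j _; have h : 1 <= 1 + `|r - s j| by rewrite lerDl.
rewrite -powR_mulrn ?(le_trans ler01 h) // -powRN; apply: ler_powR => //; lra.
Qed.

(** Peetre's inequality, s_j <= (1 + r)(1 + |r - s_j|). *)
Lemma zeros_pow_le a r j : 0 <= a -> 0 <= r -> s j `^ a <= (1 + r) `^ a * (1 + `|r - s j|) `^ a.
Proof.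
move=> a0 r0; have s0 := s_gt0 _ _ hs j; have n0 := normr_ge0 (r - s j).
have h1 : 0 <= 1 + r by lra.
have h2 : 0 <= 1 + `|r - s j| by lra.
rewrite -(powRM _ h1 h2); apply: ge0_ler_powR => //; rewrite ?nnegrE ?(ltW s0) ?(mulr_ge0 h1 h2) //.
have : s j - r <= `|r - s j| by rewrite distrC ler_norm.
nra.
Qed.

End zero_sums.

Section kernel_series.
Context {R : realType}.
Variables (nu : R) (s : nat -> R).
Hypotheses (hnu : -1 < nu) (hs : bessel_zeros nu s).
Local Notation mu := (@lebesgue_measure R).
Local Notation w := (weight nu).
Local Notation I01 := (`]0%R, 1%R[%classic : set R).
Local Notation ip := (ip nu).
Local Notation pj := (pj nu s).
Variables (K : R -> R) (B : nat -> R) (S : R).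
Hypotheses (bK : bm K) (hB : forall j y, 0 < y < 1 -> `|pj j y| <= B j).
Hypothesis (hS : forall n, \sum_(0 <= j < n) `|ip K (pj j)| * B j <= S).
Let c j := ip K (pj j).
Let part n y := \sum_(0 <= j < n) c j * pj j y.
Let kt y := limn (part ^~ y).

Let part_bound n y : 0 < y < 1 -> `|part n y| <= S.
Proof.
move=> y01; apply: le_trans (ler_norm_sum _ _ _) _; apply: le_trans (hS n).
by apply: ler_sum => j _; rewrite normrM ler_wpM2l // hB.
Qed.

Let part_cvg y : 0 < y < 1 -> part n y @[n --> \oo] --> kt y.
Proof.
move=> y01; apply: (@normed_cvg R R^o (fun j => c j * pj j y)).
apply: nondecreasing_is_cvgn.
  by apply/nondecreasing_seqP => n; rewrite /normed_series_of /= /series /= big_nat_recr //= lerDl.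
exists S => _ [n _ <-]; rewrite /series /=; apply: le_trans (hS n).
by apply: ler_sum => j _; rewrite normrM ler_wpM2l // hB.
Qed.

Let part_bm n : bm (part n).
Proof.
rewrite /part; under eq_fun do rewrite big_mkord.
by apply: (bm_sum n (fun j y => c j * pj j y)) => i; apply: bmZ; apply: bm_continuous; exact: pj_cont.
Qed.

Let kt_le y : 0 < y < 1 -> `|kt y| <= S.
Proof.
move=> y01; apply: (ler_cvg_to (cvg_norm (part_cvg y y01)) (cvg_cst S)).
by apply: nearW => n; exact: part_bound.
Qed.

Let in01 y : I01 y -> 0 < y < 1. Proof. by rewrite /= in_itv. Qed.

Let kt_bm : bm kt.
Proof.
apply/bmP; split; last by exists S; exact: kt_le.
apply: (@measurable_fun_cvg _ _ R I01 part) => [m|y /in01]; last exact: part_cvg.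
by have /bmP[] := part_bm m.
Qed.

Let integ_bm (f g : R -> R) : measurable_fun I01 f -> integ I01 (fun y => f y * w y) -> bm g ->
  integ I01 (fun y => f y * g y * w y).
Proof.
move=> mf fi /bmP[mg [C HC]].
apply: (@integ_le _ I01 _ (fun y => C * `|f y * w y|)) => //.
- by apply: measurable_funM; [exact: measurable_funM | exact: weight_measurable].
- move=> y /in01 y01; rewrite mulrAC normrM mulrC ler_wpM2r // HC //.
- apply: (@integrableZl _ _ _ mu I01 (measurable_itv _) C (fun y => (`|f y * w y|)%:E)).
  exact: (integrable_norm fi).
Qed.

Let series_dct (f : R -> R) : measurable_fun I01 f -> integ I01 (fun y => f y * w y) ->
  \sum_(0 <= j < n) c j * ip f (pj j) @[n --> \oo] --> ip f kt.
Proof.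
move=> mf fi.
have bp j : bm (pj j) by apply: bm_continuous; exact: pj_cont.
rewrite (_ : (fun n => _) = (fun n => ip f (part n))); last first.
  apply/funext => n; rewrite big_mkord -(Rintegral_sum I01 n c (fun j y => f y * pj j y * w y)) //.
    by apply: eq_Rintegral => y _; rewrite /part big_mkord mulr_sumr mulr_suml; apply: eq_bigr => i _; ring.
  by move=> i; exact: integ_bm.
apply: (Rdominated_convergence I01 _ _ (fun y => S * `|f y * w y|)) => //.
- move=> n; have /bmP[mp _] := part_bm n.
  by apply: measurable_funM; [exact: measurable_funM | exact: weight_measurable].
- have /bmP[mp _] := kt_bm.
  by apply: measurable_funM; [exact: measurable_funM | exact: weight_measurable].
- apply: aeW => y /in01 y01; apply: cvgMl; apply: cvgMr; exact: part_cvg.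
- apply: (@integrableZl _ _ _ mu I01 (measurable_itv _) S (fun y => (`|f y * w y|)%:E)).
  exact: (integrable_norm fi).
- move=> n y /in01 y01; rewrite mulrAC normrM mulrC ler_wpM2r //; exact: part_bound.
Qed.

Lemma coefE (f : R -> R) j : coef nu s f j = ip f (pj j).
Proof.
by apply: eq_Rintegral => y; rewrite inE => /in01 /andP[y0 _]; rewrite (psiE nu s hnu hs).
Qed.

(* [K] and the absolutely convergent series with its coefficients agree almost everywhere. *)
Lemma kernel_series (f : R -> R) : measurable_fun I01 f -> integ I01 (fun y => f y * w y) ->
  \sum_(0 <= j < n) ip K (pj j) * coef nu s f j @[n --> \oo] --> ip f K.
Proof.
move=> mf fi; have H := series_dct f mf fi.
have bp j : bm (pj j) by apply: bm_continuous; exact: pj_cont.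
have E : ip f K = ip f kt.
  (* By orthonormality, applying the termwise integration to psi_i itself shows that K and the sum
     of the series have equal coefficients; completeness then replaces one by the other against any
     f. *)
  have z i : ip (fun y => K y - kt y) (pj i) = 0.
    rewrite ipBl //; apply/eqP; rewrite subr_eq0; apply/eqP.
    have /bmP[mp _] := bp i.
    have D := series_dct (pj i) mp (bm_integrable nu hnu _ (bp i)).
    rewrite [RHS]ipC; have D2 : \sum_(0 <= j < n) c j * ip (pj i) (pj j) @[n --> \oo] --> c i.
      apply: cvg_near_cst; exists i.+1 => // n /= lin.
      rewrite big_mkord (bigD1 (Ordinal lin)) //= big1 ?addr0.
        by rewrite (pj_orth nu s hnu hs) eqxx mulr1.
      move=> k ki; rewrite (pj_orth nu s hnu hs) eq_sym (_ : (_ == i) = false) ?mulr0 //.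
      exact: negbTE ki.
    by apply: cvg_unique D2 D.
  have be : bm (fun y => K y - kt y) by exact: bmB.
  have := complete_integral nu s hnu hs _ f be z mf.
  rewrite (_ : Rintegral _ _ _ = ip f K - ip f kt) => [/eqP|]; first by rewrite subr_eq0 => /eqP.
  have i1 := integ_bm f K mf fi bK; have i2 := integ_bm f kt mf fi kt_bm.
  rewrite -(@RintegralB _ _ _ mu I01 _ _ (measurable_itv _) i1 i2).
  by apply: eq_Rintegral => y _; ring.
rewrite E; under eq_fun do under eq_bigr do rewrite coefE.
exact: H.
Qed.

End kernel_series.

(** * Decreasing majorants and Lebesgue points *)

Section approximate_identity.
Context {R : realType}.
Local Notation mu := (@lebesgue_measure R).
Implicit Types (d r t u x y : R).

(** The decreasing majorant of the local kernel as a function of t = |y - x|; [dpeak] is minus its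
    derivative. *)
Definition peak d r t := r * (1 + r * t) `^ (- (1 + d)).
Definition dpeak d r t := (1 + d) * (r ^+ 2 * (1 + r * t) `^ (- (2 + d))).

Lemma peak_base r t : 0 < r -> 0 <= t -> 1 <= 1 + r * t.
Proof. by move=> r0 t0; rewrite lerDl mulr_ge0 // ltW. Qed.

Lemma peak_derive d r t : 0 < r -> 0 <= t -> is_derive t 1 (fun t => - peak d r t) (dpeak d r t).
Proof.
move=> r0 t0; have p : 0 < 1 + r * t by apply: lt_le_trans (peak_base r t r0 t0).
rewrite /peak /dpeak.
eapply is_derive_val; first by der.
have -> : - (1 + d) - 1 = - (2 + d) by ring.
by move: (_ `^ _) => P; ring.
Qed.

Lemma dpeak_cont d r t : 0 < r -> 0 <= t -> {for t, continuous (dpeak d r)}.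
Proof.
move=> r0 t0; have p : 0 < 1 + r * t by apply: lt_le_trans (peak_base r t r0 t0).
by rewrite /dpeak; cont.
Qed.

Lemma peak_cont d r t : 0 < r -> 0 <= t -> {for t, continuous (peak d r)}.
Proof.
move=> r0 t0; have p : 0 < 1 + r * t by apply: lt_le_trans (peak_base r t r0 t0).
by rewrite /peak; cont.
Qed.

Lemma peak_ge0 d r t : 0 < r -> 0 <= peak d r t.
Proof. by move=> r0; rewrite mulr_ge0 ?powR_ge0 // ltW. Qed.

Lemma dpeak_ge0 d r t : 0 <= d -> 0 <= dpeak d r t.
Proof. by move=> d0; rewrite mulr_ge0 ?addr_ge0 // mulr_ge0 ?powR_ge0 ?sqr_ge0. Qed.

Lemma peak_le d r t u : 0 <= d -> 0 < r -> 0 <= t -> t <= u -> peak d r u <= peak d r t.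
Proof.
move=> d0 r0 t0 tu; rewrite /peak ler_wpM2l ?(ltW r0) //.
apply: powRN_anti; first by rewrite addr_ge0.
  exact: lt_le_trans (peak_base r t r0 t0).
by rewrite lerD2l ler_wpM2l // ltW.
Qed.

Lemma dpeak_le d r t : 0 <= d -> 0 < r -> 0 <= t -> dpeak d r t <= (1 + d) * r ^+ 2.
Proof.
move=> d0 r0 t0; rewrite /dpeak ler_wpM2l ?addr_ge0 // ler_piMr ?sqr_ge0 //.
by apply: powRN_le1; [rewrite addr_ge0 | exact: peak_base].
Qed.

Lemma dpeak_mul d r t : 0 <= d -> 0 < r -> 0 <= t -> dpeak d r t * t <= (1 + d) * peak d r t.
Proof.
move=> d0 r0 t0; have p := peak_base r t r0 t0; have p0 := lt_le_trans ltr01 p.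
rewrite /dpeak /peak -[X in X <= _]mulrA ler_wpM2l ?addr_ge0 // expr2 -!mulrA ler_wpM2l ?(ltW r0) //.
have -> : - (1 + d) = - (2 + d) + 1 by ring.
rewrite powRD; last by rewrite (gt_eqF p0) implybT.
rewrite (powRr1 (ltW p0)) mulrA [r * _]mulrC -mulrA ler_wpM2l ?powR_ge0 //; lra.
Qed.

Lemma peak_vanish d t e : 0 < d -> 0 < t -> 0 < e ->
  exists2 r0, 0 < r0 & forall r, r0 <= r -> peak d r t <= e.
Proof.
move=> d0 t0 e0; have et : 0 < e * t by rewrite mulr_gt0.
pose q := (e * t) `^ (- d^-1); have q0 : 0 < q by rewrite powR_gt0.
exists (q / t) => [|r hr]; first by rewrite divr_gt0.
have r0 : 0 < r by apply: lt_le_trans hr; rewrite divr_gt0.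
have qr : q <= r * t by rewrite -ler_pdivrMr.
have p : 0 < 1 + r * t by apply: lt_le_trans ltr01 (peak_base _ _ r0 (ltW t0)).
rewrite /peak opprD powRD; last by rewrite (gt_eqF p) implybT.
rewrite powR_inv1 ?(ltW p) // mulrA -[e](mulfK (lt0r_neq0 t0)) [_ / t]mulrC.
apply: ler_pM; rewrite ?powR_ge0 //.
- by rewrite divr_ge0 // ltW.
- by rewrite ler_pdivrMr // mulrC ler_pdivlMr //; lra.
apply: (@le_trans _ _ (q `^ (- d))); first by apply: powRN_anti => //; lra.
by rewrite -powRrM mulrNN mulVf ?gt_eqF // powRr1 // ltW.
Qed.

Lemma peak_tail d r t u : 0 < d -> 0 < r -> 0 <= t -> t < u ->
  \int[mu]_(v in `]t, u[) peak d r v <= d^-1 * (1 + r * t) `^ (- d).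
Proof.
move=> d0 r0 t0 tu.
have c v : t <= v <= u -> {for v, continuous (peak d r)}.
  by move=> /andP[tv _]; apply: peak_cont => //; exact: le_trans tv.
rewrite Rintegral_oo_cc; last by apply: continuous_in_integ => //; exact: ltW.
have -> : \int[mu]_(v in `[t, u]) peak d r v = - (d^-1 * (1 + r * u) `^ (- d)) - - (d^-1 * (1 + r * t) `^ (- d)).
  apply: (Rintegral_FTC (peak d r) (fun t => - (d^-1 * (1 + r * t) `^ (- d))) _ _ tu); last exact: c.
  move=> v /andP[tv _]; have pv : 0 < 1 + r * v by apply: lt_le_trans (peak_base _ _ r0 (le_trans t0 tv)).
  rewrite /peak; eapply is_derive_val; first by der.
  rewrite (_ : - d - 1 = - (1 + d)); last by ring.
  by move: (_ `^ _) => P; field; rewrite gt_eqF.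
by rewrite opprK addrC lerBlDr lerDl mulr_ge0 ?powR_ge0 // invr_ge0 ltW.
Qed.

Lemma peak_integral d r eps : 0 < d -> 0 < r -> 0 < eps -> \int[mu]_(t in `]0, eps[) peak d r t <= d^-1.
Proof.
move=> d0 r0 e0; have := peak_tail d r 0 eps d0 r0 (lexx _) e0.
by rewrite mulr0 addr0 powR1 mulr1.
Qed.

Variables (x eps d : R) (g : R -> R).
Hypotheses (e0 : 0 < eps) (d0 : 0 < d) (mg : measurable_fun setT g).
Local Notation D1 := (`]x - eps, x + eps[%classic : set R).
Local Notation D2 := (`]0, eps[%classic : set R).
Hypothesis ig : integ D1 g.
Let mD1 : measurable D1. Proof. exact: measurable_itv. Qed.
Let mD2 : measurable D2. Proof. exact: measurable_itv. Qed.
Let iag : integ D1 (fun y => `|g y|).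
Proof. exact: (integrable_norm ig). Qed.
Let mag : measurable_fun setT (fun y => `|g y|).
Proof. exact: measurableT_comp. Qed.

Let f r y u : R := cone x u y * dpeak d r u * `|g y|.

Let f_le r y u : 0 < r -> D1 y -> D2 u -> `|f r y u| <= `|g y| * ((1 + d) * r ^+ 2).
Proof.
move=> r0 Dy; rewrite /= in_itv /= => /andP[u0 _].
rewrite /f normrM normr_id mulrC ler_wpM2l // normrM coneE normr_nat.
rewrite (ger0_norm (dpeak_ge0 _ _ _ (ltW d0))).
case: (_ < _); rewrite ?mul1r ?mul0r; first by apply: dpeak_le => //; exact: ltW.
by rewrite mulr_ge0 ?sqr_ge0 // addr_ge0 // ltW.
Qed.

Let f_meas r : 0 < r -> measurable_fun (D1 `*` D2) (fun z : R * R => f r z.1 z.2).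
Proof.
move=> r0; apply: measurable_funM; last first.
  by apply: measurable_funTS; apply: (measurableT_comp mag measurable_fst).
apply: measurable_funM.
  apply: measurable_funTS; apply: (@measurableT_comp _ _ _ _ _ _ (\1_(`]0%R, +oo[%classic : set R) : R -> R) _ (fun z : R * R => z.2 - `|z.1 - x|)).
    exact: measurable_indic.
  apply: measurable_funB; first exact: measurable_snd.
  by apply: (meas_fst (fun y => `|y - x|)) => y; cont.
have md : measurable_fun D2 (dpeak d r).
  apply: continuous_on_measurable; first exact: interval_open.
  by move=> t; rewrite /= in_itv /= => /andP[t0 _]; apply: dpeak_cont => //; exact: ltW.
apply: (measurable_comp mD2 _ md); last exact: measurable_funTS measurable_snd.
by move=> _ [z [_ h] <-].
Qed.

Let cst_int (c : R) : integ D2 (fun=> c).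
Proof. by apply: continuous_integ_oo => t; exact: cC. Qed.

(** Layer-cake formula: up to its value at eps, the peak is a superposition of indicators |y - x| <
    u with density [dpeak]. *)
Let f_inner r y : 0 < r -> D1 y -> \int[mu]_(u in D2) f r y u = (peak d r `|y - x| - peak d r eps) * `|g y|.
Proof.
move=> r0; rewrite /= itv_ball => yx; have t0 := normr_ge0 (y - x).
have sub : `] `|y - x|, eps[%classic `<=` D2.
  by move=> t /=; rewrite !in_itv /= => /andP[h ->]; rewrite (le_lt_trans _ h).
rewrite (Rintegral_supp D2 `] `|y - x|, eps[ _ (measurable_itv _) (measurable_itv _) sub); last first.
  move=> t; rewrite /= !in_itv /= => /andP[tp te] /negP; rewrite te andbT -leNgt => h.
  by rewrite /f coneE ltNge h !mul0r.
have ct u : `|y - x| <= u <= eps -> {for u, continuous (dpeak d r)}.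
  by move=> /andP[h _]; apply: dpeak_cont => //; exact: le_trans h.
have ii : integ `] `|y - x|, eps[ (dpeak d r).
  by apply: integ_oo; apply: continuous_in_integ ct; exact: ltW.
transitivity (\int[mu]_(u in `] `|y - x|, eps[) (`|g y| * dpeak d r u)).
  apply: eq_Rintegral => t /set_mem; rewrite /= in_itv /= => /andP[h _].
  by rewrite /f coneE h mul1r mulrC.
rewrite (@RintegralZl _ _ _ mu _ _ _ (measurable_itv _) ii) mulrC; congr (_ * _).
rewrite Rintegral_oo_cc; last by apply: continuous_in_integ ct; exact: ltW.
transitivity (- peak d r eps - - peak d r `|y - x|); last by rewrite opprK addrC.
apply: (Rintegral_FTC (dpeak d r) (fun t => - peak d r t) _ _ yx) => //.
by move=> t /andP[h _]; apply: peak_derive => //; exact: le_trans h.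
Qed.

Let Phi u := \int[mu]_(y in D1) (cone x u y * `|g y|).

Let f_outer r u : \int[mu]_(y in D1) f r y u = dpeak d r u * Phi u.
Proof.
rewrite /Phi -(@RintegralZl _ _ _ mu _ _ _ mD1).
  by apply: eq_Rintegral => y _; rewrite /f; ring.
apply: (integ_le _ _ (fun y => `|g y|)) => //.
  apply: measurable_funM; last exact: measurable_funTS.
  apply: measurable_funTS; apply: (@measurableT_comp _ _ _ _ _ _ (\1_(`]0%R, +oo[%classic : set R) : R -> R) _ (fun y => u - `|y - x|)).
    exact: measurable_indic.
  apply: continuous_measurable_fun => y; apply: (cD (fun=> u) (fun y => - `|y - x|)); first exact: cC.
  by apply: cN; cont.
move=> y _; rewrite normrM normr_id coneE normr_nat.
by case: (_ < _); rewrite ?mul1r ?mul0r.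
Qed.

Hypothesis small : forall eta, 0 < eta -> exists2 tau, 0 < tau &
  forall u, 0 < u < tau -> \int[mu]_(y in `]x - u, x + u[) `|g y| <= eta * u.

(** After the layer-cake formula and Fubini only the masses of |g| on centred intervals occur. Short
    intervals are controlled by the hypothesis [small], long ones because the peak at a fixed
    positive distance tends to 0 as r grows. *)
Lemma approximate_identity e : 0 < e -> exists2 r0, 0 < r0 & forall r, r0 <= r ->
  \int[mu]_(y in D1) (peak d r `|y - x| * `|g y|) <= e.
Proof.
move=> ep; pose M := \int[mu]_(y in D1) `|g y|.
have M0 : 0 <= M by apply: Rintegral_ge0.
have d1 : 0 < 1 + d by rewrite addr_gt0.
pose eta := e * d / (2 * (1 + d)).
have eta0 : 0 < eta by rewrite divr_gt0 ?mulr_gt0.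
have [tau0 t00 Hs] := small eta eta0.
pose tau := Num.min tau0 eps.
have t0 : 0 < tau by rewrite lt_min t00 e0.
have [tle1 tle2] : tau <= tau0 /\ tau <= eps by rewrite !ge_min !lexx orbT.
clearbody tau.
(* Collects the factors of the two terms governed by the peak at tau and at eps, so that together
   they cost at most e/2. *)
pose Q := (1 + d) * (M / tau) * eps + M + 1.
have MT : 0 <= M / tau by rewrite divr_ge0 // ltW.
have Q1 : 0 <= (1 + d) * (M / tau) * eps by exact: (mulr_ge0 (mulr_ge0 (ltW d1) MT) (ltW e0)).
have Q0 : 0 < Q by rewrite ltr_wpDl // addr_ge0.
have b0 : 0 < e / (2 * Q) by rewrite divr_gt0 // mulr_gt0.
have [r1 r10 H1] := peak_vanish d tau _ d0 t0 b0.
have [r2 r20 H2] := peak_vanish d eps _ d0 e0 b0.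
exists (r1 + r2) => [|r hr]; first by rewrite addr_gt0.
have r0 : 0 < r by apply: lt_le_trans hr; rewrite addr_gt0.
have {}H1 : peak d r tau <= e / (2 * Q) by apply: H1; lra.
have {}H2 : peak d r eps <= e / (2 * Q) by apply: H2; lra.
have PhiE u : 0 < u <= eps -> Phi u = \int[mu]_(y in `]x - u, x + u[) `|g y|.
  move=> /andP[u0 ue]; rewrite /Phi (Rintegral_supp D1 `]x - u, x + u[ _ mD1 (measurable_itv _)).
  - by apply: eq_Rintegral => y /set_mem; rewrite /= itv_ball coneE => ->; rewrite mul1r.
  - by move=> y; rewrite /= !itv_ball => h; exact: lt_le_trans ue.
  - by move=> y _; rewrite /= itv_ball coneE => /negP/negbTE ->; rewrite mul0r.
have PhiM u : 0 < u <= eps -> Phi u <= M.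
  move=> hu; rewrite (PhiE u hu); apply: Rintegral_subset => // y.
  by rewrite /= !itv_ball => h; case/andP: hu => _; exact: lt_le_trans h.
have Phi0 u : 0 <= Phi u.
  by apply: Rintegral_ge0 => y _; rewrite coneE; case: (_ < _); rewrite ?mul1r ?mul0r.
(* In both ranges the mass is at most linear in u (eta u below tau, (M/tau) u above), and u [dpeak]
   u <= (1 + d) [peak] u. *)
have key u : D2 u -> `|dpeak d r u * Phi u| <= (1 + d) * (eta * peak d r u + M / tau * peak d r tau).
  rewrite /= in_itv /= => /andP[u0 ue]; have D0 := dpeak_ge0 d r u (ltW d0).
  rewrite (ger0_norm (mulr_ge0 D0 (Phi0 u))).
  have Du := dpeak_mul d r u (ltW d0) r0 (ltW u0).
  have B1 := peak_ge0 d r u r0; have B2 := peak_ge0 d r tau r0.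
  have [ut|tu] := ltP u tau.
    have P : Phi u <= eta * u.
      by rewrite PhiE ?u0 ?(ltW ue) //; apply: Hs; rewrite u0 (lt_le_trans ut).
    apply: (le_trans (ler_wpM2l D0 P)).
    have A1 := ler_wpM2l (ltW eta0) Du.
    have A2 := mulr_ge0 (ltW d1) (mulr_ge0 MT B2).
    apply: (@le_trans _ _ (eta * (dpeak d r u * u))); first by rewrite mulrCA.
    apply: (le_trans A1); rewrite mulrDr [X in _ <= X + _]mulrCA.
    by rewrite lerDl.
  have P : Phi u <= M / tau * u.
    apply: (le_trans (PhiM u _)); first by rewrite u0 ltW.
    by rewrite mulrAC ler_pdivlMr // ler_wpM2l.
  apply: (le_trans (ler_wpM2l D0 P)).
  have A3 : (1 + d) * peak d r u <= (1 + d) * peak d r tau.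
    by rewrite ler_wpM2l ?(ltW d1) //; apply: peak_le => //; exact: ltW.
  have A1 := ler_wpM2l MT (le_trans Du A3).
  have A2 := mulr_ge0 (ltW d1) (mulr_ge0 (ltW eta0) B1).
  apply: (@le_trans _ _ (M / tau * (dpeak d r u * u))); first by rewrite mulrCA.
  apply: (le_trans A1); rewrite mulrDr [X in _ <= _ + X]mulrCA.
  by rewrite lerDr.
have [fub mfub] := Rfubini_both D1 D2 (f r) (fun y => `|g y|) (fun=> (1 + d) * r ^+ 2) mD1 mD2 (f_meas r r0) iag (cst_int _) (fun y u => f_le r y u r0).
have ib : integ D2 (peak d r).
  by apply: integ_oo; apply: continuous_in_integ => [|t /andP[h _]]; [exact: ltW | exact: peak_cont].
have ibb : integ D2 (fun u => (1 + d) * (eta * peak d r u + M / tau * peak d r tau)).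
  apply: (@integrableZl _ _ _ mu _ mD2 (1 + d) (EFin \o (fun u => eta * peak d r u + M / tau * peak d r tau))).
  apply: (@integrableD _ _ _ mu _ mD2 (EFin \o (fun u => eta * peak d r u)) (EFin \o (fun u => M / tau * peak d r tau))).
    exact: (@integrableZl _ _ _ mu _ mD2 eta (EFin \o peak d r)).
  exact: cst_int.
have S2 : \int[mu]_(u in D2) (dpeak d r u * Phi u) <= (1 + d) * (eta * d^-1 + M / tau * peak d r tau * eps).
  apply: (le_trans (ler_norm _)).
  have md : measurable_fun D2 (fun u => dpeak d r u * Phi u).
    rewrite (_ : (fun u => _) = (fun u => \int[mu]_(y in D1) f r y u)) //.
    by apply/funext => u; rewrite f_outer.
  apply: (le_trans (norm_Rintegral_le D2 _ _ mD2 md key ibb)).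
  rewrite (@RintegralZl _ _ _ mu _ (fun u => eta * peak d r u + M / tau * peak d r tau)) //; last first.
    apply: (@integrableD _ _ _ mu _ mD2 (EFin \o (fun u => eta * peak d r u)) (EFin \o (fun u => M / tau * peak d r tau))).
      exact: (@integrableZl _ _ _ mu _ mD2 eta (EFin \o peak d r)).
    exact: cst_int.
  rewrite ler_wpM2l ?(ltW d1) //.
  have i1 : integ D2 (fun u => eta * peak d r u) by exact: (@integrableZl _ _ _ mu _ mD2 eta (EFin \o peak d r)).
  rewrite (@RintegralD _ _ _ mu D2 (fun u => eta * peak d r u) (fun u => M / tau * peak d r tau) mD2 i1 (cst_int _)).
  rewrite (@RintegralZl _ _ _ mu _ (peak d r) eta mD2 ib) Rintegral_cst_itv ?(ltW e0) // subr0 lerD2r ler_wpM2l ?(ltW eta0) //.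
  exact: peak_integral.
have split : \int[mu]_(y in D1) (peak d r `|y - x| * `|g y|) =
    peak d r eps * M + \int[mu]_(u in D2) (dpeak d r u * Phi u).
  have -> : \int[mu]_(u in D2) (dpeak d r u * Phi u) = \int[mu]_(y in D1) ((peak d r `|y - x| - peak d r eps) * `|g y|).
    under eq_Rintegral do rewrite -f_outer.
    by rewrite -fub; apply: eq_Rintegral => y /set_mem Dy; exact: f_inner.
  rewrite -(@RintegralZl _ _ _ mu _ _ _ mD1 iag) -(@RintegralD _ _ _ mu D1 _ _ mD1).
  - by apply: eq_Rintegral => y _; ring.
  - exact: (@integrableZl _ _ _ mu _ mD1 (peak d r eps) (EFin \o (fun y => `|g y|))).
  apply: (integ_le D1 _ (fun y => r * `|g y|) mD1).
  - apply: measurable_funM; last exact: measurable_funTS.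
    apply: measurable_funB; last exact: measurable_cst.
    apply: measurable_funTS; apply: continuous_measurable_fun => y.
    apply: (ccomp (peak d r) (fun y => `|y - x|)); first by cont.
    exact: peak_cont.
  - move=> y; rewrite /= itv_ball => hy; rewrite normrM normr_id ler_wpM2r //.
    have h1 := peak_le d r `|y - x| eps (ltW d0) r0 (normr_ge0 _) (ltW hy).
    have h2 := peak_ge0 d r eps r0.
    have h3 := peak_le d r 0 `|y - x| (ltW d0) r0 (lexx _) (normr_ge0 _).
    have h4 : peak d r 0 = r by rewrite /peak mulr0 addr0 powR1 mulr1.
    rewrite h4 in h3; rewrite ger0_norm ?subr_ge0 // lerBlDr (le_trans h3) // lerDl //.
  - exact: (@integrableZl _ _ _ mu _ mD1 r (EFin \o (fun y => `|g y|))).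
rewrite split.
have E1 : (1 + d) * (eta * d^-1) = e / 2 by rewrite /eta; field; rewrite !gt_eqF.
have B2 : peak d r eps * M <= e / (2 * Q) * M by rewrite ler_wpM2r.
have B1 : (1 + d) * (M / tau) * eps * peak d r tau <= (1 + d) * (M / tau) * eps * (e / (2 * Q)) by rewrite ler_wpM2l.
have EQ : (1 + d) * (M / tau) * eps * (e / (2 * Q)) + e / (2 * Q) * M = e / 2 - e / (2 * Q).
  have -> : e / 2 = Q * (e / (2 * Q)) by field; rewrite gt_eqF.
  by rewrite /Q; ring.
rewrite mulrDr in S2; move: S2 B1 B2 EQ b0; rewrite E1.
have -> : (1 + d) * (M / tau * peak d r tau * eps) = (1 + d) * (M / tau) * eps * peak d r tau by ring.
lra.
Qed.

End approximate_identity.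

Section growth.
Context {R : realType}.
Variables (nu : R) (s : nat -> R).
Hypotheses (hnu : -1 < nu) (hs : bessel_zeros nu s).
Local Notation pj := (pj nu s).

(** Crude polynomial growth of sup |psi_j|, expressed through r so that the decay in |r - s_j| of
    the multipliers can absorb it. For a negative exponent nu + 1/2 the first zero provides the
    bound. *)
Lemma pj_growth : exists B : nat -> R, exists a : R, exists C : R, [/\ 0 <= a, 0 <= C,
  forall j, 0 <= B j,
  forall j y, 0 < y < 1 -> `|pj j y| <= B j &
  forall j r, 0 <= r -> B j <= C * ((1 + r) `^ a * (1 + `|r - s j|) `^ a)].
Proof.
have [C C0 HC] := psi_bound_unif nu s hnu hs.
pose ka := nu + 1 / 2; pose a := `|ka|.
have a0 : 0 <= a by exact: normr_ge0.
have s00 := s_gt0 _ _ hs 0.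
exists (fun j => C * (s j `^ ka + 1)), a, (C * (2 + s 0%N `^ (- a))); split => //.
- by rewrite mulr_ge0 ?(ltW C0) // addr_ge0 ?powR_ge0.
- by move=> j; rewrite mulr_ge0 ?(ltW C0) // addr_ge0 ?powR_ge0.
- by move=> j y /andP[y0 y1]; apply: HC; rewrite !ltW.
move=> j r r0; rewrite -mulrA ler_wpM2l ?(ltW C0) //.
have h := zeros_pow_le nu s hs a r j a0 r0.
have p1 : 1 <= (1 + r) `^ a by apply: powR_ge1; rewrite ?lerDl.
have p2 : 1 <= (1 + `|r - s j|) `^ a by apply: powR_ge1; rewrite ?lerDl.
have P : 1 <= (1 + r) `^ a * (1 + `|r - s j|) `^ a by rewrite -[leLHS]mulr1 ler_pM.
have k : s j `^ ka <= s j `^ a + s 0%N `^ (- a).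
  have [k0|k0] := leP 0 ka; first by rewrite /a ger0_norm // lerDl powR_ge0.
  have -> : ka = - a by rewrite /a ltr0_norm // opprK.
  apply: (@le_trans _ _ (s 0%N `^ (- a))); last by rewrite lerDr powR_ge0.
  by apply: powRN_anti => //; apply: (s_le nu s hs).
have q0 := powR_ge0 (s 0%N) (- a).
move: h P k q0; move: (_ * _) (s 0%N `^ (- a)) (s j `^ a) (s j `^ ka) => X q u v; nra.
Qed.

End growth.

Section integ_away.
Context {R : realType}.
Variable nu : R.
Local Notation mu := (@lebesgue_measure R).

Lemma integ_away (f : R -> R) (a b : R) : 0 < a -> b <= 1 -> measurable_fun (`]0, 1[%classic : set R) f ->
  integ `]0, 1[ (fun y => f y * weight nu y) -> integ `]a, b[ f.
Proof.
move=> a0 b1 mf fi; have sub : `]a, b[%classic `<=` (`]0, 1[%classic : set R).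
  by move=> y; rewrite /= !in_itv /= => /andP[ay yb]; rewrite (lt_trans a0 ay) (lt_le_trans yb b1).
have i2 : integ `]a, b[ (fun y => f y * weight nu y) by apply: integrableS fi.
pose C := a `^ (- (2 * nu + 1)) + b `^ (- (2 * nu + 1)).
apply: (integ_le _ _ (fun y => C * `|f y * weight nu y|)) => //.
- by apply: measurable_funS mf.
- move=> y; rewrite /= in_itv /= => /andP[ay yb]; have y0 := lt_trans a0 ay; rewrite normrM mulrCA.
  rewrite ler_peMr // (ger0_norm (powR_ge0 _ _)) /weight.
  have : y `^ (- (2 * nu + 1)) <= C by apply: powR_ratio_le; rewrite ?ltW.
  by rewrite powRN => h; rewrite -ler_pdivrMr ?powR_gt0 // mul1r.
- apply: (@integrableZl _ _ _ mu _ (measurable_itv _) C (fun y => (`|f y * weight nu y|)%:E)).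
  exact: (integrable_norm i2).
Qed.

End integ_away.

(** * The local part of the means at a Lebesgue point *)

Section local_part.
Context {R : realType}.
Variables (nu delta : R) (s : nat -> R) (x eps : R) (th : R -> R) (C1 : R) (k : nat).
Hypotheses (hnu : -1 < nu) (hs : bessel_zeros nu s) (d0 : 0 < delta).
Hypotheses (x0 : 0 < x) (e0 : 0 < eps) (epx : eps <= x * prad nu) (xe1 : x + eps <= 1).
Hypotheses (C10 : 0 < C1) (cth : forall t, {for t, continuous th}) (thb : forall t, `|th t| <= C1).
Local Notation mu := (@lebesgue_measure R).
Local Notation w := (weight nu).
Local Notation I01 := (`]0%R, 1%R[%classic : set R).
Local Notation ip := (ip nu).
Local Notation pj := (pj nu s).
Local Notation E1 := (`]0, eps[%classic : set R).
Local Notation E2 := (`]x - eps, x + eps[%classic : set R).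
Local Notation ka := (nu + 1 / 2).
Implicit Types (r t y l : R).

Definition lmul r t := r * th t * Hf delta (r * t).
Definition mloc r l := \int[mu]_(t in E1) (lmul r t * cos (t * l)).

Hypothesis hmul : forall r l, 0 < r -> 0 <= l ->
  `|Mf delta (l / r) - mloc r l| <= C1 * (r `^ (- delta) * (1 + `|r - l|) `^ (delta - k.*2%:R)).

Let xe : eps <= x / 2.
Proof. by move: (prad_lt1 nu) x0 epx; nra. Qed.

Let E2P y : E2 y -> x / 2 <= y <= 2 * x /\ 0 < y < 1.
Proof. by rewrite /= in_itv /=; move: xe x0 xe1; lra. Qed.

Let lmul_cont r t : {for t, continuous (lmul r)}.
Proof.
apply: (cM (fun t => r * th t) (fun t => Hf delta (r * t))).
  by apply: cM; [exact: cC | exact: cth].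
by apply: (ccomp (Hf delta) (fun t => r * t)); [cont | exact: Hf_cont].
Qed.

Local Notation kr r := (kern nu x eps (lmul r)).

(** Conjugates [kern] from [wv] to g0: since w = y^(2 nu + 1), the factor y^(-(nu+1/2)) times w
    leaves exactly the power y^(nu+1/2) carried by [wv], and x^(-(nu+1/2)) removes it at x. *)
Definition local_kernel r : R -> R := (fun y => x `^ (- ka) * kr r y * y `^ (- ka)) \_ E2.

Let lmul_bound : exists2 C, 0 < C & forall r t, 0 < r -> 0 <= t -> `|lmul r t| <= C * peak delta r t.
Proof.
have [C C0 HC] := Hf_bound delta d0; exists (C1 * C) => [|r t r0 t0]; first by rewrite mulr_gt0.
rewrite /lmul /peak normrM normrM (gtr0_norm r0).
have h := HC (r * t); rewrite (ger0_norm (mulr_ge0 (ltW r0) t0)) addrC in h.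
have -> : C1 * C * (r * (1 + r * t) `^ (- (1 + delta))) = r * C1 * (C * (1 + r * t) `^ (- (1 + delta))) by ring.
apply: ler_pM; rewrite ?mulr_ge0 ?(ltW r0) //.
  by rewrite ler_wpM2l ?(ltW r0).
by rewrite [1 + delta]addrC [1 + r * t]addrC.
Qed.

(** For r >= 1 and t < eps, 1 + r t <= r (1 + eps): the tail of the peak is at most a multiple of
    the peak, so the perturbation part of the kernel is no larger than the principal part. *)
Let peak_tail_le r t : 1 <= r -> 0 <= t < eps ->
  \int[mu]_(u in `]t, eps[) peak delta r u <= delta^-1 * (1 + eps) * peak delta r t.
Proof.
move=> r1 /andP[t0 te]; have r0 : 0 < r by exact: lt_le_trans r1.
have p : 0 < 1 + r * t by apply: lt_le_trans ltr01 (peak_base _ _ r0 t0).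
apply: (le_trans (peak_tail delta r t eps d0 r0 t0 te)).
rewrite -mulrA ler_wpM2l ?invr_ge0 ?(ltW d0) // /peak opprD powRD; last by rewrite (gt_eqF p) implybT.
rewrite (powR_inv1 (ltW p)) !mulrA -[leLHS]mul1r ler_wpM2r ?powR_ge0 // ler_pdivlMr //.
have : r * t <= r * eps by rewrite ler_wpM2l // ltW.
by move: r1; lra.
Qed.

Let kern_le : exists2 C, 0 < C & forall r y, 1 <= r -> E2 y -> `|kr r y| <= C * peak delta r `|y - x|.
Proof.
have [CV CV0 HV] := @Vc_bound R nu x eps x0 epx.
have [C C0 HC] := lmul_bound.
exists (C + CV * (C * (delta^-1 * (1 + eps)))) => [|r y r1 Ey].
  by rewrite ltr_wpDr // !mulr_ge0 ?(ltW C0) ?invr_ge0 ?(ltW d0) ?addr_ge0 ?(ltW e0).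
have r0 : 0 < r by exact: lt_le_trans r1.
have yx : `|y - x| < eps by move: Ey; rewrite /= itv_ball.
have ib : integ E1 (fun t => C * peak delta r t).
  apply: integ_oo; apply: continuous_in_integ => [|t /andP[h _]]; first exact: ltW.
  by apply: cM; [exact: cC | exact: peak_cont].
have [_ H] := @kern_bound R nu x eps x0 epx (lmul r) (lmul_cont r) CV (fun t => C * peak delta r t) y CV0 HV
  (fun t Et => HC r t r0 (ltW (proj1 (andP Et)))) ib Ey.
have i1 : integ `] `|y - x|, eps[ (peak delta r).
  apply: integ_oo; apply: continuous_in_integ => [|t /andP[h _]]; first exact: ltW.
  by apply: peak_cont => //; exact: le_trans h.
rewrite (@RintegralZl _ _ _ mu _ (peak delta r) C (measurable_itv _) i1) in H.
have T := peak_tail_le r `|y - x| r1 _; rewrite normr_ge0 yx /= in T; have {}T := T isT.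
have h := HC r `|y - x| r0 (normr_ge0 _).
have h2 := ler_wpM2l CV0 (ler_wpM2l (ltW C0) T).
have B0 := peak_ge0 delta r `|y - x| r0.
rewrite /kern normrM [ `|2^-1|]ger0_norm; last by rewrite invr_ge0.
apply: (@le_trans _ _ ((C * peak delta r `|y - x| + CV * (C * (delta^-1 * (1 + eps) * peak delta r `|y - x|))) / 2)).
  by rewrite ler_wpM2r ?invr_ge0 // (le_trans (ler_normD _ _)) // lerD // (le_trans H).
rewrite (_ : (C + _) * _ = C * peak delta r `|y - x| + CV * (C * (delta^-1 * (1 + eps) * peak delta r `|y - x|))); last by ring.
rewrite ler_pdivrMr // ler_peMr ?ler1n //.
have q : 0 <= delta^-1 * (1 + eps) * peak delta r `|y - x|.
  by rewrite (mulr_ge0 _ B0) // mulr_ge0 ?invr_ge0 ?(ltW d0) // addr_ge0 // ltW.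
by rewrite addr_ge0 ?(mulr_ge0 CV0 (mulr_ge0 (ltW C0) q)) // (mulr_ge0 (ltW C0) B0).
Qed.

Let pow_bound (c : R) : exists2 C, 0 < C & forall y, E2 y -> y `^ c <= C.
Proof.
have x2 : 0 < x / 2 by rewrite divr_gt0.
exists ((x / 2) `^ c + (2 * x) `^ c) => [|y /E2P[h _]]; last exact: powR_ratio_le.
by rewrite addr_gt0 // powR_gt0 // mulr_gt0.
Qed.

Let kr_le r : 1 <= r -> exists2 C, 0 < C & forall y, E2 y -> `|kr r y| <= C.
Proof.
move=> r1; have r0 : 0 < r by exact: lt_le_trans r1.
have [C C0 H] := kern_le; exists (C * r) => [|y Ey]; first by rewrite mulr_gt0.
apply: (le_trans (H r y r1 Ey)); rewrite ler_wpM2l ?(ltW C0) //.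
have := peak_le delta r 0 `|y - x| (ltW d0) r0 (lexx _) (normr_ge0 _).
by rewrite {2}/peak mulr0 addr0 powR1 mulr1.
Qed.

Let mkr r : measurable_fun E2 (kr r).
Proof. exact: kern_measurable. Qed.

Let mpow (c : R) : measurable_fun E2 (fun y => y `^ c).
Proof.
apply: continuous_on_measurable; first exact: interval_open.
by move=> y /E2P[_ /andP[y0 _]]; cont.
Qed.

Let sub2 : E2 `<=` I01.
Proof. by move=> y /E2P[_]; rewrite /= in_itv. Qed.

Lemma local_kernel_bm r : 1 <= r -> bm (local_kernel r).
Proof.
move=> r1; have r0 : 0 < r by exact: lt_le_trans r1.
have [C C0 H] := kr_le r r1; have [C' C'0 H'] := pow_bound (- ka).
apply/bmP; split.
  apply: measurable_funTS; apply/(measurable_restrictT _ (measurable_itv _)).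
  by apply: measurable_funM => //; apply: measurable_funM => //; exact: mkr.
exists (x `^ (- ka) * C * C') => y y01; rewrite /local_kernel patchE; case: ifPn => [/set_mem Ey|_].
  rewrite normrM normrM [ `|_ `^ _|]ger0_norm ?powR_ge0 // [X in _ * X]ger0_norm ?powR_ge0 //.
  by rewrite ler_pM ?H' ?mulr_ge0 ?powR_ge0 // ler_wpM2l ?powR_ge0 // H.
by rewrite normr0 !mulr_ge0 ?powR_ge0 // ltW.
Qed.

Let weightE y : 0 < y -> w y = y `^ ka * y `^ ka.
Proof.
move=> y0; rewrite -powRD; last by rewrite (gt_eqF y0) implybT.
by rewrite /weight; congr (_ `^ _); field.
Qed.

Section pairing.
Variable f : R -> R.
Hypotheses (mf : measurable_fun I01 f) (fi : integ I01 (fun y => f y * w y)).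

Lemma kr_int r : 1 <= r -> integ E2 (fun y => kr r y * y `^ ka * f y).
Proof.
move=> r1; have [C C0 H] := kr_le r r1; have [C' C'0 H'] := pow_bound (- ka).
have mf2 : measurable_fun E2 f by apply: measurable_funS mf.
have i2 : integ E2 (fun y => f y * w y) by apply: integrableS fi.
apply: (integ_le _ _ (fun y => C * C' * `|f y * w y|)) => //.
- by apply: measurable_funM => //; apply: measurable_funM => //; exact: mkr.
- move=> y Ey; have /andP[y0 _] := (E2P y Ey).2.
  have YY : y `^ (- ka) * y `^ ka = 1 by rewrite powRN mulVf // gt_eqF // powR_gt0.
  have [Y0 Y'0] : 0 <= y `^ ka /\ 0 <= y `^ (- ka) by rewrite !powR_ge0.
  rewrite (weightE y y0); have := H' y Ey; have := H y Ey.
  move: (y `^ ka) (y `^ (- ka)) (kr r y) (f y) Y0 Y'0 YY => Y Y' k1 F Y0 Y'0 YY h1 h2.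
  rewrite !normrM (ger0_norm Y0).
  have -> : `|k1| * Y * `|F| = `|k1| * Y' * (`|F| * (Y * Y)).
    by transitivity (`|k1| * (Y' * Y) * Y * `|F|); [rewrite YY mulr1 | ring].
  by apply: ler_pM; rewrite ?mulr_ge0 // ler_pM.
- apply: (@integrableZl _ _ _ mu _ (measurable_itv _) (C * C') (fun y => (`|f y * w y|)%:E)).
  exact: (integrable_norm i2).
Qed.

Lemma ip_local_kernel r : 1 <= r -> ip f (local_kernel r) = x `^ (- ka) * \int[mu]_(y in E2) (kr r y * y `^ ka * f y).
Proof.
move=> r1; rewrite -(@RintegralZl _ _ _ mu _ _ _ (measurable_itv _) (kr_int r r1)).
rewrite /ip (Rintegral_supp I01 E2 _ (measurable_itv _) (measurable_itv _) sub2).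
  apply: eq_Rintegral => y /[dup] yE /set_mem Ey; have /andP[y0 _] := (E2P y Ey).2.
  rewrite /local_kernel patchE yE (weightE y y0) [y `^ (- _)]powRN; have : y `^ ka != 0 by rewrite gt_eqF // powR_gt0.
  by move: (y `^ ka) => Y Y0; field.
by move=> y _ Ey; rewrite /local_kernel patchE memNset // mulr0 mul0r.
Qed.

End pairing.

Let ip_local_kernel_g S r : 1 <= r -> ip (fun y => gbes nu (S * y)) (local_kernel r) = mloc r S * gbes nu (S * x).
Proof.
move=> r1; have bg := g_bm nu hnu S; have /bmP[mg _] := bg.
rewrite (ip_local_kernel _ mg (bm_integrable nu hnu _ bg) r r1).
have := @kernel_identity R nu x eps hnu x0 e0 epx (lmul r) (lmul_cont r) S.
rewrite -/(mloc r S) /wv => E.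
under eq_Rintegral do rewrite -mulrA.
have XX : x `^ (- ka) * x `^ ka = 1 by rewrite powRN mulVf // gt_eqF // powR_gt0.
rewrite -E; transitivity (x `^ (- ka) * x `^ ka * (mloc r S * gbes nu (S * x))); first by ring.
by rewrite XX mul1r.
Qed.

Lemma ip_local_kernel_pj r j : 1 <= r -> ip (local_kernel r) (pj j) = mloc r (s j) * pj j x.
Proof.
move=> r1; rewrite ipC (ipZl nu hnu) ?ip_local_kernel_g //; [by rewrite /pj mulrCA| exact: g_bm | exact: local_kernel_bm].
Qed.

(** The kernel identity at frequency S = 0, where g0 (S y) is constant, yields the total mass of the
    kernel. *)
Lemma ip_local_kernel_1 r : 1 <= r -> ip (fun=> 1) (local_kernel r) = mloc r 0.
Proof.
move=> r1; have g := gbes0_gt0 nu hnu.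
have := ip_local_kernel_g 0 r r1; rewrite mul0r.
rewrite (_ : (fun y => gbes nu (0 * y)) = (fun=> gbes nu 0 * 1)); last by apply/funext => y; rewrite mul0r mulr1.
rewrite (ipZl nu hnu) ?bmC ?local_kernel_bm // => E.
by apply: (mulfI (lt0r_neq0 g)); rewrite E mulrC.
Qed.

Let x01 : 0 < x < 1. Proof. by rewrite x0 /=; move: e0 xe1; lra. Qed.

Section convergence.
Variable f : R -> R.
Hypotheses (mf : measurable_fun I01 f) (fi : integ I01 (fun y => f y * w y)).
Variables (B : nat -> R) (a CB : R).
Hypotheses (a0 : 0 <= a) (CB0 : 0 <= CB) (B0 : forall j, 0 <= B j)
  (hB : forall j y, 0 < y < 1 -> `|pj j y| <= B j)
  (Bg : forall j r, 0 <= r -> B j <= CB * ((1 + r) `^ a * (1 + `|r - s j|) `^ a)).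
Hypothesis (ka2 : 2 * a + 2 <= k.*2%:R - delta).
Local Notation q := (k.*2%:R - delta).

Let q0 : 0 <= q. Proof. by move: a0 ka2; lra. Qed.

Lemma mloc_le r l : 1 <= r -> 0 <= l ->
  `|mloc r l| <= ((1 + r) `^ q + C1) * (1 + `|r - l|) `^ (- q).
Proof.
move=> r1 l0; have r0 : 0 < r by exact: lt_le_trans r1.
have h1 : `|Mf delta (l / r)| <= (1 + r) `^ q * (1 + `|r - l|) `^ (- q).
  have [lr|rl] := ltP l r; last first.
    rewrite Mf_out ?normr0 ?mulr_ge0 ?powR_ge0 // ger0_norm ?divr_ge0 ?(ltW r0) //.
    by rewrite ler_pdivlMr // mul1r.
  rewrite (ger0_norm (Mf_ge0 _ _)) (le_trans (Mf_le1 _ _ d0)) //.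
  rewrite powRN ler_pdivlMr ?powR_gt0 ?ltr_pwDl // mul1r.
  have rl0 : 0 <= r - l by rewrite subr_ge0 ltW.
  rewrite (ger0_norm rl0); apply: ge0_ler_powR; rewrite ?nnegrE //; move: l0 r0 rl0; lra.
have h2 := hmul r l r0 l0; rewrite -[delta - _]opprB in h2.
have r1' : r `^ (- delta) <= 1 by apply: powRN_le1; [exact: ltW|].
have P := powR_ge0 (1 + `|r - l|) (- q).
rewrite mulrDl -[mloc r l](subKr (Mf delta (l / r))).
apply: (le_trans (ler_normB _ _)); apply: lerD; first exact: h1.
apply: (le_trans h2); rewrite ler_wpM2l ?(ltW C10) //.
by rewrite -[leRHS]mul1r ler_wpM2r // ?powR_ge0.
Qed.

(** The decay (1 + |r - s_j|)^(-q) has to pay for two factors (1 + |r - s_j|)^a, one from psi_j(x)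
    and one from sup |psi_j|, and to leave the exponent 2 for summation over the zeros: this is the
    hypothesis [ka2]. *)
Lemma local_series r : 1 <= r ->
  \sum_(0 <= j < n) mloc r (s j) * pj j x * coef nu s f j @[n --> \oo] --> ip f (local_kernel r).
Proof.
move=> r1; have r0 : 0 < r by exact: lt_le_trans r1.
have [S S0 HS] := zeros_sum nu s hnu hs.
pose A := ((1 + r) `^ q + C1) * (CB * (1 + r) `^ a) ^+ 2.
have A0 : 0 <= A by rewrite mulr_ge0 ?sqr_ge0 // addr_ge0 ?powR_ge0 // ltW.
have hS n : \sum_(0 <= j < n) `|ip (local_kernel r) (pj j)| * B j <= A * S.
  have q2 : 2 <= q - 2 * a by move: ka2; lra.
  apply: (@le_trans _ _ (A * \sum_(0 <= j < n) (1 + `|r - s j|) `^ (- (q - 2 * a)))); last first.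
    by rewrite ler_wpM2l // HS.
  rewrite mulr_sumr; apply: ler_sum => j _; rewrite ip_local_kernel_pj // normrM.
  have b1 := mloc_le r (s j) r1 (ltW (s_gt0 _ _ hs j)).
  have b2 := le_trans (hB j x x01) (Bg j r (ltW r0)); have b3 := Bg j r (ltW r0).
  have p1 : 0 < 1 + `|r - s j| by rewrite ltr_pwDl.
  have -> : (1 + `|r - s j|) `^ (- (q - 2 * a)) = (1 + `|r - s j|) `^ (- q) * ((1 + `|r - s j|) `^ a * (1 + `|r - s j|) `^ a).
    rewrite -!powRD ?(gt_eqF p1) ?implybT //; congr (_ `^ _); ring.
  move: b1 b2 b3; rewrite /A.
  move: ((1 + `|r - s j|) `^ a) ((1 + `|r - s j|) `^ (- q)) ((1 + r) `^ a) ((1 + r) `^ q + C1) => X Y Z T b1 b2 b3.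
  have -> : T * (CB * Z) ^+ 2 * (Y * (X * X)) = (T * Y) * (CB * (Z * X)) * (CB * (Z * X)) by ring.
  by apply: ler_pM; rewrite ?mulr_ge0 // ler_pM.
have := kernel_series nu s hnu hs (local_kernel r) B (A * S) (local_kernel_bm r r1) hB hS f mf fi.
by under eq_fun do under eq_bigr do rewrite ip_local_kernel_pj //.
Qed.

Hypothesis lebx : forall eta, 0 < eta -> exists2 tau, 0 < tau &
  forall u, 0 < u < tau -> \int[mu]_(y in `]x - u, x + u[) `|f y - f x| <= eta * u.

Let g : R -> R := (fun y => f y - f x) \_ E2.

Let fE2 : integ E2 f.
Proof. by apply: (integ_away nu f _ _ _ _ mf fi); move: xe x0 xe1; lra. Qed.

Let cst2 (c : R) : integ E2 (fun=> c).
Proof. by apply: continuous_integ_oo => t; exact: cC. Qed.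

Let fdE2 : integ E2 (fun y => f y - f x).
Proof. exact: (@integrableB _ _ _ mu _ (measurable_itv _) (EFin \o f) (EFin \o (fun=> f x)) fE2 (cst2 _)). Qed.

Let gE y : E2 y -> g y = f y - f x.
Proof. by move=> /mem_set Ey; rewrite /g patchE Ey. Qed.

(** Subtracting f(x) times the mass of the kernel leaves f(y) - f(x) against an approximate
    identity; the mass tends to 1 at rate r^(-delta), by [hmul] at l = 0. *)
Lemma local_limit e : 0 < e -> exists2 r0, 1 <= r0 & forall r, r0 <= r -> `|ip f (local_kernel r) - f x| <= e.
Proof.
move=> e0'; have mfd : measurable_fun E2 (fun y => f y - f x) by have /integrableP[/measurable_EFinP] := fdE2.
have mg : measurable_fun setT g by apply/(measurable_restrictT _ (measurable_itv _)).
have ig : integ E2 g.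
  by apply: (eq_integrable _ _ _ _ fdE2) => // y /set_mem Ey /=; rewrite gE.
have sm eta : 0 < eta -> exists2 tau, 0 < tau & forall u, 0 < u < tau -> \int[mu]_(y in `]x - u, x + u[) `|g y| <= eta * u.
  move=> eta0; have [tau t0 H] := lebx eta eta0; exists (Num.min tau eps); first by rewrite lt_min t0.
  move=> u; rewrite lt_min => /and3P[u0 ut ue].
  rewrite (_ : Rintegral _ _ _ = \int[mu]_(y in `]x - u, x + u[) `|f y - f x|); first by apply: H; rewrite u0.
  apply: eq_Rintegral => y /set_mem; rewrite /= itv_ball => yu; rewrite gE //= itv_ball.
  exact: lt_trans ue.
have [Ck Ck0 Hk] := kern_le; have [Cp Cp0 Hp] := pow_bound ka.
pose X := x `^ (- ka); have X0 : 0 < X by rewrite powR_gt0.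
pose b := e / 2 / (X * (Ck * Cp)); have b0 : 0 < b by rewrite !divr_gt0 // !mulr_gt0.
have [r1 r10 H1] := @approximate_identity R x eps delta g e0 d0 mg ig sm b b0.
pose fx := `|f x| * C1 + 1; have fx0 : 0 < fx by rewrite ltr_wpDl // mulr_ge0 // ltW.
have [r2 r20 H2] : exists2 r2, 0 < r2 & forall r, r2 <= r -> r `^ (- delta) <= e / 2 / fx.
  have e2 : 0 < e / 2 / fx by rewrite !divr_gt0.
  exists ((e / 2 / fx) `^ (- delta^-1)) => [|r hr]; first by rewrite powR_gt0.
  apply: (@le_trans _ _ (((e / 2 / fx) `^ (- delta^-1)) `^ (- delta))).
    by apply: powRN_anti => //; [exact: ltW | rewrite powR_gt0].
  by rewrite -powRrM mulrNN mulVf ?gt_eqF // powRr1 // ltW.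
exists (1 + r1 + r2) => [|r hr]; first by rewrite -addrA lerDl addr_ge0 // ltW.
have rr1 : 1 <= r by move: hr r10 r20; lra.
have {}H1 : \int[mu]_(y in E2) (peak delta r `|y - x| * `|g y|) <= b by apply: H1; move: hr r10 r20; lra.
have {}H2 : r `^ (- delta) <= e / 2 / fx by apply: H2; move: hr r10 r20; lra.
have m1 : measurable_fun I01 (fun _ : R => 1 : R) by exact: measurable_cst.
have i1 : integ I01 (fun y => (fun=> 1) y * w y) by apply: bm_integrable => //; exact: bmC.
have D : ip f (local_kernel r) - f x * mloc r 0 = X * \int[mu]_(y in E2) (kr r y * y `^ ka * (f y - f x)).
  rewrite -ip_local_kernel_1 // (ip_local_kernel f mf fi) // (ip_local_kernel _ m1 i1) // -/X mulrCA -mulrBr; congr (_ * _).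
  have j1 := kr_int f mf fi r rr1; have j2 := kr_int (fun=> 1) m1 i1 r rr1.
  rewrite -(@RintegralZl _ _ _ mu _ _ _ (measurable_itv _) j2).
  have j3 : integ E2 (fun y => f x * (kr r y * y `^ ka * 1)).
    exact: (@integrableZl _ _ _ mu _ (measurable_itv _) (f x) (EFin \o (fun y => kr r y * y `^ ka * 1))).
  rewrite -(@RintegralB _ _ _ mu E2 _ _ (measurable_itv _) j1 j3).
  by apply: eq_Rintegral => y _; ring.
have D1 : `|ip f (local_kernel r) - f x * mloc r 0| <= e / 2.
  rewrite D normrM (ger0_norm (ltW X0)).
  have ib : integ E2 (fun y => peak delta r `|y - x| * `|g y|).
    have r0 : 0 < r by exact: lt_le_trans rr1.
    apply: (integ_le _ _ (fun y => r * `|g y|)) => //.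
    - apply: measurable_funM; last by apply: measurable_funTS; exact: measurableT_comp.
      apply: measurable_funTS; apply: continuous_measurable_fun => y.
      by apply: (ccomp (peak delta r) (fun y => `|y - x|)); [cont | exact: peak_cont].
    - move=> y _; rewrite normrM normr_id ler_wpM2r // ger0_norm ?peak_ge0 //.
      have := peak_le delta r 0 `|y - x| (ltW d0) r0 (lexx _) (normr_ge0 _).
      by rewrite {2}/peak mulr0 addr0 powR1 mulr1.
    - apply: (@integrableZl _ _ _ mu _ (measurable_itv _) r (fun y => (`|g y|)%:E)).
      exact: (integrable_norm ig).
  have ibc : integ E2 (fun y => Ck * Cp * (peak delta r `|y - x| * `|g y|)).
    exact: (@integrableZl _ _ _ mu _ (measurable_itv _) (Ck * Cp) (EFin \o (fun y => peak delta r `|y - x| * `|g y|))).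
  have mu_ : measurable_fun E2 (fun y => kr r y * y `^ ka * (f y - f x)).
    by apply: measurable_funM => //; apply: measurable_funM => //; exact: mkr.
  have bb y : E2 y -> `|kr r y * y `^ ka * (f y - f x)| <= Ck * Cp * (peak delta r `|y - x| * `|g y|).
    move=> Ey; rewrite (gE y Ey); have h1 := Hk r y rr1 Ey; have h2 := Hp y Ey; have h3 := powR_ge0 y ka.
    move: h1 h2 h3; move: (kr r y) (y `^ ka) (f y - f x) (peak _ _ _) => u v F b' h1 h2 h3.
    rewrite !normrM (ger0_norm h3) (_ : Ck * Cp * (b' * `|F|) = Ck * b' * Cp * `|F|); last by ring.
    by apply: ler_wpM2r => //; apply: ler_pM.
  apply: (@le_trans _ _ (X * (Ck * Cp * b))).
    rewrite ler_wpM2l ?(ltW X0) // (le_trans (norm_Rintegral_le E2 _ _ (measurable_itv _) mu_ bb ibc)) //.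
    by rewrite (@RintegralZl _ _ _ mu _ _ _ (measurable_itv _) ib) ler_wpM2l // mulr_ge0 // ltW.
  rewrite le_eqVlt; apply/orP; left; apply/eqP; rewrite /b; move: X0 Ck0 Cp0; clearbody X => X0 Ck0 Cp0.
  by field; rewrite !gt_eqF.
have D2 : `|f x * mloc r 0 - f x| <= e / 2.
  rewrite -{2}[f x]mulr1 -mulrBr normrM distrC.
  have := hmul r 0 (lt_le_trans ltr01 rr1) (lexx _).
  rewrite mul0r (_ : Mf delta 0 = 1); last by rewrite /Mf expr0n /= subr0 max_l // powR1.
  move=> h; have h3 : (1 + `|r - 0|) `^ (delta - k.*2%:R) <= 1.
    by rewrite -[delta - _]opprB; apply: (powRN_le1 _ _ q0); rewrite lerDl.
  have p0 := powR_ge0 r (- delta).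
  have h4 : `|1 - mloc r 0| <= C1 * r `^ (- delta).
    by apply: (le_trans h); rewrite ler_wpM2l ?(ltW C10) // ler_piMr.
  apply: (@le_trans _ _ (fx * r `^ (- delta))).
    apply: (le_trans (ler_wpM2l (normr_ge0 _) h4)).
    by rewrite mulrA ler_wpM2r // /fx lerDl.
  by rewrite -ler_pdivlMl // mulrC.
rewrite (_ : ip f (local_kernel r) - f x = (ip f (local_kernel r) - f x * mloc r 0) + (f x * mloc r 0 - f x)); last by rewrite subrKA.
by apply: (le_trans (ler_normD _ _)); move: D1 D2; lra.
Qed.

End convergence.
End local_part.

Section lebesgue_points.
Context {R : realType}.
Local Notation mu := (@lebesgue_measure R).

(** The weight is bounded below on each [A] n, so f is integrable there; Lebesgue differentiation is
    applied to the countably many restrictions. *)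
Lemma ae_lebesgue (nu : R) (f : R -> R) : measurable_fun (`]0, 1[%classic : set R) f ->
  integ `]0, 1[ (fun y => f y * weight nu y) ->
  {ae mu, forall x, 0 < x < 1 -> forall eta, 0 < eta -> exists2 tau, 0 < tau &
    forall u, 0 < u < tau -> \int[mu]_(y in `]x - u, x + u[) `|f y - f x| <= eta * u}.
Proof.
move=> mf fi; pose h n : R := n.+2%:R^-1.
have h0 n : 0 < h n by rewrite invr_gt0.
pose A n := (`]h n, 1 - h n[%classic : set R).
have iA n : integ (A n) f by apply: (integ_away nu) => //; rewrite lerBlDr lerDl ltW.
have H : {ae mu, forall x, forall n, lebesgue_pt (f \_ (A n)) x}.
  apply/ae_foralln => n; apply: lebesgue_differentiation.
  exact: integrable_locally_restrict (measurable_itv _) (iA n).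
apply: ae_imp H => x Hx /andP[x0 x1] eta eta0.
pose m := Num.min x (1 - x); have m0 : 0 < m by rewrite lt_min x0 subr_gt0.
have [n hn] : exists n, h n < m / 2.
  have m2 : 0 < m / 2 by rewrite divr_gt0.
  exists (Num.truncn (m / 2)^-1); rewrite /h invf_plt ?posrE // (lt_trans (truncnS_gt _)) // ltr_nat.
  by [].
have [mx m1x] : m <= x /\ m <= 1 - x by rewrite !ge_min !lexx orbT.
have xA u : 0 < u < m / 2 -> `]x - u, x + u[%classic `<=` A n.
  move=> /andP[u0 um] y; rewrite /A /= !in_itv /= => /andP[y1 y2]; apply/andP; split; lra.
have /fine_cvgP[H1 H2] := Hx n.
have e2 : 0 < eta / 2 by rewrite divr_gt0.
have /cvgrPdist_lt /(_ _ e2) [/= t1 t10 T1] := H2.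
case: H1 => [/= t2 t20 T2].
exists (Num.min (Num.min t1 t2) (m / 2)); first by rewrite !lt_min t10 t20 divr_gt0.
move=> u; rewrite !lt_min => /and3P[u0 /andP[ut1 ut2] um].
have b t : u < t -> ball_ Num.norm 0 t u by rewrite /ball_ /= sub0r normrN gtr0_norm.
have := T1 u (b _ ut1) u0; have := T2 u (b _ ut2) u0.
rewrite /= sub0r normrN.
have xu : x \in A n by rewrite inE /A /= in_itv /=; apply/andP; split; lra.
pose D := (`]x - u, x + u[%classic : set R).
have E : davg (f \_ (A n)) x u = ((2 * u)^-1%R%:E * \int[mu]_(y in D) (`|f y - f x|)%R%:E)%E.
  rewrite /davg /iavg lebesgue_measure_ball ?(ltW u0) // ball_itv mulr_natl.
  rewrite inver /= ifF; last by apply/negbTE; rewrite mulrn_eq0 /= gt_eqF.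
  congr (_ * _)%E; apply: eq_integral => y /set_mem yu /=.
  have yA : y \in A n by rewrite inE; apply: (xA u) => //; rewrite u0.
  by rewrite !patchE xu yA.
have iB : integ `]x - u, x + u[ (fun y => `|f y - f x|).
  have i0 : integ `]x - u, x + u[ (fun y => f y - f x).
    apply: (@integrableB _ _ _ mu _ (measurable_itv _) (EFin \o f) (EFin \o (fun=> f x))).
      apply: (integrableS _ _ _ (iA n)); [exact: measurable_itv | exact: measurable_itv | by apply: xA; rewrite u0].
    by apply: continuous_integ_oo => t; exact: cC.
  exact: (integrable_norm i0).
rewrite E fineM //; last by apply: integrable_fin_num; [exact: measurable_itv | exact: iB].
rewrite -/(Rintegral mu _ _) /= => _; rewrite normrM [ `|_^-1|]ger0_norm; last by rewrite invr_ge0 mulr_ge0 // ltW.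
rewrite [ `|Rintegral _ _ _|]ger0_norm; last exact: Rintegral_ge0.
rewrite mulrC ltr_pdivrMr ?mulr_gt0 // => /ltW; rewrite mulrA divfK //.
Qed.

End lebesgue_points.

(** * The error part of the multiplier *)

Section global_part.
Context {R : realType}.
Variables (nu : R) (s : nat -> R).
Hypotheses (hnu : -1 < nu) (hs : bessel_zeros nu s).
Implicit Types (a : nat -> R) (d q e r : R).

(** |a_j| is at most e1 s_j^d plus a constant A from finitely many indices. Peetre's inequality
    turns r^(-d) s_j^d into 2^d (1 + |r - s_j|)^d, absorbed by the decay; the constant is beaten by
    r^(-d). *)
Lemma global_small a d q e : 0 < d -> d + 2 <= q ->
  (forall e, 0 < e -> exists N, forall j, (N <= j)%N -> `|a j| <= e * s j `^ d) -> 0 < e ->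
  exists2 r0, 1 <= r0 & forall r n, r0 <= r ->
    \sum_(0 <= j < n) r `^ (- d) * (1 + `|r - s j|) `^ (- q) * `|a j| <= e.
Proof.
move=> d0 dq ha e0; have [S S0 HS] := zeros_sum nu s hnu hs.
have P0 : 0 < 2 `^ d * S * 2 :> R by rewrite !mulr_gt0 // powR_gt0.
have [N HN] := ha _ (divr_gt0 e0 P0); move: (HN).
set e1 := e / _; pose A := \sum_(0 <= j < N) `|a j|.
have e10 : 0 < e1 by rewrite divr_gt0.
have A0 : 0 <= A by rewrite sumr_ge0.
have aA j : `|a j| <= e1 * s j `^ d + A.
  have [Nj|jN] := leqP N j; first by rewrite (le_trans (HN j Nj)) // lerDl.
  rewrite ler_wpDl ?(mulr_ge0 (ltW e10) (powR_ge0 _ _)) // /A big_mkord.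
  by rewrite (bigD1 (Ordinal jN)) //= lerDl sumr_ge0.
pose b := e / 2 / (A * S + 1).
have b0 : 0 < b by rewrite !divr_gt0 // ltr_wpDl // mulr_ge0 // ltW.
pose r1 := b `^ (- d^-1).
exists (1 + r1); first by rewrite lerDl powR_ge0.
move=> r n hr; have r10 : 0 < r1 by rewrite powR_gt0.
have rr : 1 <= r by move: hr r10; lra.
have r0 : 0 < r by exact: lt_le_trans rr.
have rb : r `^ (- d) <= b.
  apply: (@le_trans _ _ (r1 `^ (- d))); first by apply: powRN_anti => //; [exact: ltW | move: hr; lra].
  by rewrite /r1 -powRrM mulrNN mulVf ?gt_eqF // powRr1 // ltW.
apply: (@le_trans _ _ (e1 * 2 `^ d * \sum_(0 <= j < n) (1 + `|r - s j|) `^ (- (q - d)) +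
    A * b * \sum_(0 <= j < n) (1 + `|r - s j|) `^ (- q))).
  rewrite !mulr_sumr -big_split /=; apply: ler_sum => j _.
  have p1 : 0 < 1 + `|r - s j| by rewrite ltr_pwDl.
  have -> : (1 + `|r - s j|) `^ (- (q - d)) = (1 + `|r - s j|) `^ (- q) * (1 + `|r - s j|) `^ d.
    rewrite -powRD ?(gt_eqF p1) ?implybT //; congr (_ `^ _); ring.
  have h1 := aA j; have h2 := zeros_pow_le nu s hs d r j (ltW d0) (ltW r0).
  have h3 : r `^ (- d) * (1 + r) `^ d <= 2 `^ d.
    apply: (@le_trans _ _ (r `^ (- d) * (2 * r) `^ d)).
      rewrite ler_wpM2l ?powR_ge0 // ge0_ler_powR ?nnegrE ?(ltW d0) //; move: rr; lra.
    by rewrite (powRM _ _ (ltW r0)) // mulrCA powRN mulVf ?mulr1 // gt_eqF // powR_gt0.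
  have q1 := powR_ge0 r (- d); have q2 := powR_ge0 (1 + `|r - s j|) (- q); have q3 := powR_ge0 (1 + `|r - s j|) d.
  move: h1 h2 h3 rb q1 q2 q3.
  move: (r `^ (- d)) ((1 + r) `^ d) (2 `^ d) ((1 + `|r - s j|) `^ (- q)) ((1 + `|r - s j|) `^ d) (s j `^ d) `|a j|.
  move=> X Y Z U V W aj h1 h2 h3 rb q1 q2 q3.
  apply: (@le_trans _ _ (X * U * (e1 * (Y * V) + A))).
    by rewrite ler_wpM2l ?mulr_ge0 // (le_trans h1) // lerD2r ler_wpM2l // ltW.
  have -> : X * U * (e1 * (Y * V) + A) = (X * Y) * (e1 * (U * V)) + X * (A * U) by ring.
  have -> : e1 * Z * (U * V) + A * b * U = Z * (e1 * (U * V)) + b * (A * U) by ring.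
  have eUV : 0 <= e1 * (U * V) by rewrite (mulr_ge0 (ltW e10)) // mulr_ge0.
  by rewrite lerD // ler_wpM2r // mulr_ge0.
apply: (@le_trans _ _ (e1 * 2 `^ d * S + A * b * S)).
  apply: lerD; apply: ler_wpM2l.
  - by rewrite mulr_ge0 ?powR_ge0 // ltW.
  - by apply: HS; move: dq; lra.
  - by rewrite mulr_ge0 // ltW.
  - by apply: HS; move: dq d0; lra.
have -> : e1 * 2 `^ d * S = e / 2.
  by rewrite /e1; have := powR_gt0 d (ltr0Sn R 1); move: (2 `^ d) => Z Z0; field; rewrite !gt_eqF.
have : A * b * S <= e / 2.
  rewrite mulrAC /b mulrCA ler_piMr // ?(divr_ge0 (ltW e0)) //.
  by rewrite ler_pdivrMr ?mul1r ?lerDl // ltr_wpDl // mulr_ge0 // ltW.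
lra.
Qed.

End global_part.

Section convergence_at.
Context {R : realType}.
Variables (nu delta : R) (s : nat -> R) (f : R -> R).
Hypotheses (hnu : -1 < nu) (hs : bessel_zeros nu s) (d0 : 0 < delta).
Local Notation mu := (@lebesgue_measure R).
Local Notation w := (weight nu).
Local Notation I01 := (`]0%R, 1%R[%classic : set R).
Local Notation pj := (pj nu s).
Hypotheses (mf : measurable_fun I01 f) (fi : integ I01 (fun y => f y * w y)).
Hypothesis decay : forall e, 0 < e -> exists N, forall j, (N <= j)%N -> `|coef nu s f j| <= e * s j `^ delta.

Lemma bochner_rieszE r x : 0 < x -> bochner_riesz nu s delta f r x =
  limn (fun n => \sum_(0 <= j < n) (Mf delta (s j / r) * coef nu s f j * pj j x)).
Proof.
move=> x0; rewrite /bochner_riesz; congr (limn _); apply/funext => n; apply: eq_bigr => j _.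
by rewrite (psiE nu s hnu hs) // /Mf expr_div_n.
Qed.

Lemma bochner_riesz_fin r x N : 0 < r -> 0 < x -> (forall i, (N <= i)%N -> r <= s i) ->
  bochner_riesz nu s delta f r x = \sum_(0 <= j < N) (Mf delta (s j / r) * coef nu s f j * pj j x).
Proof.
move=> r0 x0 HN; rewrite bochner_rieszE //; apply/cvg_lim => //; apply: cvg_near_cst; exists N => // n /= Nn.
rewrite (big_cat_nat (n := N)) //= [X in _ + X]big_nat_cond [X in _ + X]big1 ?addr0 // => j.
move=> /andP[/andP[Nj _] _]; rewrite Mf_out ?mul0r // ger0_norm; last first.
  by rewrite divr_ge0 ?(ltW r0) // ltW // (s_gt0 _ _ hs).
by rewrite ler_pdivlMr // mul1r; exact: HN.
Qed.

Lemma s_above r : exists N, forall n, (N <= n)%N -> r <= s n.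
Proof. by have [N _ HN] := (cvgryPge _).1 (s_cvg nu s hnu hs) r; exists N => n /HN. Qed.

(** The mean at r is a finite sum, the local part an infinite series; beyond the last zero below r
    their partial sums differ by the error part alone, whose bound is uniform in the number of
    terms. *)
Lemma bochner_riesz_cvg x : 0 < x < 1 ->
  (forall eta, 0 < eta -> exists2 tau, 0 < tau &
    forall u, 0 < u < tau -> \int[mu]_(y in `]x - u, x + u[) `|f y - f x| <= eta * u) ->
  bochner_riesz nu s delta f r x @[r --> +oo] --> f x.
Proof.
move=> x01 lebx; have /andP[x0 x1] := x01.
have [B [a [CB [a0 CB0 B0 hB Bg]]]] := pj_growth nu s hnu hs.
(* Makes the order of the difference, 2(k+1), large enough for both the local series and the error
   sum. *)
pose k := Num.truncn (2 * a + 2 + 2 * delta).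
have hk : 2 * a + 2 + 2 * delta <= k.+1.*2%:R.
  by rewrite (le_trans (ltW (truncnS_gt _))) // ler_nat -addnn leq_addr.
have [K0 K1] := (prad_gt0 nu, prad_lt1 nu).
(* Keeps the cone within the radius of the Riemann function and inside ]0, 1[. *)
pose eps := Num.min (x * prad nu) (1 - x).
have e0 : 0 < eps by rewrite lt_min mulr_gt0 // subr_gt0.
have epx : eps <= x * prad nu by rewrite ge_min lexx.
have xe1 : x + eps <= 1 by rewrite addrC -lerBrDr ge_min lexx orbT.
have dk : delta <= k.+1.*2%:R by move: hk a0 d0; lra.
have [C1 [th [C10 cth thb hmul]]] := local_multiplier delta eps k.+1 d0 e0 dk.
have ka2 : 2 * a + 2 <= k.+1.*2%:R - delta by move: hk d0; lra.
have dq : delta + 2 <= k.+1.*2%:R - delta by move: hk a0 d0; lra.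
apply/cvgrPdist_le => e ep; have e2 : 0 < e / 2 by rewrite divr_gt0.
have [r1 r11 H1] := local_limit nu delta x eps th C1 k.+1 hnu d0 x0 e0 epx xe1 C10 cth thb hmul f mf fi a a0 ka2 lebx _ e2.
have [C2 C20 HC2] := psi_bound_away nu s hnu hs x x0.
have e3 : 0 < e / 2 / (C1 * C2) by rewrite !divr_gt0 // mulr_gt0.
have [r2 r21 H2] := global_small nu s hnu hs (coef nu s f) delta _ _ d0 dq decay e3.
near=> r; have r1r : r1 <= r by near: r; apply: nbhs_pinfty_ge; exact: num_real.
have r2r : r2 <= r by near: r; apply: nbhs_pinfty_ge; exact: num_real.
have rr : 1 <= r by exact: le_trans r1r.
have r0 : 0 < r by exact: lt_le_trans rr.
have S := local_series nu delta s x eps th C1 k.+1 hnu hs d0 x0 e0 epx xe1 C10 cth thb hmul f mf fi B a CB a0 B0 hB Bg ka2 r rr.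
have {}H1 := H1 r r1r; move: S H1; set L := ip _ _ _ => S H1.
have [N HN] := s_above r.
have D : `|bochner_riesz nu s delta f r x - L| <= e / 2.
  have C : `|bochner_riesz nu s delta f r x - \sum_(0 <= j < n) mloc delta eps th r (s j) * pj j x * coef nu s f j| @[n --> \oo] --> `|bochner_riesz nu s delta f r x - L|.
    by apply: cvg_norm; apply: cvgB => //; exact: cvg_cst.
  apply: (ler_cvg_to C (cvg_cst (e / 2))); exists N => // n /= Nn.
  rewrite (bochner_riesz_fin r x n r0 x0) => [|i ni]; last by apply: HN; exact: leq_trans ni.
  rewrite -sumrB (le_trans (ler_norm_sum _ _ _)) //.
  have -> : e / 2 = C1 * C2 * (e / 2 / (C1 * C2)) by field; rewrite !gt_eqF.
  have := H2 r n r2r; rewrite -(ler_pM2l (mulr_gt0 C10 C20)); apply: le_trans.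
  rewrite mulr_sumr; apply: ler_sum => j _.
  have hm := hmul r (s j) r0 (ltW (s_gt0 _ _ hs j)); have hp := HC2 j x.
  rewrite lexx (ltW x1) /= in hp; have {}hp := hp isT.
  rewrite -[delta - _]opprB in hm.
  rewrite -/(mloc delta eps th r (s j)) in hm; move: hm hp; rewrite -/(pj j x).
  move: (mloc _ _ _ _ _) (Mf _ _) (pj j x) (coef _ _ _ _) (r `^ _) ((1 + _) `^ _) => m M p c X Y hm hp.
  have -> : M * c * p - m * p * c = (M - m) * p * c by ring.
  have -> : C1 * C2 * (X * Y * `|c|) = C1 * (X * Y) * C2 * `|c| by ring.
  by rewrite !normrM ler_wpM2r // ler_pM.
rewrite distrC (_ : _ - _ = (bochner_riesz nu s delta f r x - L) + (L - f x)); last by rewrite subrKA.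
by apply: (le_trans (ler_normD _ _)); move: D H1; lra.
Unshelve. all: by end_near. Qed.

End convergence_at.

(** * Decay of the coefficients *)

Section coefficient_decay.
Context {R : realType}.
Variables (nu delta : R) (s : nat -> R) (f : R -> R).
Hypotheses (hnu : -1 < nu) (hs : bessel_zeros nu s) (d0 : 0 < delta).
Local Notation mu := (@lebesgue_measure R).
Local Notation w := (weight nu).
Local Notation I01 := (`]0%R, 1%R[%classic : set R).
Local Notation pj := (pj nu s).
Local Notation ka := (nu + 1 / 2).
Hypotheses (mf : measurable_fun I01 f) (fi : integ I01 (fun y => f y * w y)).

Let in01 y : I01 y -> 0 < y < 1. Proof. by rewrite /= in_itv. Qed.

Lemma small_tail (h : R -> R) e : integ I01 h -> (forall y, 0 <= h y) -> 0 < e ->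
  exists2 eta, 0 < eta < 1 & \int[mu]_(y in `]0, eta[) h y <= e.
Proof.
move=> ih h0 e0; pose a n : R := n.+2%:R^-1.
have a0 n : 0 < a n by rewrite invr_gt0.
have a1 n : a n < 1 by rewrite invf_lt1 // ltr1n.
have mh : measurable_fun I01 h by have /integrableP[/measurable_EFinP] := ih.
have ca : a n @[n --> \oo] --> (0 : R) by have := (@cvg_harmonic R); rewrite -cvg_shiftS.
have C : \int[mu]_(y in I01) ((h \_ (`]0, a n[%classic)) y) @[n --> \oo] --> \int[mu]_(y in I01) (0 : R).
  apply: (Rdominated_convergence I01 _ _ h) => //.
  - by move=> n; apply: measurable_restrict_sub.
  - apply: aeW => y /in01 /andP[y0 y1]; apply: cvg_near_cst.
    have /cvgrPdist_lt /(_ _ y0) := ca; apply: filterS => n; rewrite sub0r normrN gtr0_norm // => an.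
    by rewrite patchE memNset //= in_itv /= y0 /= ltNge (ltW an).
  - by move=> n y _; rewrite patchE; case: ifPn => _; rewrite ?normr0 // ger0_norm.
rewrite Rintegral_cst // mul0r in C.
have /cvgrPdist_lt /(_ _ e0) [N _ HN] := C; have := HN N (leqnn N).
rewrite /= sub0r normrN ger0_norm; last first.
  by apply: Rintegral_ge0 => y _; rewrite patchE; case: ifP.
move=> hN; exists (a N); first by rewrite a0 a1.
apply: le_trans (ltW hN); rewrite le_eqVlt; apply/orP; left; apply/eqP; symmetry.
rewrite (Rintegral_supp I01 `]0, a N[ _ (measurable_itv _) (measurable_itv _)).
- by apply: eq_Rintegral => y yE; rewrite patchE yE.
- by move=> y; rewrite /= !in_itv /= => /andP[-> h1]; exact: lt_trans (a1 N).
- by move=> y _ ny; rewrite patchE memNset.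
Qed.

Let T j y := `|f y| * `|pj j y| * w y.

Let T0 j y : 0 <= T j y.
Proof. exact: (mulr_ge0 (mulr_ge0 (normr_ge0 _) (normr_ge0 _)) (powR_ge0 _ _)). Qed.

Let Tle j y c : `|pj j y| <= c -> `|T j y| <= c * (`|f y| * w y).
Proof.
move=> h; rewrite (ger0_norm (T0 j y)) /T mulrAC mulrC ler_wpM2r //.
exact: (mulr_ge0 (normr_ge0 _) (powR_ge0 _ _)).
Qed.

Let mT j : measurable_fun I01 (T j).
Proof.
have /bmP[mp _] : bm (pj j) by apply: bm_continuous; exact: pj_cont.
apply: measurable_funM; last exact: weight_measurable.
by apply: measurable_funM; apply: measurableT_comp.
Qed.

Let iaf : integ I01 (fun y => `|f y| * w y).
Proof.
have := integrable_norm fi; congr (integrable _ _ _); apply/funext => y /=.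
by rewrite normrM (ger0_norm (powR_ge0 _ _)).
Qed.

Let iT j : integ I01 (T j).
Proof.
have /bmP[mp [C HC]] : bm (pj j) by apply: bm_continuous; exact: pj_cont.
apply: (integ_le _ _ (fun y => C * (`|f y| * w y))) => //.
- by move=> y /in01 /HC h; exact: Tle.
- exact: (@integrableZl _ _ _ mu _ (measurable_itv _) C (EFin \o (fun y => `|f y| * w y))).
Qed.

(* Away from the origin the [psi_j] are uniformly bounded. *)
Lemma decay_near0 : (forall e, 0 < e -> exists2 eta, 0 < eta < 1 &
    forall j, \int[mu]_(y in `]0, eta[) (`|f y| * `|pj j y| * w y) <= e * s j `^ delta) ->
  forall e, 0 < e -> exists N, forall j, (N <= j)%N -> `|coef nu s f j| <= e * s j `^ delta.
Proof.
move=> H e e0; have e2 : 0 < e / 2 by rewrite divr_gt0.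
have [eta /andP[h0 h1] Hn] := H _ e2.
have [C C0 HC] := psi_bound_away nu s hnu hs eta h0.
pose F := \int[mu]_(y in I01) (`|f y| * w y).
have F0 : 0 <= F by apply: Rintegral_ge0 => y _; rewrite mulr_ge0 ?powR_ge0.
pose b := C * F / (e / 2) + 1.
have b0 : 0 < b by rewrite ltr_wpDl // divr_ge0 ?(ltW e2) // mulr_ge0 // ltW.
have [N _ HN] := (cvgryPge _).1 (s_cvg nu s hnu hs) (b `^ delta^-1).
exists N => j Nj; have sb := HN j Nj; rewrite /= in sb.
have sub : (`]0, eta[%classic : set R) `<=` I01.
  by move=> y; rewrite /= !in_itv /= => /andP[-> h]; exact: lt_trans h1.
have ir : integ I01 (T j \_ `]0, eta[%classic).
  apply: (integ_le _ _ (T j)) => //.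
  - by apply: measurable_restrict_sub.
  - by move=> y _; rewrite patchE; case: ifP => _; rewrite ?normr0 // ger0_norm.
have iC : integ I01 (fun y => C * (`|f y| * w y)).
  exact: (@integrableZl _ _ _ mu _ (measurable_itv _) C (EFin \o (fun y => `|f y| * w y))).
have iD : integ I01 (fun y => (T j \_ `]0, eta[%classic) y + C * (`|f y| * w y)).
  exact: (@integrableD _ _ _ mu _ (measurable_itv _) (EFin \o (T j \_ `]0, eta[%classic)) (EFin \o (fun y => C * (`|f y| * w y)))).
rewrite (coefE nu s hnu hs).
have m1 : measurable_fun I01 (fun y => f y * pj j y * w y).
  have /bmP[mp _] : bm (pj j) by apply: bm_continuous; exact: pj_cont.
  by apply: measurable_funM; [exact: measurable_funM | exact: weight_measurable].
have bnd y : I01 y -> `|f y * pj j y * w y| <= (T j \_ `]0, eta[%classic) y + C * (`|f y| * w y).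
  move=> Iy; have /andP[y0 y1] := in01 y Iy; have wy := powR_ge0 y (2 * nu + 1).
  have nT : `|f y * pj j y * w y| = T j y by rewrite /T (normrM _ (w y)) (normrM (f y)) (ger0_norm wy).
  rewrite nT patchE; case: ifPn => [_|].
    by rewrite lerDl mulr_ge0 ?(ltW C0) // mulr_ge0.
  rewrite notin_setE /= in_itv /= y0 /= => /negP; rewrite -leNgt => ey.
  rewrite add0r -nT -[leLHS]normr_id nT; apply: Tle.
  by apply: HC; rewrite ey ltW.
apply: (le_trans (norm_Rintegral_le I01 _ _ (measurable_itv _) m1 bnd iD)).
rewrite (@RintegralD _ _ _ mu I01 _ _ (measurable_itv _) ir iC) (@RintegralZl _ _ _ mu _ _ _ (measurable_itv _) iaf) -/F.
have -> : e * s j `^ delta = e / 2 * s j `^ delta + e / 2 * s j `^ delta by field.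
apply: lerD.
  rewrite (Rintegral_supp I01 `]0, eta[ _ (measurable_itv _) (measurable_itv _) sub).
    by rewrite (_ : Rintegral _ _ _ = \int[mu]_(y in `]0, eta[) T j y) ?Hn //; apply: eq_Rintegral => y yE; rewrite patchE yE.
  by move=> y _ ny; rewrite patchE memNset.
rewrite [leRHS]mulrC -ler_pdivrMr //; apply: (@le_trans _ _ b); first by rewrite /b lerDl.
apply: (@le_trans _ _ ((b `^ delta^-1) `^ delta)).
  by rewrite -powRrM mulVf ?gt_eqF // powRr1 // ltW.
by rewrite ge0_ler_powR ?nnegrE ?powR_ge0 ?(ltW d0) // ltW // (s_gt0 _ _ hs).
Qed.

(** Here sup |psi_j| = O(s_j^delta), and the mass of |f| w near 0 is small. *)
Lemma decay_easy : ka <= delta -> forall e, 0 < e -> exists2 eta, 0 < eta < 1 &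
    forall j, \int[mu]_(y in `]0, eta[) (`|f y| * `|pj j y| * w y) <= e * s j `^ delta.
Proof.
move=> kd e e0; have [C C0 HC] := psi_bound_unif nu s hnu hs.
have s00 := s_gt0 _ _ hs 0.
pose M := C * (s 0%N `^ (ka - delta) + s 0%N `^ (- delta)).
have M0 : 0 < M by rewrite mulr_gt0 // addr_gt0 // powR_gt0.
have [eta /andP[h0 h1] H] := small_tail _ _ iaf (fun y => mulr_ge0 (normr_ge0 (f y)) (powR_ge0 _ _)) (divr_gt0 e0 M0).
exists eta; first by rewrite h0.
move=> j; have s0 := s_gt0 _ _ hs j.
have sub : (`]0, eta[%classic : set R) `<=` I01.
  by move=> y; rewrite /= !in_itv /= => /andP[-> h]; exact: lt_trans h1.
have i1 : integ `]0, eta[ (fun y => `|f y| * w y) by apply: integrableS iaf.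
have B y : I01 y -> `|pj j y| <= M * s j `^ delta.
  move=> /in01 /andP[y0 y1]; apply: (@le_trans _ _ (C * (s j `^ ka + 1))); first by apply: HC; rewrite !ltW.
  rewrite /M -mulrA ler_wpM2l ?(ltW C0) // mulrDl lerD //.
    have -> : s j `^ ka = s j `^ (- (delta - ka)) * s j `^ delta.
      by rewrite -powRD ?(gt_eqF s0) ?implybT //; congr (_ `^ _); ring.
    rewrite ler_wpM2r ?powR_ge0 // -(opprB delta); apply: powRN_anti => //; first by rewrite subr_ge0.
    exact: (s_le nu s hs).
  rewrite powRN mulrC ler_pdivlMr ?powR_gt0 // mul1r.
  by rewrite ge0_ler_powR ?nnegrE ?(ltW d0) ?(ltW s00) ?(ltW s0) // (s_le nu s hs).
have mT2 : measurable_fun (`]0, eta[%classic : set R) (T j) by apply: measurable_funS (mT j).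
apply: (le_trans (ler_norm _)).
have b2 y : `]0, eta[%classic y -> `|T j y| <= M * s j `^ delta * (`|f y| * w y).
  by move=> /sub Iy; apply: Tle; exact: B.
have i2 : integ `]0, eta[ (fun y => M * s j `^ delta * (`|f y| * w y)).
  exact: (@integrableZl _ _ _ mu _ (measurable_itv _) (M * s j `^ delta) (EFin \o (fun y => `|f y| * w y))).
apply: (le_trans (norm_Rintegral_le _ _ _ (measurable_itv _) mT2 b2 i2)).
rewrite (@RintegralZl _ _ _ mu _ _ _ (measurable_itv _) i1).
have h := ler_wpM2l (mulr_ge0 (ltW M0) (powR_ge0 (s j) delta)) H.
apply: (le_trans h); rewrite le_eqVlt; apply/orP; left; apply/eqP.
by move: M0; clearbody M; move: (s j `^ delta) => S M0; field; rewrite gt_eqF.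
Qed.

(** Young's inequality with exponents P = p_0 and Q, applied to |f| and |psi_j| s_j^(-delta). The
    Q-part is bounded uniformly in j by scaling and made small by the Young parameter; the P-part is
    then made small by the choice of eta. *)
Lemma decay_hard : delta < ka -> integ I01 (fun y => `|f y| `^ (p0 nu delta) * w y) ->
  forall e, 0 < e -> exists2 eta, 0 < eta < 1 &
    forall j, \int[mu]_(y in `]0, eta[) (`|f y| * `|pj j y| * w y) <= e * s j `^ delta.
Proof.
move=> dk; set P := p0 nu delta => iP e e0.
have PE : P = (4 * (nu + 1)) / (2 * nu + 3 + 2 * delta).
  rewrite /P /p0 ifF //; apply/negbTE; rewrite negb_or -!leNgt -ltNge (ltW dk) /=.
  by move: d0 dk; lra.
have c0 : 0 < ka - delta by rewrite subr_gt0.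
have b0 : 0 < 2 * nu + 3 + 2 * delta by move: hnu d0; lra.
have n0 : 0 < 2 * nu + 2 by move: hnu; lra.
(* The exponent conjugate to p_0, chosen by scaling: s^((nu+1/2-delta) Q) cancels the s^(-(2 nu +
   2)) produced by substituting s y in the weighted measure. *)
pose Q := (2 * nu + 2) / (ka - delta).
have P0 : 0 < P by rewrite PE divr_gt0 // mulr_gt0 //; move: hnu; lra.
have Q0 : 0 < Q by rewrite divr_gt0.
have PQ : P^-1 + Q^-1 = 1.
  by rewrite PE /Q !invf_div; field; rewrite !gt_eqF //; move: hnu; lra.
have P1 : P^-1 <= 1 by rewrite -PQ lerDl invr_ge0 ltW.
have Q1 : Q^-1 <= 1 by rewrite -PQ lerDr invr_ge0 ltW.
have cQ : (ka - delta) * Q = 2 * nu + 2 by rewrite /Q mulrC divfK // gt_eqF.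
have [C C0 HC] := psi_bound nu s hnu hs.
pose A := C `^ Q * (delta * Q)^-1 + 1.
have dQ : 0 < delta * Q by rewrite mulr_gt0.
have A0 : 0 < A by rewrite ltr_wpDl // mulr_ge0 ?powR_ge0 // invr_ge0 ltW.
(* Fixed before eta and independently of j, so that the Q-part costs at most e/2. *)
pose la := (e / 2 / A) `^ (- Q^-1).
have la0 : 0 < la by rewrite powR_gt0 // !divr_gt0.
have laQ : la `^ (- Q) * A = e / 2.
  rewrite /la -powRrM mulrNN mulVf ?gt_eqF // powRr1 ?divfK ?gt_eqF //.
  by rewrite !divr_ge0 // ltW.
have iP' : integ I01 (fun y => la `^ P * (`|f y| `^ P * w y)).
  exact: (@integrableZl _ _ _ mu _ (measurable_itv _) (la `^ P) (EFin \o (fun y => `|f y| `^ P * w y))).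
have e2 : 0 < e / 2 by rewrite divr_gt0.
have [eta /andP[h0 h1] H] := small_tail _ _ iP' (fun y => mulr_ge0 (powR_ge0 _ _) (mulr_ge0 (powR_ge0 _ _) (powR_ge0 _ _))) e2.
exists eta; first by rewrite h0.
move=> j; have s0 := s_gt0 _ _ hs j.
have sub : (`]0, eta[%classic : set R) `<=` I01.
  by move=> y; rewrite /= !in_itv /= => /andP[-> h]; exact: lt_trans h1.
have sd0 : 0 < s j `^ delta by rewrite powR_gt0.
pose G y := la `^ P * (`|f y| `^ P * w y) + la `^ (- Q) * (C `^ Q * peak (delta * Q) (s j) y).
have bnd y : `]0, eta[%classic y -> `|T j y| <= s j `^ delta * G y.
  move=> Iy; have /andP[y0 y1] := in01 y (sub y Iy); rewrite (ger0_norm (T0 j y)).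
  have p1 := peak_base (s j) y s0 (ltW y0); have p0' := lt_le_trans ltr01 p1.
  have hp := HC j y (ltW y0); rewrite -/(pj j y) in hp.
  pose g := `|pj j y| / s j `^ delta.
  have g0 : 0 <= g by rewrite divr_ge0 // ltW.
  have gE : `|pj j y| = g * s j `^ delta by rewrite /g divfK // gt_eqF.
  have Y : `|f y| * g <= la `^ P * `|f y| `^ P + la `^ (- Q) * g `^ Q.
    have -> : `|f y| * g = (la * `|f y|) * (la^-1 * g) by rewrite mulrACA divff ?mul1r // gt_eqF.
    have la' : 0 <= la^-1 by rewrite invr_ge0 ltW.
    apply: (le_trans (conjugate_powR (mulr_ge0 (ltW la0) (normr_ge0 _)) (mulr_ge0 la' g0) P0 Q0 PQ)).
    rewrite (powRM _ (ltW la0) (normr_ge0 _)) (powRM _ la' g0) (powRV la Q la0).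
    by apply: lerD; rewrite ler_piMr // !mulr_ge0 ?powR_ge0.
  (* After scaling, g^Q w is bounded by a peak of height s_j and decay exponent 1 + delta Q, whose
     integral is at most 1/(delta Q) for every j. *)
  have gQ : g `^ Q * w y <= C `^ Q * peak (delta * Q) (s j) y.
    have h : g <= C * (s j `^ (ka - delta) * (1 + s j * y) `^ (- ka)).
      rewrite ler_pdivrMr // (le_trans hp) //.
      rewrite (powRM _ (ltW s0)) ?invr_ge0 ?(ltW p0') // (powRV _ ka p0').
      have -> : s j `^ ka = s j `^ (ka - delta) * s j `^ delta.
        by rewrite -powRD ?(gt_eqF s0) ?implybT // subrK.
      by rewrite le_eqVlt; apply/orP; left; apply/eqP; ring.
    have X0 := powR_ge0 (s j) (ka - delta); have X1 := powR_ge0 (1 + s j * y) (- ka).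
    have X2 := mulr_ge0 X0 X1.
    apply: (@le_trans _ _ ((C * (s j `^ (ka - delta) * (1 + s j * y) `^ (- ka))) `^ Q * w y)).
      by rewrite ler_wpM2r ?powR_ge0 // ge0_ler_powR ?nnegrE ?(ltW Q0) // mulr_ge0 // ltW.
    rewrite (powRM _ (ltW C0) X2) (powRM _ X0 X1) -!powRrM cQ -!mulrA ler_wpM2l ?powR_ge0 //.
    rewrite /peak /weight.
    have -> : s j `^ (2 * nu + 2) = s j * s j `^ (2 * nu + 1).
      rewrite -{2}(powRr1 (ltW s0)) -powRD ?(gt_eqF s0) ?implybT //; congr (_ `^ _); ring.
    rewrite -mulrA ler_wpM2l ?(ltW s0) // mulrCA -(powRM _ (ltW s0) (ltW y0)).
    have kE : (1 + s j * y) `^ (- (1 + delta * Q)) = (1 + s j * y) `^ (- ka * Q) * (1 + s j * y) `^ (2 * nu + 1).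
      rewrite -powRD ?(gt_eqF p0') ?implybT //; congr (_ `^ _).
      by move: cQ; lra.
    rewrite kE ler_wpM2l ?powR_ge0 // ge0_ler_powR ?nnegrE ?(ltW p0') ?mulr_ge0 ?(ltW s0) ?(ltW y0) //.
      by move: d0 dk; lra.
    by rewrite lerDr.
  rewrite /T gE (_ : _ * _ * _ = s j `^ delta * (`|f y| * g * w y)); last by ring.
  rewrite ler_wpM2l ?(ltW sd0) //; have wy := powR_ge0 y (2 * nu + 1).
  apply: (le_trans (ler_wpM2r wy Y)); rewrite mulrDl /G -!mulrA lerD2l.
  by rewrite ler_wpM2l ?powR_ge0.
have mT2 : measurable_fun (`]0, eta[%classic : set R) (T j) by apply: measurable_funS (mT j).
have j1 : integ `]0, eta[ (fun y => la `^ P * (`|f y| `^ P * w y)) by apply: integrableS iP'.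
have jb : integ `]0, eta[ (peak (delta * Q) (s j)).
  by apply: integ_oo; apply: continuous_in_integ => [|t /andP[h _]]; [exact: ltW | exact: peak_cont].
have jb1 : integ `]0, eta[ (fun y => C `^ Q * peak (delta * Q) (s j) y).
  exact: (@integrableZl _ _ _ mu _ (measurable_itv _) (C `^ Q) (EFin \o peak (delta * Q) (s j))).
have j2 : integ `]0, eta[ (fun y => la `^ (- Q) * (C `^ Q * peak (delta * Q) (s j) y)).
  exact: (@integrableZl _ _ _ mu _ (measurable_itv _) (la `^ (- Q)) (EFin \o (fun y => C `^ Q * peak (delta * Q) (s j) y))).
have jG : integ `]0, eta[ G.
  exact: (@integrableD _ _ _ mu _ (measurable_itv _) (EFin \o (fun y => la `^ P * (`|f y| `^ P * w y))) (EFin \o (fun y => la `^ (- Q) * (C `^ Q * peak (delta * Q) (s j) y)))).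
have jsG : integ `]0, eta[ (fun y => s j `^ delta * G y).
  exact: (@integrableZl _ _ _ mu _ (measurable_itv _) (s j `^ delta) (EFin \o G)).
apply: (le_trans (ler_norm _)).
apply: (le_trans (norm_Rintegral_le _ _ _ (measurable_itv _) mT2 bnd jsG)).
rewrite (@RintegralZl _ _ _ mu _ _ _ (measurable_itv _) jG) mulrC ler_wpM2r ?(ltW sd0) //.
rewrite (@RintegralD _ _ _ mu _ _ _ (measurable_itv _) j1 j2).
rewrite (@RintegralZl _ _ _ mu _ (fun y => C `^ Q * peak (delta * Q) (s j) y) _ (measurable_itv _) jb1).
rewrite (@RintegralZl _ _ _ mu _ _ _ (measurable_itv _) jb).
have B := peak_integral (delta * Q) (s j) eta dQ s0 h0.
have : la `^ (- Q) * (C `^ Q * \int[mu]_(x in `]0, eta[) peak (delta * Q) (s j) x) <= e / 2.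
  rewrite -laQ ler_wpM2l ?powR_ge0 // (@le_trans _ _ (C `^ Q * (delta * Q)^-1)) // ?ler_wpM2l ?powR_ge0 //.
  by rewrite /A lerDl.
by move: H; lra.
Qed.

End coefficient_decay.

Section sufficiency.
Context {R : realType}.
Variables (nu delta p : R) (s : nat -> R) (f : R -> R).
Hypotheses (hnu : -1 < nu) (hs : bessel_zeros nu s) (d0 : 0 < delta) (p1 : 1 <= p).
Local Notation mu := (@lebesgue_measure R).
Local Notation w := (weight nu).
Local Notation I01 := (`]0%R, 1%R[%classic : set R).
Hypothesis (hf : in_Lp_mu nu p f).

Lemma measurable_powR_norm q : measurable_fun I01 (fun y => `|f y| `^ q * w y).
Proof.
apply: measurable_funM; last exact: weight_measurable.
apply: (measurableT_comp (measurable_powR q)); apply: measurableT_comp => //; exact: hf.1.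
Qed.

Lemma Lp_integ q : 0 <= q <= p -> integ I01 (fun y => `|f y| `^ q * w y).
Proof.
move=> /andP[q0 qp].
have ip : integ I01 (fun y => `|f y| `^ p * w y).
  apply/integrableP; split; first by apply/measurable_EFinP; exact: measurable_powR_norm.
  apply: le_lt_trans hf.2; rewrite le_eqVlt; apply/orP; left; apply/eqP.
  apply: eq_integral => y _ /=; rewrite ger0_norm // mulr_ge0 ?powR_ge0 //.
apply: (integ_le _ _ (fun y => w y + `|f y| `^ p * w y)) => //.
- exact: measurable_powR_norm.
- move=> y _; have wy := powR_ge0 y (2 * nu + 1).
  rewrite (ger0_norm (mulr_ge0 (powR_ge0 _ _) wy)) -[X in _ <= X + _]mul1r -mulrDl ler_wpM2r //.
  have [f1|f1] := leP 1 `|f y|.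
    by rewrite ler_wpDl // ler_powR.
  have h : `|f y| `^ q <= 1 `^ q by rewrite ge0_ler_powR ?nnegrE // ltW.
  by rewrite powR1 in h; rewrite ler_wpDr ?powR_ge0.
- exact: (@integrableD _ _ _ mu _ (measurable_itv _) (EFin \o w) (EFin \o (fun y => `|f y| `^ p * w y)) (weight_integrable nu hnu) ip).
Qed.

Lemma sufficiency : p0 nu delta <= p ->
  {ae mu, forall x, x \in `]0, 1[ -> bochner_riesz nu s delta f r x @[r --> +oo] --> f x}.
Proof.
move=> hp; have mf := hf.1.
have fi : integ I01 (fun y => f y * w y).
  apply: (integ_le _ _ (fun y => `|f y| `^ 1 * w y)) => //.
  - by apply: measurable_funM => //; exact: weight_measurable.
  - by move=> y _; rewrite normrM (ger0_norm (powR_ge0 _ _)) powRr1.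
  - by apply: Lp_integ; rewrite ler01.
have decay : forall e, 0 < e -> exists N, forall j, (N <= j)%N -> `|coef nu s f j| <= e * s j `^ delta.
  apply: decay_near0 => //; have [kd|dk] := leP (nu + 1 / 2) delta; first exact: decay_easy.
  apply: decay_hard => //; apply: Lp_integ; rewrite hp andbT /p0; case: ifP => // _.
  by rewrite divr_ge0 ?mulr_ge0 //; move: hnu d0 dk; lra.
apply: ae_imp (ae_lebesgue nu f mf fi) => x H; rewrite in_itv /= => x01.
by apply: bochner_riesz_cvg => //; exact: H.
Qed.

End sufficiency.

(** * Riesz' theorem and the counterexample *)

Section truncated_powers.
Context {R : realType}.
Local Notation mu := (@lebesgue_measure R).
Implicit Types (a be d h l t u v x y T : R) (K n : nat).

Definition ppow a x := Num.max x 0 `^ a.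

Lemma ppow_cont a x : 0 < a -> {for x, continuous (ppow a)}.
Proof. exact: maxpow_cont. Qed.

Lemma ppow_ge0 a x : 0 <= ppow a x. Proof. exact: powR_ge0. Qed.

Lemma ppow_in a x : 0 <= x -> ppow a x = x `^ a.
Proof. by move=> x0; rewrite /ppow max_l. Qed.

Lemma ppow_out a x : 0 < a -> x <= 0 -> ppow a x = 0.
Proof. by move=> a0 x0; rewrite /ppow max_r // powR0 // gt_eqF. Qed.

Lemma ppow_comp_cont a (f : R -> R) x : 0 < a -> {for x, continuous f} -> {for x, continuous (fun y => ppow a (f y))}.
Proof. by move=> a0 cf; apply: (ccomp (ppow a) f) => //; exact: ppow_cont. Qed.

Definition beta_int be d := \int[mu]_(u in `]0, 1[) (ppow be u * ppow d (1 - u)).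

Let beta_cont be d x : 0 < be -> 0 < d -> {for x, continuous (fun u => ppow be u * ppow d (1 - u))}.
Proof. by move=> b0 d0; apply: cM; [exact: ppow_cont | apply: ppow_comp_cont => //; cont]. Qed.

Lemma beta_int_gt0 be d : 0 < be -> 0 < d -> 0 < beta_int be d.
Proof.
move=> b0 d0; have q : 0 < 4^-1 :> R by rewrite invr_gt0.
apply: (@Rintegral_gt0 _ _ _ 4^-1 (1 - 4^-1) (4^-1 `^ be * 4^-1 `^ d)).
- exact: measurable_itv.
- lra.
- by rewrite mulr_gt0 ?powR_gt0.
- by move=> x; rewrite /= !in_itv /= => /andP[h1 h2]; apply/andP; split; lra.
- by move=> x _; rewrite mulr_ge0 ?ppow_ge0.
- move=> x /andP[h1 h2]; have [x0 x1] : 0 <= x /\ 0 <= 1 - x by split; lra.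
  rewrite !ppow_in // ler_pM ?powR_ge0 // ge0_ler_powR ?nnegrE ?(ltW b0) ?(ltW d0) ?(ltW q) //; lra.
- by apply: continuous_integ_oo => x; exact: beta_cont.
Qed.

(** Euler's Beta integral: the convolution of truncated powers of exponents be and d is a multiple
    of the one of exponent be + d + 1, after rescaling the overlap interval to ]0, 1[. *)
Lemma beta_conv be d T t l : 0 < be -> 0 < d -> 0 <= l -> t <= T ->
  \int[mu]_(v in `]0, T[) (ppow be (t - T + v) * ppow d (T - v - l)) = beta_int be d * ppow (be + d + 1) (t - l).
Proof.
move=> b0 d0 l0 tT.
have [tl|lt] := leP t l.
  rewrite [X in _ = _ * X]ppow_out ?subr_le0 //; last by rewrite !addr_gt0.
  rewrite mulr0 (_ : Rintegral _ _ _ = \int[mu]_(v in `]0, T[) (0 : R)); last first.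
    apply: eq_Rintegral => v _; have [vt|tv] := leP v (T - t).
      by rewrite ppow_out ?mul0r //; lra.
    by rewrite [X in _ * X]ppow_out ?mulr0 //; lra.
  by rewrite Rintegral_cst // mul0r.
rewrite (Rintegral_supp `]0, T[ `]T - t, T - l[ _ (measurable_itv _) (measurable_itv _)); last 2 first.
- by move=> v; rewrite /= !in_itv /= => /andP[h1 h2]; apply/andP; split; lra.
- move=> v _; rewrite /= in_itv /= => /negP; rewrite negb_and -!leNgt => /orP[h|h].
    by rewrite ppow_out ?mul0r //; lra.
  by rewrite [X in _ * X]ppow_out ?mulr0 //; lra.
have a0 : 0 < t - l by rewrite subr_gt0.
pose F v := ppow be (t - T + v) * ppow d (T - v - l).
have cF v : {for v, continuous F} by apply: (cM (fun v => ppow be (t - T + v)) (fun v => ppow d (T - v - l))); [apply: (ppow_comp_cont be (fun v => t - T + v)) | apply: (ppow_comp_cont d (fun v => T - v - l))] => //; cont.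
have := Rintegral_affine F (t - l) (T - t) 0 1 a0 ltr01 cF.
rewrite mulr0 add0r mulr1 (_ : t - l + (T - t) = T - l); last by ring.
move=> ->.
have -> : \int[mu]_(x in `]0, 1[) F ((t - l) * x + (T - t)) = \int[mu]_(x in `]0, 1[) ((t - l) `^ (be + d) * (ppow be x * ppow d (1 - x))).
  apply: eq_Rintegral => u /set_mem; rewrite /= in_itv /= => /andP[u0 u1].
  have u1' : 0 <= 1 - u by rewrite subr_ge0 ltW.
  rewrite /F (_ : t - T + _ = (t - l) * u); last by ring.
  rewrite (_ : T - _ - l = (t - l) * (1 - u)); last by ring.
  rewrite (ppow_in be _ (mulr_ge0 (ltW a0) (ltW u0))) (ppow_in d _ (mulr_ge0 (ltW a0) u1')) !ppow_in // ?(ltW u0) //.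
  rewrite (powRM _ (ltW a0) (ltW u0)) (powRM _ (ltW a0) u1') powRD ?(gt_eqF a0) ?implybT //; ring.
rewrite (@RintegralZl _ _ _ mu _ _ _ (measurable_itv _)); last by apply: continuous_integ_oo => x; exact: beta_cont.
rewrite (ppow_in _ _ (ltW a0)) -/(beta_int be d) [(t - l) `^ (be + d + 1)]powRD ?(gt_eqF a0) ?implybT // (powRr1 (ltW a0)); ring.
Qed.

Lemma fd_poly K h l x : 0 <= h -> fd K.+1 h (fun y => (y - l) ^+ K) x = 0.
Proof.
move=> h0; pose F k y : R := (K ^_ k)%:R * (y - l) ^+ (K - k).
have -> : fd K.+1 h (fun y => (y - l) ^+ K) x = fd K.+1 h (F 0%N) x.
  by congr (fd _ _ _ _); apply/funext => y; rewrite /F ffactn0 subn0 mul1r.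
apply/eqP; rewrite -normr_le0 (le_trans (fd_bound K.+1 h F x 0 h0 _ _)) ?mulr0 //.
- move=> k y kK _; rewrite /F; eapply is_derive_val; first by der.
  rewrite ffactnSr natrM -subn1 -subnDA addn1.
  move: ((y - l) ^+ _) => P; ring.
- by move=> y _; rewrite /F ffact_small ?ltnSn // mul0r normr0.
Qed.

(** The rightmost node is l + h and the next one l - h, so a single term of the difference survives
    truncation at l. *)
Lemma fd_top K h l x : 0 < h -> x + K.+1%:R * h = l + h -> (0 < K)%N ->
  fd K.+1 h (fun y => ppow K%:R (y - l)) x = h ^+ K.
Proof.
move=> h0 xE K0; rewrite fdE big_ord_recl /= bin0 expr0 !mul1r mulr0 subr0 xE (_ : l + h - l = h); last by ring.
rewrite (ppow_in _ _ (ltW h0)) powR_mulrn ?(ltW h0) // big1 ?addr0 // => i _.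
rewrite ppow_out ?mulr0 ?ltr0n //.
have -> : x + (K.+1%:R - 2 * (bump 0 i)%:R) * h - l = h - 2 * (bump 0 i)%:R * h.
  by rewrite mulrBl addrA xE; ring.
rewrite /bump /= add1n -[i.+1%:R]natr1; have : 0 <= i%:R * h by rewrite mulr_ge0 // ltW.
by rewrite mulrDr mulrDl mulr1 -mulrA; lra.
Qed.

(** The centre v - K h makes v the rightmost node. Up to distance 3 K h from the singular point 0
    the size h^be suffices; beyond it all nodes are positive and the K-th derivative decays. *)
Lemma fd_ppow_bound be K : 0 < be -> be <= K%:R -> exists2 C, 0 < C & forall h v, 0 < h -> 0 < v ->
  `|fd K h (ppow be) (v - K%:R * h)| <= C * (h `^ be * (1 + v / h) `^ (be - K%:R)).
Proof.
move=> b0 bK; have [C1 C10 H1] := pow_fd be K bK.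
pose q := K%:R - be; have q0 : 0 <= q by rewrite subr_ge0.
have K1 : 1 <= K%:R :> R by rewrite ler1n -(ltr0n R); exact: lt_le_trans bK.
pose C2 := 2 ^+ K * (3 * K%:R) `^ be * (1 + 3 * K%:R) `^ q.
have C20 : 0 <= C2 by rewrite !mulr_ge0 ?powR_ge0 // exprn_ge0.
exists (C1 * 2 `^ q + C2); first by rewrite ltr_wpDr // mulr_gt0 // powR_gt0.
move=> h v h0 v0; have -> : be - K%:R = - q by rewrite opprB.
have vh : 0 < 1 + v / h by rewrite addr_gt0 // divr_gt0.
have P0 : 0 <= h `^ be * (1 + v / h) `^ (- q) by rewrite mulr_ge0 ?powR_ge0.
rewrite mulrDl; have Kh : h <= K%:R * h by rewrite ler_peMl // ltW.
have [hv|hv] := leP (3 * K%:R * h) v.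
  rewrite ler_wpDr ?(mulr_ge0 C20 P0) //.
  have u0 : 0 < v - K%:R * h by move: hv h0; rewrite -mulrA; lra.
  have hu : 2 * K%:R * h <= v - K%:R * h by move: hv; rewrite -!mulrA; lra.
  rewrite (fd_ext K h _ (fun y => y `^ be) _ (ltW h0)); last first.
    by move=> y /andP[hy _]; rewrite ppow_in //; move: hy hu h0; rewrite -mulrA; lra.
  apply: (le_trans (H1 _ h h0 u0 hu)); rewrite -mulrA ler_wpM2l ?(ltW C10) //.
  have -> : be - K%:R = - q by rewrite opprB.
  have c : 0 < h / 2 * (1 + v / h) by rewrite mulr_gt0 // divr_gt0.
  have hc : h / 2 * (1 + v / h) <= v - K%:R * h.
    have -> : h / 2 * (1 + v / h) = (h + v) / 2 by field; rewrite gt_eqF.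
    by move: hv Kh; rewrite -!mulrA; lra.
  apply: (@le_trans _ _ (h ^+ K * (h / 2 * (1 + v / h)) `^ (- q))).
    by rewrite ler_wpM2l ?exprn_ge0 ?(ltW h0) //; apply: powRN_anti.
  rewrite (powRM _ _ (ltW vh)) ?divr_ge0 ?(ltW h0) // (powRM _ (ltW h0)) ?invr_ge0 //.
  rewrite (powRV 2) // opprK -powR_mulrn ?(ltW h0) //.
  have -> : h `^ be = h `^ K%:R * h `^ (- q).
    rewrite -powRD ?(gt_eqF h0) ?implybT //; congr (_ `^ _); rewrite /q; ring.
  by rewrite le_eqVlt; apply/orP; left; apply/eqP; ring.
rewrite ler_wpDl ?(mulr_ge0 _ P0) ?mulr_ge0 ?powR_ge0 ?(ltW C10) //.
apply: (le_trans (fd_trivial K h _ _ ((3 * K%:R) `^ be * h `^ be) (ltW h0) _)).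
  move=> y /andP[_ hy]; rewrite (ger0_norm (ppow_ge0 _ _)) -(powRM _ _ (ltW h0)) ?mulr_ge0 //.
  rewrite ge0_ler_powR ?nnegrE ?(ltW b0) ?le_max ?lexx ?orbT ?mulr_ge0 ?(ltW h0) //.
  by rewrite ge_max; apply/andP; split; [move: hy hv; lra | rewrite !mulr_ge0 // ltW].
rewrite /C2; have h2 : 1 <= (1 + 3 * K%:R) `^ q * (1 + v / h) `^ (- q).
  rewrite [X in _ * X]powRN ler_pdivlMr ?powR_gt0 // mul1r (ge0_ler_powR q0) ?nnegrE ?(ltW vh) ?addr_ge0 ?mulr_ge0 //.
  by rewrite lerD2l ler_pdivrMr // ltW.
have X0 : 0 <= 2 ^+ K * ((3 * K%:R) `^ be * h `^ be) by rewrite mulr_ge0 ?exprn_ge0 // mulr_ge0 ?powR_ge0.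
have := ler_wpM2l X0 h2; rewrite mulr1; move=> h3; apply: (le_trans h3).
by rewrite le_eqVlt; apply/orP; left; apply/eqP; ring.
Qed.

End truncated_powers.

Section riesz.
Context {R : realType}.
Variables (s : nat -> R) (c d : R).
Hypotheses (c0 : 0 < c) (cs0 : c <= s 0%N) (gap : forall j, s j + c <= s j.+1) (d0 : 0 < d).
Local Notation mu := (@lebesgue_measure R).
Implicit Types (a : nat -> R).

Let sc j : c <= s j.
Proof. by elim: j => // j IH; apply: le_trans (gap j); move: IH c0; lra. Qed.

Let s0 j : 0 < s j. Proof. exact: lt_le_trans (sc j). Qed.

Let smono i j : (i <= j)%N -> s i <= s j.
Proof.
move=> /subnK <-; elim: (j - i)%N => [|n IH]; first by rewrite add0n.
by rewrite addSn; apply: le_trans (gap _); move: IH c0; lra.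
Qed.

Let sqgap i j : (i < j)%N -> s i ^+ 2 + c * s j <= s j ^+ 2.
Proof.
move=> ij; have h : s i + c <= s j by apply: le_trans (gap i) (smono _ _ ij).
by move: (s0 i) (s0 j) c0 h; nra.
Qed.

(* Riesz: the truncated power (top - s_i^2)_+^(K-1) is a fractional integral of order K-1-d of the
   means, and its K-th difference annihilates all terms but one. *)
Lemma riesz_coefficients : exists2 C, 0 < C & forall a M,
  (forall r N, 0 < r -> (forall i, (N <= i)%N -> r <= s i) ->
     `|\sum_(i < N) Mf d (s i / r) * a i| <= M) ->
  forall n, `|a n| <= C * M * s n `^ d.
Proof.
(* k > 1 + d makes be positive, and be + d + 1 = k is an integer, so that truncated k-th powers are
   polynomials to the right of their knots. *)
pose k := (Num.truncn (1 + d)).+1; pose be := k%:R - 1 - d.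
have be0 : 0 < be by rewrite /be; have := truncnS_gt (1 + d); rewrite -/k; lra.
have kE : be + d + 1 = k%:R by rewrite /be; ring.
have bek : be <= k.+1%:R by rewrite /be -natr1; move: d0; lra.
have [C1 C10 HG] := fd_ppow_bound be k.+1 be0 bek.
pose Bt := beta_int be d; have Bt0 : 0 < Bt by exact: beta_int_gt0.
have k0 : 0 < k.+1%:R :> R by rewrite ltr0n.
exists (C1 / (1 + d) / Bt * 2 `^ d * (c / (2 * k.+1%:R)) `^ (- d)).
  by rewrite !mulr_gt0 ?invr_gt0 ?powR_gt0 ?divr_gt0 ?mulr_gt0 // addr_gt0.
move=> a M HM n.
have M0 : 0 <= M.
  have := HM (s 0%N) 0%N (s0 0) (fun i _ => smono _ _ (leq0n i)).
  by rewrite big_ord0 normr0.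
pose S := s n; have S0 : 0 < S by exact: s0.
(* The nodes extend over 2(k+1) h = c S, no more than the gap between S^2 and the smaller squares
   s_i^2. *)
pose h := c * S / (2 * k.+1%:R); have h0 : 0 < h by rewrite divr_gt0 ?mulr_gt0.
have hE : 2 * k.+1%:R * h = c * S by rewrite /h; field; rewrite addrC natr1 gt_eqF.
have hcS : h <= c * S.
  by rewrite -hE ler_peMl ?(ltW h0) //; have : 1 <= k.+1%:R :> R by [rewrite ler1n]; lra.
(* With top node S^2 + h, only that node exceeds S^2, whereas all nodes exceed s_i^2 for i < n: the
   n-th term is isolated and the others are differences of polynomials. *)
pose T := S ^+ 2 + h; have T0 : 0 < T by rewrite addr_gt0 // exprn_gt0.
pose A v := \sum_(i < n.+1) a i * ppow d (T - v - s i ^+ 2).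
pose G v := fd k.+1 h (ppow be) (v - k.+1%:R * h).
have cA v : {for v, continuous A}.
  apply: (csum n.+1 (fun i v => a i * ppow d (T - v - s i ^+ 2))) => i; apply: cM; first exact: cC.
  by apply: (ppow_comp_cont d (fun v => T - v - s i ^+ 2)) => //; cont.
pose cf i : R := (-1) ^+ i * 'C(k.+1, i)%:R.
pose tt i := T - k.+1%:R * h + (k.+1%:R - 2 * i%:R) * h.
have GE v : G v = \sum_(i < k.+2) cf i * ppow be (tt i - T + v).
  by rewrite /G fdE; apply: eq_bigr => i _; congr (_ * ppow be _); rewrite /tt; ring.
have ttT i : tt i <= T.
  by rewrite /tt mulrBl -mulrA; have : 0 <= i%:R * h by [rewrite mulr_ge0 // ltW]; lra.
have ib i l : integ `]0, T[ (fun v => ppow be (tt i - T + v) * ppow d (T - v - l)).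
  apply: continuous_integ_oo => v.
  apply: (cM (fun v => ppow be (tt i - T + v)) (fun v => ppow d (T - v - l)));
    [apply: (ppow_comp_cont be (fun v => tt i - T + v)) | apply: (ppow_comp_cont d (fun v => T - v - l))] => //; cont.
have one i : (i <= n)%N -> \int[mu]_(v in `]0, T[) (G v * ppow d (T - v - s i ^+ 2)) = Bt * ((i == n)%:R * h ^+ k).
  move=> ilen; have -> : \int[mu]_(v in `]0, T[) (G v * ppow d (T - v - s i ^+ 2)) =
      \int[mu]_(v in `]0, T[) \sum_(j < k.+2) cf j * (ppow be (tt j - T + v) * ppow d (T - v - s i ^+ 2)).
    by apply: eq_Rintegral => v _; rewrite GE mulr_suml; apply: eq_bigr => j _; ring.
  rewrite (Rintegral_sum `]0, T[ k.+2 cf (fun j v => ppow be (tt j - T + v) * ppow d (T - v - s i ^+ 2))) //.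
  transitivity (Bt * fd k.+1 h (fun y => ppow k%:R (y - s i ^+ 2)) (T - k.+1%:R * h)).
    rewrite fdE mulr_sumr; apply: eq_bigr => j _.
    by rewrite beta_conv ?sqr_ge0 ?ttT // kE -/Bt /cf /tt; ring.
  congr (_ * _); have [->|iN] := eqVneq i n.
    by rewrite mul1r; apply: fd_top => //; rewrite subrK.
  have lin : (i < n)%N by rewrite ltn_neqAle iN.
  rewrite mul0r -(fd_poly k h (s i ^+ 2) (T - k.+1%:R * h) (ltW h0)).
  apply: fd_ext; first exact: ltW.
  move=> y /andP[hy _]; have g := sqgap i n lin; rewrite -/S in g.
  have y0 : 0 <= y - s i ^+ 2 by move: hy g hE h0; rewrite /T -mulrA; lra.
  by rewrite ppow_in // powR_mulrn.
have cG v : {for v, continuous G}.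
  rewrite (_ : G = fun v => \sum_(i < k.+2) cf i * ppow be (tt i - T + v)); last exact/funext.
  apply: (csum k.+2 (fun i v => cf i * ppow be (tt i - T + v))) => i; apply: cM; first exact: cC.
  by apply: (ppow_comp_cont be (fun v => tt i - T + v)) => //; cont.
have iso : \int[mu]_(v in `]0, T[) (G v * A v) = Bt * h ^+ k * a n.
  have -> : \int[mu]_(v in `]0, T[) (G v * A v) =
      \int[mu]_(v in `]0, T[) \sum_(i < n.+1) a i * (G v * ppow d (T - v - s i ^+ 2)).
    by apply: eq_Rintegral => v _; rewrite /A mulr_sumr; apply: eq_bigr => i _; ring.
  rewrite (Rintegral_sum `]0, T[ n.+1 a (fun i v => G v * ppow d (T - v - s i ^+ 2))) //; last first.
    move=> i; apply: continuous_integ_oo => v; apply: (cM G (fun v => ppow d (T - v - s i ^+ 2))) => //.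
    by apply: (ppow_comp_cont d (fun v => T - v - s i ^+ 2)) => //; cont.
  rewrite big_ord_recr /= big1 ?add0r => [|i _].
    by rewrite one // eqxx mul1r; ring.
  by rewrite one ?(ltnW (ltn_ord i)) // (ltn_eqF (ltn_ord i)) mul0r !mulr0.
(* At height T - v the truncated sum is (T - v)^d times the mean at r = sqrt(T - v); no zero after
   s_n lies below this r, so the hypothesis bounds it by M. *)
have AM v : 0 < v < T -> `|A v| <= M * T `^ d.
  move=> /andP[v0 vT]; pose m := T - v; have m0 : 0 < m by rewrite subr_gt0.
  pose r := Num.sqrt m; have r0 : 0 < r by rewrite sqrtr_gt0.
  have rm : r ^+ 2 = m by rewrite sqr_sqrtr // ltW.
  have AE : A v = m `^ d * \sum_(i < n.+1) Mf d (s i / r) * a i.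
    rewrite /A mulr_sumr; apply: eq_bigr => i _; rewrite mulrA [RHS]mulrC; congr (_ * _).
    rewrite /Mf -powRM ?le_max ?lexx ?orbT ?(ltW m0) // maxr_pMr ?(ltW m0) // mulr0 /ppow -/m.
    by rewrite expr_div_n rm mulrBr mulr1 mulrCA divff ?mulr1 // gt_eqF.
  rewrite AE normrM (ger0_norm (powR_ge0 _ _)) mulrC ler_pM ?powR_ge0 //.
    apply: HM => // i ni; have g := sqgap n i ni; rewrite -/S in g.
    rewrite -(ler_pXn2r (ltn0Sn 1)) ?nnegrE ?(ltW r0) ?(ltW (s0 i)) // rm.
    apply: le_trans g; rewrite /m /T; have : c * S <= c * s i by rewrite ler_wpM2l ?(ltW c0) // smono // ltnW.
    by move: hcS v0; lra.
  by rewrite (ge0_ler_powR (ltW d0)) ?nnegrE ?(ltW m0) ?(ltW T0) // /m lerBlDr lerDl ltW.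
have d1 : 0 < 1 + d by rewrite addr_gt0.
have hi0 : 0 < h^-1 by rewrite invr_gt0.
pose Z := C1 * h `^ be * h * (M * T `^ d).
have Z0 : 0 <= Z by exact: (mulr_ge0 (mulr_ge0 (mulr_ge0 (ltW C10) (powR_ge0 _ _)) (ltW h0)) (mulr_ge0 M0 (powR_ge0 _ _))).
have GA v : `]0, T[%classic v -> `|G v * A v| <= Z * peak (1 + d) h^-1 v.
  rewrite /= in_itv /= => vT; have /andP[v0 _] := vT.
  have bE : h * peak (1 + d) h^-1 v = (1 + v / h) `^ (be - k.+1%:R).
    rewrite /peak mulrA divff ?gt_eqF // mul1r [h^-1 * v]mulrC; congr (_ `^ _).
    by rewrite /be -natr1; ring.
  rewrite normrM (_ : Z * _ = C1 * (h `^ be * (h * peak (1 + d) h^-1 v)) * (M * T `^ d)); last by rewrite /Z; ring.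
  by rewrite bE ler_pM ?HG ?AM.
have ibb : integ `]0, T[ (peak (1 + d) h^-1).
  by apply: integ_oo; apply: continuous_in_integ => [|t /andP[t0 _]]; [exact: ltW | exact: peak_cont].
have iZ : integ `]0, T[ (fun v => Z * peak (1 + d) h^-1 v).
  exact: (@integrableZl _ _ _ mu _ (measurable_itv _) Z (EFin \o peak (1 + d) h^-1)).
have mGA : measurable_fun (`]0, T[%classic : set R) (fun v => G v * A v).
  by apply: measurable_funTS; apply: continuous_measurable_fun => v; apply: (cM G A).
have main : Bt * h ^+ k * `|a n| <= Z / (1 + d).
  have := norm_Rintegral_le _ _ _ (measurable_itv _) mGA GA iZ; rewrite iso.
  rewrite (@RintegralZl _ _ _ mu _ _ _ (measurable_itv _) ibb) normrM.
  rewrite [ `|Bt * _|]gtr0_norm; last by rewrite mulr_gt0 // exprn_gt0.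
  move=> le1; apply: (le_trans le1); rewrite ler_wpM2l //; exact: peak_integral.
have TS : T `^ d <= 2 `^ d * (S `^ d * S `^ d).
  rewrite -!powRM ?mulr_ge0 ?(ltW S0) // (ge0_ler_powR (ltW d0)) ?nnegrE ?(ltW T0) ?mulr_ge0 ?(ltW S0) //.
  have cS : c * S <= S * S by rewrite ler_wpM2r ?(ltW S0) // sc.
  by rewrite /T expr2; move: hcS cS; lra.
have hd : h `^ be * h = h ^+ k * h `^ (- d).
  rewrite -{2}(powRr1 (ltW h0)) -powR_mulrn ?(ltW h0) // -!powRD ?(gt_eqF h0) ?implybT //.
  by congr (_ `^ _); rewrite -kE; ring.
have hS : h `^ (- d) = (c / (2 * k.+1%:R)) `^ (- d) * S `^ (- d).
  by rewrite -powRM ?(ltW S0) ?divr_ge0 ?mulr_ge0 ?(ltW c0) // /h mulrAC.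
have SS : S `^ (- d) * S `^ d = 1 by rewrite powRN mulVf // gt_eqF // powR_gt0.
have hk0 : 0 < h ^+ k by rewrite exprn_gt0.
rewrite -(ler_pM2l (mulr_gt0 Bt0 hk0)) (le_trans main) // /Z -[C1 * _ * h]mulrA hd hS.
rewrite -/S; have Y0 : 0 <= C1 * (h ^+ k * ((c / (2 * k.+1%:R)) `^ (- d) * S `^ (- d))) * M / (1 + d).
  by rewrite !mulr_ge0 ?invr_ge0 ?powR_ge0 ?(ltW C10) ?(ltW hk0) ?(ltW d1).
have := ler_wpM2l Y0 TS; move: SS Bt0 d1 hk0.
move: (h ^+ k) (S `^ (- d)) (S `^ d) (T `^ d) (2 `^ d) ((c / (2 * k.+1%:R)) `^ (- d)) => H X Y U V W XY B0 D0 H0 h5.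
apply: le_trans (le_trans h5 _).
  by rewrite le_eqVlt; apply/orP; left; apply/eqP; field; rewrite gt_eqF.
rewrite le_eqVlt; apply/orP; left; apply/eqP.
transitivity (C1 * H * W * M / (1 + d) * V * Y * (X * Y)); first by field; rewrite gt_eqF.
by rewrite XY; field; rewrite !gt_eqF.
Qed.

End riesz.

(** * A lacunary sum of spikes at the origin *)

Section counterexample.
Context {R : realType}.
Variables (nu : R) (s : nat -> R).
Hypotheses (hnu : -1 < nu) (hs : bessel_zeros nu s).
Local Notation mu := (@lebesgue_measure R).
Local Notation w := (weight nu).
Local Notation I01 := (`]0%R, 1%R[%classic : set R).
Local Notation pj := (pj nu s).
Local Notation g0 := (gbes nu).
Local Notation g1 := (gbes (nu + 1)).
Local Notation ka := (nu + 1 / 2).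
Local Notation N := (psiN nu s).

Let in01 y : I01 y -> 0 < y < 1. Proof. by rewrite /= in_itv. Qed.

(** The Sturm-Liouville form makes w psi_j a derivative, so the coefficient of an initial interval
    is explicit. *)
Lemma coef_initial_interval j b : 0 < b < 1 ->
  \int[mu]_(y in `]0, b[) (pj j y * w y) = N j / 2 * b `^ (2 * nu + 2) * g1 (s j * b).
Proof.
move=> /andP[b0 b1]; have s0 := s_gt0 _ _ hs j; have s0' : s j != 0 by rewrite gt_eqF.
have sub : (`]0, b[%classic : set R) `<=` I01.
  by move=> y; rewrite /= !in_itv /= => /andP[-> h]; exact: lt_trans b1.
have i0 : integ `]0, b[ (fun y => g0 (s j * y) * w y).
  by apply: integrableS (bm_integrable nu hnu _ (g_bm nu hnu (s j))).
have i1 : integ `]0, b[ (fun y => - s j ^+ 2 * (w y * g0 (s j * y))).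
  apply: (@integrableZl _ _ _ mu _ (measurable_itv _) (- s j ^+ 2) (EFin \o (fun y => w y * g0 (s j * y)))).
  by apply: (eq_integrable _ _ _ _ i0) => // y _ /=; rewrite mulrC.
have E : \int[mu]_(y in `]0, b[) (- s j ^+ 2 * (w y * g0 (s j * y))) = w b * gd nu (s j) b - 0.
  have dF y : 0 < y < b -> is_derive y 1 (fun y => w y * gd nu (s j) y) (- s j ^+ 2 * (w y * g0 (s j * y))).
    by move=> /andP[y0 _]; exact: wgd_derive.
  have db := wgd_derive nu hnu (s j) b s0' b0.
  apply: (Rintegral_FTC_oo _ (fun y => w y * gd nu (s j) y) 0 b 0 (w b * gd nu (s j) b) b0 i1 dF).
  - move=> y /andP[y0 _]; have cw := weight_continuous nu y y0; have cg := g_cont nu hnu (s j) y.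
    by apply: (cM (fun=> - s j ^+ 2)); [exact: cC | exact: cM].
  - have c1 : {for 0, continuous (fun _ : R => 1 : R)} by exact: cC.
    by have := @wgd_lim0 R nu hnu (s j) (fun=> 1) c1; under eq_fun do rewrite mul1r.
  - by apply: cvg_at_left_filter; exact: is_derive_continuous db.
transitivity (N j * (- s j ^- 2 * (w b * gd nu (s j) b))); last first.
  by rewrite /gd -(weight_mulr nu b b0); field.
rewrite -[w b * _]subr0 -E -(@RintegralZl _ _ _ mu _ _ _ (measurable_itv _) i1).
have i2 : integ `]0, b[ (fun y => - s j ^- 2 * (- s j ^+ 2 * (w y * g0 (s j * y)))).
  exact: (@integrableZl _ _ _ mu _ (measurable_itv _) (- s j ^- 2) (EFin \o (fun y => - s j ^+ 2 * (w y * g0 (s j * y))))).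
rewrite -(@RintegralZl _ _ _ mu _ _ _ (measurable_itv _) i2).
by apply: eq_Rintegral => y _; rewrite /pj; field.
Qed.

Variables (gam tau : R) (jk : nat -> nat).
Local Notation S i := (s (jk i)).
Hypotheses (ka0 : 0 < ka) (hg1 : ka + 1 < gam) (hg2 : gam < 2 * nu + 2).
Hypotheses (tau01 : 0 < tau < 1) (g1tau : forall z, 0 <= z <= tau -> 0 < g1 z).
Hypotheses (S0 : 1 <= S 0%N) (Snext : forall i, 2 * S i `^ gam <= S i.+1).

Let gam0 : 0 < gam. Proof. by move: ka0 hg1; lra. Qed.

Let S_pow i : 1 <= S i -> S i <= S i `^ gam.
Proof.
move=> h; rewrite -{1}(powRr1 (le_trans ler01 h)) ler_powR //; move: ka0 hg1; lra.
Qed.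

Let S_ge1 i : 1 <= S i.
Proof. by elim: i => // i IH; apply: le_trans (Snext i); have := S_pow i IH; move: IH; lra. Qed.

Let S_gt0 i : 0 < S i. Proof. exact: lt_le_trans (S_ge1 i). Qed.

Let S_double i : 2 * S i <= S i.+1.
Proof. by apply: le_trans (Snext i); rewrite ler_pM2l // S_pow. Qed.

Let S_mono i k : (i <= k)%N -> S i <= S k.
Proof.
move=> /subnK <-; elim: (k - i)%N => [|n IH]; first by rewrite add0n.
by rewrite addSn; apply: le_trans (S_double _); move: IH (S_gt0 (n + i)); lra.
Qed.

Lemma lacunary_ge k : k%:R <= S k.
Proof.
elim: k => [|k IH]; first exact: ltW.
by rewrite -natr1; apply: le_trans (S_double k); move: IH (S_ge1 k); lra.
Qed.

(** The heights of all earlier spikes together stay below S_n; this controls both the size of the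
    sum and the off-diagonal coefficients. *)
Let S_sum n : \sum_(0 <= i < n) S i `^ gam <= S n.
Proof.
elim: n => [|n IH]; first by rewrite big_geq // ltW.
rewrite big_nat_recr //=; apply: le_trans (Snext n).
by have := S_pow n (S_ge1 n); move: IH; lra.
Qed.

Definition spikes n y : R := \sum_(0 <= i < n) S i `^ gam * (y < tau / S i)%R%:R.
Definition spike_sum y := limn (spikes ^~ y).

Let spikes_ge0 n y : 0 <= spikes n y.
Proof. by apply: sumr_ge0 => i _; rewrite mulr_ge0 ?powR_ge0. Qed.

(** The last spike active at y has S_n <= tau/y, and the earlier ones add at most S_n <= S_n^gam:
    whence the factor 2. *)
Let spikes_le n y : 0 < y -> spikes n y <= 2 * (tau / y) `^ gam.
Proof.
move=> y0; elim: n => [|n IH].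
  by rewrite /spikes big_geq // mulr_ge0 ?powR_ge0.
rewrite /spikes big_nat_recr //= -/(spikes n y); case: ltP => h; last by rewrite mulr0 addr0.
have Sy : S n <= tau / y.
  by rewrite ler_pdivlMr // mulrC -ler_pdivlMr // ltW.
have p : S n `^ gam <= (tau / y) `^ gam.
  by rewrite (ge0_ler_powR (ltW gam0)) ?nnegrE ?(ltW (S_gt0 n)) // (le_trans (ltW (S_gt0 n)) Sy).
have q : spikes n y <= S n.
  apply: le_trans (S_sum n); apply: ler_sum => i _.
  by case: ltP; rewrite ?mulr1 ?mulr0 ?powR_ge0.
have := S_pow n (S_ge1 n); rewrite mulr1; move: p q; lra.
Qed.

Let spikes_cvg y : 0 < y -> spikes n y @[n --> \oo] --> spike_sum y.
Proof.
move=> y0; apply: nondecreasing_is_cvgn.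
  by apply/nondecreasing_seqP => n; rewrite /spikes big_nat_recr //= lerDl mulr_ge0 ?powR_ge0.
by exists (2 * (tau / y) `^ gam) => _ [n _ <-]; exact: spikes_le.
Qed.

Let spike_sum_bounds y : 0 < y -> 0 <= spike_sum y <= 2 * (tau / y) `^ gam.
Proof.
move=> y0; apply/andP; split.
  by apply: (ler_cvg_to (cvg_cst 0) (spikes_cvg y y0)); apply: nearW => n; exact: spikes_ge0.
by apply: (ler_cvg_to (spikes_cvg y y0) (cvg_cst _)); apply: nearW => n; exact: spikes_le.
Qed.

Let step_meas b : measurable_fun setT (fun y : R => (y < b)%R%:R : R).
Proof.
rewrite (_ : (fun y => _) = \1_(`]-oo, b[%classic : set R)); first exact: measurable_indic.
by apply/funext => y; rewrite indicE mem_setE in_itv.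
Qed.

Let spikes_meas n : measurable_fun I01 (spikes n).
Proof.
elim: n => [|n IH].
  by rewrite (_ : spikes 0 = fun=> 0) //; apply/funext => y; rewrite /spikes big_geq.
rewrite (_ : spikes n.+1 = fun y => spikes n y + S n `^ gam * (y < tau / S n)%R%:R).
  by apply: measurable_funD => //; apply: measurable_funM => //; apply: measurable_funTS.
by apply/funext => y; rewrite /spikes big_nat_recr.
Qed.

Let spike_sum_meas : measurable_fun I01 spike_sum.
Proof.
apply: (@measurable_fun_cvg _ _ R I01 spikes) => // y /in01 /andP[y0 _]; exact: spikes_cvg.
Qed.

Lemma integ_power a : 0 < a -> integ I01 (fun y : R => y `^ (a - 1)).
Proof.
move=> a0; have h : -1 < (a - 2) / 2 by lra.
have := weight_integrable ((a - 2) / 2) h; rewrite (_ : weight _ = fun y => y `^ (a - 1)) //.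
by apply/funext => y; rewrite /weight; congr (_ `^ _); field.
Qed.

Let tau0 : 0 < tau. Proof. by case/andP: tau01. Qed.

Lemma spike_sum_Lp p : 1 <= p -> gam * p < 2 * nu + 2 -> in_Lp_mu nu p spike_sum.
Proof.
move=> p1 gp; split; first exact: spike_sum_meas.
have p0 : 0 < p by exact: lt_le_trans p1.
pose C := 2 `^ p * tau `^ (gam * p).
have i1 : integ I01 (fun y : R => C * y `^ (2 * nu + 2 - gam * p - 1)).
  apply: (@integrableZl _ _ _ mu _ (measurable_itv _) C (EFin \o (fun y : R => y `^ (2 * nu + 2 - gam * p - 1)))).
  by apply: integ_power; rewrite subr_gt0.
have i2 : integ I01 (fun y => `|spike_sum y| `^ p * w y).
  apply: (integ_le _ _ _ _ _ _ i1) => //.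
    apply: measurable_funM; last exact: weight_measurable.
    by apply: (measurableT_comp (measurable_powR p)); apply: measurableT_comp.
  move=> y /in01 /andP[y0 _]; have /andP[f0 f1] := spike_sum_bounds y y0.
  rewrite (ger0_norm (mulr_ge0 (powR_ge0 _ _) (powR_ge0 _ _))) (ger0_norm f0).
  have iy : 0 <= y^-1 by rewrite invr_ge0 ltW.
  have h : spike_sum y `^ p <= C * y `^ (- (gam * p)).
    apply: (@le_trans _ _ ((2 * (tau / y) `^ gam) `^ p)).
      by rewrite (ge0_ler_powR (ltW p0)) ?nnegrE // mulr_ge0 ?powR_ge0.
    rewrite powRM ?powR_ge0 // -powRrM (powRM _ (ltW tau0) iy) (powRV _ _ y0) /C mulrA //.
  apply: (le_trans (ler_wpM2r (powR_ge0 _ _) h)); rewrite -mulrA /weight -powRD ?(gt_eqF y0) ?implybT //.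
  by rewrite le_eqVlt; apply/orP; left; apply/eqP; congr (_ * _ `^ _); ring.
have /integrableP[_] := i2; apply: le_lt_trans; rewrite le_eqVlt; apply/orP; left; apply/eqP.
by apply: eq_integral => y _ /=; rewrite (ger0_norm (mulr_ge0 (powR_ge0 _ _) (powR_ge0 _ _))).
Qed.

Let b i := tau / S i.
Let b01 i : 0 < b i < 1.
Proof.
rewrite /b divr_gt0 //= ltr_pdivrMr // mul1r; case/andP: tau01 => _ h; exact: lt_le_trans h (S_ge1 i).
Qed.

(** The contribution of the i-th spike to the coefficient of index [jk] k. *)
Let T k i := S i `^ gam * (N (jk k) / 2 * b i `^ (2 * nu + 2) * g1 (S k * b i)).

Lemma coef_spikes k : \sum_(0 <= i < n) T k i @[n --> \oo] --> coef nu s spike_sum (jk k).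
Proof.
have [B [_ [_ [_ _ B0 hB _]]]] := pj_growth nu s hnu hs.
have mp : measurable_fun I01 (pj (jk k)) by have /bmP[] : bm (pj (jk k)) by apply: bm_continuous; exact: pj_cont.
rewrite (coefE nu s hnu hs) (_ : (fun n => _) = (fun n => ip nu (spikes n) (pj (jk k)))); last first.
  apply/funext => n; rewrite big_mkord.
  transitivity (\int[mu]_(y in I01) \sum_(i < n) S i `^ gam * ((y < b i)%R%:R * (pj (jk k) y * w y))); last first.
    apply: eq_Rintegral => y _; rewrite /spikes big_mkord -mulrA mulr_suml; apply: eq_bigr => i _; ring.
  have iw : integ I01 (fun y => pj (jk k) y * w y).
    by apply: bm_integrable => //; apply: bm_continuous; exact: pj_cont.
  rewrite (Rintegral_sum I01 n (fun i => S i `^ gam) (fun i y => (y < b i)%R%:R * (pj (jk k) y * w y))) //.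
    apply: eq_bigr => i _; congr (_ * _); rewrite -(coef_initial_interval _ _ (b01 i)).
    have /andP[b0 b1] := b01 i.
    rewrite (Rintegral_supp I01 `]0, b i[ _ (measurable_itv _) (measurable_itv _)).
    - by apply: eq_Rintegral => y /set_mem; rewrite /= in_itv /= => /andP[_ ->]; rewrite mul1r.
    - by move=> y; rewrite /= !in_itv /= => /andP[-> h]; exact: lt_trans b1.
    - by move=> y /in01 /andP[y0 _]; rewrite /= in_itv /= y0 /= => /negP/negbTE ->; rewrite mul0r.
  move=> i; apply: (integ_le _ _ (fun y => `|pj (jk k) y * w y|)) => //.
  - apply: measurable_funM; first by apply: measurable_funTS; exact: step_meas.
    by apply: measurable_funM => //; exact: weight_measurable.
  - by move=> y _; rewrite normrM normr_nat; case: ltP; rewrite ?mul1r ?mul0r.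
  - exact: (integrable_norm iw).
apply: (Rdominated_convergence I01 _ _ (fun y => 2 * tau `^ gam * B (jk k) * y `^ (2 * nu + 2 - gam - 1))) => //.
- move=> n; apply: measurable_funM; last exact: weight_measurable.
  by apply: measurable_funM => //; exact: spikes_meas.
- apply: measurable_funM; last exact: weight_measurable.
  by apply: measurable_funM => //; exact: spike_sum_meas.
- by apply: aeW => y /in01 /andP[y0 _]; apply: cvgMl; apply: cvgMl; exact: spikes_cvg.
- apply: (@integrableZl _ _ _ mu _ (measurable_itv _) (2 * tau `^ gam * B (jk k)) (EFin \o (fun y : R => y `^ (2 * nu + 2 - gam - 1)))).
  by apply: integ_power; rewrite subr_gt0.
- move=> n y /in01 y01; have /andP[y0 _] := y01.
  have iy : 0 <= y^-1 by rewrite invr_ge0 ltW.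
  have h1 := spikes_le n y y0; have h2 := hB (jk k) y y01.
  rewrite (powRM _ (ltW tau0) iy) (powRV _ _ y0) in h1.
  rewrite (normrM _ (w y)) (normrM (spikes n y)) (ger0_norm (spikes_ge0 n y)) (ger0_norm (powR_ge0 _ _)).
  have -> : y `^ (2 * nu + 2 - gam - 1) = y `^ (- gam) * w y.
    by rewrite /weight -powRD ?(gt_eqF y0) ?implybT //; congr (_ `^ _); ring.
  rewrite mulrA ler_wpM2r ?powR_ge0 //.
  rewrite (_ : _ * B _ * _ = 2 * (tau `^ gam * y `^ (- gam)) * B (jk k)); last by ring.
  by apply: ler_pM.
Qed.

(** The diagonal term i = k has size S_k^(gam - ka - 1). Narrower spikes, i > k, contribute
    nonnegatively because g1 is evaluated in [0, tau]; wider ones, i < k, add up to at most D by the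
    decay of g1 and [S_sum]. *)
Lemma coef_spike_lower : exists c : R, exists D : R, [/\ 0 < c, 0 <= D &
  forall k, c * S k `^ (gam - ka - 1) - D <= coef nu s spike_sum (jk k)].
Proof.
have [a [A [a0 A0 HN]]] := psiN_bounds nu s hnu hs.
have hnu1 : -1 < nu + 1 by move: hnu; lra.
have [C C0 HC] := gbes_bound (nu + 1) hnu1.
have g1t : 0 < g1 tau by apply: g1tau; rewrite (ltW tau0) lexx.
pose c := a / 2 * tau `^ (2 * nu + 2) * g1 tau.
have c0 : 0 < c by rewrite !mulr_gt0 ?powR_gt0.
pose D := A * C / 2; have D0 : 0 < D by rewrite !mulr_gt0.
exists c, D; split => //; first exact: ltW.
move=> k; have Sk := S_gt0 k.
have Tkk : c * S k `^ (gam - ka - 1) <= T k k.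
  rewrite /T /b (_ : S k * (tau / S k) = tau); last by field; rewrite gt_eqF.
  have /andP[n1 _] := HN (jk k).
  have iS : 0 <= (S k)^-1 by rewrite invr_ge0 ltW.
  rewrite (powRM _ (ltW tau0) iS) (powRV _ _ Sk).
  have -> : S k `^ (gam - ka - 1) = S k `^ gam * S k `^ ka * S k `^ (- (2 * nu + 2)).
    by rewrite -!powRD ?(gt_eqF Sk) ?implybT //; congr (_ `^ _); field.
  have q1 := powR_ge0 (S k) gam; have q2 := powR_ge0 (S k) (- (2 * nu + 2)); have q3 := powR_ge0 tau (2 * nu + 2).
  rewrite /c; move: n1 q1 q2 q3; move: (S k `^ gam) (S k `^ ka) (S k `^ (- (2 * nu + 2))) (tau `^ _) (N _) => X Y Z U V n1 q1 q2 q3.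
  have q := mulr_ge0 (mulr_ge0 (mulr_ge0 q1 q2) q3) (ltW g1t).
  have := ler_wpM2l q n1; rewrite -(ler_pM2r (x := 2^-1)) ?invr_gt0 // => h.
  rewrite [leLHS](_ : _ = X * Z * U * g1 tau * (a * Y) / 2); last by field.
  rewrite [leRHS](_ : _ = X * Z * U * g1 tau * V / 2); last by field.
  exact: h.
have Thi i : (k <= i)%N -> 0 <= T k i.
  move=> ki; have /andP[bi0 _] := b01 i; have N0 := psiN_gt0 nu s hnu hs (jk k).
  have N2 : 0 <= N (jk k) / 2 by rewrite (mulr_ge0 (ltW N0)) // invr_ge0.
  apply: (mulr_ge0 (powR_ge0 _ _) (mulr_ge0 (mulr_ge0 N2 (powR_ge0 _ _)) (ltW _))).
  apply: g1tau; rewrite (mulr_ge0 (ltW Sk) (ltW bi0)) /=.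
  by rewrite /b mulrCA ler_piMr ?(ltW tau0) // ler_pdivrMr // mul1r S_mono.
have Tlo i : - (D / S k * S i `^ gam) <= T k i.
  have /andP[bi0 bi1] := b01 i; have /andP[n1 n2] := HN (jk k).
  have N0 := psiN_gt0 nu s hnu hs (jk k).
  have z0 : 0 < S k * b i by rewrite mulr_gt0.
  have gb : `|g1 (S k * b i)| <= C * (S k `^ (- (ka + 1)) * b i `^ (- (ka + 1))).
    apply: (le_trans (HC _ (ltW z0))); rewrite ler_wpM2l ?(ltW C0) // -(powRM _ (ltW Sk) (ltW bi0)).
    rewrite (_ : nu + 1 + 1 / 2 = ka + 1); last by ring.
    by apply: powRN_anti; [move: ka0; lra | | rewrite lerDr].
  have X1 := powR_ge0 (S i) gam; have X2 := powR_ge0 (b i) (2 * nu + 2).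
  suff : `|T k i| <= D / S k * S i `^ gam by rewrite ler_norml => /andP[].
  rewrite /T normrM (ger0_norm X1) mulrC ler_wpM2r // normrM.
  rewrite (ger0_norm (mulr_ge0 (mulr_ge0 (ltW N0) _) X2)) ?invr_ge0 //.
  apply: (@le_trans _ _ (A * S k `^ ka / 2 * b i `^ (2 * nu + 2) * (C * (S k `^ (- (ka + 1)) * b i `^ (- (ka + 1)))))).
    have N2 : 0 <= N (jk k) / 2 by rewrite (mulr_ge0 (ltW N0)) // invr_ge0.
    apply: (ler_pM (mulr_ge0 N2 X2) (normr_ge0 _) _ gb).
    by rewrite ler_wpM2r // ler_wpM2r ?invr_ge0.
  have e1 : S k `^ ka * S k `^ (- (ka + 1)) = (S k)^-1.
    by rewrite -powRD ?(gt_eqF Sk) ?implybT // opprD addrA subrr add0r powR_inv1 // ltW.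
  have e2 : b i `^ (2 * nu + 2) * b i `^ (- (ka + 1)) = b i `^ ka.
    by rewrite -powRD ?(gt_eqF bi0) ?implybT //; congr (_ `^ _); field.
  rewrite (_ : _ * _ = D * (S k `^ ka * S k `^ (- (ka + 1))) * (b i `^ (2 * nu + 2) * b i `^ (- (ka + 1)))); last first.
    by rewrite /D; field.
  rewrite e1 e2 ler_piMr ?(divr_ge0 (ltW D0) (ltW Sk)) //.
  have := ge0_ler_powR (ltW ka0) _ _ (ltW bi1); rewrite !nnegrE ler01 (ltW bi0) powR1; exact.
apply: (ler_cvg_to (cvg_cst _) (coef_spikes k)); exists k.+1 => // n /= kn.
rewrite (big_cat_nat (n := k)) ?(ltnW kn) //= (big_ltn (m := k)) //.
have h1 : - D <= \sum_(0 <= i < k) T k i.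
  apply: (@le_trans _ _ (\sum_(0 <= i < k) - (D / S k * S i `^ gam))); last by apply: ler_sum => i _; exact: Tlo.
  rewrite sumrN lerN2 -mulr_sumr -mulrA ler_piMr ?(ltW D0) //.
  by rewrite mulrC ler_pdivrMr // mul1r S_sum.
have h2 : 0 <= \sum_(k.+1 <= i < n) T k i.
  by rewrite big_nat_cond; apply: sumr_ge0 => i /andP[/andP[h _] _]; apply: Thi; exact: ltnW.
by move: h1 h2 Tkk; lra.
Qed.

End counterexample.

(** * Divergence below the critical exponent *)

Section necessity.
Context {R : realType}.
Variables (nu delta : R) (s : nat -> R).
Hypotheses (hnu : -1 < nu) (hs : bessel_zeros nu s) (d0 : 0 < delta).
Local Notation mu := (@lebesgue_measure R).
Local Notation w := (weight nu).
Local Notation I01 := (`]0%R, 1%R[%classic : set R).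
Local Notation pj := (pj nu s).
Local Notation ka := (nu + 1 / 2).

Let in01 y : I01 y -> 0 < y < 1. Proof. by rewrite /= in_itv. Qed.

(** Riesz' bound asks for control of the means at every r > 0: convergence gives it for large r, and
    for the remaining r finitely many terms bounded by |a_j psi_j(x)| do. *)
Lemma cvg_terms (f : R -> R) (x l : R) : 0 < x -> bochner_riesz nu s delta f r x @[r --> +oo] --> l ->
  exists2 C, 0 <= C & forall j, `|coef nu s f j * pj j x| <= C * s j `^ delta.
Proof.
move=> x0 H; have [c c0 gap] := s_gap nu s hnu hs.
pose c' := Num.min c (s 0%N); have c'0 : 0 < c' by rewrite lt_min c0 (s_gt0 _ _ hs).
have c's : c' <= s 0%N by rewrite ge_min lexx orbT.
have gap' j : s j + c' <= s j.+1 by apply: le_trans (gap j); rewrite lerD2l ge_min lexx.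
have [C C0 HC] := riesz_coefficients s c' delta c'0 c's gap' d0.
have /cvgrPdist_lt /(_ 1 ltr01) [R0 [_ HR]] := H.
have [N0 HN0] := s_above nu s hnu hs (R0 + 1).
pose M := `|l| + 1 + \sum_(0 <= j < N0) `|coef nu s f j * pj j x|.
have sum0 : 0 <= \sum_(0 <= j < N0) `|coef nu s f j * pj j x| by rewrite sumr_ge0.
have M0 : 0 <= M by rewrite !addr_ge0.
exists (C * M) => [|j]; first by rewrite mulr_ge0 // ltW.
apply: (HC (fun j => coef nu s f j * pj j x)) => r N r0 HN.
rewrite (_ : \sum_(i < N) _ = bochner_riesz nu s delta f r x); last first.
  by rewrite (bochner_riesz_fin nu delta s f hnu hs d0 r x N) // big_mkord; apply: eq_bigr => i _; rewrite mulrA.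
have [rR|Rr] := ltP R0 r.
  have h := HR r rR; apply: (@le_trans _ _ (`|l| + 1)); last by rewrite lerDl.
  rewrite -lerBlDl (le_trans (lerB_dist _ _)) // distrC ltW //.
rewrite (bochner_riesz_fin nu delta s f hnu hs d0 r x N0) // => [|i ni]; last first.
  by apply: le_trans (HN0 i ni); rewrite (le_trans Rr) // lerDl.
apply: (le_trans (ler_norm_sum _ _ _)); rewrite /M ler_wpDl ?addr_ge0 //.
apply: ler_sum => i _; rewrite -mulrA normrM ler_piMl // ger0_norm ?Mf_ge0 //; exact: Mf_le1.
Qed.

(** Since |psi_j(y)| <= C y^(-(nu+1/2)) and w = y^(2 nu + 1), the constant C^2 dominates psi_j^2 w;
    a limit 0 would contradict the unit norms. *)
Lemma pj_no_null_subsequence (jk : nat -> nat) : 0 < ka ->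
  ~ {ae mu, forall x, 0 < x < 1 -> pj (jk k) x @[k --> \oo] --> (0 : R)}.
Proof.
move=> ka0 H; have [C C0 HC] := psi_bound nu s hnu hs.
have mp k : measurable_fun I01 (pj (jk k)) by have /bmP[] : bm (pj (jk k)) by apply: bm_continuous; exact: pj_cont.
have D : \int[mu]_(y in I01) (pj (jk k) y * pj (jk k) y * w y) @[k --> \oo] --> \int[mu]_(y in I01) (0 : R).
  apply: (Rdominated_convergence I01 _ _ (fun=> C ^+ 2)) => //.
  - move=> k; apply: measurable_funM; [exact: measurable_funM | exact: weight_measurable].
  - apply: ae_imp H => y Hy /in01 /Hy h.
    have h2 := cvgM (cvgM h h) (cvg_cst (w y)); rewrite mul0r mul0r in h2; exact: h2.
  - by apply: continuous_integ_oo => y; exact: cC.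
  - move=> k y /in01 /andP[y0 _]; have s0 := s_gt0 _ _ hs (jk k).
    have h : `|pj (jk k) y| <= C * y `^ (- ka).
      apply: (le_trans (HC (jk k) y (ltW y0))); rewrite ler_wpM2l ?(ltW C0) // -(powRV _ _ y0).
      have p : 0 < 1 + s (jk k) * y by rewrite ltr_pwDl // mulr_ge0 // ltW.
      rewrite (ge0_ler_powR (ltW ka0)) ?nnegrE ?invr_ge0 ?divr_ge0 ?(ltW s0) ?(ltW p) ?(ltW y0) //.
      by rewrite ler_pdivrMr // mulrDr mulr1 mulrCA mulVf ?gt_eqF // mulr1 lerDr invr_ge0 ltW.
    have ww : y `^ (- ka) * y `^ (- ka) * w y = 1.
      rewrite /weight -!powRD ?(gt_eqF y0) ?implybT // (_ : _ + _ + _ = 0) ?powRr0 //; last by field.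
    rewrite (normrM _ (w y)) normrM (ger0_norm (powR_ge0 _ _)) -/(w y).
    rewrite -[leRHS]mulr1 -ww mulrA ler_wpM2r ?powR_ge0 //.
    rewrite (_ : C ^+ 2 * _ = (C * y `^ (- ka)) * (C * y `^ (- ka))); last by ring.
    by apply: ler_pM.
rewrite Rintegral_cst // mul0r in D.
have E : \int[mu]_(y in I01) (pj (jk k) y * pj (jk k) y * w y) @[k --> \oo] --> (1 : R).
  rewrite (_ : (fun k => _) = (fun=> 1)); first exact: cvg_cst.
  by apply/funext => k; have := pj_orth nu s hnu hs (jk k) (jk k); rewrite eqxx.
have : (1 : R) = 0 by apply: cvg_unique E D.
by move/eqP; rewrite oner_eq0.
Qed.

Lemma necessity p : 1 <= p ->
  (forall f : R -> R, in_Lp_mu nu p f ->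
     {ae mu, forall x, x \in `]0, 1[ -> bochner_riesz nu s delta f r x @[r --> +oo] --> f x}) ->
  p0 nu delta <= p.
Proof.
move=> p1 H; rewrite leNgt; apply/negP; rewrite /p0; case: ifPn => [_|].
  by rewrite ltNge p1.
rewrite negb_or -!leNgt -ltNge => /andP[dk nuk] pp.
have p0 : 0 < p by exact: lt_le_trans p1.
have ka0 : 0 < ka by move: nuk; lra.
have den : 0 < 2 * nu + 3 + 2 * delta by move: nuk d0; lra.
move: pp; rewrite ltr_pdivlMr // => pp.
(* The midpoint of an interval that is nonempty exactly because p < p_0: the left end makes a_j
   outgrow s_j^delta, the right end keeps f in L^p. *)
pose gam := ((ka + 1 + delta) + (2 * nu + 2) / p) / 2.
have q : ka + 1 + delta < (2 * nu + 2) / p by rewrite ltr_pdivlMr //; move: pp; lra.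
have q1 : ka + 1 + delta < gam by rewrite /gam; move: q; lra.
have q2 : gam < (2 * nu + 2) / p by rewrite /gam; move: q; lra.
clearbody gam.
have q3 : gam * p < 2 * nu + 2 by rewrite -ltr_pdivlMr.
have q4 : gam < 2 * nu + 2 by apply: le_lt_trans q3; rewrite ler_peMr //; move: q1 ka0 d0; lra.
have [tau tau01 g1tau] : exists2 tau, 0 < tau < 1 & forall z, 0 <= z <= tau -> 0 < gbes (nu + 1) z.
  have hn1 : -1 < nu + 1 by move: hnu; lra.
  have g10 := gbes0_gt0 (nu + 1) hn1.
  have /cvgrPdist_lt /(_ _ g10) [/= t t0 Ht] := gbes_continuous (nu + 1) 0 hn1.
  have m0 : 0 < Num.min t 1 by rewrite lt_min t0 ltr01.
  have [mt m1] : Num.min t 1 <= t /\ Num.min t 1 <= 1 by rewrite !ge_min !lexx orbT.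
  exists (Num.min t 1 / 2); first by move: m0 m1; lra.
  move=> z /andP[z0 zt]; have : `|0 - z| < t by rewrite sub0r normrN ger0_norm //; move: m0 mt zt; lra.
  by move=> /Ht /=; rewrite ltr_norml => /andP[_]; lra.
(* [g] x is the index of some zero beyond x; iterating it produces zeros as sparse as [Snext]
   demands. *)
pose g x := sval (cid (s_above nu s hnu hs x)).
have gP x : x <= s (g x) by rewrite /g; case: cid => N /= HN; exact: HN.
pose jk k := iter k (fun j => g (2 * s j `^ gam)) (g 1).
have S0 : 1 <= s (jk 0%N) by exact: gP.
have Sn i : 2 * s (jk i) `^ gam <= s (jk i.+1) by exact: gP.
clearbody jk.
have qg : ka + 1 < gam by move: q1 d0; lra.
pose f := spike_sum s gam tau jk.
have fLp : in_Lp_mu nu p f.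
  by apply: spike_sum_Lp.
have [c [D [c0 D0 low]]] := coef_spike_lower nu s hnu hs gam tau jk ka0 qg q4 tau01 g1tau S0 Sn.
apply: (pj_no_null_subsequence jk ka0); apply: ae_imp (H f fLp) => x Hx x01.
have /andP[x0 _] := x01; have {}Hx := Hx (x01 : x \in `]0, 1[).
have [C C0 HC] := cvg_terms f x _ x0 Hx.
have Sge k : k%:R <= s (jk k) by apply: (lacunary_ge nu s gam jk).
pose e := gam - ka - 1 - delta; have e0 : 0 < e by rewrite /e; move: q1; lra.
apply/cvgrPdist_le => ep ep0.
(* Once S_k^e >= b, the subtracted constant D is at most half of the main term of the coefficient,
   and the resulting bound on |psi_(j_k)(x)| is at most ep. *)
pose b := 2 * D / c + 2 * C / c / ep + 1.
have bD : 0 <= 2 * D / c by rewrite divr_ge0 ?mulr_ge0 // ltW.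
have bC : 0 <= 2 * C / c / ep by rewrite !divr_ge0 ?mulr_ge0 ?(ltW c0) ?(ltW ep0).
have b0 : 0 < b by rewrite ltr_wpDl // addr_ge0.
near=> k; have kb : b `^ e^-1 <= k%:R by near: k; exact: nbhs_infty_ger.
have sb := le_trans kb (Sge k); have sk := s_gt0 _ _ hs (jk k).
have s1 : 1 <= s (jk k).
  apply: le_trans sb; rewrite powR_ge1 ?invr_ge0 ?(ltW e0) // /b lerDr addr_ge0 //.
have Yb : b <= s (jk k) `^ e.
  apply: (@le_trans _ _ ((b `^ e^-1) `^ e)); first by rewrite -powRrM mulVf ?gt_eqF // powRr1 // ltW.
  by rewrite (ge0_ler_powR (ltW e0)) ?nnegrE ?powR_ge0 // ltW.
have X1 : 1 <= s (jk k) `^ delta by rewrite powR_ge1 // ltW.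
have := low k; have := HC (jk k).
have -> : s (jk k) `^ (gam - ka - 1) = s (jk k) `^ delta * s (jk k) `^ e.
  by rewrite -powRD ?(gt_eqF sk) ?implybT //; congr (_ `^ _); rewrite /e; ring.
rewrite sub0r normrN normrM.
move: (s (jk k) `^ delta) (s (jk k) `^ e) (coef _ _ _ _) (pj _ _) Yb X1 => X Y a P Yb X1 h1 h2.
have Y0 : 0 < Y by exact: lt_le_trans Yb.
have X0 : 0 < X by exact: lt_le_trans X1.
have cXY : 0 < c / 2 * (X * Y) by rewrite !mulr_gt0.
have DXY : D <= c / 2 * (X * Y).
  have h : 2 * D / c <= X * Y.
    apply: (@le_trans _ _ Y); last by rewrite ler_peMl // ltW.
    by apply: le_trans Yb; rewrite /b -addrA lerDl addr_ge0.
  by rewrite ler_pdivrMr // in h; move: h; lra.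
have aXY : c / 2 * (X * Y) <= `|a|.
  apply: le_trans (ler_norm a); move: h2 DXY; lra.
have CY : C <= c / 2 * Y * ep.
  have h : 2 * C / c / ep <= Y by apply: le_trans Yb; rewrite /b -addrA addrCA lerDl addr_ge0.
  by rewrite !ler_pdivrMr // in h; move: h; lra.
rewrite -(ler_pM2l cXY); apply: (le_trans (ler_wpM2r (normr_ge0 P) aXY)); apply: (le_trans h1).
by have := ler_wpM2l (ltW X0) CY; lra.
Unshelve. all: by end_near. Qed.

End necessity.

Theorem theorem1 (R : realType) (nu delta p : R) (s : nat -> R)
  (hnu : -1 < nu) (hdelta : 0 < delta) (hp1 : 1 <= p)
  (hs : bessel_zeros nu s) :
  (forall f : R -> R, in_Lp_mu nu p f ->
     {ae (@lebesgue_measure R), forall x, x \in `]0, 1[ ->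
        bochner_riesz nu s delta f r x @[r --> +oo] --> f x})
  <-> p0 nu delta <= p.
Proof.
split => [H|pp f hf]; first exact: (necessity nu delta s hnu hs hdelta p hp1 H).
exact: (sufficiency nu delta p s f hnu hs hdelta hp1 hf pp).
Qed.
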